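(* Consider nearest-neighbor random walk on $\mathbb{Z}^d$, $d\ge3$, in a uniformly elliptic space--time product environment. There exists $\eta>0$ such that the quenched large deviation principle for the mean velocity holds in $\{\xi\in\mathbb{R}^d:|\xi-\xi_o|<\eta\}$ with rate function identically equal to $I_a$ there, and such that for every $\xi\in\mathrm{int}(\mathcal{D})$ with $|\xi-\xi_o|<\eta$ the following holds. Let $\theta\in\mathbb{R}^d$ be the unique solution of $\xi=\nabla\log\phi(\theta)$. There exists a $\mathcal{B}_0^+$-measurable function $u^\theta:\Omega\to\mathbb{R}$ with $u^\theta>0$ ($\mathbb{P}$-a.s.) and $\int u^\theta\,d\mathbb{P}=1$ satisfying, $\mathbb{P}$-a.s., $$u^\theta(\omega)=\sum_{z\in U}\overline{\pi}(\omega,T_{1,z}\omega)\,e^{\langle\theta,z\rangle-\log\phi(\theta)}\,u^\theta(T_{1,z}\omega),$$ and such that, if the transformed kernel $\overline{\pi}^\theta$ on $\Omega$ is defined by $$\overline{\pi}^\theta(\omega,T_{1,z}\omega)=\overline{\pi}(\omega,T_{1,z}\omega)\,\frac{u^\theta(T_{1,z}\omega)}{u^\theta(\omega)}\,e^{\langle\theta,z\rangle-\log\phi(\theta)},\qquad z\in U,$$ then $\mu_\xi^\infty$ is the unique stationary Markov process with transition kernel $\overline{\pi}^\theta$ whose marginal (which for $\mu_\xi^\infty$ is denoted $\mu_\xi^1$) is absolutely continuous relative to $\mathbb{P}$ on $\mathcal{B}_n^+$ for every $n\in\mathbb{Z}$.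
   Context: Environment. $U=\{z\in\mathbb{Z}^d: |z|=1\}$. An environment is $\omega=(\omega_{n,x})_{n\in\mathbb{Z},x\in\mathbb{Z}^d}$, where $\omega_{n,x}=(\pi_{n,n+1}(x,x+y))_{y\in\mathbb{Z}^d}$ is a probability vector. $\Omega$ is the product space of all environments, with Borel $\sigma$-algebra $\mathcal{B}$, and $\mathbb{P}$ is a product probability measure on $\Omega$ under which the $\omega_{n,x}$ are i.i.d. Standing assumptions: (nearest-neighbor) $\mathbb{P}(\pi_{0,1}(0,z)>0)=0$ unless $z\in U$; (uniform ellipticity) there is a constant $c>0$ with $\mathbb{P}(\pi_{0,1}(0,z)\ge c)=1$ for all $z\in U$. $\mathcal{B}_n^+$ (resp. $\mathcal{B}_n^-$) is the $\sigma$-algebra generated by $(\omega_{m,x}: x\in\mathbb{Z}^d, m\ge n)$ (resp. $m\le n$). Shifts: $(T_{m,y}\omega)_{n,x}=\omega_{n+m,x+y}$. The environment Markov chain $(T_{n,X_n}\omega)_{n\ge0}$ has transition kernel $\overline{\pi}(\omega,T_{1,z}\omega)=\pi_{0,1}(0,z)$, $z\in U$. Walk. For fixed $\omega$, $P_{k,x}^\omega$ (the quenched measure) is the law of the Markov chain $(X_n)_{n\ge k}$ with $X_k=x$ and probability $\pi_{n,n+1}(y,y+z)$ of stepping from $y$ at time $n$ to $y+z$ at time $n+1$. The averaged measure is the semi-direct product $P_{k,x}=\mathbb{P}\times P_{k,x}^\omega$. Expectations: $\mathbb{E},E_{k,x}^\omega,E_{k,x}$. The subscript $o,o$ means start at position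 $0$ at time $0$. $Z_{n+1}=X_{n+1}-X_n$. Averaged rate function. $q(z)=\mathbb{E}[\pi_{0,1}(0,z)]$, $\xi_o=\sum_{z\in U}q(z)z$, $\phi(\theta)=\sum_{z\in U}q(z)e^{\langle\theta,z\rangle}$ for $\theta\in\mathbb{R}^d$, $I_a(\xi)=\sup_{\theta\in\mathbb{R}^d}\{\langle\theta,\xi\rangle-\log\phi(\theta)\}$, and $\mathcal{D}=\{\xi\in\mathbb{R}^d: I_a(\xi)<\infty\}$. Measure $\overline{\mu}_\xi^\infty$. For $\xi\in\mathrm{int}(\mathcal{D})$ there is a unique $\theta\in\mathbb{R}^d$ with $\xi=\nabla\log\phi(\theta)$. $\overline{\mu}_\xi^\infty$ is the probability measure on $\Omega\times U^{\mathbb{N}}$ determined by $$\int f\,d\overline{\mu}_\xi^\infty=E_{o,o}\bigl[e^{\langle\theta,X_{N+M+K+1}\rangle-(N+M+K+1)\log\phi(\theta)}f(T_{N,X_N}\omega,(Z_{N+i})_{i\ge1})\bigr]$$ for all $N,M,K\in\mathbb{N}$ and all bounded measurable $f:\Omega\times U^{\mathbb{N}}\to\mathbb{R}$ such that $f(\cdot,(z_i)_{i\ge1})$ is independent of $(z_i)_{i>K}$ and $\mathcal{B}_{-N}^+\cap\mathcal{B}_M^-$-measurable for each $(z_i)_{i\ge1}$. Process $\mu_\xi^\infty$. $\mu_\xi^\infty$ is the law, under $\overline{\mu}_\xi^\infty$, of the $\Omega$-valued stationary process $(\omega,\,T_{1,z_1}\omega,\,T_{2,z_1+z_2}\omega,\ldots)$,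 where $(\omega,(z_i)_{i\ge1})\in\Omega\times U^{\mathbb{N}}$; $\mu_\xi^1$ is its one-dimensional marginal on $\Omega$. Local quenched LDP. For an open set $O\subset\mathbb{R}^d$ and a lower semicontinuous $I:O\to[0,\infty]$, the quenched LDP for the mean velocity holds in $O$ with rate function $I$ if for $\mathbb{P}$-a.e. $\omega$: $\liminf_{n\to\infty}\frac1n\log P_{o,o}^\omega(X_n/n\in G)\ge-\inf_{G}I$ for every open $G\subset O$, and $\limsup_{n\to\infty}\frac1n\log P_{o,o}^\omega(X_n/n\in F)\le-\inf_{F}I$ for every $F\subset O$ that is closed in $\mathbb{R}^d$. *)

(* Defs.v *)
From HB Require Import structures.
From mathcomp Require Import all_boot all_order all_algebra.
From mathcomp Require Import all_classical all_reals all_analysis.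

Set Implicit Arguments.
Unset Strict Implicit.
Unset Printing Implicit Defensive.

Import Order.TTheory GRing.Theory Num.Theory.
Import numFieldNormedType.Exports.

Local Open Scope classical_set_scope.
Local Open Scope ring_scope.

(* [<<s coord_sets D f >>] is the sigma-algebra generated by (f i), i in D. *)
Definition coord_sets (I T : Type) (dT : measure_display)
    (T' : measurableType dT) (D : set I) (f : I -> T -> T') : set (set T) :=
  \bigcup_(i in D) preimage_set_system setT (f i) measurable.

Definition eval_at (I T : Type) (i : I) (w : I -> T) : T := w i.

Definition prodspace (I : Type) (dT : measure_display)
    (T' : measurableType dT) : Type := I -> T'.

Section prodspace_measurable.
Context (I : Type) (dT : measure_display) (T' : measurableType dT).
HB.instance Definition _ := Pointed.copy (prodspace I T') (I -> T').
HB.instance Definition _ := Measurable.copy (prodspace I T')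
  (g_sigma_algebraType (coord_sets (T := I -> T') setT (@eval_at I T'))).
End prodspace_measurable.

Lemma measurable_eval_at (I : Type) (dT : measure_display)
    (T' : measurableType dT) (i : I) :
  measurable_fun [set: prodspace I T'] (@eval_at I T' i).
Proof.
move=> _ B mB; rewrite setTI; apply: sub_sigma_algebra.
by exists i => //; exists B => //; rewrite setTI.
Qed.

Lemma measurable_prodspace (dX : measure_display) (X : measurableType dX)
    (I : Type) (dT : measure_display) (T' : measurableType dT)
    (f : X -> prodspace I T') :
  (forall i, measurable_fun [set: X] (fun x => f x i)) ->
  measurable_fun [set: X] f.
Proof.
move=> mf; apply: (@measurability _ _ X (prodspace I T') setT f
  (coord_sets (T := I -> T') setT (@eval_at I T'))) => //.
move=> _ [_ [i _ [B mB <-]] <-].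
by have := mf i measurableT B mB; rewrite !setTI.
Qed.

(* The lattice is Z^(d+1): dimensions are successors throughout, so that the
   set of unit steps is inhabited, as the library asks of measurable types. *)
Definition lattice (d : nat) : Type := 'rV[int]_d.+1.

Section lattice_instances.
Variable d : nat.
HB.instance Definition _ := GRing.Zmodule.on (lattice d).
HB.instance Definition _ := Countable.on (lattice d).
HB.instance Definition _ := isPointed.Build (lattice d) 0.
HB.instance Definition _ := @isMeasurable.Build default_measure_display
  (lattice d) discrete_measurable discrete_measurable0
  discrete_measurableC discrete_measurableU.
End lattice_instances.

Definition dot (R : realType) (n : nat) (x y : 'rV[R]_n) : R :=
  \sum_(i < n) x 0 i * y 0 i.

(* The library's norm on ['rV[R]_n] is the sup norm, hence this definition. *)
Definition enorm (R : realType) (n : nat) (x : 'rV[R]_n) : R :=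
  Num.sqrt (\sum_(i < n) x 0 i ^+ 2).

Definition lat2vec (R : realType) (d : nat) (z : lattice d) : 'rV[R]_d.+1 :=
  \row_i (z 0 i)%:~R.

Record step (R : realType) (d : nat) : Type := Step {
  step_val :> lattice d ;
  step_unit : enorm (lat2vec R step_val) == 1 }.

Section step_instances.
Variables (R : realType) (d : nat).
HB.instance Definition _ := [isSub for @step_val R d].
HB.instance Definition _ := [Countable of step R d by <:].

Let step0_unit : enorm (lat2vec R (delta_mx 0 0 : lattice d)) == 1.
Proof.
rewrite /enorm (bigD1 ord0) //= big1 ?addr0 => [|i i0].
  by rewrite !mxE eqxx expr1n sqrtr1.
by rewrite !mxE eqxx /= (negbTE i0) expr0n.
Qed.

HB.instance Definition _ := isPointed.Build (step R d) (Step step0_unit).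
HB.instance Definition _ := @isMeasurable.Build default_measure_display
  (step R d) discrete_measurable discrete_measurable0
  discrete_measurableC discrete_measurableU.
End step_instances.

Record prob_vector (R : realType) (d : nat) : Type := ProbVector {
  pv_val :> lattice d -> R ;
  pv_ge0 : forall y, 0 <= pv_val y ;
  pv_sum1 : (\esum_(y in [set: lattice d]) (pv_val y)%:E = 1)%E }.

Section prob_vector_instances.
Variables (R : realType) (d : nat).
HB.instance Definition _ := gen_eqMixin (prob_vector R d).
HB.instance Definition _ := gen_choiceMixin (prob_vector R d).

Let pv0 (y : lattice d) : R := (y == 0)%:R.
Let pv0_ge0 y : 0 <= pv0 y. Proof. exact: ler0n. Qed.
Let pv0_sum1 : (\esum_(y in [set: lattice d]) (pv0 y)%:E = 1)%E.
Proof.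
rewrite (esumID [set 0]) => [|y _]; last by rewrite lee_fin.
rewrite setTI esum_set1 ?lee_fin // /pv0 eqxx esum1 ?adde0 //.
by move=> y [_ /eqP/negbTE ->].
Qed.

HB.instance Definition _ :=
  isPointed.Build (prob_vector R d) (ProbVector pv0_ge0 pv0_sum1).

Definition pv_coord (y : lattice d) (p : prob_vector R d) : R := p y.
Let pv_measurable := <<s coord_sets setT pv_coord >>.
Let pv_measurable0 : pv_measurable set0.
Proof. exact: sigma_algebra0. Qed.
Let pv_measurableC A : pv_measurable A -> pv_measurable (~` A).
Proof. exact: sigma_algebraC. Qed.
Let pv_measurable_bigcup (F : (set (prob_vector R d))^nat) :
  (forall i, pv_measurable (F i)) -> pv_measurable (\bigcup_i F i).
Proof. exact: sigma_algebra_bigcup. Qed.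

HB.instance Definition _ := @isMeasurable.Build
  (sigma_display (coord_sets setT pv_coord)) (prob_vector R d) pv_measurable
  pv_measurable0 pv_measurableC pv_measurable_bigcup.
End prob_vector_instances.

Definition site (d : nat) : Type := (int * lattice d)%type.

Notation env R d := (prodspace (site d) (prob_vector R d)).

Section environments.
Variables (R : realType) (d : nat).
Implicit Types (w : env R d) (P : probability (env R d) R).

(* pi_{n,n+1}(x,y) *)
Definition transition w (n : int) (x y : lattice d) : R := w (n, x) (y - x).

Definition env_shift (m : int) (y : lattice d) w : env R d :=
  fun s => w (s.1 + m, s.2 + y).

Definition sigma_ge (n : int) : set (set (env R d)) :=
  <<s coord_sets (T := env R d) [set s : site d | n <= s.1] (@eval_at _ _) >>.

Definition sigma_le (n : int) : set (set (env R d)) :=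
  <<s coord_sets (T := env R d) [set s : site d | s.1 <= n] (@eval_at _ _) >>.

Definition iid_environment P : Prop :=
  (forall (s : site d) (B : set (prob_vector R d)), measurable B ->
     P [set w | B (w s)] = P [set w | B (w (0, 0))]) /\
  (forall (S : seq (site d)) (B : site d -> set (prob_vector R d)),
     uniq S -> (forall s, measurable (B s)) ->
     P [set w | forall s, s \in S -> B s (w s)] =
     (\prod_(s <- S) P [set w | B s (w s)])%E).

Definition nearest_neighbor P : Prop :=
  forall z : lattice d, enorm (lat2vec R z) != 1 ->
    P [set w | 0 < transition w 0 0 z] = 0%E.

Definition uniformly_elliptic P : Prop :=
  exists2 c : R, 0 < c &
    forall z : step R d, P [set w | c <= transition w 0 0 z] = 1%E.

End environments.

(* A path X : nat -> Z^(d+1) started at time k lists X_k, X_(k+1), ... *)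
Notation paths d := (prodspace nat (lattice d)).

Section walk.
Variables (R : realType) (d : nat).
Implicit Types (w : env R d) (P : probability (env R d) R).

Definition is_walk_law w (k : int) (x : lattice d)
    (Q : probability (paths d) R) : Prop :=
  forall (n : nat) (p : nat -> lattice d),
    Q [set X | forall j, (j <= n)%N -> X j = p j] =
    ((p 0%N == x)%:R *
     \prod_(j < n) transition w (k + j%:Z) (p j) (p j.+1))%:E.

(* The cylinder probabilities have exactly one extension to the product
   sigma-algebra (Ionescu-Tulcea); [xget] selects it. *)
Definition quenched w (k : int) (x : lattice d) : probability (paths d) R :=
  xget (\d_point : probability (paths d) R) (is_walk_law w k x).

Definition averaged_E P (k : int) (x : lattice d)
    (g : env R d * paths d -> \bar R) : \bar R :=
  (\int[P]_w \int[quenched w k x]_X g (w, X))%E.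

Definition mean_velocity (n : nat) (X : paths d) : 'rV[R]_d.+1 :=
  n%:R^-1 *: lat2vec R (X n).

Definition quenched_LDP P (O : set 'rV[R]_d.+1) (I : 'rV[R]_d.+1 -> \bar R) :
    Prop :=
  {ae P, forall w : env R d,
    (forall G : set 'rV[R]_d.+1, open G -> G `<=` O ->
      (- ereal_inf (I @` G) <=
       limn_einf (fun n : nat => n%:R^-1%:E *
         lne (quenched w 0%R 0%R [set X | G (mean_velocity n X)])))%E) /\
    (forall F : set 'rV[R]_d.+1, closed F -> F `<=` O ->
      (limn_esup (fun n : nat => n%:R^-1%:E *
         lne (quenched w 0%R 0%R [set X | F (mean_velocity n X)])) <=
       - ereal_inf (I @` F))%E)}.

End walk.

Section averaged_rate.
Variables (R : realType) (d : nat) (P : probability (env R d) R).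

Definition q_step (z : step R d) : R := \int[P]_w transition w 0 0 z.

Definition xi_o : 'rV[R]_d.+1 :=
  \sum_(z \in [set: step R d]) (q_step z *: lat2vec R z).

Definition phi_a (theta : 'rV[R]_d.+1) : R :=
  \sum_(z \in [set: step R d]) (q_step z * expR (dot theta (lat2vec R z))).

Definition I_a (xi : 'rV[R]_d.+1) : \bar R :=
  ereal_sup [set (dot theta xi - ln (phi_a theta))%:E | theta in setT].

Definition dom_I_a : set 'rV[R]_d.+1 := [set xi | (I_a xi < +oo)%E].

End averaged_rate.

Definition gradient (R : realType) (n : nat) (f : 'rV[R]_n -> R)
    (x : 'rV[R]_n) : 'rV[R]_n :=
  \row_i 'D_(delta_mx 0 i) f x.

(* The sequence (z_1, z_2, ...) is z 0, z 1, ... *)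
Notation steps R d := (prodspace nat (step R d)).
Notation env_process R d := (prodspace nat (env R d)).

Section tilted_process.
Variables (R : realType) (d : nat).
Implicit Types (w : env R d) (P : probability (env R d) R).

(* (Z_(N+i))_(i>=1), for a path started at time 0; the default of [insubd] is
   irrelevant, since nearest-neighbor walks almost surely make unit steps. *)
Definition increments (N : nat) (X : paths d) : steps R d :=
  fun i => insubd (point : step R d) (X (N + i).+1 - X (N + i)%N).

Definition is_mu_bar P (theta : 'rV[R]_d.+1)
    (mu : probability (env R d * steps R d)%type R) : Prop :=
  forall (N M K : nat) (f : env R d * steps R d -> R),
    measurable_fun setT f ->
    (exists C : R, forall v, `|f v| <= C) ->
    (forall w (z z' : steps R d),
       (forall i, (i < K)%N -> z i = z' i) -> f (w, z) = f (w, z')) ->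
    (forall (z : steps R d) (Y : set R), measurable Y ->
       (sigma_ge (- N%:Z) `&` sigma_le M%:Z) [set w | Y (f (w, z))]) ->
    (\int[mu]_v (f v)%:E)%E =
     averaged_E P 0 0 (fun v =>
       (expR (dot theta (lat2vec R (v.2 (N + M + K + 1)%N)) -
              (N + M + K + 1)%:R * ln (phi_a P theta)) *
        f (env_shift N%:Z (v.2 N) v.1, increments N v.2))%:E).

(* For xi = grad (log phi_a) (theta), this is the measure attached to xi. The
   identities [is_mu_bar] form a consistent family, as steps are i.i.d. under
   the averaged measure; it has exactly one extension to the product
   sigma-algebra, which [xget] selects. *)
Definition mu_bar P (theta : 'rV[R]_d.+1) :
    probability (env R d * steps R d)%type R :=
  xget (\d_point : probability (env R d * steps R d)%type R)
    (is_mu_bar P theta).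

Definition env_trajectory (v : env R d * steps R d) : env_process R d :=
  fun n => env_shift n%:Z (\sum_(i < n) (v.2 i : lattice d)) v.1.

Lemma measurable_env_trajectory :
  measurable_fun [set: env R d * steps R d] env_trajectory.
Proof.
apply: measurable_prodspace => n; apply: measurable_prodspace => -[m x].
pose pos k (v : env R d * steps R d) : lattice d :=
  \sum_(i < k) (v.2 i : lattice d).
have mpos k (y : lattice d) : measurable [set v | pos k v = y].
  elim: k y => [|k IHk] y.
    have [->|y0] := eqVneq y 0.
      rewrite (_ : mkset _ = setT) //; apply/seteqP; split => // v _.
      by rewrite /= /pos big_ord0.
    rewrite (_ : mkset _ = set0) //; apply/seteqP; split => // v /=.
    by rewrite /pos big_ord0 => /esym/eqP; rewrite (negbTE y0).
  have -> : [set v | pos k.+1 v = y] =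
      \bigcup_(a in [set: lattice d])
        ([set v | pos k v = a] `&`
         (snd @^-1` (@eval_at _ (step R d) k @^-1`
           [set z | a + (z : lattice d) = y]))).
    apply/seteqP; split => [v|v [a _ [/= <-]]].
      by rewrite /= /pos big_ord_recr /= => vy; exists (pos k v).
    by rewrite /pos big_ord_recr.
  apply: countable_bigcupT_measurable => [|a]; first exact: countableP.
  apply: measurableI => //.
  rewrite -[X in measurable X]setTI; apply: measurable_snd => //.
  by rewrite -[X in measurable X]setTI; exact: measurable_eval_at.
move=> _ B mB; rewrite setTI.
have -> : (fun v => env_trajectory v n (m, x)) @^-1` B =
    \bigcup_(y in [set: lattice d])
      ([set v | pos n v = y] `&`
       [set v : env R d * steps R d | B (v.1 (m + n%:Z, x + y))]).
  apply/seteqP; split => [v Bv|v [y _ [<-]]] //.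
  by exists (pos n v).
apply: countable_bigcupT_measurable => [|y]; first exact: countableP.
apply: measurableI => //.
have := measurable_eval_at (T' := prob_vector R d) (m + n%:Z, x + y) measurableT mB.
rewrite setTI => mB'.
by rewrite -[X in measurable X]setTI; exact: (measurable_fst measurableT _ mB').
Qed.

HB.instance Definition _ := isMeasurableFun.Build _ _ _ _ env_trajectory
  measurable_env_trajectory.

Definition mu_process P (theta : 'rV[R]_d.+1) :
    probability (env_process R d) R :=
  distribution (mu_bar P theta) env_trajectory.

End tilted_process.

Section markov.
Variables (R : realType) (d : nat).
Implicit Types (P : probability (env R d) R)
  (nu : probability (env_process R d) R) (k : env R d -> step R d -> R).

Definition stationary nu : Prop :=
  forall A : set (env_process R d), measurable A ->
    nu [set eta | A (fun n => eta n.+1)] = nu A.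

(* [k w z] is the probability of the jump from w to T_{1,z} w. *)
Definition jump_kernel k (w : env R d) (B : set (env R d)) : \bar R :=
  (\sum_(z \in [set: step R d]) (k w z * \1_B (env_shift 1 z w)))%:E.

(* nu (eta_(n+1) \in B | eta_0, ..., eta_n) = jump_kernel k (eta_n) B *)
Definition markov_process nu k : Prop :=
  forall (n : nat) (A : set (env_process R d)) (B : set (env R d)),
    <<s coord_sets (T := env_process R d) [set i | (i <= n)%N]
          (@eval_at _ _) >> A ->
    measurable B ->
    nu (A `&` [set eta | B (eta n.+1)]) =
    (\int[nu]_(eta in A) jump_kernel k (eta n) B)%E.

Definition ac_on_futures P nu : Prop :=
  forall (n : int) (A : set (env R d)), sigma_ge n A ->
    P A = 0%E -> pushforward nu (@eval_at _ (env R d) 0%N) A = 0%E.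

Definition tilted_kernel P (theta : 'rV[R]_d.+1) (u : env R d -> R)
    (w : env R d) (z : step R d) : R :=
  transition w 0 0 z * (u (env_shift 1 z w) / u w) *
  expR (dot theta (lat2vec R z) - ln (phi_a P theta)).

End markov.

(* Main.v *)
(** For a small tilt theta, the partition functions [fwd n] of paths issued from
    the origin, each step z weighted by pi(z) exp(<theta,z> - log phi(theta)),
    form a nonnegative mean-one martingale. Its second moment counts pairs of
    paths in a common environment; these behave as two independent walks, up to
    a factor 1 + e each time they meet, with e small when theta is. When the
    dimension is at least 3 two independent walks meet boundedly often on
    average, so the second moments stay bounded. This gives a limit u of total
    mass one, positive and harmonic, and likewise a limit v for the paths that
    arrive at the origin. The density v * u, together with the kernel transformed
    by u, defines the tilted law.

    Uniqueness: iterating the transformed kernel on an indicator f, in the form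
    E[h sum_s tilt(s) pi(s) (f u)(T_s w)], the environment before time n decouples
    from the event read off after time n, so that these integrals converge to
    E[h u] times the mass of the event under v * u. Taking for h the density of
    an invariant law on the future divided by u identifies that law.

    Large deviations: almost surely, [fwd n] grows at most subexponentially for
    every theta, since its mean is one; it decays at most subexponentially for
    small theta, since u <= fwd n * S_n, where the sum S_n of u over a box of
    polynomial size has polynomial mean. The upper bound is Chernoff's together
    with compactness. For the lower bound, xi near xi_o is the gradient of log phi
    at some small theta, and under the weights tilted by theta all half-spaces
    away from xi have exponentially small mass. *)

Require Import Defs.
From HB Require Import structures.
From mathcomp Require Import all_boot all_order all_algebra.
From mathcomp Require Import all_classical all_reals all_analysis.
From mathcomp Require Import measurable_realfun simple_functions.
From mathcomp Require Import ring lra zify.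

Set Implicit Arguments.
Unset Strict Implicit.
Unset Printing Implicit Defensive.

Import Order.TTheory GRing.Theory Num.Theory.
Import numFieldNormedType.Exports.

Local Open Scope classical_set_scope.
Local Open Scope ring_scope.

(** * Product spaces and independence *)

(** Quenched laws and [mu_bar] are selected by [xget], so both have to be constructed: one device,
    intervals nested along the tree of words, produces either. Conditional expectations are replaced
    by integrals against test functions that depend on the past or on the future, and martingale
    convergence by an L2-Cauchy subsequence whose successors have the same limit, as the harmonic
    equation relates generations [n] and [n.+1]. The forward and backward second moments obey
    different recursions, since a meeting is charged at departure in one and at arrival in the
    other: the first is bounded by a supersolution built from the Green function, the second by a
    renewal inequality. In both, the room comes from ellipticity: two paths at a common site keep a
    fraction c^2 of independent behavior, and so separate often enough to pay for the factor 1 + e.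
    The radius eta is such that the tilts with bounded second moments still reach every velocity
    within eta of xi_o. *)

Section product_space.
Context (I : choiceType) (dT : measure_display) (T : measurableType dT).
Local Notation X := (prodspace I T).
Implicit Types (B : I -> set T) (S : pred I).

Definition cylinder B : set X := [set w | forall i, B i (w i)].

Definition cylinders : set (set X) := [set C | exists B,
  [/\ forall i, measurable (B i),
      exists s : seq I, forall i, i \notin s -> B i = setT &
      C = cylinder B]].

Lemma measurable_cylinders C : cylinders C -> measurable C.
Proof.
move=> [B [mB [s sB] ->]].
have -> : cylinder B = \bigcap_(i in [set` s]) (@eval_at I T i @^-1` B i).
  apply/seteqP; split => [w Bw i _|w Bw i]; first exact: Bw.
  by have [/Bw//|/sB ->] := boolP (i \in s).
apply: fin_bigcap_measurable => // i _.
by rewrite -[X in measurable X]setTI; exact: measurable_eval_at.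
Qed.

Lemma setI_cylinders : setI_closed cylinders.
Proof.
move=> _ _ [B [mB [s sB] ->]] [B' [mB' [s' sB'] ->]].
exists (fun i => B i `&` B' i); split.
- by move=> i; exact: measurableI.
- exists (s ++ s') => i; rewrite mem_cat negb_or => /andP[/sB -> /sB' ->].
  by rewrite setTI.
- apply/seteqP; split => [w [Bw B'w] i|w BBw]; first by split.
  by split => i; have [] := BBw i.
Qed.

Lemma cylindersT : cylinders setT.
Proof.
exists (fun=> setT); split => //; first by exists [::].
by apply/seteqP; split.
Qed.

Lemma sigma_cylinders : (@measurable _ X) = <<s cylinders >>.
Proof.
apply/seteqP; split => A.
  apply: smallest_sub; first exact: smallest_sigma_algebra.
  move=> _ [i _ [B mB <-]]; apply: sub_sigma_algebra.
  exists (fun j => if j == i then B else setT); split.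
  - by move=> j; case: ifP.
  - by exists [:: i] => j; rewrite inE => /negbTE ->.
  - rewrite setTI; apply/seteqP; split => [w Bw j|w /(_ i)]; last by rewrite eqxx.
    by case: eqP => // ->.
apply: smallest_sub; last exact: measurable_cylinders.
exact: sigma_algebra_measurable.
Qed.

Lemma prodspace_measure_unique (R : realType) (m1 m2 : measure X R) :
  (m1 setT < +oo)%E -> (forall C, cylinders C -> m1 C = m2 C) ->
  forall A, measurable A -> m1 A = m2 A.
Proof.
move=> m1oo m12; apply: (@measure_unique _ _ _ cylinders (fun=> setT)) => //.
- exact: sigma_cylinders.
- exact: setI_cylinders.
- by move=> _; exact: cylindersT.
- by rewrite bigcup_const//; exists 0%N.
Qed.

(* For sets, seen as functions into [Prop], this is invariance of membership. *)
Definition depends S (Y : Type) (f : X -> Y) : Prop :=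
  forall w w', (forall i, S i -> w i = w' i) -> f w = f w'.

(** Resetting the coordinates outside [S] to the default point turns dependence on [S] into
    factorization through a measurable map, so that sigma-algebras of coordinates need not be
    carried along as spaces of their own. *)
Definition restr S (w : X) : X := fun i => if S i then w i else point.

Lemma depends_restr S (Y : Type) (f : X -> Y) w :
  depends S f -> f (restr S w) = f w.
Proof. by apply => i Si; rewrite /restr Si. Qed.

Lemma dependsW S S' (Y : Type) (f : X -> Y) :
  {subset S <= S'} -> depends S f -> depends S' f.
Proof. by move=> SS' fS w w' ww'; apply: fS => i Si; apply/ww'/SS'. Qed.

Lemma measurable_restr S : measurable_fun setT (restr S).
Proof.
apply: measurable_prodspace => i; rewrite /restr.
by case: (S i); [exact: measurable_eval_at|exact: measurable_cst].
Qed.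

(** [restr S] is measurable from the sigma-algebra of the coordinates in [S] to the full one, and a
    set that depends on [S] is its own preimage under [restr S]. The sigma-algebras [sigma_ge] and
    [sigma_le] are handled through this equivalence. *)
Lemma sigma_coordE S (A : set X) :
  <<s coord_sets [set i | S i] (@eval_at I T) >> A <->
  measurable A /\ depends S A.
Proof.
split=> [|[mA SA]].
  move: A; apply: smallest_sub => /=; last first.
    move=> _ [i Si [B mB <-]]; rewrite setTI; split.
      by rewrite -[X in measurable X]setTI; exact: measurable_eval_at.
    by move=> w w' ww'; rewrite /= /preimage /eval_at /= ww'.
  split=> [|A [mA SA]|F FA].
  - by split.
  - split=> [|w w' ww']; first exact: measurableD.
    by rewrite /setD /= (SA w w').
  - split=> [|w w' ww']; first by apply: bigcupT_measurable => n; have [] := FA n.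
    apply/propext; split=> -[n _ Fn]; exists n => //.
      by rewrite -((FA n).2 w w').
    by rewrite ((FA n).2 w w').
pose Y := g_sigma_algebraType (coord_sets [set i | S i] (@eval_at I T)).
have mr : measurable_fun [set: Y] (restr S : Y -> X).
  apply: measurable_prodspace => i; rewrite /restr.
  have [Si|_] := boolP (S i); last exact: measurable_cst.
  move=> _ B mB; rewrite setTI; apply: sub_sigma_algebra.
  by exists i => //; exists B => //; rewrite setTI.
have := mr measurableT _ mA; rewrite setTI.
suff -> : restr S @^-1` A = A by [].
by apply/seteqP; split => w; rewrite /preimage /= depends_restr.
Qed.

Lemma restr_cylinder S B : (forall i, measurable (B i)) ->
  (exists s : seq I, forall i, i \notin s -> B i = setT) ->
  restr S @^-1` cylinder B = set0 \/
  restr S @^-1` cylinder B = cylinder (fun i => if S i then B i else setT).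
Proof.
move=> mB [s sB].
(* Outside [S] the restricted point equals [point]: either every such side of the box contains it,
   or one side excludes it and the preimage is empty. *)
have [h|/existsNP[i /not_implyP[/negP Si Bi]]] :=
    pselect (forall i, ~ S i -> B i point); [right|left].
  apply/seteqP; split => w Bw i; have := Bw i; rewrite /restr.
    by case: ifPn.
  by case: ifPn => // /negP Si _; exact: h.
apply/seteqP; split => // w /(_ i).
by rewrite /restr (negbTE Si).
Qed.

End product_space.

HB.instance Definition _ (I : choiceType) (dT : measure_display)
    (T : measurableType dT) (S : pred I) :=
  isMeasurableFun.Build _ _ _ _ (@restr I dT T S) (measurable_restr S).

Lemma measurable_env_shift (R : realType) (d : nat) (m : int) (y : lattice d) :
  measurable_fun [set: env R d] (@env_shift R d m y).
Proof.
apply: measurable_prodspace => s.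
exact: (@measurable_eval_at (site d) _ (prob_vector R d) (s.1 + m, s.2 + y)).
Qed.

HB.instance Definition _ (R : realType) (d : nat) (m : int) (y : lattice d) :=
  isMeasurableFun.Build _ _ _ _ (@env_shift R d m y) (measurable_env_shift m y).

Section pair_restriction.
Context (I : choiceType) (dT : measure_display) (T : measurableType dT).

Definition restr2 (S S' : pred I) (w : prodspace I T) :
  prodspace I T * prodspace I T := (restr S w, restr S' w).

Lemma measurable_restr2 S S' : measurable_fun setT (restr2 S S').
Proof. by apply: measurable_fun_pair; exact: measurable_restr. Qed.

HB.instance Definition _ S S' :=
  isMeasurableFun.Build _ _ _ _ (restr2 S S') (measurable_restr2 S S').

End pair_restriction.

Definition image_measure d d' (X : measurableType d) (Y : measurableType d')
    (R : realType) (m : measure X R) (f : {mfun X >-> Y}) : measure Y R :=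
  measure_function_pushforward__canonical__measure_function_Measure
    m (measurable_funPT f).

Lemma image_measureE d d' (X : measurableType d) (Y : measurableType d')
    (R : realType) (m : measure X R) (f : {mfun X >-> Y}) A :
  image_measure m f A = m (f @^-1` A).
Proof. by []. Qed.

(** The hypothesis on rectangles says that the joint law of [f1] and [f2] is the product of their
    laws; Tonelli then splits the integral. *)
Lemma indep_integral_mfun d0 d1 d2 (X : measurableType d0)
    (Y1 : measurableType d1) (Y2 : measurableType d2) (R : realType)
    (P : probability X R) (f1 : {mfun X >-> Y1}) (f2 : {mfun X >-> Y2})
    (g1 : Y1 -> R) (g2 : Y2 -> R) :
  (forall A B, measurable A -> measurable B ->
    P (f1 @^-1` A `&` f2 @^-1` B) = (P (f1 @^-1` A) * P (f2 @^-1` B))%E) ->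
  measurable_fun setT g1 -> measurable_fun setT g2 ->
  (forall x, 0 <= g1 x) -> (forall x, 0 <= g2 x) ->
  (\int[P]_w (g1 (f1 w) * g2 (f2 w))%:E =
   \int[P]_w (g1 (f1 w))%:E * \int[P]_w (g2 (f2 w))%:E)%E.
Proof.
move=> PAB mg1 mg2 g10 g20.
pose F (x : Y1 * Y2) := (g1 x.1 * g2 x.2)%:E.
have mF : measurable_fun setT F.
  apply/measurable_EFinP; apply: measurable_funM.
    by apply: measurableT_comp => //; exact: measurable_fst.
  by apply: measurableT_comp => //; exact: measurable_snd.
have F0 x : (0 <= F x)%E by rewrite lee_fin mulr_ge0.
pose f w := (f1 w, f2 w).
have mf : measurable_fun setT f by apply: measurable_fun_pair.
pose D1 : probability _ R := distribution P f1.
pose D2 : probability _ R := distribution P f2.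
pose mfP := isMeasurableFun.Build _ _ _ _ _ mf.
pose D := image_measure P (HB.pack f mfP : {mfun _ >-> _}).
transitivity (\int[D]_x F x)%E.
  by rewrite [RHS](ge0_integral_pushforward mf).
transitivity (\int[D1 \x D2]_x F x)%E.
  apply: eq_measure_integral => A mA _.
  apply/esym; apply: (product_measure_unique _ mA) => B B' mB mB'.
  by rewrite -[RHS]/(P (f1 @^-1` B) * P (f2 @^-1` B'))%E -PAB.
rewrite fubini_tonelli1//= /fubini_F /F /=.
have mg1' : measurable_fun setT (EFin \o g1) by exact/measurable_EFinP.
have mg2' : measurable_fun setT (EFin \o g2) by exact/measurable_EFinP.
have D2g : (\int[D2]_y (g2 y)%:E = \int[P]_w (g2 (f2 w))%:E)%E.
  by rewrite ge0_integral_pushforward//= => y _; rewrite lee_fin.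
under eq_integral => x _.
  under eq_integral do rewrite EFinM.
  rewrite ge0_integralZl//=; [|by move=> y _; rewrite lee_fin..|by rewrite lee_fin].
  rewrite D2g muleC; over.
have Pg0 : (0 <= \int[P]_w (g2 (f2 w))%:E)%E by apply: integral_ge0 => w _; rewrite lee_fin.
rewrite ge0_integralZl//=; last by move=> y _; rewrite lee_fin.
rewrite muleC; congr (_ * _)%E.
by rewrite ge0_integral_pushforward//= => y _; rewrite lee_fin.
Qed.

Section iid.
Context (R : realType) (d : nat) (P : probability (env R d) R).
Hypothesis hiid : iid_environment P.
Local Notation PV := (prob_vector R d).
Implicit Types (S : pred (site d)) (B : site d -> set PV).

Lemma prob_cylinder B (s : seq (site d)) : uniq s ->
  (forall i, measurable (B i)) -> (forall i, i \notin s -> B i = setT) ->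
  P (cylinder B) = (\prod_(i <- s) P [set w | B i (w i)])%E.
Proof.
move=> us mB sB; rewrite -hiid.2//; congr (P _).
apply/seteqP; split => w /= Bw i; first by move=> _; exact: Bw.
by have [/Bw//|/sB ->] := boolP (i \in s).
Qed.

Lemma indep_cylinders S S' C C' : (forall i, S i -> S' i -> false) ->
  cylinders C -> cylinders C' ->
  P (restr S @^-1` C `&` restr S' @^-1` C') =
  (P (restr S @^-1` C) * P (restr S' @^-1` C'))%E.
Proof.
move=> SS' [B [mB sB ->]] [B' [mB' sB' ->]].
have [->|->] := restr_cylinder S mB sB; first by rewrite set0I !measure0 mul0e.
have [->|->] := restr_cylinder S' mB' sB'; first by rewrite setI0 !measure0 mule0.
move: sB sB' => [s sB] [s' sB'].
set D := (X in cylinder X `&` _); set D' := (X in _ `&` cylinder X).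
have mD i : measurable (D i) by rewrite /D; case: ifP.
have mD' i : measurable (D' i) by rewrite /D'; case: ifP.
have tD i : i \notin undup (s ++ s') -> D i = setT.
  by rewrite mem_undup mem_cat negb_or /D => /andP[/sB -> _]; case: ifP.
have tD' i : i \notin undup (s ++ s') -> D' i = setT.
  by rewrite mem_undup mem_cat negb_or /D' => /andP[_ /sB' ->]; case: ifP.
have -> : cylinder D `&` cylinder D' = cylinder (fun i => D i `&` D' i).
  apply/seteqP; split => [w [h1 h2] i|w h]; first by split.
  by split=> i; have [] := h i.
rewrite (prob_cylinder (undup_uniq (s ++ s')))//; last 2 first.
- by move=> i; exact: measurableI.
- by move=> i si; rewrite tD// tD'// setTI.
rewrite (prob_cylinder (undup_uniq (s ++ s')))//.
rewrite (prob_cylinder (undup_uniq (s ++ s')))//.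
rewrite -big_split; apply: eq_bigr => i _ /=.
rewrite /D /D'; case: ifPn => Si; case: ifPn => S'i.
- by have := SS' _ Si S'i.
- rewrite (_ : [set w : env R d | setT (w i)] = setT)//.
  rewrite probability_setT mule1; congr (P _).
  by apply/seteqP; split => [w []|w].
- rewrite (_ : [set w : env R d | setT (w i)] = setT)//.
  rewrite probability_setT mul1e; congr (P _).
  by apply/seteqP; split => [w []|w].
- rewrite (_ : [set w : env R d | setT (w i)] = setT)//.
  rewrite probability_setT mul1e -[RHS](@probability_setT _ _ _ P); congr (P _).
  by apply/seteqP; split.
Qed.

Lemma measurable_preim d1 d2 (X : measurableType d1) (Y : measurableType d2)
  (f : {mfun X >-> Y}) (A : set Y) : measurable A -> measurable (f @^-1` A).
Proof. by move=> mA; rewrite -[X in measurable X]setTI; exact: measurable_funPT. Qed.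

Lemma indep_restr S S' A A' : (forall i, S i -> S' i -> false) ->
  measurable A -> measurable A' ->
  P (restr S @^-1` A `&` restr S' @^-1` A') =
  (P (restr S @^-1` A) * P (restr S' @^-1` A'))%E.
Proof.
move=> SS' mA mA'.
(* The events pass from cylinders to measurable sets one at a time: with one of them fixed, both
   sides are finite measures of the other, and they agree on cylinders. *)
have step1 C' : cylinders C' -> forall A, measurable A ->
    P (restr S @^-1` A `&` restr S' @^-1` C') =
    (P (restr S @^-1` A) * P (restr S' @^-1` C'))%E.
  move=> cC'; have mC' := measurable_preim (restr S') (measurable_cylinders cC').
  have PC'0 : 0 <= fine (P (restr S' @^-1` C')) by exact: fine_ge0.
  pose m1 := image_measure (mrestr P mC') (restr S).
  pose m2 : measure _ R := mscale (NngNum PC'0) (image_measure P (restr S)).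
  have m2E (B : set (env R d)) : m2 B = (P (restr S @^-1` B) * P (restr S' @^-1` C'))%E.
    by rewrite /m2 /= /mscale [X in (X * _)%E]fineK ?fin_num_measure// muleC.
  move=> B mB; rewrite -m2E -[LHS]/(m1 B).
  apply: prodspace_measure_unique => //.
    rewrite image_measureE preimage_setT /= /mrestr setTI.
    by rewrite -ge0_fin_numE// fin_num_measure.
  move=> C cC; rewrite m2E; exact: indep_cylinders.
have mA1 := measurable_preim (restr S) mA.
have PA0 : 0 <= fine (P (restr S @^-1` A)) by exact: fine_ge0.
pose m1 := image_measure (mrestr P mA1) (restr S').
pose m2 : measure _ R := mscale (NngNum PA0) (image_measure P (restr S')).
have m2E (B : set (env R d)) : m2 B = (P (restr S @^-1` A) * P (restr S' @^-1` B))%E.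
  by rewrite /m2 /= /mscale [X in (X * _)%E]fineK ?fin_num_measure.
rewrite -m2E setIC -[LHS]/(m1 A').
apply: prodspace_measure_unique => //.
  rewrite image_measureE preimage_setT /= /mrestr setTI.
  by rewrite -ge0_fin_numE// fin_num_measure.
by move=> C cC; rewrite m2E image_measureE /= /mrestr setIC; exact: step1.
Qed.

Lemma indep_sets S S' (A A' : set (env R d)) : (forall i, S i -> S' i -> false) ->
  measurable A -> measurable A' -> depends S A -> depends S' A' ->
  P (A `&` A') = (P A * P A')%E.
Proof.
move=> SS' mA mA' dA dA'.
have rE S0 (B : set (env R d)) : depends S0 B -> restr S0 @^-1` B = B.
  by move=> dB; apply/seteqP; split => w; rewrite /preimage /= depends_restr.
by rewrite -{1 2}(rE _ _ dA) -{1 2}(rE _ _ dA'); exact: indep_restr.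
Qed.

Lemma indep_integral S S' (f g : env R d -> R) : (forall i, S i -> S' i -> false) ->
  measurable_fun setT f -> measurable_fun setT g ->
  depends S f -> depends S' g -> (forall w, 0 <= f w) -> (forall w, 0 <= g w) ->
  (\int[P]_w (f w * g w)%:E = \int[P]_w (f w)%:E * \int[P]_w (g w)%:E)%E.
Proof.
move=> SS' mf mg df dg f0 g0.
have rE (h h' : env R d -> R) : (forall w, h w = h' w) ->
  (\int[P]_w (h w)%:E = \int[P]_w (h' w)%:E)%E.
  by move=> hh'; apply: eq_integral => w _; rewrite hh'.
rewrite (rE (fun w => f w * g w) (fun w => f (restr S w) * g (restr S' w))); last first.
  by move=> w; rewrite !depends_restr.
rewrite indep_integral_mfun//; last by move=> A B mA mB; exact: indep_restr.
congr (_ * _)%E; apply: rE => w; exact: depends_restr.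
Qed.

Lemma env_shift_measure m y A : measurable A ->
  P (@env_shift R d m y @^-1` A) = P A.
Proof.
pose m1 := image_measure P (@env_shift R d m y).
move=> mA; rewrite -[LHS]/(m1 A).
apply: prodspace_measure_unique => //.
  by rewrite image_measureE -ge0_fin_numE// fin_num_measure//; exact: measurable_preim.
move=> _ [B [mB [s sB] ->]].
apply: etrans (esym (prob_cylinder (undup_uniq s) mB _)); last first.
  by move=> i; rewrite mem_undup; exact: sB.
pose f (t : site d) : site d := (t.1 + m, t.2 + y).
pose g (t : site d) : site d := (t.1 - m, t.2 - y).
have fK : cancel f g by move=> [a b]; rewrite /f /g /= !addrK.
have gK : cancel g f by move=> [a b]; rewrite /f /g /= !subrK.
rewrite image_measureE.
have -> : env_shift m y @^-1` cylinder B = cylinder (B \o g).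
  apply/seteqP; split => [w Bw i|w Bw i]; rewrite /= .
    by have := Bw (g i); rewrite /env_shift -/(f (g i)) gK.
  by have := Bw (f i); rewrite /= fK.
apply: etrans (@prob_cylinder (B \o g) (map f (undup s)) _ _ _) _.
- by rewrite map_inj_uniq ?undup_uniq//; exact: can_inj fK.
- by move=> i; exact: mB.
- move=> i; rewrite /= => si; apply: sB; apply: contra si => si.
  by rewrite -(gK i) map_f// mem_undup.
rewrite big_map; apply: eq_bigr => i _.
by have [h1 _] := hiid; rewrite /= fK h1// [RHS]h1.
Qed.

Lemma env_shift_integral m y (f : env R d -> \bar R) :
  measurable_fun setT f -> (forall w, (0 <= f w)%E) ->
  (\int[P]_w f (env_shift m y w) = \int[P]_w f w)%E.
Proof.
move=> mf f0.
rewrite -(@ge0_integral_pushforward _ _ _ _ _ _ (measurable_env_shift m y) P setT f)//.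
by apply: eq_measure_integral => A mA _; exact: env_shift_measure.
Qed.

Lemma env_shift_negligible m y (Q : env R d -> Prop) :
  {ae P, forall w, Q w} -> {ae P, forall w, Q (env_shift m y w)}.
Proof.
move=> [N [mN PN QN]]; exists (env_shift m y @^-1` N); split.
- exact: measurable_preim.
- by rewrite env_shift_measure.
- by move=> w /= h; exact: QN.
Qed.

End iid.

(** * Second moments of two paths in a common environment *)

Section words.
Context (J : eqType) (us : seq J).

(** A path is encoded by the word of its steps, and path sums become finite sums. Splitting off the
    first or the last letter yields the recursions at the two ends of a path. *)
Fixpoint words (n : nat) : seq (seq J) :=
  if n is m.+1 then [seq z :: s | z <- us, s <- words m] else [:: [::]].

Lemma big_wordsS (V : nmodType) (n : nat) (F : seq J -> V) :
  \sum_(s <- words n.+1) F s = \sum_(z <- us) \sum_(s <- words n) F (z :: s).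
Proof. by rewrite /= big_allpairs_dep. Qed.

Lemma big_words0 (V : nmodType) (F : seq J -> V) :
  \sum_(s <- words 0) F s = F [::].
Proof. by rewrite big_seq1. Qed.

Lemma big_words_rcons (V : nmodType) (n : nat) (F : seq J -> V) :
  \sum_(s <- words n.+1) F s =
  \sum_(s <- words n) \sum_(z <- us) F (rcons s z).
Proof.
elim: n F => [|n IHn] F.
  by rewrite big_wordsS big_words0; apply: eq_bigr => z _; rewrite big_words0.
rewrite big_wordsS [RHS]big_wordsS; apply: eq_bigr => z _.
by rewrite IHn.
Qed.

Lemma big_words_cat (V : nmodType) (n m : nat) (F : seq J -> V) :
  \sum_(s <- words (n + m)) F s =
  \sum_(s <- words n) \sum_(t <- words m) F (s ++ t).
Proof.
elim: n F => [|n IHn] F; first by rewrite big_words0.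
by rewrite addSn !big_wordsS; apply: eq_bigr => z _; rewrite IHn.
Qed.

Lemma mem_words n s : (s \in words n) = (size s == n) && all (mem us) s.
Proof.
elim: n s => [|n IHn] [|z s] //=.
  by apply/negP => /allpairsP[[z s] [_ _]].
rewrite eqSS; apply/allpairsP/and3P => [[[y t] /= [yus tn [-> ->]]]|[sn zus sus]].
  by move: tn; rewrite IHn => /andP[].
by exists (z, s); rewrite /= zus IHn sn sus.
Qed.

Lemma size_words n s : s \in words n -> size s = n.
Proof. by rewrite mem_words => /andP[/eqP]. Qed.

Lemma words_uniq n : uniq us -> uniq (words n).
Proof.
move=> uus; elim: n => //= n IHn; apply: allpairs_uniq => //.
by move=> [z s] [z' s'] _ _ /= [-> ->].
Qed.

End words.

Lemma sum_uniq_le (R : numDomainType) (I : eqType) (s t : seq I) (g : I -> R) :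
  uniq s -> uniq t -> (forall i, 0 <= g i) -> (forall i, i \notin t -> g i = 0) ->
  \sum_(i <- s) g i <= \sum_(i <- t) g i.
Proof.
move=> us ut g0 gt; rewrite (bigID (mem t))/= [X in _ + X]big1 ?addr0; last first.
  by move=> i; exact: gt.
rewrite -big_filter [leRHS](bigID (mem s))/= -[X in _ <= X + _]big_filter.
rewrite [X in X <= _](perm_big [seq i <- t | i \in s]).
  by rewrite lerDl; exact: sumr_ge0.
apply: uniq_perm; rewrite ?filter_uniq// => i.
by rewrite !mem_filter andbC.
Qed.

(** * Meetings of two independent walks *)

Section free_walk.
Context (R : realFieldType) (L : zmodType) (J : eqType) (us : seq J).
Context (v : J -> L) (p : J -> R).
Hypothesis p_ge0 : forall z, 0 <= p z.
Hypothesis p_sum : \sum_(z <- us) p z = 1.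
Local Notation words := (words us).

Definition kron (x : L) : R := (x == 0)%:R.

Definition pos (s : seq J) : L := \sum_(z <- s) v z.

Definition wprod (s : seq J) : R := \prod_(z <- s) p z.

Definition walk_op (f : L -> R) (x : L) : R := \sum_(z <- us) p z * f (x + v z).

(** The transition operator of the difference, second walk minus first, of two independent copies of
    the walk. *)
Definition pair_op (f : L -> R) (x : L) : R :=
  \sum_(z <- us) \sum_(z' <- us) p z * p z' * f (x + v z' - v z).

(** The probability that two independent walks meet at time [n] when the second starts [x] ahead of
    the first. The Green function is the sum over [n]. *)
Definition green (n : nat) (x : L) : R := iter n pair_op kron x.

Lemma wprod_ge0 s : 0 <= wprod s. Proof. exact: prodr_ge0. Qed.

Lemma iter_walk_opE n f x :
  iter n walk_op f x = \sum_(s <- words n) wprod s * f (x + pos s).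
Proof.
elim: n x => [|n IHn] x.
  by rewrite big_words0 /wprod /pos !big_nil mul1r addr0.
rewrite iterS /walk_op big_wordsS; apply: eq_bigr => z _.
rewrite IHn mulr_sumr; apply: eq_bigr => s _.
by rewrite /wprod /pos !big_cons mulrA addrA.
Qed.

Lemma wprod_sum n : \sum_(s <- words n) wprod s = 1.
Proof.
elim: n => [|n IHn]; first by rewrite big_words0 /wprod big_nil.
rewrite big_wordsS -[RHS]p_sum; apply: eq_bigr => z _.
rewrite -[RHS]mulr1 -IHn mulr_sumr; apply: eq_bigr => s _.
by rewrite /wprod big_cons.
Qed.

Lemma greenE n x : green n x =
  \sum_(s <- words n) \sum_(s' <- words n)
     wprod s * wprod s' * kron (x + pos s' - pos s).
Proof.
rewrite /green; elim: n x => [|n IHn] x.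
  by rewrite big_words0 big_words0 /wprod /pos !big_nil !mul1r addr0 subr0.
rewrite iterS /pair_op big_wordsS; apply: eq_bigr => z _.
rewrite [RHS](eq_bigr (fun s => \sum_(z' <- us) \sum_(s' <- words n)
   wprod (z :: s) * wprod (z' :: s') * kron (x + pos (z' :: s') - pos (z :: s)))).
  rewrite exchange_big/=; apply: eq_bigr => z' _.
  rewrite IHn mulr_sumr; apply: eq_bigr => s _.
  rewrite mulr_sumr; apply: eq_bigr => s' _.
  rewrite /wprod /pos !big_cons mulrA; congr (_ * _); first by ring.
  by congr kron; rewrite opprD !addrA; congr (_ - _); rewrite -!addrA; congr (_ + _);
     congr (_ + _); rewrite addrC.
by move=> s _; rewrite big_wordsS.
Qed.

Let mass n (y : L) : R := \sum_(s <- words n) wprod s * kron (y - pos s).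

Let supp n := undup [seq pos s | s <- words n].

Let greenE2 n x : green n x = \sum_(y <- supp n) mass n y * mass n (x + y).
Proof.
rewrite greenE exchange_big/=.
have -> : \sum_(s' <- words n) \sum_(s <- words n)
     wprod s * wprod s' * kron (x + pos s' - pos s) =
     \sum_(s' <- words n) wprod s' * mass n (x + pos s').
  apply: eq_bigr => s' _; rewrite mulr_sumr; apply: eq_bigr => s _.
  by rewrite mulrCA mulrA.
under [RHS]eq_bigr do rewrite /mass mulr_suml.
rewrite exchange_big/=; apply: eq_big_seq => s sn.
rewrite (bigD1_seq (pos s)) ?undup_uniq ?mem_undup ?map_f//=.
rewrite [kron (_ - _)]/kron subrr eqxx mulr1 [X in _ = _ + X]big1 ?addr0// => y ys.
by rewrite [kron (_ - _)]/kron subr_eq0 (negbTE ys) mulr0 mul0r.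
Qed.

(* [green n] is the autocorrelation of the law of the walk at time [n]. *)
Lemma green_le0 n x : green n x <= green n 0.
Proof.
rewrite !greenE2.
have h : \sum_(y <- supp n) mass n (x + y) ^+ 2 <= \sum_(y <- supp n) mass n y ^+ 2.
  rewrite -(big_map (fun y => x + y) predT (fun y => mass n y ^+ 2)).
  apply: sum_uniq_le.
  - by rewrite map_inj_uniq ?undup_uniq//; exact: addrI.
  - exact: undup_uniq.
  - by move=> y; exact: sqr_ge0.
  - move=> y; rewrite mem_undup => /mapP ys; rewrite /mass big1_seq ?expr0n// => s.
    move=> /andP[_ sn]; rewrite /kron subr_eq0; case: eqP => [ysE|_].
      by exfalso; apply: ys; exists s.
    by rewrite mulr0.
(* Cauchy-Schwarz in the form 2ab <= a^2 + b^2. Both sums of squares are at most that of [mass n],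
   since a translation only moves its support. *)
have h2 : \sum_(y <- supp n) (mass n y * mass n (x + y)) *+ 2 <=
    \sum_(y <- supp n) mass n y ^+ 2 + \sum_(y <- supp n) mass n (x + y) ^+ 2.
  rewrite -big_split/=; apply: ler_sum => y _.
  by have := sqr_ge0 (mass n y - mass n (x + y)); rewrite sqrrB; lra.
rewrite -(ler_pMn2r (n := 2))// -sumrMnl.
apply: (le_trans h2); rewrite mulr2n.
rewrite (eq_bigr (fun y => mass n y ^+ 2)); last by [].
apply: lerD; first by apply: ler_sum => y _; rewrite add0r -expr2.
by apply: (le_trans h); apply: ler_sum => y _; rewrite add0r -expr2.
Qed.

Lemma green_ge0 n x : 0 <= green n x.
Proof.
rewrite greenE; apply: sumr_ge0 => s _; apply: sumr_ge0 => s' _.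
by rewrite !mulr_ge0 ?wprod_ge0 ?ler0n.
Qed.

(** Conditionally on one of the two walks, the other has to hit a prescribed site. *)
Lemma green_walk n (b : R) :
  (forall x, iter n walk_op kron x <= b) -> green n 0 <= b.
Proof.
move=> hb; rewrite greenE.
apply: (@le_trans _ _ (\sum_(s <- words n) wprod s * b)).
  apply: ler_sum => s _.
  have -> : \sum_(s' <- words n) wprod s * wprod s' * kron (0 + pos s' - pos s) =
      wprod s * iter n walk_op kron (- pos s).
    rewrite iter_walk_opE mulr_sumr; apply: eq_bigr => s' _.
    by rewrite mulrA; congr (_ * kron _); rewrite add0r addrC.
  by rewrite ler_wpM2l ?wprod_ge0.
by rewrite -mulr_suml wprod_sum mul1r.
Qed.

Lemma pair_op_shift g b x : pair_op (fun y => g (y + b)) x = pair_op g (x + b).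
Proof.
apply: eq_bigr => z _; apply: eq_bigr => z' _; congr (_ * g _).
by rewrite addrAC; congr (_ - _); rewrite addrAC.
Qed.

Lemma pair_op_sum (I : Type) (r : seq I) (a : I -> R) (F : I -> L -> R) x :
  pair_op (fun y => \sum_(i <- r) a i * F i y) x =
  \sum_(i <- r) a i * pair_op (F i) x.
Proof.
rewrite /pair_op.
under eq_bigr do under eq_bigr do rewrite mulr_sumr.
under eq_bigr do rewrite exchange_big/=.
rewrite exchange_big/=; apply: eq_bigr => i _.
rewrite mulr_sumr; apply: eq_bigr => z _.
by rewrite mulr_sumr; apply: eq_bigr => z' _; rewrite mulrCA.
Qed.

Lemma greenS n x : green n.+1 x =
  \sum_(z <- us) \sum_(z' <- us) p z * p z' * green n (x + v z' - v z).
Proof. by []. Qed.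

Lemma green_decr n : green n.+1 0 <= green n 0.
Proof.
rewrite greenS; apply: (@le_trans _ _
    (\sum_(z <- us) \sum_(z' <- us) p z * p z' * green n 0)).
  apply: ler_sum => z _; apply: ler_sum => z' _.
  by rewrite ler_wpM2l ?mulr_ge0//; exact: green_le0.
under eq_bigr do rewrite -mulr_suml -mulr_sumr p_sum mulr1.
by rewrite -mulr_suml p_sum mul1r.
Qed.

Lemma walk_op_le (b : R) f : (forall x, f x <= b) -> forall x, walk_op f x <= b.
Proof.
move=> fb x; apply: (@le_trans _ _ (\sum_(z <- us) p z * b)).
  by apply: ler_sum => z _; rewrite ler_wpM2l.
by rewrite -mulr_suml p_sum mul1r.
Qed.

Lemma walk_opB f g x : walk_op (fun y => f y - g y) x = walk_op f x - walk_op g x.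
Proof. by rewrite /walk_op -sumrB; apply: eq_bigr => z _; rewrite mulrBr. Qed.

Lemma walk_op_cst a x : walk_op (fun=> a) x = a.
Proof. by rewrite /walk_op -mulr_suml p_sum mul1r. Qed.

End free_walk.

(** Here [b] is the Green sum at 0 over the first [n] terms, [a] the next term, and [T] the weighted
    Green sum after one step from a common site. *)
Fact pair_fwd_arith (R : realFieldType) (c e G T a b : R) :
  0 < c -> e + e * G <= c / 2 -> 0 <= (1 - c) * a -> e * b <= e * G ->
  T <= (1 + e - c) * b + c * (b + a - 1) -> 1 + e + T <= 1 + (b + a).
Proof. by move=> *; lra. Qed.

Fact dbar_arith (R : realFieldType) (c e G a b : R) :
  0 <= e -> e + e * G <= c / 2 -> 0 <= (1 - c) * a -> e * b <= e * G ->
  (1 - c) * (1 - a) + e * b <= 1 - c / 2.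
Proof. by move=> *; lra. Qed.

(** * Supersolution and renewal bounds for the pair *)

Section pair_chain.
Context (R : realFieldType) (L : zmodType) (J : eqType) (us : seq J).
Context (v : J -> L) (p : J -> R) (al : J -> J -> R) (c e G : R).
Hypothesis p_ge0 : forall z, 0 <= p z.
Hypothesis p_sum : \sum_(z <- us) p z = 1.
Hypothesis c_gt0 : 0 < c.
Hypothesis c_le1 : c <= 1.
Hypothesis al_ge : forall z z', c * (p z * p z') <= al z z'.
Hypothesis al_sum : \sum_(z <- us) \sum_(z' <- us) al z z' = 1 + e.
Hypothesis e_ge0 : 0 <= e.
Hypothesis G_ge0 : 0 <= G.
Hypothesis green_sum_le : forall n, \sum_(j < n) green us v p j 0 <= G.
Hypothesis e_small : e * (1 + G) <= c / 2.
Local Notation g := (green us v p).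
Local Notation K := (pair_op us v p).

(* Second moments of the partition functions of two paths in the same
   environment: the steps of two paths have joint weight [al] when they leave
   the same site, and are independent otherwise. *)
Definition pair_weight (x : L) (z z' : J) : R :=
  if x == 0 then al z z' else p z * p z'.

Fixpoint pair_fwd (n : nat) (x : L) : R :=
  if n is m.+1 then \sum_(z <- us) \sum_(z' <- us)
    pair_weight x z z' * pair_fwd m (x + v z' - v z) else 1.

Fixpoint pair_bwd (n : nat) (x : L) : R :=
  if n is m.+1 then \sum_(z <- us) \sum_(z' <- us)
    pair_weight (x + v z' - v z) z z' * pair_bwd m (x + v z' - v z) else 1.

Let al_ge0 z z' : 0 <= al z z'.
Proof. by apply: le_trans (al_ge z z'); rewrite !mulr_ge0// ltW. Qed.

Let weight_ge0 x z z' : 0 <= pair_weight x z z'.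
Proof. by rewrite /pair_weight; case: ifP => // _; rewrite mulr_ge0. Qed.

Let e_smallD : e + e * G <= c / 2.
Proof. by rewrite -[X in X + _]mulr1 -mulrDr. Qed.

Let pp_sum : \sum_(z <- us) \sum_(z' <- us) p z * p z' = 1.
Proof.
under eq_bigr do rewrite -mulr_sumr p_sum mulr1.
exact: p_sum.
Qed.

(* The excess of [al] over [c p p] is a positive weight of mass [1 + e - c]. *)
Let al_green n : \sum_(z <- us) \sum_(z' <- us) al z z' * g n (v z' - v z) <=
  (1 + e - c) * g n 0 + c * g n.+1 0.
Proof.
have -> : (1 + e - c) * g n 0 =
    \sum_(z <- us) \sum_(z' <- us) (al z z' - c * (p z * p z')) * g n 0.
  under eq_bigr do rewrite -mulr_suml sumrB -mulr_sumr.
  by rewrite -mulr_suml sumrB al_sum -mulr_sumr pp_sum mulr1.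
rewrite greenS mulr_sumr -big_split/=; apply: ler_sum => z _.
rewrite mulr_sumr -big_split/=; apply: ler_sum => z' _.
rewrite add0r mulrA.
have h : (al z z' - c * (p z * p z')) * g n (v z' - v z) <=
    (al z z' - c * (p z * p z')) * g n 0.
  by rewrite ler_wpM2l ?subr_ge0//; exact: green_le0.
lra.
Qed.

(** [1 + S n] is a supersolution of the recursion. Away from 0 it solves it exactly, because [K]
    maps [S m] to [S m.+1] minus [kron]. At 0 the subtracted [kron], of which [al] retains at least
    the fraction [c], pays for the excess [e * (1 + G)]; this is what [e_small] is for. *)
Lemma pair_fwd_le n x : pair_fwd n x <= 1 + G.
Proof.
pose S n x := \sum_(j < n) g j x.
have SS m y : \sum_(z <- us) \sum_(z' <- us) p z * p z' * S m (y + v z' - v z) =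
    S m.+1 y - kron R y.
  rewrite /S big_ord_recl/= addrAC subrr add0r.
  under eq_bigr do under eq_bigr do rewrite mulr_sumr.
  under eq_bigr do rewrite exchange_big/=.
  by rewrite exchange_big.
suff : pair_fwd n x <= 1 + S n x.
  move=> /le_trans; apply; rewrite lerD2l; apply: le_trans (green_sum_le n).
  by apply: ler_sum => j _; exact: green_le0.
elim: n x => [|n IHn] x; first by rewrite /S big_ord0 addr0.
have S0G m : S m 0 <= G by exact: green_sum_le.
have -> : pair_fwd n.+1 x = \sum_(z <- us) \sum_(z' <- us)
    pair_weight x z z' * pair_fwd n (x + v z' - v z) by [].
apply: (@le_trans _ _ (\sum_(z <- us) \sum_(z' <- us)
    pair_weight x z z' * (1 + S n (x + v z' - v z)))).
  by apply: ler_sum => z _; apply: ler_sum => z' _; rewrite ler_wpM2l.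
under eq_bigr do under eq_bigr do rewrite mulrDr mulr1.
under eq_bigr do rewrite big_split/=.
rewrite big_split/= /pair_weight; have [->|x0] := eqVneq x 0; last first.
  rewrite pp_sum SS /kron (negbTE x0) subr0; exact: lexx.
rewrite al_sum.
have -> : \sum_(z <- us) \sum_(z' <- us) al z z' * S n (0 + v z' - v z) =
    \sum_(j < n) \sum_(z <- us) \sum_(z' <- us) al z z' * g j (v z' - v z).
  under eq_bigr do under eq_bigr do rewrite add0r mulr_sumr.
  under eq_bigr do rewrite exchange_big/=.
  by rewrite exchange_big.
have h : \sum_(j < n) \sum_(z <- us) \sum_(z' <- us) al z z' * g j (v z' - v z) <=
   (1 + e - c) * S n 0 + c * (S n.+1 0 - 1).
  apply: (@le_trans _ _ (\sum_(j < n) ((1 + e - c) * g j 0 + c * g j.+1 0))).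
    by apply: ler_sum => j _; exact: al_green.
  rewrite big_split/= -!mulr_sumr lerD2l /S big_ord_recl/=.
  by rewrite /green/= /kron eqxx addrAC subrr add0r.
have Sn : S n.+1 0 = S n 0 + g n 0 by rewrite /S big_ord_recr.
have gn0 : 0 <= g n 0 by exact: green_ge0.
have eG : e * S n 0 <= e * G by exact: ler_wpM2l.
have c1 : 0 <= (1 - c) * g n 0 by rewrite mulr_ge0 ?subr_ge0.
rewrite Sn; apply: (pair_fwd_arith c_gt0 e_smallD c1 eG).
by rewrite -Sn.
Qed.

(** A bound for the [j]-th term of the renewal kernel below. The first part telescopes and the
    second sums to at most [e * G], so the total stays below [1 - c / 2]. *)
Let dbar j : R := (1 - c) * (g j 0 - g j.+1 0) + e * g j 0.

Let dbar_ge0 j : 0 <= dbar j.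
Proof.
rewrite addr_ge0// mulr_ge0 ?subr_ge0//; first exact: green_decr.
exact: green_ge0.
Qed.

Let dbar_sum n : \sum_(j < n) dbar j <= 1 - c / 2.
Proof.
rewrite big_split/= -!mulr_sumr.
have -> : \sum_(j < n) (g j 0 - g j.+1 0) = 1 - g n 0.
  elim: n => [|n IHn]; first by rewrite big_ord0 /green/= /kron eqxx subrr.
  by rewrite big_ord_recr/= IHn addrA subrK.
have : e * \sum_(j < n) g j 0 <= e * G by exact: ler_wpM2l.
have : 0 <= (1 - c) * g n 0 by rewrite mulr_ge0 ?subr_ge0//; exact: green_ge0.
by move=> h1 h2; exact: (dbar_arith e_ge0 e_smallD h1 h2).
Qed.

(** The excess of the joint weight over the independent one, on the steps that bring the pair
    together. In [pair_bwd] the arrival site decides on the weight, so the recursion is the free one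
    plus this source times the value at 0. *)
Let coll (x : L) : R := \sum_(z <- us) \sum_(z' <- us)
  (al z z' - p z * p z') * kron R (x + v z' - v z).

Let pair_bwdS n x : pair_bwd n.+1 x = K (pair_bwd n) x + pair_bwd n 0 * coll x.
Proof.
rewrite /= /pair_op /coll mulr_sumr -big_split/=; apply: eq_bigr => z _.
rewrite mulr_sumr -big_split/=; apply: eq_bigr => z' _.
rewrite /pair_weight /kron; case: eqP => [->|_]; last by rewrite !mulr0 addr0.
by rewrite /= !mulr1; ring.
Qed.

Let KD f h a x : K (fun y => f y + a * h y) x = K f x + a * K h x.
Proof.
rewrite /pair_op mulr_sumr -big_split/=; apply: eq_bigr => z _.
by rewrite mulr_sumr -big_split/=; apply: eq_bigr => z' _; ring.
Qed.

Let iterKD m f h a x :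
  iter m K (fun y => f y + a * h y) x = iter m K f x + a * iter m K h x.
Proof.
elim: m x => // m IHm x; rewrite !iterS -KD.
by congr (K _ x); apply/funext => y.
Qed.

Let iterK1 m x : iter m K (fun=> 1) x = 1.
Proof.
elim: m x => // m IHm x; rewrite iterS (_ : iter m K _ = fun=> 1); last exact/funext.
by rewrite /pair_op; under eq_bigr do under eq_bigr do rewrite mulr1.
Qed.

Let iterK_coll m : iter m K coll 0 <= dbar m.
Proof.
have -> : iter m K coll 0 = \sum_(z <- us) \sum_(z' <- us)
    (al z z' - p z * p z') * g m (v z' - v z).
  have h x : iter m K coll x = \sum_(z <- us) \sum_(z' <- us)
      (al z z' - p z * p z') * g m (x + v z' - v z).
    elim: m x => // m IHm x; rewrite iterS.
    rewrite (_ : iter m K coll = fun y => \sum_(z <- us) 1 * (\sum_(z' <- us)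
      (al z z' - p z * p z') * g m (y + v z' - v z))); last first.
      by apply/funext => y; rewrite IHm; apply: eq_bigr => z _; rewrite mul1r.
    rewrite pair_op_sum; apply: eq_bigr => z _; rewrite mul1r pair_op_sum.
    apply: eq_bigr => z' _; congr (_ * _).
    transitivity (K (fun y => g m (y + (v z' - v z))) x).
      by congr (K _ x); apply/funext => y; rewrite addrA.
    by rewrite pair_op_shift addrA.
  by rewrite h; apply: eq_bigr => z _; apply: eq_bigr => z' _; rewrite add0r.
under eq_bigr do under eq_bigr do rewrite mulrBl.
under eq_bigr do rewrite sumrB.
rewrite sumrB; have := al_green m.
have -> : \sum_(z <- us) \sum_(z' <- us) p z * p z' * g m (v z' - v z) = g m.+1 0.
  by rewrite greenS; apply: eq_bigr => z _; apply: eq_bigr => z' _; rewrite add0r.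
rewrite /dbar; lra.
Qed.

(** Duhamel's formula: once the recursion is unrolled, the source that enters with the factor
    [pair_bwd j 0] has been transported by the free operator for the remaining generations. *)
Let pair_bwd_renewal n : pair_bwd n 0 <=
  1 + \sum_(j < n) pair_bwd j 0 * dbar (n.-1 - j)%N.
Proof.
have bwd_ge0 m x : 0 <= pair_bwd m x.
  elim: m x => // m IHm x.
  by apply: sumr_ge0 => z _; apply: sumr_ge0 => z' _; rewrite mulr_ge0.
(* The [m] additional free steps are what the induction on [n] needs: each unrolling adds one of
   them. *)
have h m : iter m K (pair_bwd n) 0 =
    1 + \sum_(j < n) pair_bwd j 0 * iter (m + (n.-1 - j))%N K coll 0.
  elim: n m => [|n IHn] m; first by rewrite big_ord0 addr0 iterK1.
  rewrite (_ : pair_bwd n.+1 = fun y => K (pair_bwd n) y + pair_bwd n 0 * coll y);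
    last by apply/funext => y; rewrite pair_bwdS.
  rewrite iterKD -iterSr IHn big_ord_recr/= subnn addn0 addrA; congr (1 + _ + _).
  apply: eq_bigr => j _.
  have -> // : (m + (n - j) = (m + (n.-1 - j)).+1)%N by have := ltn_ord j; lia.
have := h 0%N; rewrite /= => ->; rewrite lerD2l; apply: ler_sum => j _.
by rewrite add0n ler_wpM2l.
Qed.

(** The renewal kernel has mass at most [1 - c / 2], and [2 / c] is the fixed point of
    [x = 1 + (1 - c / 2) * x]; strong induction keeps every value below it. *)
Lemma pair_bwd_le n : pair_bwd n 0 <= 2 / c.
Proof.
elim/ltn_ind: n => n IHn; apply: (le_trans (pair_bwd_renewal n)).
have : \sum_(j < n) pair_bwd j 0 * dbar (n.-1 - j)%N <= 2 / c * (1 - c / 2).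
  apply: (@le_trans _ _ (\sum_(j < n) 2 / c * dbar (n.-1 - j)%N)).
    by apply: ler_sum => j _; rewrite ler_wpM2r// IHn.
  rewrite -mulr_sumr; apply: ler_wpM2l; first by rewrite divr_ge0// ltW.
  apply: le_trans (dbar_sum n).
  case: n {IHn} => [|n]; first by rewrite !big_ord0.
  rewrite (reindex_inj rev_ord_inj)/=; apply: ler_sum => j _.
  by rewrite subSS subKn// -ltnS.
have cE : 2 / c * (1 - c / 2) = 2 / c - 1.
  by rewrite mulrBr mulr1; congr (_ - _); field; rewrite gt_eqF.
rewrite cE; lra.
Qed.

End pair_chain.

(** * The Green function in three or more dimensions *)

Section central_binomial.
Variable R : realFieldType.

(** The return probability at time 2m of simple random walk on the integers. *)
Definition cbin (m : nat) : R := 'C(m.*2, m)%:R / 2 ^+ m.*2.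

Lemma bin_le_central m j : ('C(m.*2, j) <= 'C(m.*2, m))%N.
Proof.
have up k : (k < m)%N -> ('C(m.*2, k) <= 'C(m.*2, k.+1))%N.
  move=> km; have := mul_bin_left m.*2 k => h.
  have : (k.+1 * 'C(m.*2, k) <= k.+1 * 'C(m.*2, k.+1))%N.
    by rewrite h leq_mul2r; apply/orP; right; lia.
  by rewrite leq_pmul2l.
have low k : (k <= m)%N -> ('C(m.*2, k) <= 'C(m.*2, m))%N.
  move=> km; have [i ->] : exists i, k = (m - i)%N by exists (m - k)%N; lia.
  elim: i {k km} => [|i IHi]; first by rewrite subn0.
  apply: leq_trans IHi; have [im|im] := leqP m i.
    by have -> : (m - i.+1 = m - i)%N by lia.
  have -> : (m - i = (m - i.+1).+1)%N by lia.
  by apply: up; lia.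
have [jm|mj] := leqP j m; first exact: low.
have [j2|j2] := leqP j m.*2; last by rewrite bin_small.
by rewrite -bin_sub//; apply: low; lia.
Qed.

Lemma cbin_gt0 m : 0 < cbin m.
Proof.
by rewrite divr_gt0 ?exprn_gt0 ?ltr0n ?bin_gt0// -addnn leq_addr.
Qed.

Lemma cbinS m : cbin m.+1 * m.*2.+2%:R = cbin m * m.*2.+1%:R.
Proof.
have h : ('C(m.*2.+2, m.+1) * m.*2.+2 = 'C(m.*2, m) * m.*2.+1 * 4)%N.
  have h1 : (m.*2.+2 * 'C(m.*2.+1, m) = m.+1 * 'C(m.*2.+2, m.+1))%N.
    exact: mul_bin_diag.
  have h2 : (m.*2.+1 * 'C(m.*2, m) = m.+1 * 'C(m.*2.+1, m))%N.
    have := mul_bin_down m.*2.+1 m; rewrite /= => ->; congr (_ * _)%N; lia.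
  nia.
have := congr1 (fun n => n%:R : R) h; rewrite !natrM => hR.
have x0 : (2 : R) ^+ m.*2 != 0 by rewrite expf_neq0// pnatr_eq0.
rewrite /cbin doubleS !exprS; set x := 2 ^+ m.*2 in x0 *.
rewrite mulrAC hR; by field.
Qed.

(** A decay of order m^(-1/2) without Stirling's formula: the ratio in [cbinS] propagates the bound
    because (2m+1)(2m+3) <= (2m+2)^2. *)
Lemma cbin_sqr m : cbin m ^+ 2 * m.*2.+1%:R <= 1.
Proof.
elim: m => [|m IHm]; first by rewrite /cbin bin0 divr1 expr1n mulr1.
have a_gt0 : 0 < m.*2.+2%:R :> R by rewrite ltr0n.
have h := cbinS m.
rewrite -(ler_pM2r (exprn_gt0 2 a_gt0)) mul1r.
have -> : cbin m.+1 ^+ 2 * m.+1.*2.+1%:R * m.*2.+2%:R ^+ 2 =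
    cbin m ^+ 2 * m.*2.+1%:R * (m.*2.+1%:R * m.+1.*2.+1%:R).
  transitivity ((cbin m.+1 * m.*2.+2%:R) ^+ 2 * m.+1.*2.+1%:R); first by ring.
  by rewrite h; ring.
apply: (@le_trans _ _ (1 * (m.*2.+1%:R * m.+1.*2.+1%:R))).
  by rewrite ler_wpM2r// mulr_ge0.
by rewrite mul1r -natrX -natrM ler_nat; nia.
Qed.

(** Here the dimension matters: cubes of terms of order m^(-1/2) are summable, squares are not. By
    [cbinS] the decrement [cbin n - cbin n.+1] is [cbin n / (2n + 2)], which by [cbin_sqr] is at
    least half of [cbin n ^+ 3], so the sum telescopes. *)
Lemma cbin_cube_sum n : \sum_(m < n) cbin m ^+ 3 <= 2.
Proof.
suff : \sum_(m < n) cbin m ^+ 3 <= 2 * (1 - cbin n).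
  by move=> /le_trans; apply; have := cbin_gt0 n; lra.
elim: n => [|n IHn]; first by rewrite big_ord0 /cbin bin0 divr1 subrr mulr0.
rewrite big_ord_recr/=.
suff : cbin n ^+ 3 <= 2 * (cbin n - cbin n.+1) by move: IHn; lra.
have c0 := cbin_gt0 n; have cS := cbinS n; have c2 := cbin_sqr n.
have a_gt0 : 0 < n.*2.+2%:R :> R by rewrite ltr0n.
have b_gt0 : 0 < n.*2.+1%:R :> R by rewrite ltr0n.
rewrite -(ler_pM2r a_gt0).
have -> : 2 * (cbin n - cbin n.+1) * n.*2.+2%:R = 2 * cbin n.
  transitivity (2 * (cbin n * n.*2.+2%:R - cbin n.+1 * n.*2.+2%:R)); first by ring.
  by rewrite cS (_ : n.*2.+2%:R = n.*2.+1%:R + 1) ?natr1//; ring.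
apply: (@le_trans _ _ (2 * (cbin n * (cbin n ^+ 2 * n.*2.+1%:R)))).
  have -> : 2 * (cbin n * (cbin n ^+ 2 * n.*2.+1%:R)) =
     cbin n ^+ 3 * (2 * n.*2.+1%:R) by ring.
  have c3 : 0 <= cbin n ^+ 3 by rewrite exprn_ge0// ltW.
  by apply: (ler_wpM2l c3); rewrite -natrM ler_nat; lia.
by rewrite ler_wpM2l// -[leRHS]mulr1 ler_wpM2l// ltW.
Qed.

End central_binomial.

(** * Averaging over opposite steps in three directions *)

Section averaging.
Context (R : realFieldType) (L : zmodType).
Implicit Types (e : L) (f : L -> R).

Definition avg e f (x : L) : R := (f (x + e) + f (x - e)) / 2.

Lemma iter_avgE n e f x : iter n (avg e) f x =
  (\sum_(j < n.+1) 'C(n, j)%:R * f (x + e *+ j.*2 - e *+ n)) / 2 ^+ n.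
Proof.
elim: n x => [|n IHn] x.
  by rewrite big_ord1 bin0 mul1r divr1 !mulr0n addr0 subr0.
rewrite iterS /avg !IHn exprS invfM mulrA -mulrDl -!mulrA [2^-1 * _]mulrC.
congr (_ * _).
pose h j := f (x + e *+ j.*2 - e *+ n.+1).
have -> : \sum_(j < n.+1) 'C(n, j)%:R * f (x + e + e *+ j.*2 - e *+ n) =
    \sum_(j < n.+1) 'C(n, j)%:R * h j.+1.
  apply: eq_bigr => j _; congr (_ * f _).
  rewrite doubleS !mulrS opprD -!addrA; congr (_ + (_ + _)).
  by rewrite addrCA; congr (_ + _); rewrite addrA subrr add0r.
have -> : \sum_(j < n.+1) 'C(n, j)%:R * f (x - e + e *+ j.*2 - e *+ n) =
    \sum_(j < n.+1) 'C(n, j)%:R * h j.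
  apply: eq_bigr => j _; congr (_ * f _).
  by rewrite mulrS opprD addrA; congr (_ - _); rewrite addrAC.
rewrite [RHS]big_ord_recl/= bin0 mul1r.
rewrite [X in _ = _ + X](_ : _ = \sum_(j < n.+1) 'C(n, j)%:R * h j.+1 +
    \sum_(j < n.+1) 'C(n, j.+1)%:R * h j.+1); last first.
  rewrite -big_split/=; apply: eq_bigr => j _.
  by rewrite /bump/= add1n binS natrD mulrDl addrC.
rewrite addrCA; congr (_ + _).
rewrite [in RHS]big_ord_recr/= bin_small// mul0r addr0.
by rewrite addr0 [LHS]big_ord_recl/= bin0 mul1r {1}/h mulr0n addr0.
Qed.

Lemma iter_avg_le m e f x : (forall y, 0 <= f y) ->
  iter m.*2 (avg e) f x <=
  cbin R m * \sum_(j < m.*2.+1) f (x + e *+ j.*2 - e *+ m.*2).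
Proof.
move=> f0; rewrite iter_avgE /cbin mulrAC ler_pM2r ?invr_gt0 ?exprn_gt0//.
rewrite mulr_sumr; apply: ler_sum => j _.
by rewrite ler_wpM2r// ler_nat bin_le_central.
Qed.

Lemma avg_ge0 e f : (forall y, 0 <= f y) -> forall y, 0 <= avg e f y.
Proof. by move=> f0 y; rewrite divr_ge0// addr_ge0. Qed.

Lemma avg_comm e e' f : avg e (avg e' f) = avg e' (avg e f).
Proof.
apply/funext => x; rewrite /avg ![_ + e + _]addrAC ![_ - e + _]addrAC.
by field.
Qed.

Lemma avg_cst e (b : R) : avg e (fun=> b) = fun=> b.
Proof. by apply/funext => x; rewrite /avg; field. Qed.

Lemma avg_cstB e (b : R) f : avg e (fun y => b - f y) = fun x => b - avg e f x.
Proof. by apply/funext => x; rewrite /avg; field. Qed.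

End averaging.

Lemma iter_comm (T : Type) (F G : T -> T) : (forall x, F (G x) = G (F x)) ->
  forall n x, iter n F (G x) = G (iter n F x).
Proof. by move=> FG; elim=> // n IHn x; rewrite !iterS IHn FG. Qed.

Section triple_average.
Context (R : realFieldType) (L : zmodType) (e1 e2 e3 : L).
Context (l1 l2 l3 : {additive L -> int}).
Hypothesis l1E : [/\ l1 e1 = 1, l1 e2 = 0 & l1 e3 = 0].
Hypothesis l2E : [/\ l2 e1 = 0, l2 e2 = 1 & l2 e3 = 0].
Hypothesis l3E : [/\ l3 e1 = 0, l3 e2 = 0 & l3 e3 = 1].

(** Each direction is averaged twice, so that [m] iterations perform an even number 2m of averages
    per direction and the central binomial coefficient governs them. *)
Definition avg3 (f : L -> R) : L -> R :=
  avg e1 (avg e1 (avg e2 (avg e2 (avg e3 (avg e3 f))))).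

Let avg_iter_comm e e' n (f : L -> R) : avg e (iter n (avg e') f) = iter n (avg e') (avg e f).
Proof. by rewrite iter_comm// => h; exact: avg_comm. Qed.

Lemma iter_avg3E m f : iter m avg3 f =
  iter m.*2 (avg e1) (iter m.*2 (avg e2) (iter m.*2 (avg e3) f)).
Proof.
elim: m => // m IHm; rewrite iterS IHm /avg3 doubleS.
have h n e (g : L -> R) : iter n.+2 (avg e) g = iter n (avg e) (avg e (avg e g)).
  by rewrite !iterSr.
by rewrite !h !avg_iter_comm.
Qed.

Let sum1_le (l : {additive L -> int}) (e : L) (x : int) (n : nat) : l e = 1 ->
  \sum_(j < n.*2.+1) (x + l (e *+ j.*2) - l (e *+ n.*2) == 0)%:R <= 1 :> R.
Proof.
move=> le.
have lE k : l (e *+ k) = k%:Z by rewrite raddfMn le -mulr_natl mulr1 natz.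
have [[j jE]|no] := pselect (exists j : 'I_(n.*2.+1),
    x + l (e *+ j.*2) - l (e *+ n.*2) = 0); last first.
  rewrite big1// => j _; case: eqP => // jE; by exfalso; apply: no; exists j.
rewrite (bigD1 j)//= jE eqxx big1 ?addr0// => i ij.
case: eqP => // iE; exfalso; move/eqP: ij; apply; apply/val_inj => /=.
move: jE iE; rewrite !lE; lia.
Qed.

(** The averages in the three directions commute, and each contributes its largest binomial weight,
    [cbin]. The functionals [l1], [l2], [l3] separate the remaining triple sum of [kron]: in each
    direction at most one index reaches 0, so this sum is at most 1. *)
Lemma iter_avg3_le m x : iter m avg3 (kron R (L:=L)) x <= cbin R m ^+ 3.
Proof.
have k0 (y : L) : 0 <= kron R y by exact: ler0n.
have it0 n e (f : L -> R) : (forall y, 0 <= f y) -> forall y, 0 <= iter n (avg e) f y.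
  by move=> f0; elim: n => // n IHn; exact: avg_ge0.
have c0 : 0 <= cbin R m by exact/ltW/cbin_gt0.
rewrite iter_avg3E.
apply: (le_trans (iter_avg_le _ _ _ (it0 _ _ _ (it0 _ _ _ k0)))).
apply: (@le_trans _ _ (cbin R m * \sum_(i < m.*2.+1) cbin R m *
   \sum_(j < m.*2.+1) cbin R m * \sum_(k < m.*2.+1)
     kron R (x + e1 *+ i.*2 - e1 *+ m.*2 + e2 *+ j.*2 - e2 *+ m.*2
             + e3 *+ k.*2 - e3 *+ m.*2))).
  rewrite ler_wpM2l//; apply: ler_sum => i _.
  apply: (le_trans (iter_avg_le _ _ _ (it0 _ _ _ k0))).
  rewrite ler_wpM2l//; apply: ler_sum => j _; exact: iter_avg_le.
rewrite (_ : cbin R m ^+ 3 = cbin R m * (cbin R m * (cbin R m * 1))); last first.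
  by rewrite !exprS expr0.
rewrite ler_wpM2l// -mulr_sumr ler_wpM2l//.
have -> : \sum_(i < m.*2.+1) \sum_(j < m.*2.+1) cbin R m * \sum_(k < m.*2.+1)
     kron R (x + e1 *+ i.*2 - e1 *+ m.*2 + e2 *+ j.*2 - e2 *+ m.*2
             + e3 *+ k.*2 - e3 *+ m.*2) =
   cbin R m * \sum_(i < m.*2.+1) \sum_(j < m.*2.+1) \sum_(k < m.*2.+1)
     kron R (x + e1 *+ i.*2 - e1 *+ m.*2 + e2 *+ j.*2 - e2 *+ m.*2
             + e3 *+ k.*2 - e3 *+ m.*2).
  by rewrite mulr_sumr; apply: eq_bigr => i _; rewrite mulr_sumr.
rewrite ler_wpM2l//.
case: l1E l2E l3E => l11 l12 l13 [l21 l22 l23] [l31 l32 l33].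
pose t (l : {additive L -> int}) (e : L) (j : nat) : R :=
  (l x + l (e *+ j.*2) - l (e *+ m.*2) == 0)%:R.
apply: (@le_trans _ _ (\sum_(i < m.*2.+1) \sum_(j < m.*2.+1) \sum_(k < m.*2.+1)
    t l1 e1 i * (t l2 e2 j * t l3 e3 k))).
  apply: ler_sum => i _; apply: ler_sum => j _; apply: ler_sum => k _.
  rewrite /kron; case: eqP => [xE|_]; last by rewrite !mulr_ge0 ?ler0n.
  have lx (l : {additive L -> int}) := congr1 l xE.
  move: (lx l1) (lx l2) (lx l3).
  rewrite !(raddfD, raddfN, raddfMn, raddf0) l11 l12 l13 l21 l22 l23 l31 l32 l33.
  rewrite !(mul0rn, oppr0, addr0) => h1 h2 h3.
  by rewrite /t !raddfMn l11 l22 l33 h1 h2 h3 eqxx !mulr1.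
under eq_bigr do under eq_bigr do rewrite -!mulr_sumr.
under eq_bigr do rewrite -mulr_sumr -mulr_suml.
rewrite -mulr_suml.
have s1 := sum1_le (l1 x) m l11; have s2 := sum1_le (l2 x) m l22.
have s3 := sum1_le (l3 x) m l33.
rewrite -[leRHS]mulr1; apply: ler_pM => //.
- by apply: sumr_ge0 => i _; exact: ler0n.
- by rewrite mulr_ge0//; apply: sumr_ge0 => i _; exact: ler0n.
- rewrite -[leRHS]mulr1; apply: ler_pM => //;
  by apply: sumr_ge0 => i _; exact: ler0n.
Qed.

End triple_average.

(** * Comparison of a walk with a product of three walks *)

Section operator_comparison.
Context (R : realFieldType) (L : Type) (A B : (L -> R) -> L -> R) (eps : R).
Context (f0 : L -> R) (b : nat -> R).
Hypothesis eps_gt0 : 0 < eps.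
Hypothesis eps_le1 : eps <= 1.
Hypothesis A_le : forall (f : L -> R) (c : R), (forall x, f x <= c) ->
  forall x, A f x <= eps * B f x + (1 - eps) * c.
Hypothesis AB : forall f, A (B f) = B (A f).
Hypothesis B_le : forall m x, iter m B f0 x <= b m.
Hypothesis b_ge0 : forall m, 0 <= b m.

(** The mean of [b] at [m] plus a binomial variable with parameters [n] and [eps]: each application
    of [A] acts as [B] with probability [eps]. *)
Fixpoint mixed_bound (n m : nat) : R :=
  if n is k.+1 then eps * mixed_bound k m.+1 + (1 - eps) * mixed_bound k m
  else b m.

Lemma mixed_bound_ge0 n m : 0 <= mixed_bound n m.
Proof.
elim: n m => //= n IHn m.
by rewrite addr_ge0// mulr_ge0 ?subr_ge0// ltW.
Qed.

Lemma iter_mixed_le n m x : iter n A (iter m B f0) x <= mixed_bound n m.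
Proof.
elim: n m x => [|n IHn] m x /=; first exact: B_le.
apply: (le_trans (A_le (IHn m) x)); rewrite lerD2r ler_wpM2l ?(ltW eps_gt0)//.
by rewrite -(iter_comm AB) -iterS.
Qed.

(** A binomial counter stays at each value for a mean time [1 / eps]. Algebraically, the recursion
    bounds the sum at [m] by [b m] plus [eps] times the sum at [m.+1] plus [1 - eps] times
    itself. *)
Lemma sum_mixed_bound N m :
  \sum_(n < N) mixed_bound n m <= (\sum_(n < N) b (m + n)%N) / eps.
Proof.
elim: N m => [|N IHN] m; first by rewrite !big_ord0 mul0r.
have h : \sum_(n < N.+1) mixed_bound n m <= b m +
    (eps * \sum_(n < N) mixed_bound n m.+1 +
     (1 - eps) * \sum_(n < N.+1) mixed_bound n m).
  rewrite {1}big_ord_recl/= lerD2l big_split/= -!mulr_sumr lerD2l.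
  rewrite ler_wpM2l ?subr_ge0// big_ord_recr/= lerDl; exact: mixed_bound_ge0.
have h2 := IHN m.+1.
rewrite ler_pdivlMr// [X in _ <= X]big_ord_recl addn0.
rewrite ler_pdivlMr// in h2.
have h3 : \sum_(n < N) b (m.+1 + n)%N = \sum_(n < N) b (m + bump 0 n)%N.
  by apply: eq_bigr => n _; rewrite /bump add1n addnS.
rewrite -h3; move: h h2.
move: (\sum_(n < N.+1) _) (\sum_(n < N) _) (\sum_(n < N) _) => x y z; lra.
Qed.

End operator_comparison.

Section transience.
Context (R : realFieldType) (L : zmodType) (J : eqType) (us : seq J).
Context (v : J -> L) (p : J -> R) (c : R).
Context (e1 e2 e3 : L) (l1 l2 l3 : {additive L -> int}).
Hypothesis us_uniq : uniq us.
Hypothesis p_ge0 : forall z, 0 <= p z.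
Hypothesis p_sum : \sum_(z <- us) p z = 1.
Hypothesis c_gt0 : 0 < c.
Hypothesis p_ge : forall z, c <= p z.
Hypothesis l1E : [/\ l1 e1 = 1, l1 e2 = 0 & l1 e3 = 0].
Hypothesis l2E : [/\ l2 e1 = 0, l2 e2 = 1 & l2 e3 = 0].
Hypothesis l3E : [/\ l3 e1 = 0, l3 e2 = 0 & l3 e3 = 1].
Hypothesis steps_e : forall e, e \in [:: e1; e2; e3] ->
  exists2 zz : J * J, (zz.1 \in us) && (zz.2 \in us) &
    v zz.1 = e /\ v zz.2 = - e.
Local Notation W := (walk_op us v p).

Let e_neq e : e \in [:: e1; e2; e3] -> e != - e.
Proof.
case: l1E l2E l3E => l11 l12 l13 [l21 l22 l23] [l31 l32 l33].
have h (l : {additive L -> int}) (x : L) : l x = 1 -> x != - x.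
  by move=> lx; apply/eqP => /(congr1 l); rewrite raddfN lx.
by rewrite !inE => /or3P[] /eqP ->; [exact: (h l1)|exact: (h l2)|exact: (h l3)].
Qed.

Lemma walk_op_ge_avg e (f : L -> R) x : e \in [:: e1; e2; e3] -> (forall y, 0 <= f y) ->
  2 * c * avg e f x <= W f x.
Proof.
move=> ee f0; have [[z z'] /= /andP[zus z'us] [vz vz']] := steps_e ee.
have zz' : z' != z.
  by apply/eqP => zz'; have := e_neq ee; rewrite -vz' -vz zz' eqxx.
rewrite /walk_op (bigD1_seq z)//= -big_filter.
rewrite (bigD1_seq z') ?filter_uniq ?mem_filter ?zz'//= vz vz' addrA.
have -> : 2 * c * avg e f x = c * f (x + e) + c * f (x - e).
  by rewrite /avg; field.
apply: (@le_trans _ _ (p z * f (x + e) + p z' * f (x - e))).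
  by apply: lerD; rewrite ler_wpM2r.
by rewrite lerDl; apply: sumr_ge0 => i _; rewrite mulr_ge0.
Qed.

Lemma walk_op_avg_comm e (f : L -> R) : W (avg e f) = avg e (W f).
Proof.
apply/funext => x; rewrite /walk_op /avg -big_split/= mulr_suml.
apply: eq_bigr => z _; rewrite ![x + v z + _]addrAC [x - e + _]addrAC.
by field.
Qed.

(** Six steps of the walk can follow the six averages of [avg3]. Each of them contributes [2 * c],
    since both signs of a direction have probability at least [c] and [avg] divides by two. *)
Lemma iter_walk_ge_avg3 (f : L -> R) x : (forall y, 0 <= f y) ->
  (2 * c) ^+ 6 * avg3 e1 e2 e3 f x <= iter 6 W f x.
Proof.
have c2 : 0 <= 2 * c by rewrite mulr_ge0// ltW.
have WZ a g y : W (fun t => a * g t) y = a * W g y.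
  by rewrite /walk_op mulr_sumr; apply: eq_bigr => z _; rewrite mulrCA.
have Wle (g h : L -> R) : (forall y, g y <= h y) -> forall y, W g y <= W h y.
  by move=> gh y; apply: ler_sum => z _; rewrite ler_wpM2l.
have step e (g h : L -> R) (a : R) : e \in [:: e1; e2; e3] -> 0 <= a ->
    (forall y, 0 <= g y) -> (forall y, a * g y <= h y) ->
    forall y, a * (2 * c) * avg e g y <= W h y.
  move=> ee a0 g0 gh y; apply: le_trans (Wle _ _ gh y).
  by rewrite WZ -mulrA ler_wpM2l// walk_op_ge_avg.
move=> f0; have -> : (2 * c) ^+ 6 = 1 * (2 * c) * (2 * c) * (2 * c) * (2 * c) * (2 * c) * (2 * c).
  by ring.
have m1 : e1 \in [:: e1; e2; e3] by rewrite !inE eqxx.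
have m2 : e2 \in [:: e1; e2; e3] by rewrite !inE eqxx orbT.
have m3 : e3 \in [:: e1; e2; e3] by rewrite !inE eqxx !orbT.
move: x; rewrite /avg3.
set a := 2 * c in step c2 *.
have q (b : R) : 0 <= b -> 0 <= b * a by move=> b0; rewrite mulr_ge0.
apply: (@step e1 _ (iter 5 W f)); [by []|by do 5 apply: (q _)|by do 5 apply: avg_ge0|].
apply: (@step e1 _ (iter 4 W f)); [by []|by do 4 apply: (q _)|by do 4 apply: avg_ge0|].
apply: (@step e2 _ (iter 3 W f)); [by []|by do 3 apply: (q _)|by do 3 apply: avg_ge0|].
apply: (@step e2 _ (iter 2 W f)); [by []|by do 2 apply: (q _)|by do 2 apply: avg_ge0|].
apply: (@step e3 _ (iter 1 W f)); [by []|exact: q|exact: avg_ge0|].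
apply: (@step e3 _ f); [by []|by []|by []|].
by move=> y; rewrite mul1r.
Qed.

Let eps := (2 * c) ^+ 6.

Let iter_cst n (b : R) x : iter n W (fun=> b) x = b.
Proof.
elim: n x => // n IHn x; rewrite iterS (_ : iter n W _ = fun=> b); last exact/funext.
exact: walk_op_cst.
Qed.

Let iterB n (f g : L -> R) x : iter n W (fun y => f y - g y) x = iter n W f x - iter n W g x.
Proof.
elim: n x => // n IHn x; rewrite !iterS -walk_opB.
by congr (W _ x); apply/funext.
Qed.

Let eps_gt0 : 0 < eps. Proof. by rewrite exprn_gt0// mulr_gt0. Qed.

Let eps_le1 : eps <= 1.
Proof.
have := @iter_walk_ge_avg3 (fun=> 1) 0 (fun=> ler01).
by rewrite iter_cst /avg3 !avg_cst mulr1.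
Qed.

(* Removing a fraction [eps] of [avg3] from the six-step walk leaves a walk,
   which does not increase suprema. *)
Lemma iter_walk_le (f : L -> R) b : (forall x, f x <= b) ->
  forall x, iter 6 W f x <= eps * avg3 e1 e2 e3 f x + (1 - eps) * b.
Proof.
move=> fb x; have := @iter_walk_ge_avg3 (fun y => b - f y) x.
rewrite iterB iter_cst.
have -> : avg3 e1 e2 e3 (fun y => b - f y) x = b - avg3 e1 e2 e3 f x.
  by rewrite /avg3 !avg_cstB.
move=> h; have {}h : eps * (b - avg3 e1 e2 e3 f x) <= b - iter 6 W f x.
  by apply: h => y; rewrite subr_ge0.
by move: h; move: (iter 6 W f x) (avg3 _ _ _ f x) => t u; lra.
Qed.

Let avg3_walk (f : L -> R) : iter 6 W (avg3 e1 e2 e3 f) = avg3 e1 e2 e3 (iter 6 W f).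
Proof.
apply: iter_comm => g; rewrite /avg3.
by rewrite !walk_op_avg_comm.
Qed.

Local Notation bnd := (mixed_bound eps (fun m => cbin R m ^+ 3)).

(** Blocks of six steps obey the comparison with [avg3]; the [n %% 6] steps left over do not raise a
    supremum. *)
Lemma iter_walk_kron_le n x : iter n W (kron R (L:=L)) x <= bnd (n %/ 6) 0.
Proof.
have h q y : iter (q * 6) W (kron R (L:=L)) y <= bnd q 0.
  have -> : iter (q * 6) W (kron R (L:=L)) = iter q (iter 6 W) (kron R (L:=L)).
    by elim: q => // q IHq; rewrite mulSn iterD IHq.
  apply: (@iter_mixed_le _ _ _ (avg3 e1 e2 e3) _ _ _ eps_gt0 _ _ _ q 0) => //.
  - exact: iter_walk_le.
  - by move=> m t; exact: (iter_avg3_le R l1E l2E l3E).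
rewrite {1}(divn_eq n 6) addnC iterD.
elim: (n %% 6)%N x => [|r IHr] x; first exact: h.
by rewrite iterS; apply: walk_op_le.
Qed.

Let sum_div6 N : \sum_(j < N * 6) bnd (j %/ 6) 0 = 6 * \sum_(q < N) bnd q 0.
Proof.
elim: N => [|N IHN]; first by rewrite !big_ord0 mulr0.
rewrite mulSn addnC big_split_ord/= IHN [in RHS]big_ord_recr/= mulrDr; congr (_ + _).
rewrite (eq_bigr (fun=> bnd N 0)); last first.
  by move=> i _; rewrite divnMDl// divn_small ?addn0.
by rewrite sumr_const card_ord -[LHS]mulr_natl.
Qed.

(** The constant is 6 * 2 / eps: six times per block, the bound 2 of [cbin_cube_sum], and the mean
    waiting time [1 / eps] with [eps = (2 * c) ^+ 6]. *)
Lemma green_sum_bounded n :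
  \sum_(j < n) green us v p j 0 <= 12 / (2 * c) ^+ 6.
Proof.
have cb0 m : 0 <= cbin R m ^+ 3 by rewrite exprn_ge0// ltW// cbin_gt0.
apply: (@le_trans _ _ (\sum_(j < n) bnd (j %/ 6) 0)).
  by apply: ler_sum => j _; apply: (green_walk p_ge0 p_sum) => x; exact: iter_walk_kron_le.
apply: (@le_trans _ _ (\sum_(j < n * 6) bnd (j %/ 6) 0)).
  rewrite (big_ord_widen (n * 6) (fun j => bnd (j %/ 6) 0)) ?leq_pmulr//.
  rewrite big_mkcond/=; apply: ler_sum => j _; case: ifP => // _.
  exact: mixed_bound_ge0.
rewrite sum_div6 (_ : 12 / (2 * c) ^+ 6 = 6 * (2 / eps)); last by rewrite mulrA -natrM.
rewrite ler_wpM2l//.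
apply: (le_trans (sum_mixed_bound eps_gt0 eps_le1 cb0 _ _)).
by rewrite ler_pM2r ?invr_gt0//; exact: cbin_cube_sum.
Qed.

End transience.

(** * Paths, steps and moments of one site *)

Section integral_lemmas.
Context (dT : measure_display) (T : measurableType dT) (R : realType).
Variable mu : measure T R.

Lemma ge0_integral_rsum (I : Type) (r : seq I) (F : I -> T -> R) :
  (forall i, measurable_fun setT (F i)) -> (forall i x, 0 <= F i x) ->
  (\int[mu]_x (\sum_(i <- r) F i x)%:E = \sum_(i <- r) \int[mu]_x (F i x)%:E)%E.
Proof.
move=> mF F0; rewrite -ge0_integral_sum//.
- by apply: eq_integral => x _; rewrite sumEFin.
- by move=> i; exact/measurable_EFinP.
- by move=> i x _; rewrite lee_fin.
Qed.

Lemma ge0_integral_rZl (k : R) (f : T -> R) : measurable_fun setT f ->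
  (forall x, 0 <= f x) -> 0 <= k ->
  (\int[mu]_x (k * f x)%:E = k%:E * \int[mu]_x (f x)%:E)%E.
Proof.
move=> mf f0 k0; rewrite -ge0_integralZl//.
- exact/measurable_EFinP.
- by move=> x _; rewrite lee_fin.
Qed.

Lemma ge0_integral_rD (f g : T -> R) : measurable_fun setT f ->
  measurable_fun setT g -> (forall x, 0 <= f x) -> (forall x, 0 <= g x) ->
  (\int[mu]_x (f x + g x)%:E = \int[mu]_x (f x)%:E + \int[mu]_x (g x)%:E)%E.
Proof.
move=> mf mg f0 g0; rewrite -ge0_integralD//.
- by move=> x _; rewrite lee_fin.
- exact/measurable_EFinP.
- by move=> x _; rewrite lee_fin.
- exact/measurable_EFinP.
Qed.

Lemma eq_integral_fun (f g : T -> R) : (forall x, f x = g x) ->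
  (\int[mu]_x (f x)%:E = \int[mu]_x (g x)%:E)%E.
Proof. by move=> fg; apply: eq_integral => x _; rewrite fg. Qed.

End integral_lemmas.

Section steps.
Context (R : realType) (d : nat).
Local Notation U := (step R d).

Lemma step_sqr (z : U) : \sum_i ((z : lattice d) 0 i) ^+ 2 = 1.
Proof.
have := step_unit z; rewrite /enorm => /eqP h.
have s0 : 0 <= \sum_i (lat2vec R z) 0 i ^+ 2 by apply: sumr_ge0 => i _; exact: sqr_ge0.
have {}h : \sum_i (lat2vec R z) 0 i ^+ 2 = 1.
  by rewrite -(sqr_sqrtr s0) h expr1n.
apply: (@intr_inj R); rewrite -[RHS]h raddf_sum/=; apply: eq_bigr => i _.
by rewrite mxE rmorphXn.
Qed.

Lemma step_coord_le1 (z : U) i : `|(z : lattice d) 0 i| <= 1.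
Proof.
have : ((z : lattice d) 0 i) ^+ 2 <= 1.
  rewrite -(step_sqr z) (bigD1 i)//= lerDl; apply: sumr_ge0 => j _; exact: sqr_ge0.
move: ((z : lattice d) 0 i) => k; rewrite expr2 => h.
have : (-1 <= k) && (k <= 1) by nia.
by lia.
Qed.

Lemma finite_steps : finite_set [set: U].
Proof.
pose F (z : U) : {ffun 'I_d.+1 -> 'I_3} := [ffun i => inord (absz ((z : lattice d) 0 i + 1))].
have Finj : injective F.
  move=> z z' FE; apply: val_inj; apply/rowP => i.
  have := congr1 (fun f : {ffun 'I_d.+1 -> 'I_3} => val (f i)) FE; rewrite !ffunE.
  have := step_coord_le1 z i; have := step_coord_le1 z' i.
  change (step_val z 0 i) with ((z : lattice d) 0 i).
  move: ((z : lattice d) 0 i) ((z' : lattice d) 0 i) => a b h1 h2.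
  by rewrite /= !inordK; lia.
rewrite -(preimage_setT F); apply: finite_preimage; first by move=> x y _ _; exact: Finj.
exact: finite_finset.
Qed.

Definition steps_seq : seq U := finmap.enum_fset (fset_set [set: U]).

Lemma mem_steps z : z \in steps_seq.
Proof. by rewrite /steps_seq in_fset_set ?inE//; exact: finite_steps. Qed.

Lemma steps_uniq : uniq steps_seq.
Proof. exact: finmap.fset_uniq. Qed.

Lemma fsum_steps (F : U -> R) :
  \sum_(z \in [set: U]) F z = \sum_(z <- steps_seq) F z.
Proof. by rewrite fsbig_finite//; exact: finite_steps. Qed.

Lemma signed_step_unit (i : 'I_d.+1) (b : bool) :
  enorm (lat2vec R ((if b then delta_mx 0 i else - delta_mx 0 i) : lattice d)) == 1.
Proof.
rewrite /enorm (bigD1 i)//= big1 ?addr0 => [|j ij].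
  by case: b; rewrite !mxE !eqxx/= ?rmorphN/= ?sqrrN rmorph1 expr1n sqrtr1.
by case: b; rewrite !mxE eqxx (negbTE ij)/= ?oppr0 expr0n.
Qed.

Definition signed_step i b : U := Step (signed_step_unit i b).

Definition l1norm (th : 'rV[R]_d.+1) : R := \sum_i `|th 0 i|.

Lemma dot_step_le (th : 'rV[R]_d.+1) (z : U) :
  `|dot th (lat2vec R z)| <= l1norm th.
Proof.
apply: (le_trans (ler_norm_sum _ _ _)); apply: ler_sum => i _.
rewrite normrM mxE -[leRHS]mulr1 ler_wpM2l// -intr_norm -[leRHS]/(1%:~R).
by rewrite ler_int; exact: step_coord_le1.
Qed.

End steps.

Section transitions.
Context (R : realType) (d : nat).
Local Notation U := (step R d).
Local Notation E := (env R d).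
Local Notation pos := (@pos (lattice d) U (@step_val R d)).
Implicit Types (w : E) (s : seq U) (x y : lattice d) (n m : int).

Lemma transitionD w n x y : transition w n x (x + y) = w (n, x) y.
Proof. by rewrite /transition addrAC subrr add0r. Qed.

Fixpoint path_weight w n x s : R :=
  if s is z :: s' then w (n, x) z * path_weight w (n + 1) (x + step_val z) s' else 1.

Lemma pv_le1 (p : prob_vector R d) y : p y <= 1.
Proof.
have p0 z : (0 <= (p z)%:E)%E by rewrite lee_fin pv_ge0.
rewrite -lee_fin -(pv_sum1 p) (esumID [set y])// setTI esum_set1//.
by rewrite leeDl// esum_ge0.
Qed.

Lemma path_weight_ge0 w n x s : 0 <= path_weight w n x s.
Proof. by elim: s n x => //= z s IHs n x; rewrite mulr_ge0 ?pv_ge0. Qed.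

Lemma path_weight_le1 w n x s : path_weight w n x s <= 1.
Proof.
elim: s n x => //= z s IHs n x.
by rewrite -[leRHS]mulr1 ler_pM ?pv_ge0 ?path_weight_ge0 ?pv_le1.
Qed.

Lemma pos_cons z s : pos (z :: s) = step_val z + pos s.
Proof. by rewrite /pos big_cons. Qed.

Lemma pos_nil : pos [::] = 0. Proof. by rewrite /pos big_nil. Qed.

Lemma pos_cat s t : pos (s ++ t) = pos s + pos t.
Proof. by rewrite /pos big_cat. Qed.

Lemma pos_rcons s z : pos (rcons s z) = pos s + step_val z.
Proof. by rewrite -cats1 pos_cat pos_cons pos_nil addr0. Qed.

Lemma path_weight_cat w n x s t : path_weight w n x (s ++ t) =
  path_weight w n x s * path_weight w (n + (size s)%:Z) (x + pos s) t.
Proof.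
elim: s n x => [|z s IHs] n x /=; first by rewrite mul1r pos_nil !addr0.
rewrite IHs mulrA pos_cons addrA; congr (_ * path_weight _ _ _ _).
by rewrite -addrA -PoszD add1n.
Qed.

Lemma path_weight_rcons w n x s z : path_weight w n x (rcons s z) =
  path_weight w n x s * w (n + (size s)%:Z, x + pos s) z.
Proof. by rewrite -cats1 path_weight_cat /= mulr1. Qed.

Lemma path_weight_shift w n m x y s :
  path_weight (env_shift m y w) n x s = path_weight w (n + m) (x + y) s.
Proof.
elim: s n x => //= z s IHs n x; rewrite IHs; congr (_ * path_weight _ _ _ _).
  by rewrite addrAC.
by rewrite addrAC.
Qed.

Lemma env_shiftD m n x y w :
  env_shift m x (env_shift n y w) = env_shift (m + n) (x + y) w.
Proof. by apply/funext => -[a b]; rewrite /env_shift/= !addrA. Qed.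

Lemma env_shift0 w : env_shift 0 0 w = w.
Proof. by apply/funext => -[a b]; rewrite /env_shift/= !addr0. Qed.

Lemma measurable_pv n x y : measurable_fun setT (fun w : E => w (n, x) y).
Proof.
have m1 : measurable_fun setT (@pv_coord R d y).
  move=> _ B mB; rewrite setTI; apply: sub_sigma_algebra.
  by exists y => //; exists B => //; rewrite setTI.
have := measurableT_comp m1 (@measurable_eval_at (site d) _ (prob_vector R d) (n, x)).
by [].
Qed.

Lemma measurable_path_weight n x s :
  measurable_fun setT (fun w : E => path_weight w n x s).
Proof.
elim: s n x => [|z s IHs] n x /=; first exact: measurable_cst.
by apply: measurable_funM; [exact: measurable_pv|exact: IHs].
Qed.

Definition times_ge n : pred (site d) := fun i => n <= i.1.
Definition times_lt n : pred (site d) := fun i => i.1 < n.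
Definition times_in n m : pred (site d) := fun i => (n <= i.1) && (i.1 < m).

Lemma depends_path_weight n x s :
  depends (times_in n (n + (size s)%:Z)) (fun w : E => path_weight w n x s).
Proof.
elim: s n x => [//|z s IHs] n x w w' ww' /=; congr (_ * _).
  by rewrite ww'// /times_in/=; lia.
apply: IHs => i; rewrite /times_in => h; apply: ww'.
by move: h; rewrite /times_in/=; lia.
Qed.

Lemma depends_shift (S S' : pred (site d)) m x (Y : Type) (f : E -> Y) :
  depends S f -> (forall i, S i -> S' (i.1 + m, i.2 + x)) ->
  depends S' (fun w => f (env_shift m x w)).
Proof. by move=> fS SS' w w' ww'; apply: fS => i Si; apply: ww'; exact: SS'. Qed.

Lemma sigma_geE n (A : set E) :
  sigma_ge n A <-> measurable A /\ depends (times_ge n) A.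
Proof. exact: (@sigma_coordE (site d) _ (prob_vector R d) (times_ge n)). Qed.

Lemma sigma_leE n (A : set E) :
  sigma_le n A <-> measurable A /\ depends (fun i : site d => i.1 <= n) A.
Proof. exact: (@sigma_coordE (site d) _ (prob_vector R d) (fun i => i.1 <= n)). Qed.

End transitions.

Lemma bigcap_measurable_countable (dT : measure_display) (T : measurableType dT)
    (I : countType) (D : set I) (F : I -> set T) :
  (forall i, D i -> measurable (F i)) -> measurable (\bigcap_(i in D) F i).
Proof.
move=> mF; rewrite -[X in measurable X]setCK setC_bigcap.
apply: measurableC; rewrite bigcup_mkcond.
apply: countable_bigcupT_measurable => [|i]; first exact: countableP.
by case: ifPn => // /set_mem Di; apply: measurableC; exact: mF.
Qed.

Lemma ae_forall_countable (dT : measure_display) (T : measurableType dT)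
    (R : realType) (mu : measure T R) (I : countType) (Q : I -> T -> Prop) :
  (forall i, {ae mu, forall w, Q i w}) -> {ae mu, forall w, forall i, Q i w}.
Proof.
move=> Qi; have := @ae_foralln _ _ _ mu
  (fun n w => if unpickle n is Some i then Q i w else True) _.
have h n : {ae mu, forall w, if unpickle n is Some i then Q i w else True}.
  by case: unpickle => [i|]; [exact: Qi|exact: aeW].
move=> /(_ h); apply: filterS => w hw i.
by have := hw (pickle i); rewrite pickleK.
Qed.

Section one_step_moments.
Context (R : realType) (d : nat) (P : probability (env R d) R) (c : R).
Hypothesis hiid : iid_environment P.
Hypothesis hnn : nearest_neighbor P.
Hypothesis c_gt0 : 0 < c.
Hypothesis hc : forall z : step R d, P [set w | c <= transition w 0 0 z] = 1%E.
Local Notation U := (step R d).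
Local Notation E := (env R d).
Local Notation us := (steps_seq R d).

Lemma ge0_bounded_integral (f : E -> R) (b : R) : measurable_fun setT f ->
  (forall w, 0 <= f w) -> (forall w, f w <= b) ->
  (\int[P]_w (f w)%:E = (fine (\int[P]_w (f w)%:E))%:E)%E.
Proof.
move=> mf f0 fb; rewrite fineK// ge0_fin_numE; last first.
  by apply: integral_ge0 => w _; rewrite lee_fin.
apply: (@le_lt_trans _ _ (\int[P]_w (b%:E))%E).
  apply: ge0_le_integral => //.
  - by move=> w _; rewrite lee_fin.
  - exact/measurable_EFinP.
  - by move=> w _; rewrite lee_fin.
by rewrite integral_cst//= probability_setT mule1 ltry.
Qed.

Lemma integral_pv n x (z : U) :
  (\int[P]_w (w (n, x) (z : lattice d))%:E = (q_step P z)%:E)%E.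
Proof.
have -> : q_step P z = fine (\int[P]_w (w (0, 0) (z : lattice d))%:E)%E.
  rewrite /q_step /Rintegral; congr fine; apply: eq_integral_fun => w.
  by rewrite /transition subr0.
rewrite -(@ge0_bounded_integral _ 1); first last.
- by move=> w; exact: pv_le1.
- by move=> w; exact: pv_ge0.
- exact: measurable_pv.
rewrite -(env_shift_integral hiid n x (f := fun w : E => (w (0, 0) (z : lattice d))%:E)).
- by apply: eq_integral_fun => w; rewrite /env_shift /= !add0r.
- by apply/measurable_EFinP; exact: measurable_pv.
- by move=> w; rewrite lee_fin pv_ge0.
Qed.

Lemma q_ge0 (z : U) : 0 <= q_step P z.
Proof.
rewrite /q_step /Rintegral fine_ge0//; apply: integral_ge0 => w _.
by rewrite lee_fin pv_ge0.
Qed.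

Definition q2_step (z z' : U) : R :=
  fine (\int[P]_w (w (0, 0) (z : lattice d) * w (0, 0) (z' : lattice d))%:E)%E.

Lemma q2_stepC z z' : q2_step z z' = q2_step z' z.
Proof. by congr fine; apply: eq_integral_fun => w; rewrite mulrC. Qed.

Let measurable_pvM n x y n' x' y' :
  measurable_fun setT (fun w : E => w (n, x) y * w (n', x') y').
Proof. by apply: measurable_funM; exact: measurable_pv. Qed.

Let pvM_ge0 n x y n' x' y' (w : E) : 0 <= w (n, x) y * w (n', x') y'.
Proof. by rewrite mulr_ge0 ?pv_ge0. Qed.

Lemma integral_pv2 n x x' (z z' : U) :
  (\int[P]_w (w (n, x) (z : lattice d) * w (n, x') (z' : lattice d))%:E =
   (if x' == x then q2_step z z' else q_step P z * q_step P z')%:E)%E.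
Proof.
case: eqP => [->|xx'].
  rewrite /q2_step -(@ge0_bounded_integral _ 1)//; last first.
    by move=> w; rewrite -[leRHS]mulr1 ler_pM ?pv_ge0 ?pv_le1.
  rewrite -(env_shift_integral hiid n x
    (f := fun w : E => (w (0, 0) (z : lattice d) * w (0, 0) (z' : lattice d))%:E)).
  - by apply: eq_integral_fun => w; rewrite /env_shift /= !add0r.
  - exact/measurable_EFinP.
  - by move=> w; rewrite lee_fin.
rewrite (indep_integral hiid (S := pred1 (n, x)) (S' := pred1 (n, x'))).
- by rewrite !integral_pv.
- by move=> i /eqP -> /eqP[/esym].
- exact: measurable_pv.
- exact: measurable_pv.
- by move=> w w' ww' /=; rewrite ww'/=.
- by move=> w w' ww' /=; rewrite ww'/=.
- by move=> w; exact: pv_ge0.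
- by move=> w; exact: pv_ge0.
Qed.

(** The nearest-neighbor hypothesis concerns one site and one displacement at a time; this collects
    all of them in a measurable set of full measure, on which rows sum to 1 over unit steps and
    quenched laws can be computed. *)
Definition nn_env : set E := [set w | forall n x (y : lattice d),
  enorm (lat2vec R y) != 1 -> w (n, x) y = 0].

Lemma measurable_nn_env : measurable nn_env.
Proof.
have -> : nn_env = \bigcap_(y in [set y : lattice d | enorm (lat2vec R y) != 1])
    \bigcap_(s in [set: site d]) [set w : E | w s y = 0].
  apply/seteqP; split => [w h y /= y1 [n x] _|w h n x y y1]; first exact: h.
  exact: (h y y1 (n, x)).
apply: bigcap_measurable_countable => y _; apply: bigcap_measurable_countable => -[n x] _.
have := @measurable_pv R d n x y measurableT [set 0] (measurable_set1 0).
by rewrite setTI.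
Qed.

Lemma nn_env_ae : {ae P, forall w, nn_env w}.
Proof.
have h (s : site d) (y : lattice d) : {ae P, forall w : E,
    enorm (lat2vec R y) != 1 -> w s y = 0}.
  have [y1|y1] := boolP (enorm (lat2vec R y) != 1); last exact: aeW.
  have h0 : P [set w : E | 0 < w (0, 0) y] = 0%E.
    have := hnn y1; rewrite (_ : mkset _ = [set w : E | 0 < w (0, 0) y])//.
    by apply/seteqP; split => w; rewrite /= /transition subr0.
  have m0 (t : site d) : measurable [set w : E | 0 < w t y].
    rewrite (_ : mkset _ = (fun w : E => w t y) @^-1` `]0, +oo[%classic).
      by rewrite -[X in measurable X]setTI; case: t => a b; exact: measurable_pv.
    by apply/seteqP; split => w; rewrite /= in_itv/= andbT.
  have : P [set w : E | 0 < w s y] = 0%E.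
    rewrite -h0 -[RHS](env_shift_measure hiid s.1 s.2 (m0 _)); congr (P _).
    by apply/seteqP; split => w; rewrite /= /env_shift/= !add0r; case: s.
  move=> /(negligibleP P (m0 s)) [N [mN PN sN]]; exists N; split => //.
  apply: subset_trans sN => w /= ws; rewrite lt_neqAle eq_sym pv_ge0 andbT.
  by apply/eqP => ws0; apply: ws => _.
have := @ae_forall_countable _ _ _ P (site d * lattice d)%type
  (fun i w => enorm (lat2vec R i.2) != 1 -> w i.1 i.2 = 0) (fun i => h i.1 i.2).
by apply: filterS => w hw n x y y1; exact: (hw ((n, x), y)).
Qed.

Lemma row_sum w n x : nn_env w -> \sum_(z <- us) w (n, x) (z : lattice d) = 1.
Proof.
move=> nnw; set p := w (n, x).
have p0 z : (0 <= (p z)%:E)%E by rewrite lee_fin pv_ge0.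
apply: EFin_inj; rewrite -(pv_sum1 p) (esumID (range (@step_val R d)))// setTI.
rewrite [X in _ = (_ + X)%E]esum1 ?adde0; last first.
  move=> y [_ /= yU]; rewrite /p nnw//; apply/negP => y1; apply: yU.
  by exists (Step y1).
rewrite esum_fset//; last first.
  by apply: finite_image; exact: finite_steps.
rewrite (@reindex_fsbig _ _ _ _ _ (@step_val R d) setT); last first.
  split; first by move=> z _; exists z.
    by move=> z z' _ _; exact: val_inj.
  by move=> _ [z _ <-]; exists z.
by rewrite fsbig_finite/=; [rewrite -sumEFin|exact: finite_steps].
Qed.

Lemma q_sum : \sum_(z <- us) q_step P z = 1.
Proof.
apply: EFin_inj; rewrite -sumEFin.
transitivity (\int[P]_w (\sum_(z <- us) w (0, 0) (z : lattice d))%:E)%E.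
  rewrite ge0_integral_rsum.
  - by apply: eq_bigr => z _; rewrite integral_pv.
  - by move=> z; exact: measurable_pv.
  - by move=> z w; exact: pv_ge0.
rewrite (@ge0_ae_eq_integral _ _ _ P setT _ (cst 1%E))//.
- by rewrite integral_cst//= probability_setT mul1e.
- by apply/measurable_EFinP; apply: measurable_sum => z; exact: measurable_pv.
- by move=> w _; rewrite lee_fin sumr_ge0// => z _; exact: pv_ge0.
- have := nn_env_ae; apply: filterS => w nnw _ /=; congr EFin; exact: row_sum.
Qed.

Lemma q_le1 (z : U) : q_step P z <= 1.
Proof.
rewrite -q_sum (bigD1_seq z) ?mem_steps ?steps_uniq//= lerDl.
by apply: sumr_ge0 => y _; exact: q_ge0.
Qed.

Lemma elliptic_ae : {ae P, forall w : E, forall (z : U) n x, c <= w (n, x) (z : lattice d)}.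
Proof.
have mc (t : site d) (z : U) : measurable [set w : E | c <= w t (z : lattice d)].
  rewrite (_ : mkset _ = (fun w : E => w t (z : lattice d)) @^-1` `[c, +oo[%classic).
    by rewrite -[X in measurable X]setTI; case: t => a b; exact: measurable_pv.
  by apply/seteqP; split => w; rewrite /= in_itv/= andbT.
have h (z : U) (s : site d) : {ae P, forall w : E, c <= w s (z : lattice d)}.
  have h1 : P [set w : E | c <= w s (z : lattice d)] = 1%E.
    rewrite -(hc z) (_ : [set w | c <= transition w 0 0 z] =
      [set w : E | c <= w (0, 0) (z : lattice d)]); last first.
      by apply/seteqP; split => w; rewrite /= /transition subr0.
    rewrite -[RHS](env_shift_measure hiid s.1 s.2 (mc _ _)); congr (P _).
    by apply/seteqP; split => w; rewrite /= /env_shift/= !add0r; case: s.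
  apply/(@negligibleP _ _ _ P); first exact: measurableC.
  by apply: etrans (probability_setC P (mc s z)) _; rewrite h1 subee.
have := @ae_forall_countable _ _ _ P (U * site d)%type
  (fun i w => c <= w i.2 (step_val i.1)) (fun i => h i.1 i.2).
by apply: filterS => w hw z n x; exact: (hw (z, (n, x))).
Qed.

Lemma ae_ge_integral (f : E -> R) (b : R) : measurable_fun setT f ->
  (forall w, 0 <= f w) -> 0 <= b -> {ae P, forall w, b <= f w} ->
  (b%:E <= \int[P]_w (f w)%:E)%E.
Proof.
move=> mf f0 b0 bf; have -> : (b%:E = \int[P]_w (cst b%:E w))%E.
  by rewrite integral_cst//= probability_setT mule1.
apply: ae_ge0_le_integral => //.
- by move=> w _; rewrite lee_fin.
- exact/measurable_EFinP.
- by apply: filterS bf => w bw _ /=; rewrite lee_fin.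
Qed.

Lemma q_ge (z : U) : c <= q_step P z.
Proof.
rewrite -lee_fin -(integral_pv 0 0 z); apply: ae_ge_integral.
- exact: measurable_pv.
- by move=> w; exact: pv_ge0.
- exact: ltW.
- by apply: filterS elliptic_ae => w; exact.
Qed.

Lemma q2_ge (z z' : U) : c ^+ 2 <= q2_step z z'.
Proof.
have := integral_pv2 0 0 0 z z'; rewrite eqxx -lee_fin => <-.
apply: ae_ge_integral => //; first exact: sqr_ge0.
apply: filterS elliptic_ae => w h; rewrite expr2.
by apply: ler_pM => //; exact: ltW.
Qed.

Lemma c_le1 : c <= 1.
Proof. by apply: le_trans (q_le1 point); exact: q_ge. Qed.

End one_step_moments.

(** * Tilted partition functions *)

Lemma integral_one (dT : measure_display) (T : measurableType dT) (R : realType)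
  (P : probability T R) : (\int[P]_w (cst 1%R w)%:E = 1)%E.
Proof.
have := integral_cst P measurableT 1%E; rewrite mul1e => ->.
exact: probability_setT.
Qed.

Section tilt.
Context (R : realType) (d : nat) (P : probability (env R d) R).
Context (th : 'rV[R]_d.+1).
Local Notation U := (step R d).
Local Notation E := (env R d).
Local Notation us := (steps_seq R d).
Local Notation pos := (@pos (lattice d) U (@step_val R d)).

Definition tilt (z : U) : R := expR (dot th (lat2vec R z) - ln (phi_a P th)).

Definition tilt_word (s : seq U) : R := \prod_(z <- s) tilt z.

Definition tstep (z : U) : R := q_step P z * tilt z.

Definition tstep2 (z z' : U) : R := q2_step P z z' * (tilt z * tilt z').

Definition fwd (n : nat) (w : E) : R :=
  \sum_(s <- words us n) tilt_word s * path_weight w 0 0 s.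

(* Weight of the paths that end at the origin at time [0]. *)
Definition bwd (n : nat) (w : E) : R :=
  \sum_(s <- words us n) tilt_word s * path_weight w (- n%:Z) (- pos s) s.

Lemma tilt_gt0 z : 0 < tilt z. Proof. exact: expR_gt0. Qed.

Lemma tilt_ge0 z : 0 <= tilt z. Proof. exact: ltW (tilt_gt0 z). Qed.

Lemma tilt_word_gt0 s : 0 < tilt_word s.
Proof. by rewrite /tilt_word; elim/big_ind: _ => // [x y x0 y0|z _]; [rewrite mulr_gt0|exact: tilt_gt0]. Qed.

Lemma tilt_word_ge0 s : 0 <= tilt_word s.
Proof. exact: ltW (tilt_word_gt0 s). Qed.

Lemma tilt_word_cons z s : tilt_word (z :: s) = tilt z * tilt_word s.
Proof. by rewrite /tilt_word big_cons. Qed.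

Lemma tilt_word_cat s t : tilt_word (s ++ t) = tilt_word s * tilt_word t.
Proof. by rewrite /tilt_word big_cat. Qed.

Lemma tilt_word_rcons s z : tilt_word (rcons s z) = tilt_word s * tilt z.
Proof. by rewrite -cats1 tilt_word_cat /tilt_word big_seq1. Qed.

Lemma tilt_word_nil : tilt_word [::] = 1.
Proof. by rewrite /tilt_word big_nil. Qed.

Lemma lat2vecD (x y : lattice d) : lat2vec R (x + y) = lat2vec R x + lat2vec R y.
Proof. by apply/rowP => i; rewrite !mxE intrD. Qed.

Lemma dotDr (t x y : 'rV[R]_d.+1) : dot t (x + y) = dot t x + dot t y.
Proof. by rewrite -big_split; apply: eq_bigr => i _; rewrite mxE mulrDr. Qed.

Lemma lat2vec0 : lat2vec R (0 : lattice d) = 0.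
Proof. by apply/rowP => i; rewrite !mxE. Qed.

Lemma dotr0 (t : 'rV[R]_d.+1) : dot t 0 = 0.
Proof. by rewrite /dot big1// => i _; rewrite mxE mulr0. Qed.

Lemma tilt_wordE s : tilt_word s =
  expR (dot th (lat2vec R (pos s)) - (size s)%:R * ln (phi_a P th)).
Proof.
elim: s => [|z s IHs].
  by rewrite tilt_word_nil pos_nil lat2vec0 dotr0 mul0r subr0 expR0.
rewrite tilt_word_cons IHs -expRD pos_cons lat2vecD dotDr /= -natr1 mulrDl mul1r.
by congr expR; ring.
Qed.

Lemma fwd0 w : fwd 0 w = 1.
Proof. by rewrite /fwd big_words0 tilt_word_nil /= mulr1. Qed.

Lemma bwd0 w : bwd 0 w = 1.
Proof. by rewrite /bwd big_words0 tilt_word_nil /= mulr1. Qed.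

Lemma fwdS n w : fwd n.+1 w =
  \sum_(z <- us) tilt z * (w (0, 0) (z : lattice d) * fwd n (env_shift 1 z w)).
Proof.
rewrite /fwd big_wordsS; apply: eq_bigr => z _; rewrite 2!mulr_sumr.
apply: eq_bigr => s _; rewrite tilt_word_cons /= path_weight_shift !add0r; ring.
Qed.

Lemma bwdS n w : bwd n.+1 w =
  \sum_(z <- us) tilt z *
    (w (-1, - step_val z) (z : lattice d) * bwd n (env_shift (-1) (- step_val z) w)).
Proof.
rewrite /bwd big_words_rcons exchange_big/=; apply: eq_bigr => z _.
rewrite 2!mulr_sumr; apply: eq_big_seq => s /size_words sn.
rewrite tilt_word_rcons path_weight_rcons path_weight_shift pos_rcons sn.
have -> : - n.+1%:Z + n%:Z = -1 by lia.
have -> : - (pos s + step_val z) + pos s = - step_val z.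
  by rewrite opprD addrAC addNr add0r.
have -> : - n%:Z - 1 = - n.+1%:Z by lia.
by rewrite opprD; ring.
Qed.

Lemma fwd_ge0 n w : 0 <= fwd n w.
Proof. by apply: sumr_ge0 => s _; rewrite mulr_ge0 ?tilt_word_ge0 ?path_weight_ge0. Qed.

Lemma bwd_ge0 n w : 0 <= bwd n w.
Proof. by apply: sumr_ge0 => s _; rewrite mulr_ge0 ?tilt_word_ge0 ?path_weight_ge0. Qed.

Lemma fwd_le n w : fwd n w <= \sum_(s <- words us n) tilt_word s.
Proof.
apply: ler_sum => s _; rewrite -[leRHS]mulr1 ler_wpM2l ?tilt_word_ge0//.
exact: path_weight_le1.
Qed.

Lemma bwd_le n w : bwd n w <= \sum_(s <- words us n) tilt_word s.
Proof.
apply: ler_sum => s _; rewrite -[leRHS]mulr1 ler_wpM2l ?tilt_word_ge0//.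
exact: path_weight_le1.
Qed.

Lemma measurable_fwd n : measurable_fun setT (fwd n).
Proof.
apply: measurable_sum => s; apply: measurable_funM => //.
exact: measurable_path_weight.
Qed.

Lemma measurable_bwd n : measurable_fun setT (bwd n).
Proof.
apply: measurable_sum => s; apply: measurable_funM => //.
exact: measurable_path_weight.
Qed.

Lemma depends_fwd n : depends (times_in 0 n%:Z) (fwd n).
Proof.
move=> w w' ww'; apply: eq_big_seq => s /size_words sn; congr (_ * _).
by apply: depends_path_weight => i; rewrite sn add0r; exact: ww'.
Qed.

Lemma depends_bwd n : depends (times_in (- n%:Z) 0) (bwd n).
Proof.
move=> w w' ww'; apply: eq_big_seq => s /size_words sn; congr (_ * _).
by apply: depends_path_weight => i; rewrite sn addNr; exact: ww'.
Qed.

Lemma phi_aE : phi_a P th =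
  \sum_(z <- us) q_step P z * expR (dot th (lat2vec R z)).
Proof. exact: fsum_steps. Qed.

Hypothesis hiid : iid_environment P.
Hypothesis hnn : nearest_neighbor P.

Lemma phi_gt0 : 0 < phi_a P th.
Proof.
rewrite lt_neqAle eq_sym; apply/andP; split; last first.
  by rewrite phi_aE sumr_ge0// => z _; rewrite mulr_ge0 ?q_ge0 ?expR_ge0.
apply/eqP => phi0.
have h z : z \in us -> q_step P z * expR (dot th (lat2vec R z)) = 0.
  move=> zus; move: phi0; rewrite phi_aE => /eqP; rewrite psumr_eq0; last first.
    by move=> y _; rewrite mulr_ge0 ?q_ge0 ?expR_ge0.
  by move=> /allP/(_ z zus)/eqP.
have : \sum_(z <- us) q_step P z = 0.
  apply: big1_seq => z /andP[_ zus]; have /eqP := h z zus.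
  by rewrite mulf_eq0 (gt_eqF (expR_gt0 _)) orbF => /eqP.
by rewrite q_sum// => /eqP; rewrite oner_eq0.
Qed.

Lemma tiltE z : tilt z = expR (dot th (lat2vec R z)) / phi_a P th.
Proof. by rewrite /tilt expRB lnK// posrE phi_gt0. Qed.

Lemma tstep_ge0 z : 0 <= tstep z.
Proof. by rewrite mulr_ge0 ?q_ge0 ?tilt_ge0. Qed.

Lemma tstep_sum : \sum_(z <- us) tstep z = 1.
Proof.
rewrite /tstep; under eq_bigr do rewrite tiltE mulrA.
by rewrite -mulr_suml -phi_aE divff// gt_eqF// phi_gt0.
Qed.

(** The martingale property, tested against functions of the past. The new step reads a site at time
    [n], which is independent of [h] and of the path before, and its tilted mean is 1 by the
    normalization with phi. *)
Lemma fwd_step n (h : E -> R) : measurable_fun setT h -> (forall w, 0 <= h w) ->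
  depends (times_lt n%:Z) h ->
  (\int[P]_w (fwd n.+1 w * h w)%:E = \int[P]_w (fwd n w * h w)%:E)%E.
Proof.
move=> mh h0 dh.
have mp s : measurable_fun setT (fun w : E => path_weight w 0 0 s * h w).
  by apply: measurable_funM => //; exact: measurable_path_weight.
have p0 s w : 0 <= path_weight w 0 0 s * h w by rewrite mulr_ge0 ?path_weight_ge0.
rewrite (@eq_integral_fun _ _ _ _ _ (fun w => \sum_(s <- words us n) \sum_(z <- us)
    tilt_word s * tilt z *
    (path_weight w 0 0 s * h w * w (n%:Z, pos s) (z : lattice d)))); last first.
  move=> w; rewrite /fwd big_words_rcons mulr_suml; apply: eq_big_seq => s.
  move=> /size_words sn; rewrite mulr_suml; apply: eq_bigr => z _.
  by rewrite tilt_word_rcons path_weight_rcons sn !add0r; ring.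
have mF s z : measurable_fun setT (fun w : E => tilt_word s * tilt z *
    (path_weight w 0 0 s * h w * w (n%:Z, pos s) (z : lattice d))).
  apply: measurable_funM => //; apply: measurable_funM => //; exact: measurable_pv.
have F0 s z (w : E) : 0 <= tilt_word s * tilt z *
    (path_weight w 0 0 s * h w * w (n%:Z, pos s) (z : lattice d)).
  by rewrite !mulr_ge0 ?tilt_word_ge0 ?tilt_ge0 ?path_weight_ge0 ?pv_ge0.
rewrite [RHS](@eq_integral_fun _ _ _ _ _ (fun w => \sum_(s <- words us n)
    tilt_word s * (path_weight w 0 0 s * h w))); last first.
  by move=> w; rewrite /fwd mulr_suml; apply: eq_bigr => s _; rewrite mulrA.
rewrite ge0_integral_rsum; [|by move=> s; exact: measurable_sum|
  by move=> s w; apply: sumr_ge0].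
rewrite ge0_integral_rsum; [|by move=> s; apply: measurable_funM|
  by move=> s w; rewrite mulr_ge0 ?tilt_word_ge0].
apply: eq_big_seq => s /size_words sn.
rewrite ge0_integral_rsum//.
rewrite [RHS]ge0_integral_rZl ?tilt_word_ge0//.
transitivity (\sum_(z <- us) ((tilt_word s * tstep z)%:E *
    \int[P]_w (path_weight w 0 0 s * h w)%:E))%E.
  apply: eq_bigr => z _.
  rewrite ge0_integral_rZl; last 3 first.
  - by apply: measurable_funM => //; exact: measurable_pv.
  - by move=> w; rewrite mulr_ge0 ?pv_ge0.
  - by rewrite mulr_ge0 ?tilt_word_ge0 ?tilt_ge0.
  rewrite (indep_integral hiid (S := times_lt n%:Z) (S' := pred1 (n%:Z, pos s))
    (f := fun w : E => path_weight w 0 0 s * h w)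
    (g := fun w : E => w (n%:Z, pos s) (z : lattice d)))//.
  - rewrite integral_pv// muleCA -EFinM muleC; congr (_%:E * _)%E.
    by rewrite /tstep; ring.
  - by move=> i /[swap] /eqP -> ; rewrite /times_lt/= ltxx.
  - exact: measurable_pv.
  - move=> w w' ww'; congr (_ * _); last exact: dh.
    apply: (dependsW _ (@depends_path_weight R d 0 0 s)) ww' => i.
    by rewrite /times_in sn add0r => /andP[].
  - by move=> w w' ww' /=; rewrite ww'/=.
  - by move=> w; exact: pv_ge0.
rewrite -ge0_sume_distrl; last by move=> z _; rewrite lee_fin mulr_ge0 ?tilt_word_ge0 ?tstep_ge0.
by rewrite sumEFin -mulr_sumr tstep_sum mulr1.
Qed.

(** Time runs backward here: the new step precedes the path and reads a site at time [- n.+1], below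
    all times seen by [h] and by the path. *)
Lemma bwd_step n (h : E -> R) : measurable_fun setT h -> (forall w, 0 <= h w) ->
  depends (times_ge (- n%:Z)) h ->
  (\int[P]_w (bwd n.+1 w * h w)%:E = \int[P]_w (bwd n w * h w)%:E)%E.
Proof.
move=> mh h0 dh.
pose pw s (w : E) := path_weight w (- n%:Z) (- pos s) s.
have mp s : measurable_fun setT (fun w : E => pw s w * h w).
  by apply: measurable_funM => //; exact: measurable_path_weight.
have p0 s w : 0 <= pw s w * h w by rewrite mulr_ge0 ?path_weight_ge0.
rewrite (@eq_integral_fun _ _ _ _ _ (fun w => \sum_(s <- words us n) \sum_(z <- us)
    tilt_word s * tilt z *
    (pw s w * h w * w (- n.+1%:Z, - pos (z :: s)) (z : lattice d)))); last first.
  move=> w; rewrite /bwd big_wordsS exchange_big/= mulr_suml; apply: eq_big_seq => s.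
  move=> /size_words sn; rewrite mulr_suml; apply: eq_bigr => z _.
  rewrite tilt_word_cons /= /pw.
  have -> : - n.+1%:Z + 1 = - n%:Z by lia.
  have -> : - pos (z :: s) + step_val z = - pos s.
    by rewrite pos_cons opprD addrAC addNr add0r.
  ring.
have mF s z : measurable_fun setT (fun w : E => tilt_word s * tilt z *
    (pw s w * h w * w (- n.+1%:Z, - pos (z :: s)) (z : lattice d))).
  apply: measurable_funM => //; apply: measurable_funM => //; exact: measurable_pv.
have F0 s z (w : E) : 0 <= tilt_word s * tilt z *
    (pw s w * h w * w (- n.+1%:Z, - pos (z :: s)) (z : lattice d)).
  by rewrite !mulr_ge0 ?tilt_word_ge0 ?tilt_ge0 ?path_weight_ge0 ?pv_ge0.
rewrite [RHS](@eq_integral_fun _ _ _ _ _ (fun w => \sum_(s <- words us n)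
    tilt_word s * (pw s w * h w))); last first.
  by move=> w; rewrite /bwd mulr_suml; apply: eq_bigr => s _; rewrite mulrA.
rewrite ge0_integral_rsum; [|by move=> s; exact: measurable_sum|
  by move=> s w; apply: sumr_ge0].
rewrite ge0_integral_rsum; [|by move=> s; apply: measurable_funM|
  by move=> s w; rewrite mulr_ge0 ?tilt_word_ge0].
apply: eq_big_seq => s /size_words sn.
rewrite ge0_integral_rsum//.
rewrite [RHS]ge0_integral_rZl ?tilt_word_ge0//.
transitivity (\sum_(z <- us) ((tilt_word s * tstep z)%:E *
    \int[P]_w (pw s w * h w)%:E))%E.
  apply: eq_bigr => z _.
  rewrite ge0_integral_rZl; last 3 first.
  - by apply: measurable_funM => //; exact: measurable_pv.
  - by move=> w; rewrite mulr_ge0 ?pv_ge0.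
  - by rewrite mulr_ge0 ?tilt_word_ge0 ?tilt_ge0.
  rewrite (indep_integral hiid (S := times_ge (- n%:Z))
    (S' := pred1 (- n.+1%:Z, - pos (z :: s))) (f := fun w : E => pw s w * h w)
    (g := fun w : E => w (- n.+1%:Z, - pos (z :: s)) (z : lattice d)))//.
  - rewrite integral_pv// muleCA -EFinM muleC; congr (_%:E * _)%E.
    by rewrite /tstep; ring.
  - by move=> i /[swap] /eqP -> ; rewrite /times_ge/=; lia.
  - exact: measurable_pv.
  - move=> w w' ww'; congr (_ * _); last exact: dh.
    apply: (dependsW _ (@depends_path_weight R d (- n%:Z) (- pos s) s)) ww' => i.
    by rewrite /times_in => /andP[].
  - by move=> w w' ww' /=; rewrite ww'/=.
  - by move=> w; exact: pv_ge0.
rewrite -ge0_sume_distrl; last by move=> z _; rewrite lee_fin mulr_ge0 ?tilt_word_ge0 ?tstep_ge0.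
by rewrite sumEFin -mulr_sumr tstep_sum mulr1.
Qed.

Lemma fwd_martingale n m (h : E -> R) : (n <= m)%N ->
  measurable_fun setT h -> (forall w, 0 <= h w) -> depends (times_lt n%:Z) h ->
  (\int[P]_w (fwd m w * h w)%:E = \int[P]_w (fwd n w * h w)%:E)%E.
Proof.
move=> /subnK <- mh h0 dh; elim: (m - n)%N => // k IHk.
rewrite addSn fwd_step// => w w' ww'; apply: dh => i i0; apply: ww'.
by move: i0; rewrite /times_lt; lia.
Qed.

Lemma bwd_martingale n m (h : E -> R) : (n <= m)%N ->
  measurable_fun setT h -> (forall w, 0 <= h w) -> depends (times_ge (- n%:Z)) h ->
  (\int[P]_w (bwd m w * h w)%:E = \int[P]_w (bwd n w * h w)%:E)%E.
Proof.
move=> /subnK <- mh h0 dh; elim: (m - n)%N => // k IHk.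
rewrite addSn bwd_step// => w w' ww'; apply: dh => i i0; apply: ww'.
by move: i0; rewrite /times_ge; lia.
Qed.

(** Starting the two paths at distance [x] closes the recursion: after one step the distance is
    [x + z' - z], and the environment from time 1 on is independent of the first step. *)
Lemma fwd_second_moment n x :
  (\int[P]_w (fwd n w * fwd n (env_shift 0 x w))%:E =
   (pair_fwd us (@step_val R d : U -> lattice d) tstep tstep2 n x)%:E)%E.
Proof.
elim: n x => [|n IHn] x.
  rewrite (@eq_integral_fun _ _ _ _ _ (cst 1)); last by move=> w; rewrite !fwd0 mulr1.
  by rewrite integral_one.
have mfs m y : measurable_fun setT (fun w => fwd n (@env_shift R d m y w)).
  by apply: measurableT_comp; [exact: measurable_fwd|exact: measurable_env_shift].
pose A (z z' : U) (w : E) : R := w (0, 0) (step_val z) * w (0, x) (step_val z').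
pose B (z z' : U) (w : E) : R :=
  fwd n (env_shift 1 (step_val z) w) * fwd n (env_shift 1 (x + step_val z') w).
have A0 z z' w : 0 <= A z z' w by rewrite mulr_ge0 ?pv_ge0.
have B0 z z' w : 0 <= B z z' w by rewrite mulr_ge0 ?fwd_ge0.
have mA z z' : measurable_fun setT (A z z').
  by apply: measurable_funM; exact: measurable_pv.
have mB z z' : measurable_fun setT (B z z') by apply: measurable_funM.
have AB0 z z' w : 0 <= tilt z * tilt z' * (A z z' w * B z z' w).
  by apply: mulr_ge0; apply: mulr_ge0 => //; exact: tilt_ge0.
have mAB z z' : measurable_fun setT (fun w => tilt z * tilt z' * (A z z' w * B z z' w)).
  by apply: measurable_funM => //; apply: measurable_funM.
rewrite (@eq_integral_fun _ _ _ _ _ (fun w => \sum_(z <- us) \sum_(z' <- us)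
    tilt z * tilt z' * (A z z' w * B z z' w))); last first.
  move=> w; rewrite !fwdS mulr_suml; apply: eq_bigr => z _.
  rewrite mulr_sumr; apply: eq_bigr => z' _.
  rewrite /A /B env_shiftD addr0 [step_val z' + x]addrC.
  have -> : env_shift 0 x w (0, 0) = w (0, x) by rewrite /env_shift/= !add0r.
  ring.
rewrite ge0_integral_rsum; [|by move=> z; apply: measurable_sum|
  by move=> z w; apply: sumr_ge0].
rewrite /= -sumEFin; apply: eq_bigr => z _.
rewrite ge0_integral_rsum// -sumEFin; apply: eq_bigr => z' _.
rewrite ge0_integral_rZl ?mulr_ge0 ?tilt_ge0//; last 2 first.
- exact: measurable_funM.
- by move=> w; rewrite mulr_ge0.
rewrite (indep_integral hiid (S := times_lt 1) (S' := times_ge 1)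
  (f := A z z') (g := B z z'))//; last 3 first.
- by move=> i; rewrite /times_lt /times_ge; lia.
- by move=> w w' ww'; rewrite /A !ww'.
- move=> w w' ww'; rewrite /B; congr (_ * _).
  + apply: (depends_shift (depends_fwd (n:=n))) ww' => i.
    by rewrite /times_in /times_ge /=; lia.
  + apply: (depends_shift (depends_fwd (n:=n))) ww' => i.
    by rewrite /times_in /times_ge /=; lia.
have -> : (\int[P]_w (B z z' w)%:E = (pair_fwd us (@step_val R d : U -> lattice d)
    tstep tstep2 n (x + step_val z' - step_val z))%:E)%E.
  rewrite -IHn.
  rewrite -(env_shift_integral hiid 1 (step_val z) (f := fun w =>
    (fwd n w * fwd n (env_shift 0 (x + step_val z' - step_val z) w))%:E)).
  - by apply: eq_integral => w _; rewrite /B env_shiftD add0r subrK.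
  - apply/measurable_EFinP; apply: measurable_funM => //; exact: measurable_fwd.
  - by move=> w; rewrite lee_fin mulr_ge0 ?fwd_ge0.
rewrite integral_pv2// -!EFinM; congr EFin; rewrite /pair_weight /tstep2 /tstep.
by case: eqP => _; ring.
Qed.

Lemma bwd_second_moment n x :
  (\int[P]_w (bwd n w * bwd n (env_shift 0 x w))%:E =
   (pair_bwd us (@step_val R d : U -> lattice d) tstep tstep2 n x)%:E)%E.
Proof.
elim: n x => [|n IHn] x.
  rewrite (@eq_integral_fun _ _ _ _ _ (cst 1)); last by move=> w; rewrite !bwd0 mulr1.
  by rewrite integral_one.
have mfs m y : measurable_fun setT (fun w => bwd n (@env_shift R d m y w)).
  by apply: measurableT_comp; [exact: measurable_bwd|exact: measurable_env_shift].
(* The first path takes [z'] and the second [z]: seen from their common end time, steps count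
   negatively, and with this labeling the new distance is again [x + z' - z]. *)
pose A (z z' : U) (w : E) : R := w (-1, - step_val z') (step_val z') *
  w (-1, x - step_val z) (step_val z).
pose B (z z' : U) (w : E) : R := bwd n (env_shift (-1) (- step_val z') w) *
  bwd n (env_shift (-1) (x - step_val z) w).
have A0 z z' w : 0 <= A z z' w by rewrite mulr_ge0 ?pv_ge0.
have B0 z z' w : 0 <= B z z' w by rewrite mulr_ge0 ?bwd_ge0.
have mA z z' : measurable_fun setT (A z z').
  by apply: measurable_funM; exact: measurable_pv.
have mB z z' : measurable_fun setT (B z z') by apply: measurable_funM.
have AB0 z z' w : 0 <= tilt z * tilt z' * (A z z' w * B z z' w).
  by apply: mulr_ge0; apply: mulr_ge0 => //; exact: tilt_ge0.
have mAB z z' : measurable_fun setT (fun w => tilt z * tilt z' * (A z z' w * B z z' w)).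
  by apply: measurable_funM => //; apply: measurable_funM.
rewrite (@eq_integral_fun _ _ _ _ _ (fun w => \sum_(z <- us) \sum_(z' <- us)
    tilt z * tilt z' * (A z z' w * B z z' w))); last first.
  move=> w; rewrite !bwdS [RHS]exchange_big mulr_suml/=; apply: eq_bigr => z' _.
  rewrite mulr_sumr; apply: eq_bigr => z _.
  rewrite /A /B env_shiftD addr0 [- step_val z + x]addrC.
  have -> : env_shift 0 x w (-1, - step_val z) = w (-1, x - step_val z).
    by rewrite /env_shift/= addr0 addrC.
  ring.
rewrite ge0_integral_rsum; [|by move=> z; apply: measurable_sum|
  by move=> z w; apply: sumr_ge0].
rewrite /= -sumEFin; apply: eq_bigr => z _.
rewrite ge0_integral_rsum// -sumEFin; apply: eq_bigr => z' _.
rewrite ge0_integral_rZl ?mulr_ge0 ?tilt_ge0//; last 2 first.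
- exact: measurable_funM.
- by move=> w; rewrite mulr_ge0.
rewrite (indep_integral hiid (S := times_ge (-1)) (S' := times_lt (-1))
  (f := A z z') (g := B z z'))//; last 3 first.
- by move=> i; rewrite /times_lt /times_ge; lia.
- by move=> w w' ww'; rewrite /A !ww'.
- move=> w w' ww'; rewrite /B; congr (_ * _).
  + apply: (depends_shift (depends_bwd (n:=n))) ww' => i.
    by rewrite /times_in /times_lt /=; lia.
  + apply: (depends_shift (depends_bwd (n:=n))) ww' => i.
    by rewrite /times_in /times_lt /=; lia.
have -> : (\int[P]_w (B z z' w)%:E = (pair_bwd us (@step_val R d : U -> lattice d)
    tstep tstep2 n (x + step_val z' - step_val z))%:E)%E.
  rewrite -IHn.
  rewrite -(env_shift_integral hiid (-1) (- step_val z') (f := fun w =>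
    (bwd n w * bwd n (env_shift 0 (x + step_val z' - step_val z) w))%:E)).
  - by apply: eq_integral => w _; rewrite /B env_shiftD add0r addrAC addrK.
  - apply/measurable_EFinP; apply: measurable_funM => //; exact: measurable_bwd.
  - by move=> w; rewrite lee_fin mulr_ge0 ?bwd_ge0.
rewrite integral_pv2// -!EFinM; congr EFin; rewrite /pair_weight /tstep2 /tstep.
rewrite -addr_eq0 addrAC [q2_step _ z' z]q2_stepC.
by case: eqP => _; ring.
Qed.

Lemma integral_bounds (f : E -> R) (a b : R) : measurable_fun setT f ->
  0 <= a -> (forall w, a <= f w) -> (forall w, f w <= b) ->
  a <= fine (\int[P]_w (f w)%:E)%E <= b.
Proof.
move=> mf a0 af fb.
have f0 w : 0 <= f w by apply: le_trans (af w).
have cE k : (\int[P]_w (cst k w)%:E = k%:E)%E.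
  have := integral_cst P measurableT k%:E => ->.
  by rewrite [X in (_ * X)%E]probability_setT mule1.
have h := ge0_bounded_integral P mf f0 fb.
have b0 : 0 <= b by apply: le_trans (fb point).
rewrite -!lee_fin -h -(cE a) -(cE b); apply/andP; split; apply: ge0_le_integral => //=.
all: try by move=> w _; rewrite lee_fin.
all: by apply/measurable_EFinP.
Qed.

End tilt.

(** * Almost sure limits along subsequences *)

Section summable_expectations.
Context (dT : measure_display) (T : measurableType dT) (R : realType).
Context (P : probability T R).

Lemma nneseries_ae_lty (X : nat -> T -> R) (a : nat -> R) :
  (forall k, measurable_fun setT (X k)) -> (forall k w, 0 <= X k w) ->
  (forall k, (\int[P]_w (X k w)%:E <= (a k)%:E)%E) -> cvgn (series a) ->
  (\int[P]_w (\sum_(0 <= k <oo) (X k w)%:E) < +oo)%E /\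
  {ae P, forall w, (\sum_(0 <= k <oo) (X k w)%:E < +oo)%E}.
Proof.
move=> mX X0 Xa ca.
have mX' k : measurable_fun setT (fun w => (X k w)%:E) by exact/measurable_EFinP.
have a0 k : 0 <= a k.
  rewrite -lee_fin; apply: le_trans (Xa k).
  by apply: integral_ge0 => w _; rewrite lee_fin.
have X0' w : (0 <= \sum_(0 <= k <oo) (X k w)%:E)%E.
  by apply: nneseries_ge0 => k _ _; rewrite lee_fin.
have fin : (\int[P]_w (\sum_(0 <= k <oo) (X k w)%:E) < +oo)%E.
  rewrite integral_nneseries//; last by move=> k w _; rewrite lee_fin.
  apply: (@le_lt_trans _ _ (\sum_(0 <= k <oo) (a k)%:E)%E).
    apply: lee_nneseries => k _ //.
    by move=> _; apply: integral_ge0 => w _; rewrite lee_fin.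
  have -> : (\sum_(0 <= k <oo) (a k)%:E = limn (EFin \o series a))%E.
    by congr (limn _); apply/funext => n /=; rewrite sumEFin.
  by rewrite EFin_lim// ltry.
split=> //.
have mS : measurable_fun setT (fun w => \sum_(0 <= k <oo) (X k w)%:E)%E.
  by apply: ge0_emeasurable_sum => // k w _ _; rewrite lee_fin.
have := @integrable_ae _ T R P setT measurableT
  (fun w => \sum_(0 <= k <oo) (X k w)%:E)%E.
have intS : P.-integrable setT (fun w => \sum_(0 <= k <oo) (X k w)%:E)%E.
  apply/integrableP; split => //.
  under eq_integral do rewrite gee0_abs//.
  exact: fin.
move=> /(_ intS); apply: filterS => w /(_ I).
by rewrite ge0_fin_numE.
Qed.

Lemma nneseries_ae_cvg (X : nat -> T -> R) (a : nat -> R) :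
  (forall k, measurable_fun setT (X k)) -> (forall k w, 0 <= X k w) ->
  (forall k, (\int[P]_w (X k w)%:E <= (a k)%:E)%E) -> cvgn (series a) ->
  {ae P, forall w, cvgn (series (X ^~ w))}.
Proof.
move=> mX X0 Xa ca; have [_] := nneseries_ae_lty mX X0 Xa ca.
by apply: filterS => w; apply: nnseries_is_cvg.
Qed.

End summable_expectations.

(** * L2 limits of martingales *)

Section L2_limit.
Context (dT : measure_display) (T : measurableType dT) (R : realType).
Context (P : probability T R) (f : nat -> T -> R) (B : nat -> R) (C : R).
Hypothesis mf : forall n, measurable_fun setT (f n).
Hypothesis f_ge0 : forall n w, 0 <= f n w.
Hypothesis f_le : forall n w, f n w <= B n.
Hypothesis f_orth : forall n m, (n <= m)%N ->
  (\int[P]_w (f m w * f n w)%:E = \int[P]_w (f n w * f n w)%:E)%E.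
Hypothesis f_bnd : forall n, (\int[P]_w (f n w * f n w)%:E <= C%:E)%E.

Let a n : R := fine (\int[P]_w (f n w * f n w)%:E)%E.

Let mff n m : measurable_fun setT (fun w => f n w * f m w).
Proof. exact: measurable_funM. Qed.

Let ff_ge0 n m w : 0 <= f n w * f m w. Proof. exact: mulr_ge0. Qed.

Let aE n : (\int[P]_w (f n w * f n w)%:E = (a n)%:E)%E.
Proof.
rewrite /a fineK// ge0_fin_numE.
  by apply: le_lt_trans (f_bnd n) _; rewrite ltry.
by apply: integral_ge0 => w _; rewrite lee_fin.
Qed.

Let sq_dist n m : (n <= m)%N ->
  (\int[P]_w ((f m w - f n w) ^+ 2)%:E = (a m - a n)%:E)%E.
Proof.
move=> nm.
have md : measurable_fun setT (fun w => (f m w - f n w) ^+ 2).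
  by apply: measurable_funX; apply: measurable_funB.
have h : (\int[P]_w ((f m w - f n w) ^+ 2)%:E + 2%:E * (a n)%:E =
    (a m)%:E + (a n)%:E)%E.
  rewrite -aE -(f_orth nm) -ge0_integral_rZl//; last first.
  rewrite -ge0_integral_rD//; last 3 first.
  - by apply: measurable_funM => //.
  - by move=> w; exact: sqr_ge0.
  - by move=> w; rewrite mulr_ge0.
  rewrite (f_orth nm) -!aE -ge0_integral_rD//.
  by apply: eq_integral_fun => w; ring.
move: h; rewrite -EFinM -EFinD.
case: (\int[P]_w _)%E => [r||] //= [h].
by congr EFin; lra.
Qed.

Let a_mono n m : (n <= m)%N -> a n <= a m.
Proof.
move=> nm; rewrite -subr_ge0 -lee_fin -sq_dist//.
by apply: integral_ge0 => w _; rewrite lee_fin sqr_ge0.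
Qed.

(** The rate 8^-k for squares leaves 2^-k in [abs_dist], which is summable in [k]. *)
Let a_cauchy k : exists N, forall n m, (N <= n)%N -> (n <= m)%N ->
  a m - a n <= 8^-1 ^+ k.
Proof.
have e0 : 0 < (8^-1 : R) ^+ k by rewrite exprn_gt0// invr_gt0.
have cva : cvgn a.
  apply: nondecreasing_is_cvgn; first by move=> n m; exact: a_mono.
  by exists C => _ [n _ <-]; rewrite -lee_fin -aE.
have cva' : a n @[n --> \oo] --> limn a by exact: cva.
move/cvgrPdist_lt : cva' => /(_ _ e0) [N _ hN].
exists N => n m Nn nm; apply/ltW/(le_lt_trans _ (hN n Nn)).
apply: le_trans (ler_norm _); rewrite lerD2r; exact: nondecreasing_cvgn_le.
Qed.

Let thr k : nat := sval (cid (a_cauchy k)).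

(** Adding up the thresholds makes the index increasing, at least the [k]-th threshold, and at least
    [k]. *)
Definition L2_index k : nat := \sum_(i < k.+1) (thr i).+1.

Local Notation nk := L2_index.

(** Upper limit, [fine] and absolute value make the limit everywhere defined, nonnegative and a
    function of the values [f n w] alone. No exceptional set then interferes with its measurability
    or with the coordinates it depends on. *)
Definition L2_lim (w : T) : R := `|fine (limn_esup (fun k => (f (nk k) w)%:E))|.

Let nk_ge k : (thr k <= nk k)%N.
Proof. by rewrite /nk big_ord_recr/= (leq_trans (leqnSn _))// leq_addl. Qed.

Lemma L2_index_ge k : (k <= nk k)%N.
Proof.
elim: k => // k IHk; rewrite [L2_index k.+1]big_ord_recr/=.
by apply: (@leq_trans (L2_index k + 1)); [rewrite addn1|rewrite leq_add2l].
Qed.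

Let nkS k : (nk k <= nk k.+1)%N.
Proof. by rewrite [X in (_ <= X)%N]/L2_index big_ord_recr/= leq_addr. Qed.

(** From L2 to L1 by [|x| <= (1 / t + t * x^2) / 2] with [t = 2 ^+ k], which balances the two terms
    against 8^-k. *)
Let abs_dist k n m : (thr k <= n)%N -> (n <= m)%N ->
  (\int[P]_w (`|f m w - f n w|)%:E <= (2^-1 ^+ k)%:E)%E.
Proof.
move=> kn nm; pose t : R := 2 ^+ k.
have t0 : 0 < t by rewrite exprn_gt0.
have md : measurable_fun setT (fun w => (f m w - f n w) ^+ 2).
  by apply: measurable_funX; apply: measurable_funB.
have ti0 : 0 <= t^-1 by rewrite invr_ge0 ltW.
have q0 w : 0 <= t * (f m w - f n w) ^+ 2.
  by apply: mulr_ge0; [exact: ltW|exact: sqr_ge0].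
have am_gm (x : R) : x <= 2^-1 * (t^-1 + t * x ^+ 2).
  have h : 0 <= t^-1 * (t * x - 1) ^+ 2.
    by apply: mulr_ge0; [rewrite invr_ge0 ltW|exact: sqr_ge0].
  have hE : t^-1 * (t * x - 1) ^+ 2 = t * x ^+ 2 - 2 * x + t^-1.
    by field; rewrite gt_eqF.
  move: h; rewrite hE; lra.
apply: (@le_trans _ _ (\int[P]_w (2^-1 * (t^-1 + t * (f m w - f n w) ^+ 2))%:E)%E).
  apply: ge0_le_integral => //.
  - by apply/measurable_EFinP; apply: measurableT_comp => //; exact: measurable_funB.
  - apply/measurable_EFinP; apply: measurable_funM => //; apply: measurable_funD => //.
    by apply: measurable_funM.
  move=> w _; rewrite lee_fin -[(f m w - f n w) ^+ 2]real_normK ?num_real//.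
rewrite ge0_integral_rZl//; last 2 first.
- by apply: measurable_funD => //; apply: measurable_funM.
- by move=> w; rewrite addr_ge0.
rewrite ge0_integral_rD//; last by apply: measurable_funM.
rewrite ge0_integral_rZl//; last 2 first.
- by move=> w; exact: sqr_ge0.
- exact: ltW.
rewrite sq_dist//.
have -> : (\int[P]_w (t^-1)%:E = (t^-1)%:E)%E.
  have := integral_cst P measurableT (t^-1)%:E => ->.
  by rewrite [X in (_ * X)%E]probability_setT mule1.
rewrite -[(t%:E * _)%E]EFinM -EFinD -EFinM lee_fin.
have h : a m - a n <= 8^-1 ^+ k by exact: (svalP (cid (a_cauchy k))).
have h8 : (8^-1 : R) ^+ k = t^-1 ^+ 3.
  by rewrite /t -!exprVn -exprM mulnC exprM; congr (_ ^+ _); field.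
have : t * (a m - a n) <= t^-1.
  have -> : t^-1 = t * t^-1 ^+ 2 by field; rewrite gt_eqF.
  apply: ler_wpM2l; first exact: ltW.
  apply: (le_trans h); rewrite h8 exprS -[leRHS]mul1r ler_wpM2r ?sqr_ge0//.
  by rewrite invf_le1// /t -[leLHS](expr1n _ k) lerXn2r ?nnegrE ?ler1n.
by rewrite /t -exprVn; move: (_ ^+ k) => s; lra.
Qed.

(** The second term makes the values at index [(nk k).+1] converge as well, to the same limit. *)
Let D k w : R := `|f (nk k.+1) w - f (nk k) w| + `|f (nk k).+1 w - f (nk k) w|.

Let mD k : measurable_fun setT (D k).
Proof.
by apply: measurable_funD; apply: measurableT_comp => //; apply: measurable_funB.
Qed.

Let D_ge0 k w : 0 <= D k w. Proof. by rewrite addr_ge0. Qed.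

Let D_int k : (\int[P]_w (D k w)%:E <= (geometric 2 2^-1 k)%:E)%E.
Proof.
rewrite ge0_integral_rD//; last 2 first.
- by apply: measurableT_comp => //; exact: measurable_funB.
- by apply: measurableT_comp => //; exact: measurable_funB.
rewrite /= mulr_natl mulr2n EFinD; apply: leeD; exact: abs_dist.
Qed.

Let geo_cvg : cvgn (series (geometric (2 : R) 2^-1)).
Proof. by apply: is_cvg_geometric_series; rewrite ger0_norm// invf_lt1// ltr1n. Qed.

Let telescope_f w k : f (nk k) w = f (nk 0) w +
  series (fun i => f (nk i.+1) w - f (nk i) w) k.
Proof. exact: (eq_sum_telescope (fun i => f (nk i) w)). Qed.

Let f_cvg w : cvgn (series (D ^~ w)) ->
  cvgn (fun k => f (nk k) w) /\ (f (nk k).+1 w - f (nk k) w) @[k --> \oo] --> (0 : R).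
Proof.
move=> cD; split.
  have c1 : cvgn (series (fun i => f (nk i.+1) w - f (nk i) w)).
    apply: normed_cvg; apply: (series_le_cvg _ _ _ cD) => [i|i|i] /=.
    - by [].
    - by [].
    - by rewrite lerDl.
  rewrite (_ : (fun k => f (nk k) w) = (fun k => f (nk 0) w +
    series (fun i => f (nk i.+1) w - f (nk i) w) k)); last exact/funext.
  by apply: is_cvgD => //; exact: is_cvg_cst.
have D0 := cvg_series_cvg_0 cD.
apply/cvgrPdist_lt => e e0.
move/cvgrPdist_lt : D0 => /(_ e e0); apply: filterS => k.
rewrite !sub0r !normrN; apply: le_lt_trans.
by rewrite [leRHS]ger0_norm// lerDr.
Qed.

Lemma L2_lim_cvg : {ae P, forall w, f (nk k) w @[k --> \oo] --> L2_lim w /\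
  f (nk k).+1 w @[k --> \oo] --> L2_lim w}.
Proof.
have := nneseries_ae_cvg mD D_ge0 D_int geo_cvg.
apply: filterS => w /f_cvg[c1 c2].
have e1 : limn_esup (fun k => (f (nk k) w)%:E) = (limn (fun k => f (nk k) w))%:E.
  rewrite is_cvg_limn_esupE ?EFin_lim//.
  by apply: cvg_EFin => //; exact: nearW.
have e2 : L2_lim w = limn (fun k => f (nk k) w).
  by rewrite /L2_lim e1/= ger0_norm//; apply: limr_ge => //; apply: nearW.
have c3 : f (nk k) w @[k --> \oo] --> L2_lim w by rewrite e2.
split=> //.
rewrite (_ : (fun k => f (nk k).+1 w) =
  (fun k => f (nk k) w + (f (nk k).+1 w - f (nk k) w))); last first.
  by apply/funext => k; rewrite addrC subrK.
by rewrite -[L2_lim w]addr0; exact: cvgD.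
Qed.

Lemma L2_lim_ge0 w : 0 <= L2_lim w. Proof. exact: normr_ge0. Qed.

Lemma measurable_L2_lim : measurable_fun setT L2_lim.
Proof.
apply: measurableT_comp => //; apply: measurableT_comp => //.
by apply: measurable_fun_limn_esup => k; exact/measurable_EFinP.
Qed.

Lemma L2_lim_eq w w' : (forall n, f n w = f n w') -> L2_lim w = L2_lim w'.
Proof.
by move=> ff; rewrite /L2_lim; congr (`|fine (limn_esup _)|); apply/funext => k; rewrite ff.
Qed.

(** Dominated convergence: along the subsequence [f] stays below its first value, which is bounded,
    plus the sum of all [D], whose integral is finite. *)
Lemma L2_lim_integral (h : T -> R) (b : R) : measurable_fun setT h ->
  (forall w, 0 <= h w) -> (forall w, h w <= b) ->
  (\int[P]_w (f (nk k) w * h w)%:E)%E @[k --> \oo] -->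
  (\int[P]_w (L2_lim w * h w)%:E)%E.
Proof.
move=> mh h0 hb.
have b0 : 0 <= b by apply: le_trans (hb point).
pose S w : \bar R := (\sum_(0 <= k <oo) (D k w)%:E)%E.
have S0 w : (0 <= S w)%E by apply: nneseries_ge0 => k _ _; rewrite lee_fin.
have mS : measurable_fun setT S.
  apply: ge0_emeasurable_sum => [k w _ _|k _]; first by rewrite lee_fin.
  exact/measurable_EFinP.
have [intS _] := nneseries_ae_lty mD D_ge0 D_int geo_cvg.
pose Y w : \bar R := (b%:E * ((B (nk 0))%:E + S w))%E.
have mY : measurable_fun setT Y by apply: measurable_funeM; apply: emeasurable_funD.
have B0 : 0 <= B (nk 0) by apply: le_trans (f_le _ point).
have Y0 w : (0 <= Y w)%E by rewrite mule_ge0 ?lee_fin// adde_ge0 ?lee_fin.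
have intY : P.-integrable setT Y.
  apply/integrableP; split => //.
  under eq_integral do rewrite gee0_abs//.
  have -> : (\int[P]_w Y w = b%:E * \int[P]_w ((B (nk 0))%:E + S w))%E.
    apply: ge0_integralZl; rewrite ?lee_fin//; first exact: emeasurable_funD.
    by move=> w _; rewrite adde_ge0 ?lee_fin.
  rewrite ge0_integralD//.
  have := integral_cst P measurableT (B (nk 0))%:E => ->.
  rewrite [X in (_ * X + _)%E]probability_setT mule1.
  by rewrite lte_mul_pinfty ?lee_fin// lte_add_pinfty ?ltry.
have := @dominated_convergence _ T R P setT measurableT
  (fun k w => (f (nk k) w * h w)%:E) (fun w => (L2_lim w * h w)%:E) Y.
case=> //.
- by move=> k; apply/measurable_EFinP; apply: measurable_funM.
- by apply/measurable_EFinP; apply: measurable_funM => //; exact: measurable_L2_lim.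
- apply: filterS L2_lim_cvg => w [c _] _.
  by apply: cvg_EFin; [exact: nearW|apply: cvgM => //; exact: cvg_cst].
- apply: aeW => w k _; rewrite gee0_abs ?lee_fin ?mulr_ge0// /Y.
  rewrite EFinM muleC; apply: lee_pmul; rewrite ?lee_fin//.
  rewrite telescope_f EFinD; apply: leeD; first by rewrite lee_fin.
  apply: (@le_trans _ _ (\sum_(0 <= i < k) (D i w)%:E)%E).
    rewrite sumEFin lee_fin; apply: ler_sum => i _.
    by apply: le_trans (ler_norm _) _; rewrite lerDl.
  by apply: nneseries_lim_ge => i _ _; rewrite lee_fin.
Qed.

End L2_limit.

Definition lat_coord (d : nat) (i : 'I_d.+1) (x : lattice d) : int := x 0 i.

Lemma lat_coord_is_additive (d : nat) (i : 'I_d.+1) :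
  {morph @lat_coord d i : x y / x - y}.
Proof. by move=> x y; rewrite /lat_coord !mxE. Qed.

HB.instance Definition _ (d : nat) (i : 'I_d.+1) :=
  GRing.isZmodMorphism.Build (lattice d) int (@lat_coord d i)
    (@lat_coord_is_additive d i).

(** * Bounded second moments for small tilts *)

Section radius.
Context (R : realType) (d : nat) (P : probability (env R d) R) (c : R).
Hypothesis hd : (3 <= d.+1)%N.
Hypothesis hiid : iid_environment P.
Hypothesis hnn : nearest_neighbor P.
Hypothesis c_gt0 : 0 < c.
Hypothesis hc : forall z : step R d, P [set w | c <= transition w 0 0 z] = 1%E.
Local Notation U := (step R d).
Local Notation E := (env R d).
Local Notation us := (steps_seq R d).
Local Notation sv := (@step_val R d : U -> lattice d).

Lemma row_sum_le1 (w : E) n x : \sum_(z <- us) w (n, x) (sv z) <= 1.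
Proof.
set p := w (n, x).
have p0 z : (0 <= (p z)%:E)%E by rewrite lee_fin pv_ge0.
rewrite -lee_fin -(pv_sum1 p) (esumID (range sv))// setTI.
apply: (@le_trans _ _ (\esum_(i in range sv) (p i)%:E)%E); last first.
  by rewrite leeDl// esum_ge0.
rewrite esum_fset//; last by apply: finite_image; exact: finite_steps.
rewrite (@reindex_fsbig _ _ _ _ _ sv setT); last first.
  split; first by move=> z _; exists z.
    by move=> z z' _ _; exact: val_inj.
  by move=> _ [z _ <-]; exists z.
by rewrite fsbig_finite/=; [rewrite -sumEFin|exact: finite_steps].
Qed.

Lemma phi_bounds th : expR (- l1norm th) <= phi_a P th <= expR (l1norm th).
Proof.
have h z : expR (- l1norm th) <= expR (dot th (lat2vec R (sv z))) <= expR (l1norm th).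
  have := dot_step_le th z; rewrite ler_norml => /andP[h1 h2].
  by rewrite !ler_expR h1 h2.
rewrite phi_aE; apply/andP; split.
  rewrite -[leLHS]mul1r -(q_sum hiid hnn) mulr_suml; apply: ler_sum => z _.
  by rewrite ler_wpM2l ?q_ge0//; have /andP[] := h z.
rewrite -[leRHS]mul1r -(q_sum hiid hnn) mulr_suml; apply: ler_sum => z _.
by rewrite ler_wpM2l ?q_ge0//; have /andP[] := h z.
Qed.

Lemma tilt_bounds th z :
  expR (- (2 * l1norm th)) <= tilt P th z <= expR (2 * l1norm th).
Proof.
have phi0 := phi_gt0 th hiid hnn; have /andP[p1 p2] := phi_bounds th.
have := dot_step_le th z; rewrite ler_norml => /andP[h1 h2].
rewrite tiltE//; apply/andP; split.
  rewrite ler_pdivlMr//; apply: (@le_trans _ _ (expR (- (2 * l1norm th)) * expR (l1norm th))).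
    by rewrite ler_wpM2l ?expR_ge0.
  by rewrite -expRD ler_expR; lra.
rewrite ler_pdivrMr//; apply: (@le_trans _ _ (expR (2 * l1norm th) * expR (- l1norm th))).
  by rewrite -expRD ler_expR; lra.
by rewrite ler_wpM2l ?expR_ge0.
Qed.

Lemma l1norm_ge0 (th : 'rV[R]_d.+1) : 0 <= l1norm th.
Proof. exact: sumr_ge0. Qed.

(** The total joint weight at a common site, that is, [1 + e] in the notation of the pair chain. As
    the second moment of [fwd 1] it is at least 1 by Jensen, and at most the square of the pointwise
    bound on [fwd 1]. *)
Let mass2 th := \sum_(z <- us) \sum_(z' <- us) tstep2 P th z z'.

Let mass2E th :
  (\int[P]_w (fwd P th 1 w * fwd P th 1 w)%:E = (mass2 th)%:E)%E.
Proof.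
have := fwd_second_moment th hiid 1 0.
rewrite (@eq_integral_fun _ _ _ _ _ (fun w => fwd P th 1 w * fwd P th 1 w)); last first.
  by move=> w; rewrite env_shift0.
move=> ->; congr EFin; rewrite /=; apply: eq_bigr => z _; apply: eq_bigr => z' _.
by rewrite /pair_weight eqxx mulr1.
Qed.

Lemma integral_fwd th n : (\int[P]_w (fwd P th n w)%:E = 1)%E.
Proof.
have := @fwd_martingale _ _ _ th hiid hnn 0 n (cst 1) (leq0n n) (measurable_cst _)
  (fun=> ler01) (fun _ _ _ => erefl).
rewrite (@eq_integral_fun _ _ _ _ _ (fwd P th n)); last by move=> w; rewrite mulr1.
move=> ->; rewrite -(integral_one P); apply: eq_integral_fun => w.
by rewrite fwd0 mulr1.
Qed.

Let mass2_ge1 th : 1 <= mass2 th.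
Proof.
rewrite -lee_fin -mass2E.
have mF := measurable_fwd P th 1.
have h : (\int[P]_w (2 * fwd P th 1 w)%:E <=
    \int[P]_w (fwd P th 1 w * fwd P th 1 w + 1)%:E)%E.
  apply: ge0_le_integral => //.
  - by move=> w _; rewrite lee_fin mulr_ge0 ?fwd_ge0.
  - by apply/measurable_EFinP; apply: measurable_funM.
  - by apply/measurable_EFinP; apply: measurable_funD => //; apply: measurable_funM.
  move=> w _; rewrite lee_fin; have := sqr_ge0 (fwd P th 1 w - 1).
  by move: (fwd P th 1 w) => x; rewrite expr2; lra.
move: h; rewrite ge0_integral_rZl//; last by move=> w; exact: fwd_ge0.
rewrite integral_fwd mule1 ge0_integral_rD//; last 2 first.
- exact: measurable_funM.
- by move=> w; rewrite mulr_ge0 ?fwd_ge0.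
have i1 : (\int[P]_w (1%R)%:E = 1)%E by exact: integral_one.
rewrite i1 mass2E -EFinD !lee_fin; lra.
Qed.

Let mass2_le th : mass2 th <= expR (4 * l1norm th).
Proof.
have N0 := l1norm_ge0 th.
have fle w : 0 <= fwd P th 1 w <= expR (2 * l1norm th).
  rewrite fwd_ge0/= fwdS.
  apply: (@le_trans _ _ (\sum_(z <- us) expR (2 * l1norm th) * w (0, 0) (sv z))).
    apply: ler_sum => z _; rewrite fwd0 mulr1 ler_wpM2r ?pv_ge0//.
    by have /andP[] := tilt_bounds th z.
  by rewrite -mulr_sumr -[leRHS]mulr1 ler_wpM2l ?expR_ge0// row_sum_le1.
have /andP[_ h] : 0 <= fine (\int[P]_w (fwd P th 1 w * fwd P th 1 w)%:E)%E <=
    expR (4 * l1norm th).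
  apply: integral_bounds => //.
  - by apply: measurable_funM; exact: measurable_fwd.
  - by move=> w; rewrite mulr_ge0 ?fwd_ge0.
  - move=> w; have /andP[f0 f1] := fle w.
    have -> : expR (4 * l1norm th) = expR (2 * l1norm th) * expR (2 * l1norm th).
      by rewrite -expRD; congr expR; lra.
    exact: ler_pM.
by move: h; rewrite mass2E.
Qed.

(** A lower bound for [tstep] when [l1norm th <= 1]: [q_step] is at least [c], and by [tilt_bounds]
    a tilt is at least exp(-2). *)
Let c' := c * expR (-2).

Let c'_gt0 : 0 < c'. Proof. by rewrite mulr_gt0 ?expR_gt0. Qed.

Let G := 12 / (2 * c') ^+ 6.

Let green_le th n : l1norm th <= 1 ->
  \sum_(j < n) green us sv (tstep P th) j 0 <= G.
Proof.
move=> th1.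
pose e (i : nat) : lattice d := delta_mx 0 (inord i).
have eE (i j : nat) : (i <= 2)%N -> (j <= 2)%N ->
    lat_coord (inord i) (e j) = (i == j)%:R.
  move=> i2 j2; rewrite /lat_coord /e mxE eqxx/= -val_eqE/= !inordK//.
  - by apply: leq_trans hd.
  - by apply: leq_trans hd.
apply: (@green_sum_bounded R (lattice d) U us sv (tstep P th) c' (e 0) (e 1) (e 2)
  (@lat_coord d (inord 0)) (@lat_coord d (inord 1)) (@lat_coord d (inord 2))).
- exact: steps_uniq.
- exact: tstep_ge0.
- exact: tstep_sum.
- exact: c'_gt0.
- move=> z; rewrite /c' /tstep; apply: ler_pM.
  + exact: ltW.
  + exact: expR_ge0.
  + exact: (q_ge hiid c_gt0 hc).
  + have /andP[h _] := tilt_bounds th z; apply: le_trans h.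
    by rewrite ler_expR; lra.
- by split; [exact: (eE 0%N 0%N)|exact: (eE 0%N 1%N)|exact: (eE 0%N 2%N)].
- by split; [exact: (eE 1%N 0%N)|exact: (eE 1%N 1%N)|exact: (eE 1%N 2%N)].
- by split; [exact: (eE 2%N 0%N)|exact: (eE 2%N 1%N)|exact: (eE 2%N 2%N)].
- move=> x xe; have [i ->] : exists i, x = e i.
    by move: xe; rewrite !inE => /or3P[] /eqP ->; [exists 0|exists 1|exists 2].
  exists (signed_step R (inord i) true, signed_step R (inord i) false).
    by rewrite !mem_steps.
  by [].
Qed.

Lemma second_moment_radius : exists2 r : R, 0 < r & exists C : R,
  forall th, l1norm th <= r -> forall n,
    pair_fwd us sv (tstep P th) (tstep2 P th) n 0 <= C /\
    pair_bwd us sv (tstep P th) (tstep2 P th) n 0 <= C.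
Proof.
have G0 : 0 <= G by rewrite divr_ge0// exprn_ge0// mulr_ge0// ltW.
have c2_gt0 : 0 < c ^+ 2 by rewrite exprn_gt0.
(* The bound 1/8 gives exp(4 |th|) <= 2, hence [e <= 8 * r]; the second bound turns this into
   [e * (1 + G) <= c ^+ 2 / 2], the smallness condition of the pair chain with [c ^+ 2] in the role
   of [c]. *)
pose r := Num.min (8^-1) (c ^+ 2 / (16 * (1 + G))).
have r_gt0 : 0 < r.
  by rewrite lt_min invr_gt0 ltr0n/= divr_gt0// mulr_gt0//; lra.
exists r => //; exists (1 + G + 2 / c ^+ 2) => th thr n.
have r8 : r <= 8^-1 by rewrite ge_min lexx.
have rG : r * (16 * (1 + G)) <= c ^+ 2.
  by rewrite -ler_pdivlMr ?mulr_gt0//; [rewrite ge_min lexx orbT|lra].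
have N0 := l1norm_ge0 th.
have th1 : l1norm th <= 1 by lra.
have e_le : mass2 th - 1 <= 8 * r.
  have h := mass2_le th.
  have h1 : expR (4 * l1norm th) * (1 - 4 * l1norm th) <= 1.
    rewrite -[leRHS](expR0 R) -(subrr (4 * l1norm th)) expRD ler_wpM2l ?expR_ge0//.
    by have := expR_ge1Dx (- (4 * l1norm th)).
  set x := expR _ in h h1; set t := l1norm th in h1 N0 thr *.
  have x0 : 0 <= x by exact: expR_ge0.
  have : x * (1 - 4 * t) >= x * 2^-1 by rewrite ler_wpM2l//; lra.
  move=> h2; have x2 : x <= 2 by lra.
  have : x * t <= 2 * r by apply: ler_pM.
  lra.
have e_small : (mass2 th - 1) * (1 + G) <= c ^+ 2 / 2.
  apply: (@le_trans _ _ (8 * r * (1 + G))); first by rewrite ler_wpM2r//; lra.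
  lra.
have c2_le1 : c ^+ 2 <= 1 by rewrite expr_le1// ?(c_le1 hiid hnn c_gt0 hc)// ltW.
(* The fraction of independent behavior is [c ^+ 2]: joint moments are at least [c ^+ 2], while
   products of means are at most 1. *)
have al_ge z z' : c ^+ 2 * (tstep P th z * tstep P th z') <= tstep2 P th z z'.
  rewrite /tstep /tstep2.
  have -> : c ^+ 2 * (q_step P z * tilt P th z * (q_step P z' * tilt P th z')) =
     (c ^+ 2 * (q_step P z * q_step P z')) * (tilt P th z * tilt P th z') by ring.
  rewrite ler_wpM2r ?mulr_ge0 ?tilt_ge0//.
  apply: le_trans (q2_ge hiid c_gt0 hc z z').
  have qq : q_step P z * q_step P z' <= 1 * 1.
    by apply: ler_pM; rewrite ?q_ge0// (q_le1 hiid hnn).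
  rewrite mulr1 in qq; rewrite -[leRHS]mulr1; apply: ler_wpM2l => //; exact: ltW.
have al_sum : mass2 th = 1 + (mass2 th - 1) by rewrite addrC subrK.
have e_ge0 : 0 <= mass2 th - 1 by rewrite subr_ge0.
have gle m := green_le m th1.
have C1 : 0 <= 2 / c ^+ 2 by rewrite divr_ge0// ltW.
split.
- apply: (@le_trans _ _ (1 + G)); last by lra.
  exact: (pair_fwd_le (tstep_ge0 P th) (tstep_sum th hiid hnn) c2_gt0 c2_le1 al_ge
    al_sum e_ge0 gle e_small).
- apply: (@le_trans _ _ (2 / c ^+ 2)); last by lra.
  exact: (pair_bwd_le (tstep_ge0 P th) (tstep_sum th hiid hnn) c2_gt0 c2_le1 al_ge
    al_sum e_ge0 G0 gle e_small).
Qed.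

End radius.

(* [g] is an almost sure limit of [f] along a sparse subsequence, which also
   passes to the limit in integrals against bounded functions. *)
Record subseq_limit (dT : measure_display) (T : measurableType dT) (R : realType)
    (P : probability T R) (f : nat -> T -> R) (g : T -> R) : Prop := SubseqLimit {
  lim_meas : measurable_fun setT g ;
  lim_ge0 : forall w, 0 <= g w ;
  lim_ext : forall w w', (forall n, f n w = f n w') -> g w = g w' ;
  lim_idx : exists idx : nat -> nat, [/\ forall k, (k <= idx k)%N,
    {ae P, forall w, f (idx k) w @[k --> \oo] --> g w /\
                     f (idx k).+1 w @[k --> \oo] --> g w} &
    forall (h : T -> R) (b : R), measurable_fun setT h -> (forall w, 0 <= h w) ->
      (forall w, h w <= b) ->
      (\int[P]_w (f (idx k) w * h w)%:E)%E @[k --> \oo] --> (\int[P]_w (g w * h w)%:E)%E] }.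

Lemma subseq_limit_exists (dT : measure_display) (T : measurableType dT) (R : realType)
  (P : probability T R) (f : nat -> T -> R) (B : nat -> R) (C : R) :
  (forall n, measurable_fun setT (f n)) -> (forall n w, 0 <= f n w) ->
  (forall n w, f n w <= B n) ->
  (forall n m, (n <= m)%N ->
    (\int[P]_w (f m w * f n w)%:E = \int[P]_w (f n w * f n w)%:E)%E) ->
  (forall n, (\int[P]_w (f n w * f n w)%:E <= C%:E)%E) ->
  exists g, subseq_limit P f g.
Proof.
move=> mf f0 fB fo fC; exists (L2_lim mf f0 fo fC); split.
- exact: measurable_L2_lim.
- exact: L2_lim_ge0.
- exact: L2_lim_eq.
exists (L2_index mf f0 fo fC); split.
- exact: L2_index_ge.
- exact: L2_lim_cvg.
- by move=> h b; apply: L2_lim_integral; exact: fB.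
Qed.

Fact absz_lt (i : int) (n : nat) : (absz i < n)%N -> i < n%:Z.
Proof. lia. Qed.

Section limits_lemmas.
Context (R : realType).

Lemma cvg_rsum (J : Type) (r : seq J) (F : J -> nat -> R) (l : J -> R) :
  (forall j, F j k @[k --> \oo] --> l j) ->
  (\sum_(j <- r) F j k) @[k --> \oo] --> \sum_(j <- r) l j.
Proof.
move=> Fl; elim: r => [|j r IHr].
  rewrite big_nil (_ : (fun k => _) = (fun=> 0)); first exact: cvg_cst.
  by apply/funext => k; rewrite big_nil.
rewrite big_cons (_ : (fun k => _) = (fun k => F j k + \sum_(i <- r) F i k)).
  by apply: cvgD => //; exact: Fl.
by apply/funext => k; rewrite big_cons.
Qed.

Context (dT : measure_display) (T : measurableType dT) (P : probability T R).

Lemma integral_trunc_cvg (f h : T -> R) : measurable_fun setT f ->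
  measurable_fun setT h -> (forall w, 0 <= f w) -> (forall w, 0 <= h w) ->
  (\int[P]_w (f w * Num.min (h w) k%:R)%:E)%E @[k --> \oo] -->
  (\int[P]_w (f w * h w)%:E)%E.
Proof.
move=> mf mh f0 h0.
have mm k : measurable_fun setT (fun w => Num.min (h w) k%:R).
  by apply: measurable_minr => //; exact: measurable_cst.
have cv w : (f w * Num.min (h w) k%:R)%:E @[k --> \oo] --> (f w * h w)%:E.
  apply: cvg_EFin; first exact: nearW.
  apply: cvg_near_cst; near=> k; rewrite /= min_l//.
  by near: k; exact: nbhs_infty_ger.
rewrite (@eq_integral _ _ _ P setT (fun w => limn (fun k => (f w * Num.min (h w) k%:R)%:E))).
  apply: cvg_monotone_convergence => //.
  - by move=> k; apply/measurable_EFinP; apply: measurable_funM.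
  - by move=> k w _; rewrite lee_fin mulr_ge0// le_min h0/=.
  - move=> w _ k k' kk'; rewrite lee_fin ler_wpM2l// le_min ge_min lexx/=.
    by rewrite ge_min ler_nat kk' orbT.
by move=> w _; exact/esym/cvg_lim.
Unshelve. all: by end_near. Qed.

(** Weak limits are available against bounded functions only; truncation carries the resulting
    identities over to unbounded [h] such as [u]. *)
Lemma eq_integral_trunc (f g h : T -> R) : measurable_fun setT f ->
  measurable_fun setT g -> measurable_fun setT h -> (forall w, 0 <= f w) ->
  (forall w, 0 <= g w) -> (forall w, 0 <= h w) ->
  (forall k : nat, (\int[P]_w (f w * Num.min (h w) k%:R)%:E =
    \int[P]_w (g w * Num.min (h w) k%:R)%:E)%E) ->
  (\int[P]_w (f w * h w)%:E = \int[P]_w (g w * h w)%:E)%E.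
Proof.
move=> mf mg mh f0 g0 h0 fg.
have c1 := integral_trunc_cvg mf mh f0 h0.
have c2 := integral_trunc_cvg mg mh g0 h0.
rewrite -(cvg_lim _ c1)//; apply: cvg_lim => //.
by rewrite (eq_cvg _ _ fg).
Qed.

Lemma ae_measure_eq (A B : set T) : measurable A -> measurable B ->
  {ae P, forall w, A w <-> B w} -> P A = P B.
Proof.
move=> mA mB AB; rewrite -(setIT A) -(setIT B).
rewrite -!integral_indic//; apply: ae_eq_integral => //.
- by apply/measurable_EFinP.
- by apply/measurable_EFinP.
apply: filterS AB => w h _ /=; rewrite !indicE; congr (_%:R%:E).
by congr nat_of_bool; apply/idP/idP; rewrite !inE => /h.
Qed.

End limits_lemmas.

(** * Harmonic limits of the partition functions *)

Section martingale_limits.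
Context (R : realType) (d : nat) (P : probability (env R d) R) (c : R).
Hypothesis hiid : iid_environment P.
Hypothesis hnn : nearest_neighbor P.
Hypothesis c_gt0 : 0 < c.
Hypothesis hc : forall z : step R d, P [set w | c <= transition w 0 0 z] = 1%E.
Context (th : 'rV[R]_d.+1).
Local Notation U := (step R d).
Local Notation E := (env R d).
Local Notation us := (steps_seq R d).
Local Notation sv := (@step_val R d : U -> lattice d).
Local Notation pos := (@pos (lattice d) U (@step_val R d)).

Lemma fwd_limit_exists (C : R) :
  (forall n, pair_fwd us sv (tstep P th) (tstep2 P th) n 0 <= C) ->
  exists u, subseq_limit P (fwd P th) u.
Proof.
move=> hC; apply: (@subseq_limit_exists _ _ _ P (fwd P th) _ C).
- exact: measurable_fwd.
- exact: fwd_ge0.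
- exact: fwd_le.
- move=> n m nm; apply: (@fwd_martingale _ _ _ th hiid hnn n m (fwd P th n) nm).
  + exact: measurable_fwd.
  + exact: fwd_ge0.
  + by move=> w w' ww'; apply: (@depends_fwd _ _ _ th n) => i /andP[_ i1]; exact: ww'.
- move=> n; have := fwd_second_moment th hiid n 0.
  rewrite (@eq_integral_fun _ _ _ _ _ (fun w => fwd P th n w * fwd P th n w)).
    by move=> ->; rewrite lee_fin.
  by move=> w; rewrite env_shift0.
Qed.

Lemma bwd_limit_exists (C : R) :
  (forall n, pair_bwd us sv (tstep P th) (tstep2 P th) n 0 <= C) ->
  exists v, subseq_limit P (bwd P th) v.
Proof.
move=> hC; apply: (@subseq_limit_exists _ _ _ P (bwd P th) _ C).
- exact: measurable_bwd.
- exact: bwd_ge0.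
- exact: bwd_le.
- move=> n m nm; apply: (@bwd_martingale _ _ _ th hiid hnn n m (bwd P th n) nm).
  + exact: measurable_bwd.
  + exact: bwd_ge0.
  + by move=> w w' ww'; apply: (@depends_bwd _ _ _ th n) => i /andP[i1 _]; exact: ww'.
- move=> n; have := bwd_second_moment th hiid n 0.
  rewrite (@eq_integral_fun _ _ _ _ _ (fun w => bwd P th n w * bwd P th n w)).
    by move=> ->; rewrite lee_fin.
  by move=> w; rewrite env_shift0.
Qed.

(** Against a truncation of [h], the integrals of [f m] no longer change once [m] exceeds [n], so
    the weak limit has the value at [n]. *)
Let lim_martingale (f : nat -> E -> R) g (S : nat -> pred (site d)) :
  subseq_limit P f g -> (forall n, measurable_fun setT (f n)) ->
  (forall n w, 0 <= f n w) ->
  (forall n m (h : E -> R), (n <= m)%N -> measurable_fun setT h -> (forall w, 0 <= h w) ->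
    depends (S n) h -> (\int[P]_w (f m w * h w)%:E = \int[P]_w (f n w * h w)%:E)%E) ->
  forall n (h : E -> R), measurable_fun setT h -> (forall w, 0 <= h w) ->
    depends (S n) h -> (\int[P]_w (g w * h w)%:E = \int[P]_w (f n w * h w)%:E)%E.
Proof.
move=> [mg g0 _ [idx [idx_ge _ idx_cvg]]] mf f0 fS n h mh h0 Sh.
apply: eq_integral_trunc => // k.
have hk0 w : 0 <= Num.min (h w) k%:R by rewrite le_min h0/=.
have mhk : measurable_fun setT (fun w => Num.min (h w) k%:R).
  by apply: measurable_minr => //; exact: measurable_cst.
have c1 := idx_cvg _ k%:R mhk hk0.
have {}c1 := c1 (fun w => ltac:(by rewrite ge_min lexx orbT)).
rewrite -(cvg_lim _ c1)//; apply: cvg_lim => //.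
apply: cvg_near_cst; near=> j; apply: fS => //.
  by apply: leq_trans (idx_ge j); near: j; exact: nbhs_infty_ge.
by move=> w w' ww'; rewrite (Sh _ _ ww').
Unshelve. all: by end_near. Qed.

Section forward.
Variable u : E -> R.
Hypothesis hu : subseq_limit P (fwd P th) u.

Lemma depends_fwd_limit : depends (times_ge 0) u.
Proof.
move=> w w' ww'; apply: (lim_ext hu) => n; apply: (@depends_fwd _ _ P th) => i.
by move=> /andP[i0 _]; exact: ww'.
Qed.

Lemma integral_fwd_limit n (h : E -> R) : measurable_fun setT h ->
  (forall w, 0 <= h w) -> depends (times_lt n%:Z) h ->
  (\int[P]_w (u w * h w)%:E = \int[P]_w (fwd P th n w * h w)%:E)%E.
Proof.
apply: (@lim_martingale (fwd P th) u (fun n => times_lt n%:Z) hu).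
- exact: measurable_fwd.
- exact: fwd_ge0.
- exact: fwd_martingale.
Qed.

Lemma integral_fwd_limit1 : (\int[P]_w (u w)%:E = 1)%E.
Proof.
have := @integral_fwd_limit 0 (cst 1) (measurable_cst _) (fun=> ler01) (fun _ _ _ => erefl).
rewrite (@eq_integral_fun _ _ _ _ _ u); last by move=> w; rewrite mulr1.
move=> ->; rewrite -(integral_one P); apply: eq_integral_fun => w.
by rewrite fwd0 mulr1.
Qed.

(** The recursion [fwdS] passes to the limit: the left side along the successors of the subsequence,
    the right side along the subsequence itself, in finitely many shifted environments. *)
Lemma fwd_limit_harmonic : {ae P, forall w, u w =
  \sum_(z <- us) tilt P th z * (w (0, 0) (sv z) * u (env_shift 1 z w))}.
Proof.
have [idx [_ ae1 _]] := lim_idx hu.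
have ae2 : {ae P, forall w, forall z : U,
    fwd P th (idx k) (env_shift 1 (sv z) w) @[k --> \oo] --> u (env_shift 1 (sv z) w)}.
  apply: ae_forall_countable => z.
  have ae3 : {ae P, forall w, fwd P th (idx k) w @[k --> \oo] --> u w}.
    by apply: filterS ae1 => w [].
  exact: (env_shift_negligible hiid 1 (sv z) ae3).
apply: filterS2 ae1 ae2 => w [_ c1] c2.
rewrite -(cvg_lim _ c1)//; apply: cvg_lim => //.
rewrite (_ : (fun k => _) = (fun k => \sum_(z <- us) tilt P th z *
    (w (0, 0) (sv z) * fwd P th (idx k) (env_shift 1 (sv z) w)))).
  apply: cvg_rsum => z; apply: cvgMr => //; apply: cvgMr => //; exact: c2.
by apply/funext => k; rewrite fwdS.
Qed.

Lemma fwd_limit_words n : {ae P, forall w, u w =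
  \sum_(s <- words us n) tilt_word P th s * (path_weight w 0 0 s * u (env_shift n%:Z (pos s) w))}.
Proof.
elim: n => [|n IHn].
  apply: aeW => w; rewrite big_words0 tilt_word_nil /= !mul1r.
  by rewrite pos_nil env_shift0.
have ae2 : {ae P, forall w, forall z : U, u (env_shift 1 (sv z) w) =
    \sum_(s <- words us n) tilt_word P th s * (path_weight (env_shift 1 (sv z) w) 0 0 s *
      u (env_shift n%:Z (pos s) (env_shift 1 (sv z) w)))}.
  by apply: ae_forall_countable => z; exact: (env_shift_negligible hiid 1 (sv z) IHn).
apply: filterS2 fwd_limit_harmonic ae2 => w -> hz.
rewrite big_wordsS; apply: eq_bigr => z _; rewrite hz !mulr_sumr.
apply: eq_bigr => s _; rewrite tilt_word_cons/= path_weight_shift env_shiftD pos_cons.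
rewrite !add0r (addrC (pos s)) -[n.+1]addn1 PoszD; ring.
Qed.

(** A zero-one law. By harmonicity and ellipticity, [u] vanishes exactly when it vanishes at every
    endpoint of an [n]-step path, an event of times at least [n]. As [n] is arbitrary, the event [Z]
    is independent of all cylinders, hence of itself, and probability 1 is excluded by the mean of
    [u]. *)
Lemma fwd_limit_gt0 : {ae P, forall w, 0 < u w}.
Proof.
have mu_ := lim_meas hu.
pose Z := [set w : E | u w = 0].
have mZ : measurable Z.
  have := mu_ measurableT _ (measurable_set1 (0 : R)).
  by rewrite setTI.
pose Zn n := \bigcap_(s in [set` words us n]) [set w : E | u (env_shift n%:Z (pos s) w) = 0].
have mZn n : measurable (Zn n).
  apply: bigcap_measurable_countable => s _.
  exact: (@measurable_preim _ _ _ _ (@env_shift R d n%:Z (pos s)) Z mZ).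
have dZn n : depends (times_ge n%:Z) (Zn n).
  move=> w w' ww'; apply/propext; split => h s /h /= <-; [apply/esym|];
    apply: (@depends_shift _ _ (times_ge 0) _ _ _ _ _ depends_fwd_limit _ _ _ ww') => i;
    by rewrite /times_ge/= => i0; lia.
have ZZn n : {ae P, forall w, Z w <-> Zn n w}.
  apply: filterS2 (fwd_limit_words n) (elliptic_ae hiid hc) => w hw ell.
  have pw0 m x s : 0 < path_weight w m x s.
    elim: s m x => [|z s IHs] m x /=; first exact: ltr01.
    by rewrite mulr_gt0// (lt_le_trans c_gt0).
  have t0 s : 0 <= tilt_word P th s * (path_weight w 0 0 s * u (env_shift n%:Z (pos s) w)).
    by rewrite !mulr_ge0 ?tilt_word_ge0 ?path_weight_ge0 ?(lim_ge0 hu).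
  rewrite /Z/= hw; split => [/eqP|h].
    rewrite psumr_eq0// => /allP h s /= /h /=.
    rewrite mulf_eq0 (gt_eqF (tilt_word_gt0 _ _ _))/= mulf_eq0 gt_eqF//=.
    by move/eqP.
  by rewrite big_seq big1// => s sn; rewrite h// !mulr0.
have PZZn n A : measurable A -> P (A `&` Z) = P (A `&` Zn n).
  move=> mA; apply: ae_measure_eq; [exact: measurableI|exact: measurableI|].
  by apply: filterS (ZZn n) => w h; split => -[Aw /h].
have PZ A : measurable A -> P (A `&` Z) = (P Z * P A)%E.
  move=> mA.
  pose m1 : measure E R := mrestr P mZ.
  pose m2 : measure E R := mscale (NngNum (fine_ge0 (measure_ge0 P Z))) P.
  have ZE : P Z = (fine (P Z))%:E by rewrite fineK// fin_num_measure.
  suff h : m1 A = m2 A by rewrite [X in (X * _)%E]ZE; exact: h.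
  apply: prodspace_measure_unique mA.
    by apply: le_lt_trans (probability_le1 P _) (ltry _); exact: measurableI.
  move=> C cC; suff h : P (C `&` Z) = (P Z * P C)%E by move: h; rewrite [X in (X * _)%E]ZE.
  have [B [_ [s sB] CB]] := cC.
  have mC := measurable_cylinders cC.
  pose n := \max_(i <- s) (absz i.1).+1.
  have dC : depends (times_lt n%:Z) C.
    have dC1 w w' : (forall i, times_lt n%:Z i -> w i = w' i) -> cylinder B w -> cylinder B w'.
      move=> ww' h i; have [is_|is_] := boolP (i \in s); last by rewrite sB.
      rewrite -ww'; first exact: h.
      have : ((absz i.1).+1 <= n)%N by rewrite /n (big_rem i)//= leq_maxl.
      exact: absz_lt.
    move=> w w' ww'; rewrite CB; apply/propext; split; apply: dC1 => // i i1.
    by rewrite ww'.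
  rewrite (PZZn n)// (indep_sets hiid (S := times_lt n%:Z) (S' := times_ge n%:Z))//.
    rewrite muleC; congr (_ * _)%E; apply/esym.
    by rewrite -(setTI Z) -(setTI (Zn n)); exact: PZZn.
  by move=> i; rewrite /times_lt /times_ge => h1 h2; lia.
have ZZ : (P Z = P Z * P Z)%E by rewrite -{1}(setIid Z) PZ.
have ZE : P Z = (fine (P Z))%:E by rewrite fineK// fin_num_measure.
have : P Z = 0%E \/ P Z = 1%E.
  move: ZZ; rewrite ZE -EFinM => -[] /eqP; rewrite -subr_eq0.
  rewrite -{1}[X in X - _]mulr1 -mulrBr mulf_eq0 subr_eq0 => /orP[/eqP ->|/eqP <-]; by [left|right].
case => [Z0|Z1].
  exists Z; split => // w /= /negP; rewrite lt_neqAle (lim_ge0 hu) andbT negbK.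
  by move=> /eqP.
have N : P (~` Z) = 0%E by rewrite probability_setC// Z1 subee.
have aeu : {ae P, forall w, setT w -> (u w)%:E = 0%E}.
  exists (~` Z); split => //; first exact: measurableC.
  by move=> w /= h Zw; apply: h => _; rewrite Zw.
have := integral_fwd_limit1.
have -> : (\int[P]_w (u w)%:E = \int[P]_(w in setT) 0)%E.
  by apply: ae_eq_integral => //; exact/measurable_EFinP.
by rewrite integral0 => /esym/eqP; rewrite onee_eq0.
Qed.

End forward.

Section backward.
Variable v : E -> R.
Hypothesis hv : subseq_limit P (bwd P th) v.

Lemma integral_bwd_limit n (h : E -> R) : measurable_fun setT h ->
  (forall w, 0 <= h w) -> depends (times_ge (- n%:Z)) h ->
  (\int[P]_w (v w * h w)%:E = \int[P]_w (bwd P th n w * h w)%:E)%E.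
Proof.
apply: (@lim_martingale (bwd P th) v (fun n => times_ge (- n%:Z)) hv).
- exact: measurable_bwd.
- exact: bwd_ge0.
- exact: bwd_martingale.
Qed.

Lemma bwd_limit_harmonic : {ae P, forall w, v w =
  \sum_(z <- us) tilt P th z * (w (-1, - sv z) (sv z) * v (env_shift (-1) (- sv z) w))}.
Proof.
have [idx [_ ae1 _]] := lim_idx hv.
have ae2 : {ae P, forall w, forall z : U,
    bwd P th (idx k) (env_shift (-1) (- sv z) w) @[k --> \oo] -->
    v (env_shift (-1) (- sv z) w)}.
  apply: ae_forall_countable => z.
  have ae3 : {ae P, forall w, bwd P th (idx k) w @[k --> \oo] --> v w}.
    by apply: filterS ae1 => w [].
  exact: (env_shift_negligible hiid (-1) (- sv z) ae3).
apply: filterS2 ae1 ae2 => w [_ c1] c2.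
rewrite -(cvg_lim _ c1)//; apply: cvg_lim => //.
rewrite (_ : (fun k => _) = (fun k => \sum_(z <- us) tilt P th z *
    (w (-1, - sv z) (sv z) * bwd P th (idx k) (env_shift (-1) (- sv z) w)))).
  apply: cvg_rsum => z; apply: cvgMr => //; apply: cvgMr => //; exact: c2.
by apply/funext => k; rewrite bwdS.
Qed.

End backward.

End martingale_limits.

(** * The tilted measure *)

Section probability_of_measure.
Context (dT : measure_display) (T : measurableType dT) (R : realType).

Definition unit_mass (mu : measure T R) (h : mu setT = 1%E) : set T -> \bar R := mu.

Section instance.
Variables (mu : measure T R) (h : mu setT = 1%E).
HB.instance Definition _ := Measure.copy (unit_mass h) mu.
HB.instance Definition _ := Measure_isProbability.Build _ _ _ (unit_mass h) h.
End instance.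

Definition prob_of (mu : measure T R) (h : mu setT = 1%E) : probability T R :=
  unit_mass h.

Lemma prob_ofE (mu : measure T R) (h : mu setT = 1%E) A : prob_of h A = mu A.
Proof. by []. Qed.

End probability_of_measure.

Lemma bigcup_measurable_countable (dT : measure_display) (T : measurableType dT)
    (I : countType) (D : set I) (F : I -> set T) :
  (forall i, D i -> measurable (F i)) -> measurable (\bigcup_(i in D) F i).
Proof.
move=> mF; rewrite bigcup_mkcond; apply: countable_bigcupT_measurable.
  exact: countableP.
by move=> i; case: ifPn => // Di; apply: mF; rewrite inE in Di.
Qed.

Lemma words_steps (R : realType) (d n : nat) (s : seq (step R d)) :
  (s \in words (steps_seq R d) n) = (size s == n).
Proof.
by rewrite mem_words; case: eqP => //= _; apply/allP => z _; exact: mem_steps.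
Qed.

(** * Laws with prescribed densities of prefixes *)

Section extension.
Context (R : realType) (d : nat) (dX : measure_display) (X : measurableType dX).
Context (m : probability X R).
Local Notation U := (step R d).
Local Notation us := (steps_seq R d).
Context (l : seq U -> X -> R).
Hypothesis ml : forall s, measurable_fun setT (l s).
Hypothesis l_ge0 : forall s x, 0 <= l s x.
Hypothesis lS : forall s x, l s x = \sum_(z <- us) l (rcons s z) x.
Hypothesis l1 : (\int[m]_x (l [::] x)%:E = 1)%E.
Local Notation RR := (measurableTypeR R).

(** Over each [x] the interval from 0 to [l [::] x] is cut into consecutive half-open pieces, one
    for each word of a given length, and refined as words grow. The piece [I s] has length [l s x]
    and starts at [off s x]; [psum] is the length of the siblings that precede [z]. The pieces fit
    by [lS]. *)
Let psum s z x : R := \sum_(0 <= j < index z us) l (rcons s (nth point us j)) x.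

Let off s x : R := \sum_(0 <= i < size s) psum (take i s) (nth point s i) x.

Let I s : set (X * RR) := [set p | (off s p.1 <= p.2) && (p.2 < off s p.1 + l s p.1)].

Let sum_mono s x i j : (i <= j)%N ->
  \sum_(0 <= k < i) l (rcons s (nth point us k)) x <=
  \sum_(0 <= k < j) l (rcons s (nth point us k)) x.
Proof.
by move=> ij; rewrite (big_cat_nat (leq0n i) ij)/= lerDl sumr_ge0.
Qed.

Let psumS s z x : psum s z x + l (rcons s z) x =
  \sum_(0 <= k < (index z us).+1) l (rcons s (nth point us k)) x.
Proof. by rewrite big_nat_recr//= nth_index ?mem_steps. Qed.

Let sum_us s x : l s x = \sum_(0 <= k < size us) l (rcons s (nth point us k)) x.
Proof. by rewrite lS (big_nth point). Qed.

Let off_rcons s z x : off (rcons s z) x = off s x + psum s z x.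
Proof.
rewrite /off size_rcons big_nat_recr//=; congr (_ + _).
  apply: eq_big_nat => i /andP[_ si].
  by rewrite nth_rcons si -cats1 takel_cat// ltnW.
by rewrite nth_rcons ltnn eqxx -cats1 take_size_cat.
Qed.

Let I_rcons s z p : I (rcons s z) p -> I s p.
Proof.
rewrite /I/= off_rcons => /andP[h1 h2]; apply/andP; split.
  by apply: le_trans h1; rewrite lerDl sumr_ge0.
apply: (lt_le_trans h2); rewrite -addrA psumS sum_us lerD2l.
by apply: sum_mono; rewrite index_mem mem_steps.
Qed.

Let I_uniq s s' p : size s = size s' -> I s p -> I s' p -> s = s'.
Proof.
elim/last_ind: s s' => [|s z IHs] s'; first by case: s'.
elim/last_ind: s' => [|s' z' _]; first by rewrite size_rcons.
rewrite !size_rcons => -[ss'] I1 I2.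
have ss := IHs _ ss' (I_rcons I1) (I_rcons I2); rewrite -ss in I2 *; congr rcons.
have lt_disj (a b : U) : I (rcons s a) p -> I (rcons s b) p ->
    (index b us <= index a us)%N.
  rewrite /I/= !off_rcons => /andP[_ h1] /andP[h2 _]; rewrite leqNgt; apply/negP => ab.
  have := le_lt_trans h2 h1; rewrite -addrA psumS ltrD2l ltNge.
  by move/negP; apply; exact: sum_mono.
have : index z us = index z' us by apply/eqP; rewrite eqn_leq !lt_disj.
by move/(congr1 (nth point us)); rewrite !nth_index ?mem_steps.
Qed.

Let I_cover s p : I s p -> exists z, I (rcons s z) p.
Proof.
move=> /andP[h1 h2].
have ex : exists i, p.2 < off s p.1 + \sum_(0 <= k < i) l (rcons s (nth point us k)) p.1.
  by exists (size us); rewrite -sum_us.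
case: (ex_minnP ex) => -[|i] hi mini.
  by move: hi; rewrite big_geq// addr0 ltNge h1.
have iu : (i < size us)%N by rewrite -ltnS ltnS; apply: mini; rewrite -sum_us.
exists (nth point us i); rewrite /I/= off_rcons -addrA psumS.
rewrite /psum index_uniq ?steps_uniq// hi andbT leNgt; apply/negP => /mini.
by rewrite ltnn.
Qed.

Let I_word n p : I [::] p -> exists2 s, size s = n & I s p.
Proof.
move=> Ip; elim: n => [|n [s sn Is]]; first by exists [::].
by have [z Iz] := I_cover Is; exists (rcons s z); rewrite ?size_rcons ?sn.
Qed.

Let I_nil s p : I s p -> I [::] p.
Proof. by elim/last_ind: s => // s z IHs /I_rcons. Qed.

Let Y (p : X * RR) : prodspace nat U :=
  fun n => xget point [set z | exists2 s, size s = n & I (rcons s z) p].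

Let Y_eq p s z : I (rcons s z) p -> Y p (size s) = z.
Proof.
move=> Ip; have [s' ss' Is'] : [set z | exists2 s', size s' = size s & I (rcons s' z) p] (Y p (size s)).
  by apply: (xgetPex point); exists z; exists s.
have := I_uniq _ Is' Ip; rewrite !size_rcons ss' => /(_ erefl)/rcons_inj[_ ->] //.
Qed.

Let Y_prefix p s : I [::] p -> (mkseq (Y p) (size s) = s <-> I s p).
Proof.
have h1 t : I t p -> mkseq (Y p) (size t) = t.
  elim/last_ind: t => // t z IHt It.
  by rewrite size_rcons mkseqS (IHt (I_rcons It)) (Y_eq It).
move=> Ip; split; last exact: h1.
have [t ts It] := I_word (size s) Ip.
by rewrite -ts (h1 _ It) => <-.
Qed.

Let measurable_off s : measurable_fun setT (off s).
Proof.
apply: measurable_sum => i; apply: measurable_sum => j; exact: ml.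
Qed.

Let measurable_I s : measurable (I s).
Proof.
have m1 (f : X -> R) : measurable_fun setT f ->
    measurable_fun setT ((fun p => f p.1) : X * RR -> R).
  by move=> mf; exact: (measurableT_comp mf measurable_fst).
have m2 : measurable_fun setT ((fun p => p.2) : X * RR -> R) by exact: measurable_snd.
have me : measurable_fun setT (fun x => off s x + l s x) by exact: measurable_funD.
rewrite -[I s]setTI; apply: (measurable_and (measurable_fun_ler (m1 _ (measurable_off s)) m2)
  (measurable_fun_ltr m2 (m1 _ me)) measurableT (Y := [set true])) => //.
Qed.

Let measurable_Y : measurable_fun setT Y.
Proof.
apply: measurable_prodspace => n _ B _; rewrite setTI.
have -> : (fun p => Y p n) @^-1` B = \bigcup_(z in B) [set p | Y p n = z].
  by apply/seteqP; split => [p Bp|p [z Bz /= pz]]; [exists (Y p n)|rewrite /preimage/= pz].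
apply: bigcup_measurable_countable => z _.
(* Outside [I [::]] no word contains the point, and [xget] returns its default [point]; this
   accounts for the second set. *)
have -> : [set p | Y p n = z] = (\bigcup_(s in [set` words us n]) I (rcons s z)) `|`
    (if z == point then ~` I [::] else set0).
  apply/seteqP; split => p /=.
    move=> pz; have [Ip|Ip] := pselect (I [::] p); last first.
      right; rewrite -pz; suff -> : Y p n = point by rewrite eqxx.
      by apply: xgetPN => y [s _ /I_nil].
    left; have [s sn Is] := I_word n.+1 Ip.
    elim/last_ind: s sn Is => // s y _; rewrite size_rcons => -[sn] Is.
    move: pz; rewrite -sn (Y_eq Is) => <-; exists s => //=.
    by rewrite words_steps.
  case=> [[s /= sn Is]|]; first by rewrite -(Y_eq Is) (size_words sn).
  case: eqP => // -> Ip; apply: xgetPN => y [s _ /I_nil]; exact: Ip.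
apply: measurableU; last by case: eqP => // _; exact: measurableC.
by apply: bigcup_measurable_countable.
Qed.

Let Y2 (p : X * RR) : X * prodspace nat U := (p.1, Y p).

Let measurable_Y2 : measurable_fun setT Y2.
Proof. by apply: (measurable_fun_pair (f := fst) (g := Y)) => //; exact: measurable_fst. Qed.

HB.instance Definition _ := isMeasurableFun.Build _ _ _ _ Y2 measurable_Y2.

Let base : measure (X * RR)%type R := (m \x @lebesgue_measure R)%E.

Let baseI s A : measurable A ->
  base (A `*` setT `&` I s) = (\int[m]_(x in A) (l s x)%:E)%E.
Proof.
move=> mA; rewrite /base/= /product_measure1 [RHS]integral_mkcond.
apply: eq_integral => x _ /=; rewrite patchE.
case: ifPn => [xA|xA].
  have -> : xsection (A `*` setT `&` I s) x = `[off s x, off s x + l s x[%classic.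
    by apply/seteqP; split => t /=; rewrite /xsection/= inE/= in_itv/=; [case|split => //; split => //; rewrite inE in xA].
  rewrite lebesgue_measure_itv/= lte_fin; case: ifP => [_|].
    by rewrite -EFinB addrC addKr.
  by rewrite ltrDl => /negbT; rewrite -leNgt => l0; congr EFin; apply/le_anti; rewrite l_ge0.
rewrite (_ : xsection _ _ = set0) ?measure0//.
apply/seteqP; split => t //; rewrite /xsection/= inE/= => -[[Ax _] _].
by move/negP: xA; apply; exact/mem_set.
Qed.

(** The law is the image of [m] times Lebesgue measure, restricted to [I [::]], under the map that
    keeps [x] and reads off the branch of the tree through the second coordinate. The mass of a
    prefix is then the integral of the length of its piece. *)
Lemma prefix_extension : exists M : probability (X * prodspace nat U)%type R,
  forall (A : set X) (s : seq U), measurable A ->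
    M (A `*` [set y | mkseq y (size s) = s]) = (\int[m]_(x in A) (l s x)%:E)%E.
Proof.
pose M0 := image_measure (mrestr base (measurable_I [::])) Y2.
have M0E A s : measurable A ->
    M0 (A `*` [set y | mkseq y (size s) = s]) = (\int[m]_(x in A) (l s x)%:E)%E.
  move=> mA; rewrite -(baseI s mA) /M0/= /mrestr/=; congr (base _).
  apply/seteqP; split => p /=.
    by move=> [[Ap /= h] Ip]; split => //; apply/(Y_prefix _ Ip).
  by move=> [[Ap _] Ip]; have I0 := I_nil Ip; split => //; split => //; apply/(Y_prefix _ I0).
have M01 : M0 setT = 1%E.
  have := M0E setT [::] measurableT; rewrite l1 => <-; congr (M0 _).
  by apply/seteqP; split.
by exists (prob_of M01).
Qed.

End extension.

Definition mfun_of (d1 d2 : measure_display) (T1 : measurableType d1)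
    (T2 : measurableType d2) (f : T1 -> T2) (mf : measurable_fun setT f) :
    {mfun T1 >-> T2} :=
  let mfP := isMeasurableFun.Build _ _ _ _ _ mf in HB.pack f mfP.

Section integral_extras.
Context (dT : measure_display) (T : measurableType dT) (R : realType).
Import HBNNSimple.

(** For nonnegative functions, measurable or not, the integral is a supremum over the simple
    functions below. Multiplying one of these by the indicator of [A] keeps its integral and brings
    it below [g]. *)
Let ge0_integral_modify_le (mu : measure T R) (A : set T) (f g : T -> \bar R) :
  measurable A -> mu (~` A) = 0%E -> (forall w, 0 <= f w)%E -> (forall w, 0 <= g w)%E ->
  (forall w, A w -> f w = g w) -> (\int[mu]_w f w <= \int[mu]_w g w)%E.
Proof.
move=> mA A0 f0 g0 fg; rewrite !ge0_integralTE//.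
apply: ge_ereal_sup => _ [h /= hf <-]; apply: ereal_sup_ubound.
exists (mul_nnsfun h (indic_nnsfun R mA)) => /=.
  move=> w; rewrite /mindic indicE; have [/set_mem wA|_] := boolP (w \in A).
    by rewrite mulr1 -fg.
  by rewrite mulr0.
rewrite -!integralT_nnsfun; apply: ae_eq_integral => //.
- exact/measurable_EFinP.
- exact/measurable_EFinP.
exists (~` A); split => //; first exact: measurableC.
by move=> w /= h1 wA; apply: h1 => _; rewrite /mindic indicE mem_set// mulr1.
Qed.

(* No measurability is asked of [f], which fits quenched integrals: they are
   only under control on a set of full measure. *)
Lemma integral_modify (mu : measure T R) (A : set T) (f g : T -> \bar R) :
  measurable A -> mu (~` A) = 0%E -> (forall w, A w -> f w = g w) ->
  (\int[mu]_w f w = \int[mu]_w g w)%E.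
Proof.
move=> mA A0 fg; rewrite integralE [RHS]integralE; congr (_ - _)%E;
  apply/le_anti/andP; split; apply: (@ge0_integral_modify_le mu A) => // w Aw;
  by rewrite ?funeposE ?funenegE fg.
Qed.

(** The absolute values change nothing, as [h] is nonnegative, but make every coefficient visibly
    nonnegative. *)
Lemma nnsfun_sumE (h : {nnsfun T >-> R}) w :
  h w = \sum_(y <- finmap.enum_fset (fset_set (range h))) `|y| * \1_(h @^-1` [set y]) w.
Proof.
rewrite fimfunE fsbig_finite//=; apply: eq_bigr => y _.
rewrite indicE; have [/set_mem wB|_] := boolP (w \in _); last by rewrite !mulr0.
by rewrite ger0_norm// -wB.
Qed.

End integral_extras.

Section transport.
Context (d1 d2 : measure_display) (T1 : measurableType d1) (T2 : measurableType d2).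
Context (R : realType) (m1 : measure T1 R) (m2 : measure T2 R).
Context (J : Type) (r : seq J) (k : J -> T2 -> R) (tau : J -> T2 -> T1).
Import HBNNSimple.
Hypothesis mk : forall j, measurable_fun setT (k j).
Hypothesis k0 : forall j w, 0 <= k j w.
Hypothesis mtau : forall j, measurable_fun setT (tau j).

Let Op (f : T1 -> R) (w : T2) : R := \sum_(j <- r) k j w * f (tau j w).

Let mOp f : measurable_fun setT f -> measurable_fun setT (Op f).
Proof.
move=> mf; apply: measurable_sum => j; apply: measurable_funM => //.
by apply: measurableT_comp.
Qed.

Let Op0 (f : T1 -> R) w : (forall x, 0 <= f x) -> 0 <= Op f w.
Proof. by move=> f0; rewrite sumr_ge0// => j _; rewrite mulr_ge0. Qed.

(** The passage from sets to functions, through simple functions and monotone convergence. Finitely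
    many weights and maps are allowed so that it serves both densities and jump kernels. *)
Lemma transport_integral (f : T1 -> R) :
  (forall A, measurable A -> m1 A =
    (\int[m2]_w (\sum_(j <- r) k j w * \1_A (tau j w))%:E)%E) ->
  measurable_fun setT f -> (forall w, 0 <= f w) ->
  (\int[m1]_w (f w)%:E = \int[m2]_w (\sum_(j <- r) k j w * f (tau j w))%:E)%E.
Proof.
move=> m12 mf f0.
have mf' : measurable_fun setT (EFin \o f) by exact/measurable_EFinP.
pose f_ := nnsfun_approx measurableT mf'.
have cv w : (f_ n w)%:E @[n --> \oo] --> (f w)%:E.
  have f0' x : setT x -> (0 <= (EFin \o f) x)%E by move=> _; rewrite lee_fin.
  exact: (@cvg_nnsfun_approx _ _ _ _ measurableT _ mf' f0' w I).
have nd w : {homo (fun n => f_ n w) : a b / (a <= b)%N >-> a <= b}.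
  by move=> a b ab; exact/lefP/nd_nnsfun_approx.
have step n : (\int[m1]_w (f_ n w)%:E = \int[m2]_w (Op (f_ n) w)%:E)%E.
  pose s := finmap.enum_fset (fset_set (range (f_ n))).
  pose B y := f_ n @^-1` [set y].
  have mB y : measurable (B y) by exact: measurable_sfunP.
  have mI y : measurable_fun setT (\1_(B y) : T1 -> R) by exact: measurable_indic.
  have I0 y x : 0 <= (\1_(B y) x : R) by rewrite indicE.
  rewrite (@eq_integral_fun _ _ _ _ _ _ (nnsfun_sumE (f_ n))) ge0_integral_rsum; last 2 first.
  - by move=> y; apply: measurable_funM => //; exact: measurable_cst.
  - by move=> y w; rewrite mulr_ge0.
  rewrite (@eq_integral_fun _ _ _ m2 _ (fun w => \sum_(y <- s) `|y| * Op \1_(B y) w)); last first.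
    move=> w; rewrite /Op; under eq_bigr do rewrite nnsfun_sumE mulr_sumr.
    rewrite exchange_big; apply: eq_bigr => y _; rewrite mulr_sumr.
    by apply: eq_bigr => j _; rewrite mulrCA.
  rewrite ge0_integral_rsum; last 2 first.
  - by move=> y; apply: measurable_funM; [exact: measurable_cst|exact: mOp].
  - by move=> y w; rewrite mulr_ge0// Op0.
  apply: eq_bigr => y _; rewrite !ge0_integral_rZl//; last 2 first.
  - exact: mOp.
  - by move=> w; exact: Op0.
  by congr (_ * _)%E; rewrite integral_indic// setIT m12.
have c1 : (\int[m1]_w (f_ n w)%:E)%E @[n --> \oo] --> (\int[m1]_w (f w)%:E)%E.
  rewrite (@eq_integral _ _ _ m1 setT (fun w => limn (fun n => (f_ n w)%:E))).
    apply: cvg_monotone_convergence => //.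
    - by move=> n; exact/measurable_EFinP.
    - by move=> n w _; rewrite lee_fin.
    - by move=> w _ a b ab; rewrite lee_fin nd.
  by move=> w _; exact/esym/cvg_lim.
have c2 : (\int[m2]_w (Op (f_ n) w)%:E)%E @[n --> \oo] --> (\int[m2]_w (Op f w)%:E)%E.
  rewrite (@eq_integral _ _ _ m2 setT (fun w => limn (fun n => (Op (f_ n) w)%:E))).
    apply: cvg_monotone_convergence => //.
    - by move=> n; apply/measurable_EFinP; exact: mOp.
    - by move=> n w _; rewrite lee_fin Op0.
    - move=> w _ a b ab; rewrite lee_fin; apply: ler_sum => j _.
      by rewrite ler_wpM2l// nd.
  move=> w _; apply/esym/cvg_lim => //; apply: cvg_EFin; first exact: nearW.
  apply: cvg_rsum => j; apply: cvgMr => //.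
  by have /fine_cvg := cv (tau j w).
rewrite -(cvg_lim _ c1)//; apply: cvg_lim => //.
by rewrite (eq_cvg _ _ step).
Qed.

End transport.

Lemma density_integral (dT : measure_display) (T : measurableType dT) (R : realType)
  (m1 m2 : measure T R) (l : T -> R) (f : T -> R) :
  measurable_fun setT l -> (forall w, 0 <= l w) ->
  (forall A, measurable A -> m1 A = (\int[m2]_(w in A) (l w)%:E)%E) ->
  measurable_fun setT f -> (forall w, 0 <= f w) ->
  (\int[m1]_w (f w)%:E = \int[m2]_w (f w * l w)%:E)%E.
Proof.
move=> ml l0 m12 mf f0.
rewrite (@transport_integral _ _ _ _ _ m1 m2 _ [:: tt] (fun=> l) (fun=> id))//.
  by apply: eq_integral_fun => w; rewrite big_seq1 mulrC.
move=> A mA; rewrite m12// integral_mkcond; apply: eq_integral => w _.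
by rewrite patchE big_seq1 indicE; case: ifP => _; rewrite ?mulr1 ?mulr0.
Qed.


(** * Quenched laws as sums over words *)

Section walk_law.
Context (R : realType) (d : nat).
Local Notation U := (step R d).
Local Notation E := (env R d).
Local Notation us := (steps_seq R d).
Local Notation sv := (@step_val R d : U -> lattice d).
Local Notation pos := (@pos (lattice d) U (@step_val R d)).
Implicit Types (w : E) (s : seq U) (x : lattice d) (k : int).

Definition path_of x s : paths d := fun j => x + pos (take j s).

Definition walk_of x (y : steps R d) : paths d := fun n => x + \sum_(i < n) sv (y i).

Lemma walk_of_prefix x (y : steps R d) n j : (j <= n)%N ->
  walk_of x y j = path_of x (mkseq y n) j.
Proof.
move=> jn; rewrite /walk_of /path_of /mkseq -map_take take_iota (minn_idPl jn).
rewrite -/(mkseq y j); elim: j {jn} => [|j IHj]; first by rewrite big_ord0 pos_nil.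
by rewrite big_ord_recr/= mkseqS pos_rcons !addrA IHj.
Qed.

Lemma measurable_prefix n s : measurable [set y : steps R d | mkseq y n = s].
Proof.
have -> : [set y : steps R d | mkseq y n = s] = if size s == n then
    cylinder (fun i => if (i < n)%N then [set nth point s i] else setT) else set0.
  case: eqP => [sn|sn]; apply/seteqP; split => y //=.
  - move=> <- i; case: ifP => // i_n; by rewrite /= nth_mkseq.
  - move=> h; apply: (@eq_from_nth _ point); rewrite size_mkseq ?sn// => i i_n.
    by rewrite nth_mkseq//; have := h i; rewrite i_n.
  - by move=> ys; apply: sn; rewrite -ys size_mkseq.
case: eqP => // _; apply: measurable_cylinders.
exists (fun i => if (i < n)%N then [set nth point s i] else setT); split => //.
exists (iota 0 n) => i; rewrite mem_iota/= add0n.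
by case: ifP.
Qed.

Lemma measurable_walk_of x : measurable_fun setT (walk_of x).
Proof.
apply: measurable_prodspace => n _ B _; rewrite setTI.
have -> : (fun y : steps R d => walk_of x y n) @^-1` B =
    \bigcup_(s in [set s : seq U | B (path_of x s n)]) [set y | mkseq y n = s].
  apply/seteqP; split => y; rewrite /preimage/= (@walk_of_prefix _ _ n n)//.
    by move=> By; exists (mkseq y n).
  by move=> [s /= Bs ->].
apply: bigcup_measurable_countable => s _.
exact: measurable_prefix.
Qed.

HB.instance Definition _ x := isMeasurableFun.Build _ _ _ _ (walk_of x) (measurable_walk_of x).

Lemma path_weightE w k x s : path_weight w k x s =
  \prod_(j < size s) w (k + j%:Z, path_of x s j) (sv (nth point s j)).
Proof.
elim/last_ind: s => [|s z IHs]; first by rewrite big_ord0.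
rewrite path_weight_rcons size_rcons big_ord_recr/=; congr (_ * _).
  rewrite IHs; apply: eq_bigr => j _.
  by rewrite nth_rcons ltn_ord /path_of -cats1 takel_cat// ltnW.
by rewrite nth_rcons ltnn eqxx /path_of -cats1 take_size_cat.
Qed.

Lemma path_weight_sum w k x n : nn_env w ->
  \sum_(s <- words us n) path_weight w k x s = 1.
Proof.
move=> hw; elim: n => [|n IHn]; first by rewrite big_words0.
rewrite big_words_rcons -[RHS]IHn; apply: eq_bigr => s _.
under eq_bigr do rewrite path_weight_rcons.
by rewrite -mulr_sumr row_sum// mulr1.
Qed.

Lemma path_ofS x s j : (j < size s)%N ->
  path_of x s j.+1 = path_of x s j + sv (nth point s j).
Proof. by move=> js; rewrite /path_of (take_nth point)// pos_rcons addrA. Qed.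

Lemma walk_law_exists w k x : nn_env w -> exists Q, is_walk_law w k x Q.
Proof.
move=> hw.
have lS s (w' : E) : path_weight w k x s = \sum_(z <- us) path_weight w k x (rcons s z).
  under eq_bigr do rewrite path_weight_rcons.
  by rewrite -mulr_sumr row_sum// mulr1.
(* The environment is frozen, so the base space is irrelevant: a Dirac mass carries it, with
   densities constant in its variable. *)
have [M hM] := @prefix_extension R d _ E (\d_(point : E)) (fun s _ => path_weight w k x s)
  (fun s => measurable_cst _) (fun s _ => path_weight_ge0 _ _ _ _) lS (integral_one _).
pose f (v : E * steps R d) := walk_of x v.2.
have mf : measurable_fun setT f.
  by apply: measurableT_comp => //; exact: measurable_walk_of.
pose Q0 := image_measure M (mfun_of mf).
have Q01 : Q0 setT = 1%E by exact: probability_setT.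
exists (prob_of Q01) => n p; rewrite prob_ofE/= /pushforward/=.
have f0 v : f v 0%N = x by rewrite /f /walk_of big_ord0 addr0.
case: eqP => [p0|p0]; last first.
  rewrite mul0r (_ : _ @^-1` _ = set0) ?measure0//; apply/seteqP; split => v //=.
  by move=> /(_ 0%N isT); rewrite f0 => /esym.
rewrite mul1r.
have [unit_p|] := pselect (forall j, (j < n)%N -> enorm (lat2vec R (p j.+1 - p j)) == 1).
  pose s := mkseq (fun j => insubd (point : U) (p j.+1 - p j)) n.
  have sE j : (j < n)%N -> sv (nth point s j) = p j.+1 - p j.
    by move=> jn; rewrite nth_mkseq// insubdK//; exact: unit_p.
  have ps j : (j <= n)%N -> path_of x s j = p j.
    elim: j => [|j IHj] jn; first by rewrite /path_of take0 pos_nil addr0.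
    by rewrite path_ofS ?size_mkseq// IHj ?(ltnW jn)// sE// addrC subrK.
  have -> : f @^-1` [set X | forall j, (j <= n)%N -> X j = p j] =
      setT `*` [set y | mkseq y (size s) = s].
    rewrite size_mkseq; apply/seteqP; split => v /=.
      move=> h; split => //; apply: (@eq_from_nth _ point); rewrite !size_mkseq// => j jn.
      rewrite nth_mkseq//; apply: val_inj; rewrite [RHS]sE//.
      rewrite -(h j.+1)// -(h j) ?(ltnW jn)// /f /walk_of big_ord_recr/= addrA.
      by rewrite [RHS]addrC addKr.
    by move=> [_ h] j jn; rewrite /f (@walk_of_prefix _ _ n)// h ps.
  apply: etrans (hM _ _ measurableT) _.
  apply: etrans (integral_cst (\d_(point : E) : probability E R) measurableT _) _.
  rewrite [X in (_ * X)%E]diracT mule1; congr EFin.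
  rewrite path_weightE size_mkseq; apply: eq_bigr => j _.
  by rewrite ps ?(ltnW (ltn_ord j))// sE// ltn_ord.
(* A prescribed path with a jump of length other than 1 has mass 0 on both sides: the walk built
   here makes unit steps, and on [nn_env] the transition probability vanishes. *)
move/existsNP => [j /not_implyP[jn up]].
rewrite (_ : _ @^-1` _ = set0) ?measure0; last first.
  apply/seteqP; split => v //= h; apply: up.
  rewrite -(h j.+1)// -(h j) ?(ltnW jn)// /f /walk_of big_ord_recr/= addrA.
  by rewrite [X in lat2vec _ X]addrC addKr; exact: step_unit.
congr EFin; apply/esym/eqP/prodf_eq0; exists (Ordinal jn) => //=.
by rewrite /transition hw//; apply/negP.
Qed.

Lemma walk_law_path w k x (Q : probability (paths d) R) s : is_walk_law w k x Q ->
  Q [set X | forall j, (j <= size s)%N -> X j = path_of x s j] = (path_weight w k x s)%:E.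
Proof.
move=> ->; rewrite {1}/path_of take0 pos_nil addr0 eqxx mul1r path_weightE; congr EFin.
apply: eq_bigr => j _; rewrite path_ofS// transitionD.
by [].
Qed.

(** The finitely many sets [C s] are disjoint and carry all the mass, and [g] is constant on each of
    them; so [g] may be replaced by a combination of indicators without being known to be
    measurable. *)
Lemma walk_law_integral w k x (Q : probability (paths d) R) n (g : paths d -> R) :
  nn_env w -> is_walk_law w k x Q -> depends (fun i => (i <= n)%N) g ->
  (\int[Q]_X (g X)%:E = (\sum_(s <- words us n) path_weight w k x s * g (path_of x s))%:E)%E.
Proof.
move=> hw hQ dg.
pose C s := [set X : paths d | forall j, (j <= n)%N -> X j = path_of x s j].
have mC s : measurable (C s).
  apply: measurable_cylinders.
  exists (fun j => if (j <= n)%N then [set path_of x s j] else setT); split.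
  - by move=> j; case: ifP.
  - by exists (iota 0 n.+1) => j; rewrite mem_iota/= add0n ltnS => /negbTE ->.
  - apply/seteqP; split => X /= h j; first by case: ifP => // jn; exact: h.
    by move=> jn; have := h j; rewrite jn.
have QC s : size s = n -> Q (C s) = (path_weight w k x s)%:E.
  by move=> sn; rewrite /C -sn; exact: walk_law_path.
pose A := \bigcup_(s in [set` words us n]) C s.
have mA : measurable A by apply: bigcup_measurable_countable => s _; exact: mC.
have C_inj s t X : size s = n -> size t = n -> C s X -> C t X -> s = t.
  move=> sn tn Cs Ct; apply: (@eq_from_nth _ point); rewrite ?sn ?tn// => j jn.
  apply: val_inj; apply: (@addrI _ (path_of x s j)).
  rewrite -[LHS](path_ofS x) ?sn// -(Cs j.+1)// (Ct j.+1)// path_ofS ?tn//.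
  by rewrite -(Ct j) ?(ltnW jn)// (Cs j)// ltnW.
have sumC X s : s \in words us n -> C s X ->
    \sum_(t <- words us n) g (path_of x t) * \1_(C t) X = g X.
  move=> sw Cs; rewrite (bigD1_seq s)//=; last exact: (words_uniq _ (steps_uniq _ _)).
  rewrite indicE mem_set// mulr1 big_seq_cond big1 ?addr0.
    by apply: dg => j jn; rewrite (Cs j).
  move=> t /andP[tw ts]; rewrite indicE memNset ?mulr0// => Ct.
  move/eqP: ts; apply; apply: C_inj Ct Cs; [exact: size_words tw|exact: size_words sw].
have QA : Q (~` A) = 0%E.
  have QA1 : Q A = 1%E.
    transitivity (\sum_(s <- words us n) Q (C s))%E; last first.
      rewrite (@eq_big_seq _ _ _ _ _ _ (fun s => (path_weight w k x s)%:E)).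
        by rewrite sumEFin path_weight_sum.
      by move=> s sw; apply: QC; exact: size_words sw.
    rewrite /A measure_fin_bigcup//.
    - by rewrite -fsbig_seq//; apply: words_uniq; exact: steps_uniq.
    - exact: finite_seq.
    - move=> s t sw tw [X [Cs Ct]].
      by apply: C_inj Cs Ct; [exact: size_words sw|exact: size_words tw].
  by rewrite probability_setC// QA1 subee.
rewrite (@integral_modify _ _ _ Q A _
  (fun X => \sum_(s <- words us n) (g (path_of x s))%:E * (\1_(C s) X)%:E)%E mA QA); last first.
  move=> X [s /= sw Cs]; rewrite -(sumC X s sw Cs) -sumEFin.
  by apply: eq_bigr => t _; rewrite EFinM.
have iC s : Q.-integrable setT (fun X => (\1_(C s) X)%:E).
  exact: integrable_indic.
rewrite integral_sum//; last by move=> s; apply: integrableZl.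
rewrite -sumEFin; apply: eq_big_seq => s sw.
rewrite integralZl//.
have -> : (\int[Q]_X (\1_(C s) X)%:E = (path_weight w k x s)%:E)%E.
  apply: etrans (integral_indic Q measurableT (mC s)) _; rewrite setIT.
  exact: QC (size_words sw).
by rewrite -EFinM mulrC.
Qed.

Lemma quenched_law w k x : nn_env w -> is_walk_law w k x (quenched w k x).
Proof. by move=> hw; apply: xgetPex; exact: walk_law_exists. Qed.

End walk_law.

Lemma ge0_integrable (dT : measure_display) (T : measurableType dT) (R : realType)
  (mu : measure T R) (f : T -> R) : measurable_fun setT f -> (forall x, 0 <= f x) ->
  (\int[mu]_x (f x)%:E < +oo)%E -> mu.-integrable setT (EFin \o f).
Proof.
move=> mf f0 foo; apply/integrableP; split; first exact/measurable_EFinP.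
by under eq_integral => x _ do rewrite /= ger0_norm//.
Qed.

Section dependence.
Context (I : choiceType) (dT : measure_display) (T : measurableType dT).
Local Notation X := (prodspace I T).

(** The point [w2], equal to [w] on [S] and to [w'] elsewhere, agrees with [w] on [S] and with [w']
    on [S']. *)
Lemma dependsI (S S' : pred I) (Y : Type) (f : X -> Y) :
  depends S f -> depends S' f -> depends (fun i => S i && S' i) f.
Proof.
move=> fS fS' w w' ww'; pose w2 : X := fun i => if S i then w i else w' i.
transitivity (f w2); first by apply: fS => i Si; rewrite /w2 Si.
apply: fS' => i S'i; rewrite /w2; case: ifPn => // Si.
by apply: ww'; rewrite Si.
Qed.

Lemma depends_fun (R : realType) (S : pred I) (f : X -> R) :
  (forall Y : set R, measurable Y -> depends S [set w | Y (f w)]) -> depends S f.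
Proof.
move=> h w w' ww'.
have := h [set f w'] (measurable_set1 _) w w' ww'; rewrite /= => e.
by have : f w' = f w' by []; rewrite -e.
Qed.

End dependence.

Section tilted_measure.
Context (R : realType) (d : nat) (P : probability (env R d) R) (c : R).
Hypothesis hiid : iid_environment P.
Hypothesis hnn : nearest_neighbor P.
Context (th : 'rV[R]_d.+1).
Local Notation U := (step R d).
Local Notation E := (env R d).
Local Notation us := (steps_seq R d).
Local Notation sv := (@step_val R d : U -> lattice d).
Local Notation pos := (@pos (lattice d) U (@step_val R d)).
Local Notation tw := (tilt_word P th).
Local Notation pw := path_weight.
Context (u v : E -> R).
Hypothesis hu : subseq_limit P (fwd P th) u.
Hypothesis hv : subseq_limit P (bwd P th) v.

Let mu_ : measurable_fun setT u := lim_meas hu.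
Let mv_ : measurable_fun setT v := lim_meas hv.
Let u0 w : 0 <= u w. Proof. exact: lim_ge0 hu w. Qed.
Let v0 w : 0 <= v w. Proof. exact: lim_ge0 hv w. Qed.

(** The density with respect to [P] of the environment together with the event that the first steps
    are [s]: [v] accounts for the past, the weights for [s], and [u], at the endpoint, for the
    future. *)
Definition tilted_density (s : seq U) (w : E) : R :=
  v w * (tw s * (pw w 0 0 s * u (env_shift (size s)%:Z (pos s) w))).

Lemma tilted_density_ge0 s w : 0 <= tilted_density s w.
Proof. by rewrite !mulr_ge0 ?tilt_word_ge0 ?path_weight_ge0. Qed.

Lemma measurable_shifted (f : E -> R) m x : measurable_fun setT f ->
  measurable_fun setT (fun w => f (env_shift m x w)).
Proof. by move=> mf; apply: measurableT_comp => //; exact: measurable_env_shift. Qed.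

Lemma measurable_tilted_density s : measurable_fun setT (tilted_density s).
Proof.
apply: measurable_funM => //; apply: measurable_funM => //.
by apply: measurable_funM; [exact: measurable_path_weight|exact: measurable_shifted].
Qed.

(** A description of [mu_bar] that is free of the parameters N, M and K: it prescribes the mass of
    all rectangles with a prefix event. *)
Definition is_tilted (M : probability (E * steps R d)%type R) : Prop :=
  forall (A : set E) (s : seq U), measurable A ->
    M (A `*` [set y | mkseq y (size s) = s]) =
    (\int[P]_(w in A) (tilted_density s w)%:E)%E.

Lemma integral_bwd_limit_fwd_limit : (\int[P]_w (v w * u w)%:E = 1)%E.
Proof.
rewrite (integral_bwd_limit hiid hnn hv (n := 0))//; last first.
  by rewrite oppr0; exact: depends_fwd_limit hu.
rewrite -(integral_fwd_limit1 hiid hnn hu); apply: eq_integral_fun => w.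
by rewrite bwd0 mul1r.
Qed.

Let step_rhs (w : E) : R := \sum_(z <- us) tilt P th z * (w (0, 0) (sv z) * u (env_shift 1 z w)).

Let harm : set E := [set w | forall i : site d,
  u (env_shift i.1 i.2 w) = step_rhs (env_shift i.1 i.2 w)].

Let measurable_rhs : measurable_fun setT step_rhs.
Proof.
apply: measurable_sum => z; apply: measurable_funM => //.
by apply: measurable_funM; [exact: measurable_pv|exact: measurable_shifted].
Qed.

Let measurable_harm : measurable harm.
Proof.
have -> : harm = \bigcap_(i in [set: site d])
    [set w | u (env_shift i.1 i.2 w) - step_rhs (env_shift i.1 i.2 w) = 0].
  apply/seteqP; split => w h i; first by move=> _ /=; rewrite h subrr.
  by apply/eqP; rewrite -subr_eq0; apply/eqP; exact: h.
apply: bigcap_measurable_countable => i _.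
have mh : measurable_fun setT
    (fun w => u (env_shift i.1 i.2 w) - step_rhs (env_shift i.1 i.2 w)).
  by apply: measurable_funB; exact: measurable_shifted.
by have := mh measurableT _ (measurable_set1 (0 : R)); rewrite setTI.
Qed.

Let ae_harm : {ae P, forall w, harm w}.
Proof.
apply: ae_forall_countable => i.
exact: (env_shift_negligible hiid i.1 i.2 (fwd_limit_harmonic hiid hu)).
Qed.

Lemma ae_integral A (f g : E -> R) : measurable A -> measurable_fun setT f ->
  measurable_fun setT g -> {ae P, forall w, f w = g w} ->
  (\int[P]_(w in A) (f w)%:E = \int[P]_(w in A) (g w)%:E)%E.
Proof.
move=> mA mf mg fg; apply: ae_eq_integral => //.
- by apply/measurable_EFinP; exact: measurable_funTS.
- by apply/measurable_EFinP; exact: measurable_funTS.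
by apply: filterS fg => w -> _.
Qed.

Lemma tilted_exists : exists M, is_tilted M.
Proof.
(* [prefix_extension] asks for consistency in every environment, but [u] is harmonic only almost
   surely: the densities are set to 0 outside [harm], where some shift fails the equation. *)
pose l s w := \1_harm w * tilted_density s w.
have ml s : measurable_fun setT (l s).
  by apply: measurable_funM; [exact: measurable_indic|exact: measurable_tilted_density].
have l0 s w : 0 <= l s w by rewrite mulr_ge0 ?tilted_density_ge0// indicE.
have lS s w : l s w = \sum_(z <- us) l (rcons s z) w.
  rewrite /l indicE; have [/set_mem hw|_] := boolP (w \in harm); last first.
    by rewrite mul0r big1// => z _; rewrite mul0r.
  rewrite mul1r /tilted_density (hw ((size s)%:Z, pos s))/= /step_rhs !mulr_sumr.
  apply: eq_bigr => z _; rewrite mul1r tilt_word_rcons path_weight_rcons pos_rcons size_rcons.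
  rewrite env_shiftD (addrC (sv z)) -[(size s).+1]add1n PoszD /env_shift/= !add0r.
  ring.
have ae_l s : {ae P, forall w, l s w = tilted_density s w}.
  by apply: filterS ae_harm => w hw; rewrite /l indicE mem_set// mul1r.
have l1 : (\int[P]_w (l [::] w)%:E = 1)%E.
  rewrite -integral_bwd_limit_fwd_limit.
  rewrite (ae_integral measurableT (ml _) (measurable_tilted_density _) (ae_l _)).
  apply: eq_integral_fun => w.
  by rewrite /tilted_density tilt_word_nil/= !mul1r pos_nil env_shift0.
have [M hM] := prefix_extension ml l0 lS l1.
exists M => A s mA; rewrite hM//.
by apply: ae_integral => //; exact: measurable_tilted_density.
Qed.

Definition pad (s : seq U) : steps R d := fun i => nth point s i.

Lemma tilted_marginal M (A : set E) : is_tilted M -> measurable A ->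
  M (A `*` setT) = (\int[P]_(w in A) (v w * u w)%:E)%E.
Proof.
move=> hM mA; have := hM A [::] mA.
rewrite (_ : [set y | _] = setT); last by apply/seteqP; split.
move=> ->; apply: eq_integral => w _; rewrite /tilted_density tilt_word_nil/= !mul1r.
by rewrite pos_nil env_shift0.
Qed.

Lemma tilted_integral M (f : E * steps R d -> R) K : is_tilted M ->
  measurable_fun setT f -> (forall x, 0 <= f x) ->
  (forall w (y y' : steps R d), (forall i, (i < K)%N -> y i = y' i) -> f (w, y) = f (w, y')) ->
  (\int[M]_x (f x)%:E =
   \sum_(s <- words us K) \int[P]_w (f (w, pad s) * tilted_density s w)%:E)%E.
Proof.
move=> hM mf f0 df.
pose C s : set (E * steps R d) := setT `*` [set y | mkseq y K = s].
have mC s : measurable (C s) by apply: measurableX => //; exact: measurable_prefix.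
have mfs s : measurable_fun setT (fun w => f (w, pad s)).
  by apply: measurableT_comp => //; exact: measurable_pair1.
have mfs1 s : measurable_fun setT (fun x : E * steps R d => f (x.1, pad s)).
  by apply: (measurableT_comp (mfs s)); exact: measurable_fst.
have m1 s : measurable_fun setT (\1_(C s) : E * steps R d -> R) by exact: measurable_indic.
have i0 s x : 0 <= (\1_(C s) x : R) by rewrite indicE.
have -> : (\int[M]_x (f x)%:E =
    \int[M]_x (\sum_(s <- words us K) f (x.1, pad s) * \1_(C s) x)%:E)%E.
  apply: eq_integral_fun => -[w y]; rewrite (bigD1_seq (mkseq y K))/=; last 2 first.
  - by rewrite words_steps size_mkseq.
  - by apply: words_uniq; exact: steps_uniq.
  rewrite indicE mem_set//= mulr1 big1 ?addr0.
    by apply: df => i iK; rewrite /pad nth_mkseq.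
  move=> s /eqP sy; rewrite indicE memNset ?mulr0// => -[_ /= ys].
  by apply: sy; rewrite ys.
rewrite ge0_integral_rsum; last 2 first.
- by move=> s; exact: measurable_funM.
- by move=> s x; rewrite mulr_ge0.
apply: eq_big_seq => s; rewrite words_steps => /eqP sK.
pose M1 : measure (E * steps R d)%type R := mrestr M (mC s).
pose rho : measure E R := image_measure M1 (mfun_of (@measurable_fst _ _ E (steps R d))).
transitivity (\int[M1]_x (f (x.1, pad s))%:E)%E.
  apply/esym/density_integral => // A mA.
  apply: etrans (esym (integral_indic M mA (mC s))).
  by rewrite setIC.
transitivity (\int[rho]_w (f (w, pad s))%:E)%E.
  apply/esym; apply: (@ge0_integral_pushforward _ _ _ E R fst measurable_fst M1 setT
    (fun w => (f (w, pad s))%:E)) => //.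
  - by apply/measurable_EFinP.
  - by move=> w _; rewrite lee_fin.
apply: density_integral => //.
- exact: measurable_tilted_density.
- exact: tilted_density_ge0.
move=> A mA; rewrite -hM//; rewrite /rho/= /pushforward /mrestr; congr (M _).
by rewrite sK; apply/seteqP; split => -[w y] /=; [move=> [? [_]]|move=> []].
Qed.

(** Shift invariance of [P] moves a path that arrives at the origin at time 0 to one that leaves the
    origin at time 0; [h] is then evaluated at its endpoint. *)
Lemma integral_bwd_words N (h : E -> R) : measurable_fun setT h -> (forall w, 0 <= h w) ->
  (\int[P]_w (bwd P th N w * h w)%:E =
   \sum_(t <- words us N) \int[P]_w (tw t * (pw w 0 0 t * h (env_shift N%:Z (pos t) w)))%:E)%E.
Proof.
move=> mh h0.
rewrite (@eq_integral_fun _ _ _ _ _ (fun w => \sum_(t <- words us N)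
    tw t * (pw w (- N%:Z) (- pos t) t * h w))); last first.
  by move=> w; rewrite /bwd mulr_suml; apply: eq_bigr => t _; rewrite mulrA.
have mF t : measurable_fun setT (fun w => tw t * (pw w (- N%:Z) (- pos t) t * h w)).
  by apply: measurable_funM => //; apply: measurable_funM => //; exact: measurable_path_weight.
have F0 t w : 0 <= tw t * (pw w (- N%:Z) (- pos t) t * h w).
  by rewrite !mulr_ge0 ?tilt_word_ge0 ?path_weight_ge0.
rewrite ge0_integral_rsum//; apply: eq_bigr => t _.
rewrite -(env_shift_integral hiid N%:Z (pos t) (f := fun w => (tw t * (pw w (- N%:Z) (- pos t) t * h w))%:E)).
- by apply: eq_integral_fun => w; rewrite path_weight_shift !addNr.
- by apply/measurable_EFinP.
- by move=> w; rewrite lee_fin.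
Qed.

Lemma integral_fwd_limit_shift n m x (h : E -> R) : measurable_fun setT h ->
  (forall w, 0 <= h w) -> depends (times_lt (m + n%:Z)) h ->
  (\int[P]_w (u (env_shift m x w) * h w)%:E =
   \int[P]_w (fwd P th n (env_shift m x w) * h w)%:E)%E.
Proof.
move=> mh h0 dh.
have hE w : h w = h (env_shift (- m) (- x) (env_shift m x w)).
  by rewrite env_shiftD !addNr env_shift0.
have mh' := measurable_shifted (- m) (- x) mh.
have key (F : E -> R) : measurable_fun setT F -> (forall w, 0 <= F w) ->
    (\int[P]_w (F (env_shift m x w) * h w)%:E =
     \int[P]_w (F w * h (env_shift (- m) (- x) w))%:E)%E.
  move=> mF F0.
  rewrite -(env_shift_integral hiid m x (f := fun w => (F w * h (env_shift (- m) (- x) w))%:E)).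
  - by apply: eq_integral_fun => w; rewrite -hE.
  - by apply/measurable_EFinP; apply: measurable_funM.
  - by move=> w; rewrite lee_fin mulr_ge0.
rewrite !key//; last 2 first.
- exact: measurable_fwd.
- by move=> w; exact: fwd_ge0.
apply: (integral_fwd_limit hiid hnn hu) => //.
apply: (depends_shift dh) => i; rewrite /times_lt/=; lia.
Qed.

Section mu_bar_identity.
Variables (N L K : nat) (f : E * steps R d -> R).
Hypothesis mf : measurable_fun setT f.
Hypothesis df : forall w (y y' : steps R d),
  (forall i, (i < K)%N -> y i = y' i) -> f (w, y) = f (w, y').
Hypothesis sf : forall (z : steps R d) (Y : set R), measurable Y ->
  (sigma_ge (- N%:Z) `&` sigma_le L%:Z) [set w | Y (f (w, z))].

Let len := (N + L + K + 1)%N.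

Definition annealed_words (w : E) : R := \sum_(q <- words us len)
  pw w 0 0 q * (tw q * f (env_shift N%:Z (pos (take N q)) w, pad (drop N q))).

Let mfz z : measurable_fun setT (fun w => f (w, z)).
Proof. by apply: measurableT_comp => //; exact: measurable_pair1. Qed.

Let dfz z : depends (fun i => times_ge (- N%:Z) i && (i.1 <= L%:Z)) (fun w => f (w, z)).
Proof.
apply: dependsI; apply: depends_fun => Y mY; have [h1 h2] := sf z mY.
  by have [_] := (sigma_geE _ _).1 h1.
by have [_] := (sigma_leE _ _).1 h2.
Qed.

Lemma measurable_annealed_words : measurable_fun setT annealed_words.
Proof.
apply: measurable_sum => q; apply: measurable_funM; first exact: measurable_path_weight.
by apply: measurable_funM => //; exact: (measurable_shifted _ _ (mfz _)).
Qed.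

(** The quenched integrals are computed on [nn_env] only, and [integral_modify] replaces them there
    although nothing is known about their measurability elsewhere. *)
Lemma averaged_annealed :
  averaged_E P 0 0 (fun v =>
       (expR (dot th (lat2vec R (v.2 len)) - len%:R * ln (phi_a P th)) *
        f (env_shift N%:Z (v.2 N) v.1, increments R N v.2))%:E) =
  (\int[P]_w (annealed_words w)%:E)%E.
Proof.
have nn0 : P (~` @nn_env R d) = 0%E.
  have [A [mA A0 sA]] := nn_env_ae hiid hnn.
  apply/negligibleP; first by apply: measurableC; exact: measurable_nn_env.
  by exists A.
rewrite /averaged_E; apply: (@integral_modify _ _ _ P (@nn_env R d) _ _ (@measurable_nn_env R d) nn0) => w hw.
rewrite (walk_law_integral (n := len) hw (quenched_law _ _ hw)); last first.
  move=> X X' XX' /=; rewrite XX'// (XX' N) ?/len; last by lia.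
  congr (_ * _); apply: df => i iK; rewrite /increments.
  by rewrite !XX'// /len; lia.
congr EFin; apply: eq_big_seq => q; rewrite words_steps => /eqP qn.
congr (_ * _); rewrite /= /path_of add0r -{1}qn take_size tilt_wordE qn; congr (_ * _).
rewrite add0r; apply: df => i iK; rewrite /increments /pad.
have iq : (N + i < size q)%N by rewrite qn /len; lia.
rewrite !add0r (take_nth point)// pos_rcons addrC addKr nth_drop.
by apply: val_inj; rewrite /= insubdK//; exact: step_unit.
Qed.

Lemma tilted_annealed M : is_tilted M -> (forall x, 0 <= f x) ->
  (\int[M]_x (f x)%:E = \int[P]_w (annealed_words w)%:E)%E.
Proof.
move=> hM f0; rewrite (tilted_integral hM mf f0 df).
rewrite ge0_integral_rsum; last 2 first.
- move=> q; apply: measurable_funM; first exact: measurable_path_weight.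
  by apply: measurable_funM => //; exact: (measurable_shifted _ _ (mfz _)).
- by move=> q w; rewrite !mulr_ge0 ?path_weight_ge0 ?tilt_word_ge0.
(* The first [N] steps turn [v] into [bwd N], the next [K] are the steps that [f] reads, and the
   last [L.+1] turn [u] into [fwd L.+1]. After the shift [f] sees times up to [N + L], which lie
   below the end [N + K + L.+1] of the word. *)
have -> : len = (N + (K + L.+1))%N by rewrite /len; lia.
rewrite big_words_cat; under [RHS]eq_bigr do rewrite big_words_cat.
rewrite exchange_big; apply: eq_big_seq => s; rewrite words_steps => /eqP sK.
have mp m x q : measurable_fun setT (fun w : E => pw w m x q) by exact: measurable_path_weight.
pose h w := f (w, pad s) * (tw s * (pw w 0 0 s * u (env_shift K%:Z (pos s) w))).
have mh : measurable_fun setT h.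
  apply: measurable_funM => //; apply: measurable_funM => //.
  by apply: measurable_funM => //; exact: measurable_shifted.
have h0 w : 0 <= h w by rewrite !mulr_ge0 ?path_weight_ge0 ?tilt_word_ge0.
have dh : depends (times_ge (- N%:Z)) h.
  move=> w w' ww'; rewrite /h; congr (_ * (_ * (_ * _))).
  - by apply: (dfz (pad s)) => i /andP[i1 _]; exact: ww'.
  - apply: depends_path_weight => i /andP[i1 _]; apply: ww'.
    by move: i1; rewrite /times_ge; lia.
  apply: (depends_shift (S' := times_ge (- N%:Z)) (depends_fwd_limit hu)) ww' => i.
  by rewrite /times_ge/=; lia.
transitivity (\int[P]_w (v w * h w)%:E)%E.
  by apply: eq_integral_fun => w; rewrite /tilted_density sK /h mulrCA.
rewrite (integral_bwd_limit hiid hnn hv mh h0 dh) integral_bwd_words//.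
apply: eq_big_seq => t; rewrite words_steps => /eqP tN.
pose g w := tw t * pw w 0 0 t * (tw s * pw w N%:Z (pos t) s) *
  f (env_shift N%:Z (pos t) w, pad s).
have mg : measurable_fun setT g.
  apply: measurable_funM; last exact: (measurable_shifted _ _ (mfz _)).
  by apply: measurable_funM; apply: measurable_funM.
have g0 w : 0 <= g w by rewrite !mulr_ge0 ?path_weight_ge0 ?tilt_word_ge0.
have dg : depends (times_lt ((N + K)%N%:Z + L.+1%:Z)) g.
  move=> w w' ww'; rewrite /g; congr (_ * _ * (_ * _) * _).
  - apply: depends_path_weight => i /andP[_ i1]; apply: ww'.
    by move: i1; rewrite /times_lt tN; lia.
  - apply: depends_path_weight => i /andP[_ i1]; apply: ww'.
    by move: i1; rewrite /times_lt sK; lia.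
  apply: (depends_shift (S' := times_lt ((N + K)%N%:Z + L.+1%:Z)) (dfz (pad s))) ww' => i.
  by move=> /andP[_]; rewrite /times_lt/=; lia.
transitivity (\int[P]_w (u (env_shift (N + K)%N%:Z (pos t + pos s) w) * g w)%:E)%E.
  apply: eq_integral_fun => w; rewrite /h /g env_shiftD path_weight_shift !add0r.
  rewrite (addrC K%:Z) (addrC (pos s)) PoszD; ring.
rewrite (integral_fwd_limit_shift _ mg g0 dg).
rewrite (@eq_integral_fun _ _ _ _ _ (fun w => \sum_(r <- words us L.+1) pw w 0 0 (t ++ s ++ r) *
     (tw (t ++ s ++ r) * f (env_shift N%:Z (pos (take N (t ++ s ++ r))) w, pad (drop N (t ++ s ++ r)))))).
  rewrite ge0_integral_rsum//.
  - move=> q; apply: measurable_funM => //.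
    by apply: measurable_funM => //; exact: (measurable_shifted _ _ (mfz _)).
  - by move=> q w; rewrite !mulr_ge0 ?path_weight_ge0 ?tilt_word_ge0.
move=> w; rewrite /fwd mulr_suml; apply: eq_bigr => r _.
rewrite -tN take_size_cat// drop_size_cat// tN /g !tilt_word_cat !path_weight_cat.
rewrite path_weight_shift !add0r tN sK.
have -> : f (env_shift N%:Z (pos t) w, pad (s ++ r)) = f (env_shift N%:Z (pos t) w, pad s).
  by apply: df => i iK; rewrite /pad nth_cat sK iK.
rewrite PoszD; ring.
Qed.

End mu_bar_identity.

Lemma tilted_is_mu_bar M : is_tilted M -> is_mu_bar P th M.
Proof.
move=> hM N L K f mf [C fC] df sf; rewrite averaged_annealed//.
(* The computation with [u] and [v] is for nonnegative functions; a bounded [f] is the difference of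
   [f + C] and the constant [C], both of which are admissible. *)
pose f1 x := f x + C; pose f2 (x : E * steps R d) := C.
have mfC : measurable_fun setT f1 by exact: measurable_funD.
have C0 : 0 <= C by apply: le_trans (fC point); exact: normr_ge0.
have f10 x : 0 <= f1 x by have := fC x; rewrite ler_norml /f1 => /andP[]; lra.
have sf1 z (Y : set R) : measurable Y ->
    (sigma_ge (- N%:Z) `&` sigma_le L%:Z) [set w | Y (f1 (w, z))].
  move=> mY; apply: (sf z (fun r => Y (r + C))).
  have mD : measurable_fun setT (fun r : R => r + C) by exact: measurable_funD.
  by have := mD measurableT Y mY; rewrite setTI.
have sf2 (z : steps R d) (Y : set R) : measurable Y ->
    (sigma_ge (- N%:Z) `&` sigma_le L%:Z) [set w : E | Y (f2 (w, z))].
  move=> mY; split; [apply/sigma_geE|apply/sigma_leE]; split=> //;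
    by have := @measurable_cst _ _ E R setT C measurableT Y mY; rewrite setTI.
have df1 w (y y' : steps R d) : (forall i, (i < K)%N -> y i = y' i) -> f1 (w, y) = f1 (w, y').
  by move=> h; rewrite /f1 (df w y y').
have e1 := tilted_annealed mfC df1 sf1 hM f10.
have e2 : (\int[M]_x (f2 x)%:E = \int[P]_w (annealed_words N L K f2 w)%:E)%E :=
  tilted_annealed (measurable_cst C) (fun _ _ _ _ => erefl) sf2 hM (fun=> C0).
have f1lt : (\int[M]_x (f1 x)%:E < +oo)%E.
  apply: (@le_lt_trans _ _ (\int[M]_x (cst (C + C)%:E x))%E).
    apply: ge0_le_integral => //.
    - by move=> x _; rewrite lee_fin.
    - exact/measurable_EFinP.
    - by move=> x _; rewrite lee_fin lerD2r; have := fC x; rewrite ler_norml => /andP[].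
  have := integral_cst M measurableT (C + C)%:E => ->.
  by rewrite [X in (_ * X)%E]probability_setT mule1 ltry.
have f2lt : (\int[M]_x (f2 x)%:E < +oo)%E.
  have := integral_cst M measurableT C%:E => ->.
  by rewrite [X in (_ * X)%E]probability_setT mule1 ltry.
have g0 (g : E * steps R d -> R) w : (forall x, 0 <= g x) -> 0 <= annealed_words N L K g w.
  move=> gge0; rewrite sumr_ge0// => q _.
  by rewrite !mulr_ge0 ?path_weight_ge0 ?tilt_word_ge0.
rewrite (@eq_integral_fun _ _ _ M f (fun x => f1 x - f2 x)); last first.
  by move=> x; rewrite /f1 addrK.
rewrite (@eq_integral_fun _ _ _ P _ (fun w => annealed_words N L K f1 w - annealed_words N L K f2 w)).
  have i1 := ge0_integrable mfC f10 f1lt.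
  have i2 := ge0_integrable (measurable_cst C) (fun=> C0) f2lt.
  rewrite e1 in f1lt; rewrite e2 in f2lt.
  have j1 := ge0_integrable (measurable_annealed_words N L K mfC) (fun w => g0 _ w f10) f1lt.
  have j2 := ge0_integrable (measurable_annealed_words N L K (measurable_cst C))
    (fun w => g0 _ w (fun=> C0)) f2lt.
  by rewrite (integralB_EFin measurableT i1 i2) (integralB_EFin measurableT j1 j2) e1 e2.
move=> w; rewrite /annealed_words -sumrB; apply: eq_bigr => q _.
by rewrite -!mulrBr /f1 addrK.
Qed.

End tilted_measure.

Section product_uniqueness.
Context (R : realType).

Lemma rectangle_unique (d1 d2 : measure_display) (T1 : measurableType d1)
    (T2 : measurableType d2) (m1 m2 : probability (T1 * T2)%type R) :
  (forall A B, measurable A -> measurable B -> m1 (A `*` B) = m2 (A `*` B)) ->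
  forall X, measurable X -> m1 X = m2 X.
Proof.
move=> m12 X mX.
pose C : set (set (T1 * T2)) := [set A `*` B | A in measurable & B in measurable].
have CI : setI_closed C.
  move=> _ _ [A mA [B mB <-]] [A' mA' [B' mB' <-]]; rewrite -setXI.
  by exists (A `&` A'); [exact: measurableI|exists (B `&` B') => //; exact: measurableI].
apply: (measure_unique C (fun=> setT)) => //.
- exact: measurable_prod_measurableType.
- by move=> _; exists setT => //; exists setT => //; rewrite setXTT.
- by rewrite bigcup_const//; exists 0%N.
- by move=> _ [A mA [B mB <-]]; exact: m12.
- by move=> _; rewrite (le_lt_trans (probability_le1 _ measurableT)) ?ltry.
Qed.

Lemma pair_prodspace_unique (I J : choiceType) (d1 d2 : measure_display)
    (T1 : measurableType d1) (T2 : measurableType d2)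
    (m1 m2 : probability (prodspace I T1 * prodspace J T2)%type R) :
  (forall C C', cylinders C -> cylinders C' -> m1 (C `*` C') = m2 (C `*` C')) ->
  forall X, measurable X -> m1 X = m2 X.
Proof.
move=> m12; apply: rectangle_unique => A B mA mB.
have lt1 (m : probability (prodspace I T1 * prodspace J T2)%type R) X :
    measurable X -> (m X < +oo)%E.
  by move=> mX; rewrite (le_lt_trans (probability_le1 _ mX)) ?ltry.
have half C : cylinders C -> m1 (C `*` B) = m2 (C `*` B).
  move=> cC; have mC := measurable_cylinders cC.
  have mCT : measurable (C `*` [set: prodspace J T2]) by exact: measurableX.
  pose r (m : probability (prodspace I T1 * prodspace J T2)%type R) : measure (prodspace J T2) R :=
    image_measure (mrestr m mCT) (mfun_of (@measurable_snd _ _ (prodspace I T1) (prodspace J T2))).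
  have rE m D : r m D = m (C `*` D).
    rewrite /r/= /pushforward /mrestr; congr (m _).
    by apply/seteqP; split => -[x y] /=; [move=> [? [? _]]|move=> [? ?]].
  rewrite -!rE; apply: prodspace_measure_unique mB.
    by rewrite rE lt1.
  by move=> C' cC'; rewrite !rE; exact: m12.
have mTB : measurable ([set: prodspace I T1] `*` B) by exact: measurableX.
pose r (m : probability (prodspace I T1 * prodspace J T2)%type R) : measure (prodspace I T1) R :=
  image_measure (mrestr m mTB) (mfun_of (@measurable_fst _ _ (prodspace I T1) (prodspace J T2))).
have rE m D : r m D = m (D `*` B).
  rewrite /r/= /pushforward /mrestr; congr (m _).
  by apply/seteqP; split => -[x y] /=; [move=> [? [_ ?]]|move=> [? ?]].
rewrite -!rE; apply: prodspace_measure_unique mA.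
  by rewrite rE lt1.
by move=> C cC; rewrite !rE; exact: half.
Qed.

End product_uniqueness.

Section mu_bar_unique.
Context (R : realType) (d : nat) (P : probability (env R d) R).
Hypothesis hiid : iid_environment P.
Hypothesis hnn : nearest_neighbor P.
Context (th : 'rV[R]_d.+1).
Local Notation U := (step R d).
Local Notation E := (env R d).

(** A product of two cylinders involves finitely many times and finitely many steps, so its
    indicator is an admissible test function once N = M and K are large. *)
Lemma is_mu_bar_unique (m1 m2 : probability (E * steps R d)%type R) :
  is_mu_bar P th m1 -> is_mu_bar P th m2 ->
  forall X, measurable X -> m1 X = m2 X.
Proof.
move=> h1 h2; apply: pair_prodspace_unique => C C' cC cC'.
have mC := measurable_cylinders cC; have mC' := measurable_cylinders cC'.
have mX : measurable (C `*` C') by exact: measurableX.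
have [B [mB [s sB] CE]] := cC; have [B' [mB' [s' sB'] C'E]] := cC'.
pose N := \max_(i <- s) (absz i.1).
pose K := \max_(i <- s') i.+1.
pose f : E * steps R d -> R := \1_(C `*` C').
have fE w z : f (w, z) = \1_C w * \1_C' z.
  rewrite /f !indicE.
  have [wC|wC] := boolP (w \in C); have [zC|zC] := boolP (z \in C'); rewrite ?mul0r ?mul1r ?mulr0.
  - by rewrite mem_set//; split => /=; exact/set_mem.
  - by rewrite memNset// => -[/= _ zC']; move/negP: zC; apply; exact/mem_set.
  - by rewrite memNset// => -[/= wC' _]; move/negP: wC; apply; exact/mem_set.
  - by rewrite memNset// => -[/= wC' _]; move/negP: wC; apply; exact/mem_set.
have mf : measurable_fun setT f by exact: measurable_indic.
have fb : exists b : R, forall x, `|f x| <= b.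
  by exists 1 => x; rewrite /f indicE; case: (_ \in _); rewrite ?normr1 ?normr0.
have df w (y y' : steps R d) : (forall i, (i < K)%N -> y i = y' i) -> f (w, y) = f (w, y').
  move=> yy'; rewrite !fE; congr (_ * _); rewrite !indicE C'E; congr (_%:R).
  have imp (z z' : steps R d) : (forall i, (i < K)%N -> z i = z' i) -> cylinder B' z -> cylinder B' z'.
    move=> zz' h i; have [is_|is_] := boolP (i \in s'); last by rewrite sB'.
    by rewrite -zz'//; rewrite /K (big_rem i)//= leq_maxl.
  by congr nat_of_bool; apply/idP/idP => /set_mem h; apply/mem_set; apply: imp h => i iK; rewrite yy'.
have dC (S : pred (site d)) : (forall i, i \in s -> S i) -> depends S C.
  move=> sS; have imp w w' : (forall i, S i -> w i = w' i) -> cylinder B w -> cylinder B w'.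
    move=> ww' h i; have [is_|is_] := boolP (i \in s); last by rewrite sB.
    by rewrite -ww'; [exact: h|exact: sS].
  by move=> w w' ww'; rewrite CE; apply/propext; split; apply: imp => // i Si; rewrite ww'.
have iN i : i \in s -> (absz i.1 <= N)%N by move=> is_; rewrite /N (big_rem i)//= leq_maxl.
have sf (z : steps R d) (Y : set R) : measurable Y ->
    (sigma_ge (- N%:Z) `&` sigma_le N%:Z) [set w : E | Y (f (w, z))].
  move=> mY; have mI : measurable [set w : E | Y (f (w, z))].
    have mfz : measurable_fun setT (fun w => f (w, z)).
      by apply: measurableT_comp => //; exact: measurable_pair1.
    by have := mfz measurableT Y mY; rewrite setTI.
  have dI (S : pred (site d)) : (forall i, i \in s -> S i) -> depends S [set w : E | Y (f (w, z))].
    move=> /dC dS w w' ww' /=; rewrite !fE !indicE.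
    by rewrite (_ : (w \in C) = (w' \in C))// /in_mem/=; congr (`[< _ >]); exact: dS.
  split; [apply/sigma_geE|apply/sigma_leE]; split => //; apply: dI => i /iN;
    rewrite /times_ge; move: (i.1) => j; lia.
have e (m : probability (E * steps R d)%type R) : (\int[m]_x (f x)%:E)%E = m (C `*` C').
  by apply: etrans (integral_indic m measurableT mX) _; rewrite setIT.
by rewrite -(e m1) -(e m2) (h1 N N K f mf fb df sf) (h2 N N K f mf fb df sf).
Qed.

Context (u v : E -> R).
Hypothesis hu : subseq_limit P (fwd P th) u.
Hypothesis hv : subseq_limit P (bwd P th) v.

(** The measure chosen by [xget] satisfies [is_mu_bar], because the tilted one does; uniqueness then
    identifies the two. *)
Lemma mu_bar_tilted : is_tilted P th u v (mu_bar P th).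
Proof.
have [M hM] := tilted_exists hiid hnn hu hv.
have bM := tilted_is_mu_bar hiid hnn hu hv hM.
have bb : is_mu_bar P th (mu_bar P th) by apply: xgetPex; exists M.
move=> A s mA; rewrite -hM//; apply: is_mu_bar_unique => //.
by apply: measurableX => //; exact: measurable_prefix.
Qed.

End mu_bar_unique.

(** * Markov processes of environments *)

Section markov_laws.
Context (R : realType) (d : nat).
Local Notation U := (step R d).
Local Notation E := (env R d).
Local Notation us := (steps_seq R d).
Implicit Types (k : E -> U -> R) (nu : probability (env_process R d) R).

Definition jump k (g : E -> R) (w : E) : R :=
  \sum_(z <- us) k w z * g (env_shift 1 (step_val z) w).

Lemma jump_kernelE k w (B : set E) : jump_kernel k w B = (jump k \1_B w)%:E.
Proof. by rewrite /jump_kernel fsum_steps. Qed.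

Lemma measurable_jump k g : (forall z, measurable_fun setT (k ^~ z)) ->
  measurable_fun setT g -> measurable_fun setT (jump k g).
Proof.
move=> mk mg; apply: measurable_sum => z; apply: measurable_funM => //.
exact: measurable_shifted.
Qed.

Lemma jump_ge0 k g w : (forall w z, 0 <= k w z) -> (forall w, 0 <= g w) -> 0 <= jump k g w.
Proof. by move=> k0 g0; rewrite sumr_ge0// => z _; rewrite mulr_ge0. Qed.

Lemma jump_integralE nu k (n : nat) (A : set (env_process R d)) (B : set E) :
  (\int[nu]_(eta in A) jump_kernel k (eta n) B =
   \int[nu]_eta (\1_A eta * jump k \1_B (eta n))%:E)%E.
Proof.
rewrite integral_mkcond; apply: eq_integral => eta _.
by rewrite patchE jump_kernelE indicE; case: ifP; rewrite ?mul1r ?mul0r.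
Qed.

Lemma markov_processP nu k (n : nat) (A : set (env_process R d)) (B : set E) :
  (forall z, measurable_fun setT (k ^~ z)) -> (forall w z, 0 <= k w z) ->
  markov_process nu k -> measurable A -> depends (fun i => (i <= n)%N) A -> measurable B ->
  nu (A `&` [set eta | B (eta n.+1)]) =
  (\int[nu]_eta (\1_A eta * jump k \1_B (eta n))%:E)%E.
Proof.
move=> mk k0 hnu mA dA mB; rewrite (hnu n A B)//; last exact/sigma_coordE.
exact: jump_integralE.
Qed.

Lemma integral_restr nu nu' (S : pred nat) (f : env_process R d -> R) :
  (forall A, measurable A -> depends S A -> nu A = nu' A) ->
  measurable_fun setT f -> (forall x, 0 <= f x) -> depends S f ->
  (\int[nu]_x (f x)%:E = \int[nu']_x (f x)%:E)%E.
Proof.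
move=> h mf f0 df.
have e (m : probability (env_process R d) R) :
    (\int[m]_x (f x)%:E = \int[image_measure m (restr S)]_x (f x)%:E)%E.
  apply/esym; rewrite (@ge0_integral_pushforward _ _ _ _ _ (restr S) (measurable_restr S) m setT
    (fun w => (f w)%:E)) => //.
  - by apply: eq_integral => x _ /=; rewrite depends_restr.
  - by apply/measurable_EFinP.
  - by move=> x _; rewrite lee_fin.
rewrite !e; apply: eq_measure_integral => A mA _ /=; rewrite /pushforward.
apply: h; first exact: (measurable_preim (restr S)).
move=> x x' xx'; rewrite /preimage/=; congr A.
by apply/funext => i; rewrite /restr; case: ifPn => // /xx'.
Qed.

Lemma markov_unique nu nu' k :
  (forall z, measurable_fun setT (k ^~ z)) -> (forall w z, 0 <= k w z) ->
  markov_process nu k -> markov_process nu' k ->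
  (forall A : set E, measurable A -> nu [set eta | A (eta 0%N)] = nu' [set eta | A (eta 0%N)]) ->
  forall A, measurable A -> nu A = nu' A.
Proof.
move=> mk k0 hnu hnu' h0.
have fin n A : measurable A -> depends (fun i => (i <= n)%N) A -> nu A = nu' A.
  elim: n A => [|n IHn] A mA dA.
    pose A0 := [set w : E | A (fun=> w)].
    have mA0 : measurable A0.
      have mc : measurable_fun setT ((fun w _ => w) : E -> env_process R d).
        by apply: measurable_prodspace => i; exact: measurable_id.
      by have := mc measurableT A mA; rewrite setTI.
    have -> : A = [set eta | A0 (eta 0%N)]; last exact: h0.
    apply/funext => eta; apply: dA => i; by rewrite leqn0 => /eqP ->.
  have preE (m : probability (env_process R d) R) : m A =
      image_measure m (restr (fun i => (i <= n.+1)%N)) A.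
    rewrite /= /pushforward; congr (m _); apply/funext => eta.
    by rewrite /preimage/= depends_restr.
  rewrite !preE; apply: prodspace_measure_unique mA.
    by apply: le_lt_trans (probability_le1 _ _) (ltry _); exact: (measurable_preim (restr _)).
  move=> _ [B [mB sB ->]]; rewrite /= /pushforward.
  have [->|->] := restr_cylinder (fun i => (i <= n.+1)%N) mB sB; first by rewrite !measure0.
  (* The last coordinate is split off the cylinder. The Markov property expresses the mass by an
     integral over the coordinates up to [n], to which the induction hypothesis applies. *)
  pose A' := cylinder (fun i => if (i <= n)%N then B i else setT).
  have -> : cylinder (fun i => if (i <= n.+1)%N then B i else setT) =
      A' `&` [set eta | B n.+1 (eta n.+1)].
    apply/seteqP; split => eta.
      move=> h; split; last by have := h n.+1; rewrite leqnn.
      by move=> i; have := h i; case: (leqP i n) => // ii; rewrite leqW.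
    move=> [h1 h2] i; case: ifP => //; rewrite leq_eqVlt => /orP[/eqP ->//|ii].
    by have := h1 i; rewrite -ltnS ii.
  have mA' : measurable A'.
    apply: measurable_cylinders; exists (fun i => if (i <= n)%N then B i else setT); split => //.
      by move=> i; case: ifP.
    by exists (iota 0 n.+1) => i; rewrite mem_iota/= add0n ltnS => /negbTE ->.
  have dA' : depends (fun i => (i <= n)%N) A'.
    move=> x x' xx'; apply/propext; split => h i; have := h i; case: ifP => // ii.
      by rewrite xx'.
    by rewrite xx'.
  rewrite !(markov_processP mk k0)//; apply: (@integral_restr _ _ (fun i => (i <= n)%N)) => //.
  - apply: measurable_funM; first exact: measurable_indic.
    apply: measurableT_comp; last exact: measurable_eval_at.
    by apply: measurable_jump => //; exact: measurable_indic.
  - move=> eta; rewrite mulr_ge0 ?indicE//; apply: jump_ge0 => // w; by rewrite indicE.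
  - move=> x x' xx'; rewrite xx'//; congr (_ * _); rewrite !indicE; congr (_%:R).
    by rewrite /in_mem/=; congr nat_of_bool; congr (`[< _ >]); exact: dA'.
move=> A mA; apply: prodspace_measure_unique mA.
  by rewrite (le_lt_trans (probability_le1 _ measurableT)) ?ltry.
move=> C cC; have mC := measurable_cylinders cC; have [B [mB [s sB] CE]] := cC.
apply: (fin (\max_(i <- s) i)) => // x x' xx'.
have imp y y' : (forall i, (i <= \max_(i <- s) i)%N -> y i = y' i) -> cylinder B y -> cylinder B y'.
  move=> yy' h i; have [is_|is_] := boolP (i \in s); last by rewrite sB.
  by rewrite -yy'; [exact: h|rewrite (big_rem i)//= leq_maxl].
by rewrite CE; apply/propext; split; apply: imp => // i ii; rewrite xx'.
Qed.

Definition shift_process (eta : env_process R d) : env_process R d := fun n => eta n.+1.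

Lemma measurable_shift_process : measurable_fun setT shift_process.
Proof. by apply: measurable_prodspace => i; exact: measurable_eval_at. Qed.

HB.instance Definition _ := isMeasurableFun.Build _ _ _ _ shift_process measurable_shift_process.

Lemma markov_shift nu k :
  (forall z, measurable_fun setT (k ^~ z)) -> (forall w z, 0 <= k w z) ->
  markov_process nu k -> markov_process (distribution nu shift_process) k.
Proof.
move=> mk k0 hnu n A B /sigma_coordE [mA dA] mB.
pose A' := shift_process @^-1` A.
have mA' : measurable A' by exact: measurable_preim.
have dA' : depends (fun i => (i <= n.+1)%N) A'.
  by move=> x x' xx'; apply: dA => i ii; exact: xx'.
rewrite [LHS](_ : _ = nu (A' `&` [set eta | B (eta n.+2)]))//.
rewrite (markov_processP mk k0)// jump_integralE.
rewrite (@ge0_integral_pushforward _ _ _ _ _ shift_process measurable_shift_process nu setT)//.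
- apply/measurable_EFinP; apply: measurable_funM; first exact: measurable_indic.
  apply: measurableT_comp; last exact: measurable_eval_at.
  by apply: measurable_jump => //; exact: measurable_indic.
- move=> eta _; rewrite lee_fin mulr_ge0 ?indicE//; apply: jump_ge0 => // w; by rewrite indicE.
Qed.

End markov_laws.

Section tilted_process.
Context (R : realType) (d : nat) (P : probability (env R d) R) (c : R).
Hypothesis hiid : iid_environment P.
Hypothesis hnn : nearest_neighbor P.
Hypothesis c_gt0 : 0 < c.
Hypothesis hc : forall z : step R d, P [set w | c <= transition w 0 0 z] = 1%E.
Context (th : 'rV[R]_d.+1).
Local Notation U := (step R d).
Local Notation E := (env R d).
Local Notation us := (steps_seq R d).
Local Notation sv := (@step_val R d : U -> lattice d).
Local Notation pos := (@pos (lattice d) U (@step_val R d)).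
Local Notation tw := (tilt_word P th).
Local Notation pw := path_weight.
Context (u v : E -> R).
Hypothesis hu : subseq_limit P (fwd P th) u.
Hypothesis hv : subseq_limit P (bwd P th) v.
Local Notation dens := (tilted_density P th u v).
Local Notation ker := (tilted_kernel P th u).

Let mu_ : measurable_fun setT u := lim_meas hu.
Let mv_ : measurable_fun setT v := lim_meas hv.
Let u0 w : 0 <= u w. Proof. exact: lim_ge0 hu w. Qed.
Let v0 w : 0 <= v w. Proof. exact: lim_ge0 hv w. Qed.

Lemma tilted_kernelE w (z : U) :
  ker w z = w (0, 0) (sv z) * (u (env_shift 1 (sv z) w) / u w) * tilt P th z.
Proof. by rewrite /tilted_kernel /transition subr0. Qed.

Lemma tilted_kernel_ge0 w z : 0 <= ker w z.
Proof. by rewrite tilted_kernelE !mulr_ge0 ?invr_ge0 ?pv_ge0 ?tilt_ge0. Qed.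

Lemma measurable_tilted_kernel z : measurable_fun setT (ker ^~ z).
Proof.
rewrite (_ : ker ^~ z = fun w => w (0, 0) (sv z) *
    (u (env_shift 1 (sv z) w) * powR (u w) (-1)) * tilt P th z); last first.
  by apply/funext => w; rewrite tilted_kernelE powR_inv1.
apply: measurable_funM => //; apply: measurable_funM; first exact: measurable_pv.
apply: measurable_funM; first exact: measurable_shifted.
exact: (measurableT_comp (measurable_powR _)).
Qed.

Lemma env_trajectory_eq w (y y' : steps R d) n : (forall i, (i < n)%N -> y i = y' i) ->
  env_trajectory (w, y) n = env_trajectory (w, y') n.
Proof.
move=> yy'; rewrite /env_trajectory/=.
have -> // : \sum_(i < n) sv (y i) = \sum_(i < n) sv (y' i).
by apply: eq_bigr => i _; rewrite yy'.
Qed.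

Lemma env_trajectory_pad w s : env_trajectory (w, pad s) (size s) = env_shift (size s)%:Z (pos s) w.
Proof.
rewrite /env_trajectory/=; have -> // : \sum_(i < size s) sv (pad s i) = pos s.
rewrite /pad; elim/last_ind: s => [|s z IHs]; first by rewrite big_ord0 pos_nil.
rewrite pos_rcons size_rcons big_ord_recr/= nth_rcons ltnn eqxx -IHs; congr (_ + _).
by apply: eq_bigr => i _; rewrite nth_rcons ltn_ord.
Qed.

Lemma measurable_at (g : E -> R) n : measurable_fun setT g ->
  measurable_fun setT (fun eta : env_process R d => g (eta n)).
Proof. by move=> mg; exact: (measurableT_comp mg (measurable_eval_at n)). Qed.

Context (M : probability (E * steps R d)%type R).
Hypothesis hM : is_tilted P th u v M.
Let nu : probability (env_process R d) R := distribution M (@env_trajectory R d).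

Lemma law_integral (f : env_process R d -> R) n : measurable_fun setT f ->
  (forall x, 0 <= f x) -> depends (fun i => (i <= n)%N) f ->
  (\int[nu]_x (f x)%:E =
   \sum_(s <- words us n) \int[P]_w (f (env_trajectory (w, pad s)) * dens s w)%:E)%E.
Proof.
move=> mf f0 df.
rewrite (@ge0_integral_pushforward _ _ _ _ _ _ (@measurable_env_trajectory R d) M setT)//.
- rewrite (tilted_integral (K := n) hu hv hM (f := fun x => f (env_trajectory x)))//.
  + by apply: measurableT_comp => //; exact: measurable_env_trajectory.
  + move=> w y y' yy'; apply: df => i ii; apply: env_trajectory_eq => j ji.
    by apply: yy'; exact: leq_trans ji ii.
- exact/measurable_EFinP.
- by move=> x _; rewrite lee_fin.
Qed.

Lemma law_initial (g : E -> R) : measurable_fun setT g -> (forall w, 0 <= g w) ->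
  (\int[nu]_eta (g (eta 0%N))%:E = \int[P]_w (g w * (v w * u w))%:E)%E.
Proof.
move=> mg g0; rewrite (@law_integral (fun eta => g (eta 0%N)) 0)//.
- rewrite big_words0; apply: eq_integral_fun => w.
  rewrite (env_trajectory_pad w [::])/= pos_nil env_shift0 /tilted_density.
  by rewrite tilt_word_nil/= !mul1r pos_nil env_shift0.
- exact: measurable_at.
- by move=> x x' xx'; rewrite xx'.
Qed.

(** Appending a letter multiplies the density by the transformed kernel at the current environment:
    the denominator of [ker] cancels the [u] of the shorter word. This takes positivity of [u]
    there, whence an almost sure argument. *)
Lemma tilted_markov : markov_process nu ker.
Proof.
move=> n A B /sigma_coordE[mA dA] mB; rewrite jump_integralE.
have mA' : measurable (A `&` [set eta : env_process R d | B (eta n.+1)]).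
  apply: measurableI => //; rewrite -[X in measurable X]setTI.
  exact: measurable_eval_at.
have dA1 (x x' : env_process R d) : (forall i, (i <= n)%N -> x i = x' i) -> \1_A x = \1_A x' :> R.
  move=> xx'; rewrite !indicE; congr (_%:R); rewrite /in_mem/=; congr nat_of_bool.
  by congr (`[< _ >]); exact: dA.
have mB1 : measurable_fun setT (\1_B : E -> R) by exact: measurable_indic.
have B0 w : 0 <= (\1_B w : R) by rewrite indicE.
have A0 x : 0 <= (\1_A x : R) by rewrite indicE.
have mA1 : measurable_fun setT (\1_A : env_process R d -> R) by exact: measurable_indic.
have mF : measurable_fun setT (fun eta : env_process R d => \1_A eta * \1_B (eta n.+1) : R).
  by apply: measurable_funM; [exact: mA1|exact: measurable_at].
have mJ : measurable_fun setT (jump ker \1_B).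
  by apply: measurable_jump => //; exact: measurable_tilted_kernel.
have mG : measurable_fun setT (fun eta : env_process R d => \1_A eta * jump ker \1_B (eta n)).
  by apply: measurable_funM; [exact: mA1|exact: measurable_at].
have J0 w : 0 <= jump ker \1_B w by apply: jump_ge0 => //; exact: tilted_kernel_ge0.
transitivity (\int[nu]_eta (\1_A eta * \1_B (eta n.+1))%:E)%E.
  apply/esym; apply: etrans (etrans (integral_indic nu measurableT mA') _); last by rewrite setIT.
  apply: eq_integral_fun => eta; rewrite -[LHS]/((\1_A \* \1_([set eta : env_process R d | B (eta n.+1)])) eta).
  by rewrite indicI.
rewrite (law_integral (n := n.+1) mF); last 2 first.
- by move=> x; rewrite mulr_ge0.
- move=> x x' xx'; rewrite xx'//; congr (_ * _); apply: dA1 => i ii.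
  by apply: xx'; exact: leqW.
rewrite (law_integral (n := n) mG); last 2 first.
- by move=> x; rewrite mulr_ge0.
- by move=> x x' xx'; rewrite xx'//; congr (_ * _); exact: dA1.
rewrite big_words_rcons; apply: eq_big_seq => s; rewrite words_steps => /eqP sn.
have mtr (f : env_process R d -> R) y : measurable_fun setT f ->
    measurable_fun setT (fun w => f (env_trajectory (w, y))).
  move=> mf.
  exact: (measurableT_comp (measurableT_comp mf (@measurable_env_trajectory R d))
    (measurable_pair2 y)).
have md q : measurable_fun setT (dens q) by exact: measurable_tilted_density.
have d0 q w : 0 <= dens q w by exact: (tilted_density_ge0 hu hv).
rewrite -ge0_integral_rsum; last 2 first.
- by move=> z; apply: measurable_funM => //; exact: (mtr (fun eta => \1_A eta * \1_B (eta n.+1))).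
- by move=> z w; rewrite mulr_ge0// mulr_ge0.
apply: (ae_integral measurableT).
- apply: measurable_sum => z; apply: measurable_funM => //.
  exact: (mtr (fun eta => \1_A eta * \1_B (eta n.+1))).
- by apply: measurable_funM => //; exact: (mtr (fun eta => \1_A eta * jump ker \1_B (eta n))).
have := env_shift_negligible hiid n%:Z (pos s) (fwd_limit_gt0 hiid hnn c_gt0 hc hu).
apply: filterS => w ugt0.
have := env_trajectory_pad w s; rewrite sn => ->.
rewrite /jump mulr_sumr mulr_suml; apply: eq_bigr => z _.
have <- : \1_A (env_trajectory (w, pad (rcons s z))) = \1_A (env_trajectory (w, pad s)) :> R.
  apply: dA1 => i ii; apply: env_trajectory_eq => j ji.
  by rewrite /pad nth_rcons sn (leq_trans ji ii).
have := env_trajectory_pad w (rcons s z); rewrite size_rcons sn => ->.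
rewrite tilted_kernelE env_shiftD pos_rcons /tilted_density tilt_word_rcons path_weight_rcons.
rewrite size_rcons sn pos_rcons (addrC (sv z)) -[in n.+1%:Z](add1n n) PoszD.
rewrite /env_shift/= !add0r.
have un0 : u (fun s0 => w (s0.1 + n, s0.2 + pos s)) != 0 by rewrite gt_eqF.
by field.
Qed.

(** The factor [u w] cancels the denominators of [ker]. Shifting the term of [z] by (-1, -z) brings
    [h * u] back to the origin, and the factors left in front sum to [v] by backward harmonicity. *)
Lemma kernel_invariant (h : E -> R) : measurable_fun setT h -> (forall w, 0 <= h w) ->
  (\int[P]_w (jump ker h w * (v w * u w))%:E = \int[P]_w (h w * (v w * u w))%:E)%E.
Proof.
move=> mh h0.
pose F z (w : E) : R := tilt P th z * (w (0, 0) (sv z) * (u (env_shift 1 (sv z) w) *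
  (h (env_shift 1 (sv z) w) * v w))).
have mF z : measurable_fun setT (F z).
  apply: measurable_funM => //; apply: measurable_funM; first exact: measurable_pv.
  apply: measurable_funM; first exact: measurable_shifted.
  by apply: measurable_funM => //; exact: measurable_shifted.
have F0 z w : 0 <= F z w by rewrite !mulr_ge0 ?tilt_ge0 ?pv_ge0.
pose G z (w : E) : R := F z (env_shift (-1) (- sv z) w).
have mG z : measurable_fun setT (G z) by exact: measurable_shifted.
transitivity (\int[P]_w (\sum_(z <- us) F z w)%:E)%E.
  apply: ae_integral => //.
  - apply: measurable_funM; last exact: measurable_funM.
    by apply: measurable_jump => //; exact: measurable_tilted_kernel.
  - exact: measurable_sum.
  apply: filterS (fwd_limit_gt0 hiid hnn c_gt0 hc hu) => w uw.
  rewrite /jump mulr_suml; apply: eq_bigr => z _; rewrite tilted_kernelE /F.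
  have un0 : u w != 0 by rewrite gt_eqF.
  by field.
rewrite ge0_integral_rsum//.
transitivity (\sum_(z <- us) \int[P]_w (G z w)%:E)%E.
  apply: eq_bigr => z _; apply/esym.
  apply: (env_shift_integral hiid (-1) (- sv z) (f := fun w => (F z w)%:E)).
    exact/measurable_EFinP.
  by move=> w; rewrite lee_fin.
rewrite -ge0_integral_rsum//; last by move=> z w; exact: F0.
apply: ae_integral => //.
- exact: measurable_sum.
- by apply: measurable_funM => //; exact: measurable_funM.
apply: filterS (bwd_limit_harmonic hiid hv) => w vE.
rewrite [in RHS]vE mulr_suml mulr_sumr; apply: eq_bigr => z _.
rewrite /G /F env_shiftD !addrN env_shift0 {1}/env_shift/= !add0r; ring.
Qed.

Lemma law_initial_set (A : set E) : measurable A ->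
  nu [set eta | A (eta 0%N)] = (\int[P]_w (\1_A w * (v w * u w))%:E)%E.
Proof.
move=> mA; rewrite -law_initial//.
  have mA0 : measurable [set eta : env_process R d | A (eta 0%N)].
    by rewrite -[X in measurable X]setTI; exact: (measurable_eval_at 0%N).
  by apply/esym; apply: etrans (integral_indic nu measurableT mA0) _; rewrite setIT.
Qed.

(** The shifted process is Markov with the same kernel, so by [markov_unique] it suffices to compare
    the laws at time 0, where [kernel_invariant] applies. *)
Lemma tilted_stationary : stationary nu.
Proof.
move=> A mA.
have mk := measurable_tilted_kernel; have k0 := tilted_kernel_ge0.
have mks : markov_process (distribution nu (@shift_process R d)) ker.
  exact: markov_shift tilted_markov.
apply: (markov_unique mk k0 mks tilted_markov _ mA) => B mB.
rewrite law_initial_set//.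
transitivity (nu (setT `&` [set eta : env_process R d | B (eta 1%N)])).
  by rewrite setTI.
rewrite (markov_processP mk k0 tilted_markov)//.
have mB1 : measurable_fun setT (\1_B : E -> R) by exact: measurable_indic.
have mJ : measurable_fun setT (jump ker \1_B) by exact: measurable_jump.
have B0 w : 0 <= (\1_B w : R) by rewrite indicE.
rewrite -kernel_invariant// -law_initial//; last by move=> w; exact: jump_ge0.
by apply: eq_integral_fun => eta; rewrite indicE in_setT mul1r.
Qed.

Lemma tilted_ac : ac_on_futures P nu.
Proof.
move=> n A /sigma_geE[mA _] A0.
rewrite [LHS](law_initial_set mA) (ae_integral measurableT (g := cst 0))//.
- exact: integral0.
- by apply: measurable_funM; [exact: measurable_indic|exact: measurable_funM].
exists A; split => // w /= h; apply: contrapT => Aw; apply: h.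
by rewrite indicE memNset// mul0r.
Qed.

End tilted_process.

(** * Uniqueness of the invariant law *)

Section weak_convergence.
Context (dT : measure_display) (T : measurableType dT) (R : realType).
Import HBNNSimple.
Context (P : probability T R) (W : nat -> T -> R) (u : T -> R) (ka : R).
Hypothesis mW : forall n, measurable_fun setT (W n).
Hypothesis mu_ : measurable_fun setT u.
Hypothesis W0 : forall n w, 0 <= W n w.
Hypothesis u0 : forall w, 0 <= u w.
Hypothesis Wu : forall n, {ae P, forall w, W n w <= u w}.
Hypothesis u1 : (\int[P]_w (u w)%:E < +oo)%E.
Hypothesis ka0 : 0 <= ka.

(* Only meaningful for [h] with [u * h] integrable. *)
Let a n (h : T -> R) : R := fine (\int[P]_w (W n w * h w)%:E).
Let b (h : T -> R) : R := fine (\int[P]_w (u w * h w)%:E).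
Let adm (h : T -> R) : Prop := [/\ measurable_fun setT h, forall w, 0 <= h w &
  (\int[P]_w (u w * h w)%:E < +oo)%E].
Let Q h := a n h @[n --> \oo] --> ka * b h.

Let int_ge0 (f h : T -> R) : (forall w, 0 <= f w) -> (forall w, 0 <= h w) ->
  (0 <= \int[P]_w (f w * h w)%:E)%E.
Proof. by move=> f0 h0; apply: integral_ge0 => w _; rewrite lee_fin mulr_ge0. Qed.

Let bE (h : T -> R) : adm h -> (\int[P]_w (u w * h w)%:E = (b h)%:E)%E.
Proof. by move=> [mh h0 hoo]; rewrite /b fineK// ge0_fin_numE// int_ge0. Qed.

Let a_le n (h : T -> R) : adm h -> (\int[P]_w (W n w * h w)%:E <= (b h)%:E)%E.
Proof.
move=> ah; rewrite -bE//; case: ah => mh h0 hoo.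
apply: ae_ge0_le_integral => //.
- by move=> w _; rewrite lee_fin mulr_ge0.
- by apply/measurable_EFinP; exact: measurable_funM.
- by move=> w _; rewrite lee_fin mulr_ge0.
- by apply/measurable_EFinP; exact: measurable_funM.
by apply: filterS (Wu n) => w Wuw _; rewrite lee_fin ler_wpM2r.
Qed.

Let aE n (h : T -> R) : adm h -> (\int[P]_w (W n w * h w)%:E = (a n h)%:E)%E.
Proof.
move=> ah; rewrite /a fineK// ge0_fin_numE; last by case: ah => *; exact: int_ge0.
by apply: le_lt_trans (a_le n ah) _; rewrite ltry.
Qed.

Let a_ge0 n (h : T -> R) : (forall w, 0 <= h w) -> 0 <= a n h.
Proof. by move=> h0; rewrite /a fine_ge0// int_ge0. Qed.

Let b_ge0 (h : T -> R) : (forall w, 0 <= h w) -> 0 <= b h.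
Proof. by move=> h0; rewrite /b fine_ge0// int_ge0. Qed.

Let a_le_b n (h : T -> R) : adm h -> a n h <= b h.
Proof. by move=> ah; rewrite -lee_fin -aE// a_le. Qed.

Let intD (f h h' : T -> R) : measurable_fun setT f -> (forall w, 0 <= f w) ->
  measurable_fun setT h -> (forall w, 0 <= h w) ->
  measurable_fun setT h' -> (forall w, 0 <= h' w) -> (\int[P]_w (f w * (h w + h' w))%:E =
    \int[P]_w (f w * h w)%:E + \int[P]_w (f w * h' w)%:E)%E.
Proof.
move=> mf f0 mh h0 mh' h0'.
rewrite (@eq_integral_fun _ _ _ _ _ (fun w => f w * h w + f w * h' w)); last first.
  by move=> w; rewrite mulrDr.
rewrite ge0_integral_rD//; try exact: measurable_funM.
+ by move=> w; rewrite mulr_ge0.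
+ by move=> w; rewrite mulr_ge0.
Qed.

Let admD (h h' : T -> R) : adm h -> adm h' -> adm (fun w => h w + h' w).
Proof.
move=> [mh h0 hoo] [mh' h0' hoo']; split.
- exact: measurable_funD.
- by move=> w; rewrite addr_ge0.
- by rewrite intD// lte_add_pinfty.
Qed.

Let aD n (h h' : T -> R) : adm h -> adm h' -> a n (fun w => h w + h' w) = a n h + a n h'.
Proof.
move=> ah ah'; rewrite {1}/a; have [mh h0 _] := ah; have [mh' h0' _] := ah'.
by rewrite intD// !aE.
Qed.

Let bD (h h' : T -> R) : adm h -> adm h' -> b (fun w => h w + h' w) = b h + b h'.
Proof.
move=> ah ah'; rewrite {1}/b; have [mh h0 _] := ah; have [mh' h0' _] := ah'.
by rewrite intD// !bE.
Qed.

Let adm_le (h h' : T -> R) : measurable_fun setT h' -> (forall w, 0 <= h' w) -> (forall w, h' w <= h w) ->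
  adm h -> adm h'.
Proof.
move=> mh' h'0 h'h [mh h0 hoo]; split => //; apply: le_lt_trans hoo.
apply: ge0_le_integral => //.
- by move=> w _; rewrite lee_fin mulr_ge0.
- by apply/measurable_EFinP; exact: measurable_funM.
- by apply/measurable_EFinP; exact: measurable_funM.
- by move=> w _; rewrite lee_fin ler_wpM2l.
Qed.

Let admB (h h' : T -> R) : adm h -> adm h' -> (forall w, h' w <= h w) -> adm (fun w => h w - h' w).
Proof.
move=> ah ah' h'h; apply: (adm_le _ _ _ ah).
- by case: ah => mh _ _; case: ah' => mh' _ _; exact: measurable_funB.
- by move=> w; rewrite subr_ge0.
- by move=> w; rewrite gerBl; case: ah'.
Qed.

Let aB n (h h' : T -> R) : adm h -> adm h' -> (forall w, h' w <= h w) ->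
  a n (fun w => h w - h' w) = a n h - a n h'.
Proof.
move=> ah ah' h'h; apply/eqP; rewrite eq_sym subr_eq -aD//; last exact: admB.
by apply/eqP; congr (a n _); apply/funext => w; rewrite subrK.
Qed.

Let bB (h h' : T -> R) : adm h -> adm h' -> (forall w, h' w <= h w) ->
  b (fun w => h w - h' w) = b h - b h'.
Proof.
move=> ah ah' h'h; apply/eqP; rewrite eq_sym subr_eq -bD//; last exact: admB.
by apply/eqP; congr (b _); apply/funext => w; rewrite subrK.
Qed.

Let QD (h h' : T -> R) : adm h -> adm h' -> Q h -> Q h' -> Q (fun w => h w + h' w).
Proof.
move=> ah ah' Qh Qh'; rewrite /Q bD// mulrDr.
rewrite (_ : (fun n => _) = (fun n => a n h + a n h')); first exact: cvgD.
by apply/funext => n; rewrite aD.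
Qed.

Let QB (h h' : T -> R) : adm h -> adm h' -> (forall w, h' w <= h w) -> Q h -> Q h' ->
  Q (fun w => h w - h' w).
Proof.
move=> ah ah' h'h Qh Qh'; rewrite /Q bB// mulrBr.
rewrite (_ : (fun n => _) = (fun n => a n h - a n h')); first exact: cvgB.
by apply/funext => n; rewrite aB.
Qed.

Let admZ k (h : T -> R) : 0 <= k -> adm h -> adm (fun w => k * h w).
Proof.
move=> k0 [mh h0 hoo]; split.
- exact: measurable_funM.
- by move=> w; rewrite mulr_ge0.
- rewrite (@eq_integral_fun _ _ _ _ _ (fun w => k * (u w * h w))); last first.
    by move=> w; rewrite mulrCA.
  rewrite ge0_integral_rZl//; last 2 first.
  + exact: measurable_funM.
  + by move=> w; rewrite mulr_ge0.
  by apply: lte_mul_pinfty.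
Qed.

Let QZ k (h : T -> R) : 0 <= k -> adm h -> Q h -> Q (fun w => k * h w).
Proof.
move=> k0 [mh h0 hoo] Qh; rewrite /Q.
have E (f : T -> R) : measurable_fun setT f -> (forall w, 0 <= f w) ->
    (\int[P]_w (f w * (k * h w))%:E = k%:E * \int[P]_w (f w * h w)%:E)%E.
  move=> mf f0; rewrite (@eq_integral_fun _ _ _ _ _ (fun w => k * (f w * h w))); last first.
    by move=> w; rewrite mulrCA.
  rewrite ge0_integral_rZl//; first exact: measurable_funM.
  by move=> w; rewrite mulr_ge0.
have ah : adm h by split.
have -> : b (fun w => k * h w) = k * b h by rewrite /b E// bE.
rewrite mulrCA (_ : (fun n => _) = (fun n => k * a n h)).
  by apply: cvgMr => //; exact: cvg_cst.
by apply/funext => n; rewrite /a E// aE.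
Qed.

(** The bound [W n <= u] makes the error uniform in [n]: replacing [h] by [H j] changes [a n] by at
    most [b h - b (H j)]. *)
Let Q_mono (H : nat -> T -> R) (h : T -> R) : adm h -> (forall j, adm (H j)) ->
  (forall w, {homo H^~ w : i j / (i <= j)%N >-> i <= j}) ->
  (forall w, H j w @[j --> \oo] --> h w) -> (forall j, Q (H j)) -> Q h.
Proof.
move=> ah aH ndH cvH QH.
have Hh j w : H j w <= h w.
  rewrite -(cvg_lim _ (cvH w))//; apply: (@nondecreasing_cvgn_le _ (H^~ w)).
    exact: ndH.
  by apply/cvg_ex; exists (h w); exact: cvH.
have cb : b (H j) @[j --> \oo] --> b h.
  have : (\int[P]_w (u w * H j w)%:E)%E @[j --> \oo] --> (\int[P]_w (u w * h w)%:E)%E.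
    rewrite (@eq_integral _ _ _ P setT (fun w => limn (fun j => (u w * H j w)%:E))).
      apply: cvg_monotone_convergence => //.
      - by move=> j; apply/measurable_EFinP; apply: measurable_funM => //; case: (aH j).
      - by move=> j w _; rewrite lee_fin mulr_ge0//; case: (aH j).
      - by move=> w _ i j ij; rewrite lee_fin ler_wpM2l// ndH.
    move=> w _; apply/esym/cvg_lim => //; apply: cvg_EFin; first exact: nearW.
    by apply: cvgMr => //; exact: cvH.
  rewrite bE//; under eq_fun do rewrite bE//.
  by move=> /fine_cvg.
apply/cvgrPdist_lt => e e0.
(* The error [b h - b (H j)] enters twice, once directly and once multiplied by [ka]; dividing by
   [4 * (1 + ka)] keeps the two together below [e / 4]. *)
have e4 : 0 < e / (4 * (1 + ka)) by rewrite divr_gt0// mulr_gt0// ltr_pwDl.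
have /cvgrPdist_lt/(_ _ e4)[j _ hj] := cb.
have /(_ j (leqnn j)) hb := hj.
near=> n.
have hn : `|ka * b (H j) - a n (H j)| < e / 4.
  near: n; have /cvgrPdist_lt := QH j; apply; by rewrite divr_gt0.
have h1 : 0 <= a n h - a n (H j) by rewrite -aB// a_ge0// => w; rewrite subr_ge0.
have h2 : a n h - a n (H j) <= b h - b (H j).
  by rewrite -aB// -bB//; apply: a_le_b; exact: admB.
have h3 : `|b h - b (H j)| * (1 + ka) < e / 4.
  have k1 : 0 < 1 + ka by rewrite ltr_pwDl.
  rewrite -ltr_pdivlMr//; apply: lt_le_trans hb _.
  by rewrite invfM mulrA.
have h4 : 0 <= b h - b (H j) by apply: le_trans h2.
move: h3; rewrite ger0_norm// mulrDr mulr1 => h3.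
move: hn; rewrite !ltr_norml => /andP[hn1 hn2].
have h5 : 0 <= (b h - b (H j)) * ka by rewrite mulr_ge0.
have h6 : (b h - b (H j)) * ka = ka * b h - ka * b (H j) by ring.
rewrite h6 in h3 h5.
move: (a n h) (a n (H j)) (ka * b h) (ka * b (H j)) (b h) (b (H j)) hn1 hn2 h1 h2 h3 h4 h5.
move=> x1 x2 x3 x4 x5 x6 *; apply/andP; split; lra.
Unshelve. all: by end_near. Qed.

Let adm1 A : measurable A -> adm \1_A.
Proof.
move=> mA; split.
- exact: measurable_indic.
- by move=> w; rewrite indicE.
apply: le_lt_trans u1; apply: ge0_le_integral => //.
- by move=> w _; rewrite lee_fin mulr_ge0// indicE.
- by apply/measurable_EFinP; apply: measurable_funM => //; exact: measurable_indic.
- exact/measurable_EFinP.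
- by move=> w _; rewrite lee_fin -[leRHS]mulr1 ler_wpM2l// indicE; case: (_ \in _).
Qed.

(** A monotone-class argument leads from the pi-system [G] to all measurable sets, with [QB] and
    [Q_mono] as closure properties. Simple functions and a last use of [Q_mono] reach [h], which may
    be unbounded. *)
Lemma weak_convergence (G : set (set T)) : measurable = <<s G >> -> setI_closed G ->
  G setT -> (forall C, G C -> fine (\int[P]_w (W n w * \1_C w)%:E)%E @[n --> \oo] -->
    ka * fine (\int[P]_w (u w * \1_C w)%:E)%E) ->
  forall h : T -> R, measurable_fun setT h -> (forall w, 0 <= h w) ->
  (\int[P]_w (u w * h w)%:E < +oo)%E ->
  fine (\int[P]_w (W n w * h w)%:E)%E @[n --> \oo] -->
    ka * fine (\int[P]_w (u w * h w)%:E)%E.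
Proof.
move=> mG IG GT QG h mh h0 hoo.
have Qind A : measurable A -> Q \1_A.
  have : <<s G >> `<=` [set A | measurable A /\ Q \1_A].
    apply: lambda_system_subset => //.
      split => //.
      - by split; [exact: measurableT|exact: QG].
      - move=> A' B BA [mA' QA'] [mB QB']; split; first exact: measurableD.
        have BAi w : (\1_B w : R) <= \1_A' w.
          rewrite !indicE ler_nat; case: (boolP (w \in B)) => // /set_mem/BA wA.
          by rewrite mem_set.
        rewrite (_ : \1_(A' `\` B) = (fun w => \1_A' w - \1_B w : R)); last first.
          apply/funext => w; rewrite !indicE in_setD.
          case: (boolP (w \in B)) => [/set_mem/BA wA|_]; first by rewrite mem_set//= subrr.
          by rewrite andbT subr0.
        by apply: QB => //; exact: adm1.
      - move=> F ndF HF; split; first by apply: bigcup_measurable => k _; have [] := HF k.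
        apply: (@Q_mono (fun j => \1_(F j))).
        + by apply: adm1; apply: bigcup_measurable => k _; have [] := HF k.
        + by move=> j; apply: adm1; have [] := HF j.
        + move=> w i j ij; rewrite !indicE ler_nat.
          case: (boolP (w \in F i)) => // /set_mem wi.
          by rewrite mem_set//; have /subsetPset := ndF _ _ ij; exact.
        + move=> w; have [/set_mem[k _ Fk]|nF] := boolP (w \in \bigcup_i F i).
            have e2 : w \in \bigcup_i F i by apply/mem_set; exists k.
            apply: cvg_near_cst; near=> j.
            have kj : (k <= j)%N by near: j; exact: nbhs_infty_ge.
            have e1 : w \in F j by apply/mem_set; have /subsetPset := ndF _ _ kj; exact.
            by rewrite !indicE e1 e2.
          rewrite (_ : (fun j => _) = cst (\1_(\bigcup_i F i) w)); first exact: cvg_cst.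
          apply/funext => j; rewrite !indicE (negbTE nF) memNset// => Fj.
          by move/negP: nF; apply; apply/mem_set; exists j.
        + by move=> j; have [] := HF j.
    by move=> C GC; split; [rewrite mG; exact: sub_sigma_algebra|exact: QG].
  by rewrite -mG => hs mA; have [] := hs _ mA.
have ah : adm h by split.
have mh' : measurable_fun setT (EFin \o h) by exact/measurable_EFinP.
pose h_ := nnsfun_approx measurableT mh'.
have cv w : h_ k w @[k --> \oo] --> h w.
  have h0' x : setT x -> (0 <= (EFin \o h) x)%E by move=> _; rewrite lee_fin.
  have := @cvg_nnsfun_approx _ _ _ _ measurableT _ mh' h0' w I.
  by move/fine_cvg.
have nd w : {homo (fun k => h_ k w) : a b / (a <= b)%N >-> a <= b}.
  by move=> i j ij; exact/lefP/nd_nnsfun_approx.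
have le_h k w : h_ k w <= h w.
  rewrite -(cvg_lim _ (cv w))//; apply: (@nondecreasing_cvgn_le _ (fun k => h_ k w)) => //.
  by apply/cvg_ex; exists (h w).
have ah_ k : adm (h_ k) by apply: adm_le ah.
apply: (Q_mono ah ah_ nd cv) => k.
pose r := finmap.enum_fset (fset_set (range (h_ k))).
pose B y := h_ k @^-1` [set y].
have mB y : measurable (B y) by exact: measurable_sfunP.
have -> : (h_ k : T -> R) = (fun w => \sum_(y <- r) `|y| * \1_(B y) w).
  by apply/funext => w; exact: nnsfun_sumE.
have QBy y : adm (fun w => `|y| * \1_(B y) w) /\ Q (fun w => `|y| * \1_(B y) w).
  by split; [apply: admZ => //; exact: adm1|apply: QZ => //; [exact: adm1|exact: Qind]].
suff [] : adm (fun w => \sum_(y <- r) `|y| * \1_(B y) w) /\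
    Q (fun w => \sum_(y <- r) `|y| * \1_(B y) w) by [].
elim: r => [|y r [ar Qr]].
  rewrite (_ : (fun w => _) = (fun w => 0 * \1_setT w)); last first.
    by apply/funext => w; rewrite big_nil mul0r.
  by split; [apply: admZ => //; exact: adm1|apply: QZ => //; [exact: adm1|exact: Qind]].
rewrite (_ : (fun w => _) = (fun w => `|y| * \1_(B y) w + \sum_(z <- r) `|z| * \1_(B z) w)).
  by have [aBy QBy'] := QBy y; split; [exact: admD|exact: QD].
by apply/funext => w; rewrite big_cons.
Unshelve. all: by end_near. Qed.

End weak_convergence.

Fact absz_ge (i : int) (n : nat) : (absz i <= n)%N -> - n%:Z <= i.
Proof. lia. Qed.

Section invariant_law.
Context (R : realType) (d : nat) (P : probability (env R d) R) (c : R).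
Hypothesis hiid : iid_environment P.
Hypothesis hnn : nearest_neighbor P.
Hypothesis c_gt0 : 0 < c.
Hypothesis hc : forall z : step R d, P [set w | c <= transition w 0 0 z] = 1%E.
Context (th : 'rV[R]_d.+1).
Local Notation U := (step R d).
Local Notation E := (env R d).
Local Notation us := (steps_seq R d).
Local Notation sv := (@step_val R d : U -> lattice d).
Local Notation pos := (@pos (lattice d) U (@step_val R d)).
Local Notation tw := (tilt_word P th).
Local Notation pw := path_weight.
Context (u v : E -> R).
Hypothesis hu : subseq_limit P (fwd P th) u.
Hypothesis hv : subseq_limit P (bwd P th) v.
Local Notation ker := (tilted_kernel P th u).

Let mu_ : measurable_fun setT u := lim_meas hu.
Let mv_ : measurable_fun setT v := lim_meas hv.
Let u0 w : 0 <= u w. Proof. exact: lim_ge0 hu w. Qed.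
Let v0 w : 0 <= v w. Proof. exact: lim_ge0 hv w. Qed.
Let ugt0 : {ae P, forall w, 0 < u w} := fwd_limit_gt0 hiid hnn c_gt0 hc hu.
Let mpw m x s : measurable_fun setT (fun w : E => pw w m x s).
Proof. exact: measurable_path_weight. Qed.

(** [u] times the [n]-th iterate of the transformed kernel on [f], as [iter_jumpE] shows where [u]
    is positive; in this form there are no denominators. *)
Definition fwd_with (f : E -> R) (n : nat) (w : E) : R :=
  \sum_(s <- words us n) tw s * (pw w 0 0 s *
    (f (env_shift n%:Z (pos s) w) * u (env_shift n%:Z (pos s) w))).

Lemma fwd_withD f n m w : fwd_with f (n + m) w = \sum_(s <- words us n)
  tw s * (pw w 0 0 s * fwd_with f m (env_shift n%:Z (pos s) w)).
Proof.
rewrite /fwd_with big_words_cat; apply: eq_big_seq => s; rewrite words_steps => /eqP sn.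
rewrite !mulr_sumr; apply: eq_bigr => t _.
rewrite tilt_word_cat path_weight_cat pos_cat path_weight_shift env_shiftD !add0r sn.
rewrite (addrC m%:Z) (addrC (pos t)) PoszD; ring.
Qed.

Lemma fwd_with0 f w : fwd_with f 0 w = f w * u w.
Proof. by rewrite /fwd_with big_words0 tilt_word_nil/= pos_nil env_shift0 !mul1r. Qed.

Lemma fwd_with_ge0 (f : E -> R) n w : (forall w, 0 <= f w) -> 0 <= fwd_with f n w.
Proof.
move=> f0; rewrite sumr_ge0// => s _.
by rewrite mulr_ge0 ?tilt_word_ge0// mulr_ge0 ?path_weight_ge0// mulr_ge0.
Qed.

Lemma measurable_fwd_with (f : E -> R) n : measurable_fun setT f ->
  measurable_fun setT (fwd_with f n).
Proof.
move=> mf; apply: measurable_sum => s; apply: measurable_funM => //.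
by apply: measurable_funM => //; apply: measurable_funM; exact: measurable_shifted.
Qed.

(** After [n >= m] steps, times at least [-m] seen from the endpoint are times at least 0. Events
    that look into the past thus come within reach of a density known on the future only. *)
Lemma depends_fwd_with (f : E -> R) n m : (m <= n)%N -> depends (times_ge (- m%:Z)) f ->
  depends (times_ge 0) (fwd_with f n).
Proof.
move=> mn df w w' ww'; apply: eq_big_seq => s; rewrite words_steps => /eqP sn.
congr (_ * (_ * (_ * _))).
- by apply: depends_path_weight => i /andP[i0 _]; exact: ww'.
- apply: (depends_shift (S' := times_ge 0) df) ww' => i.
  by rewrite /times_ge/=; lia.
- apply: (depends_shift (S' := times_ge 0) (depends_fwd_limit hu)) ww' => i.
  by rewrite /times_ge/=; lia.
Qed.

Lemma fwd_with_le (f : E -> R) n : (forall w, f w <= 1) ->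
  {ae P, forall w, fwd_with f n w <= u w}.
Proof.
move=> f1; apply: filterS (fwd_limit_words hiid hu n) => w ->.
apply: ler_sum => s _; rewrite ler_wpM2l ?tilt_word_ge0// ler_wpM2l ?path_weight_ge0//.
by rewrite -[leRHS]mul1r ler_wpM2r.
Qed.

Let posu : set E := [set w | forall i : site d, 0 < u (env_shift i.1 i.2 w)].

Let posu_shift w m x : posu w -> posu (env_shift m x w).
Proof. by move=> h i; rewrite env_shiftD; exact: (h (i.1 + m, i.2 + x)). Qed.

Lemma iter_jumpE (f : E -> R) n w : (forall i : site d, 0 < u (env_shift i.1 i.2 w)) ->
  iter n (jump ker) f w = fwd_with f n w / u w.
Proof.
elim: n w => [|n IHn] w hw; have uw := hw (0, 0); rewrite /= env_shift0 in uw.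
  by rewrite fwd_with0 mulfK// gt_eqF.
rewrite iterS /jump -[n.+1]add1n fwd_withD mulr_suml.
rewrite [RHS](_ : _ = \sum_(z <- us) \sum_(s <- words us 0) tw (z :: s) *
  (pw w 0 0 (z :: s) * fwd_with f n (env_shift 1 (pos (z :: s)) w)) / u w); last first.
  by rewrite big_wordsS.
apply: eq_bigr => z _; rewrite IHn; last exact: posu_shift.
rewrite big_words0 tilt_word_cons tilt_word_nil/= !mulr1 pos_cons pos_nil addr0 tilted_kernelE.
have := hw (1, sv z); rewrite /= => uz.
have un0 : u (env_shift 1 (sv z) w) != 0 by rewrite gt_eqF.
have un1 : u w != 0 by rewrite gt_eqF.
by field; rewrite un0 un1.
Qed.

Section mass.
Variables (A : set E) (m : nat).
Hypothesis mA : measurable A.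
Hypothesis dA : depends (times_ge (- m%:Z)) A.

Let mA1 : measurable_fun setT (\1_A : E -> R). Proof. exact: measurable_indic. Qed.
Let A0 w : 0 <= (\1_A w : R). Proof. by rewrite indicE. Qed.
Let dA1 : depends (times_ge (- m%:Z)) (\1_A : E -> R).
Proof.
move=> w w' ww'; rewrite !indicE /in_mem/=; congr (nat_of_bool `[< _ >])%:R.
exact: dA.
Qed.

Definition tilted_mass : R := fine (\int[P]_w (\1_A w * (v w * u w))%:E)%E.

Lemma tilted_massE : (\int[P]_w (\1_A w * (v w * u w))%:E = tilted_mass%:E)%E.
Proof.
have I0 : (0 <= \int[P]_w (\1_A w * (v w * u w))%:E)%E.
  by apply: integral_ge0 => w _; rewrite lee_fin !mulr_ge0.
rewrite /tilted_mass fineK// ge0_fin_numE//.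
apply: (@le_lt_trans _ _ (\int[P]_w (v w * u w)%:E)%E); last first.
  by rewrite (integral_bwd_limit_fwd_limit hiid hnn hu hv) ltry.
apply: ge0_le_integral => //.
- by move=> w _; rewrite lee_fin !mulr_ge0.
- by apply/measurable_EFinP; apply: measurable_funM => //; exact: measurable_funM.
- by apply/measurable_EFinP; exact: measurable_funM.
- by move=> w _; rewrite lee_fin -[leRHS]mul1r ler_wpM2r// mulr_ge0.
Qed.

(** The event and [u] see only times at least [-m], so [v] may be replaced by [bwd m], and
    [integral_bwd_words] turns backward paths into forward ones. *)
Lemma integral_fwd_with : (\int[P]_w (fwd_with \1_A m w)%:E = tilted_mass%:E)%E.
Proof.
rewrite -tilted_massE.
rewrite [RHS](@eq_integral_fun _ _ _ _ _ (fun w => v w * (\1_A w * u w))); last first.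
  by move=> w; rewrite mulrCA.
have mh : measurable_fun setT (fun w => \1_A w * u w : R) by exact: measurable_funM.
have h0 w : 0 <= (\1_A w : R) * u w by rewrite mulr_ge0.
rewrite (integral_bwd_limit hiid hnn hv (n := m))//; last first.
  move=> w w' ww'; rewrite (dA1 ww') (depends_fwd_limit hu (w' := w'))//.
  by move=> i i0; apply: ww'; move: i0; rewrite /times_ge; lia.
rewrite (integral_bwd_words hiid)// ge0_integral_rsum//.
- move=> s; apply: measurable_funM => //; apply: measurable_funM => //.
  by apply: measurable_funM; exact: measurable_shifted.
- move=> s w; rewrite mulr_ge0 ?tilt_word_ge0// mulr_ge0 ?path_weight_ge0// mulr_ge0//.
Qed.

(** After the first [n] steps, the factor [fwd_with \1_A m] at the endpoint sees times at least [n]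
    only, hence is independent of [C] and of these steps; its mean is [tilted_mass], wherever the
    endpoint is. *)
Lemma fwd_with_decouple (C : set E) n : measurable C -> depends (times_lt n%:Z) C ->
  (\int[P]_w (fwd_with \1_A (n + m) w * \1_C w)%:E =
   tilted_mass%:E * \int[P]_w (u w * \1_C w)%:E)%E.
Proof.
move=> mC dC.
have mC1 : measurable_fun setT (\1_C : E -> R) by exact: measurable_indic.
have C0 w : 0 <= (\1_C w : R) by rewrite indicE.
have dC1 : depends (times_lt n%:Z) (\1_C : E -> R).
  move=> w w' ww'; rewrite !indicE /in_mem/=; congr (nat_of_bool `[< _ >])%:R.
  exact: dC.
pose p s (w : E) : R := pw w 0 0 s * \1_C w.
pose g s (w : E) : R := fwd_with \1_A m (env_shift n%:Z (pos s) w).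
have mp s : measurable_fun setT (p s) by exact: measurable_funM.
have mg s : measurable_fun setT (g s).
  by apply: measurable_shifted; exact: measurable_fwd_with.
have p0 s w : 0 <= p s w by rewrite mulr_ge0 ?path_weight_ge0.
have g0 s w : 0 <= g s w by exact: fwd_with_ge0.
rewrite (@eq_integral_fun _ _ _ _ _ (fun w => \sum_(s <- words us n) tw s * (p s w * g s w))); last first.
  move=> w; rewrite fwd_withD mulr_suml; apply: eq_bigr => s _; rewrite /p /g; ring.
rewrite ge0_integral_rsum; last 2 first.
- by move=> s; apply: measurable_funM => //; exact: measurable_funM.
- by move=> s w; rewrite mulr_ge0 ?tilt_word_ge0// mulr_ge0.
rewrite (integral_fwd_limit hiid hnn hu mC1 C0 dC1).
rewrite [in RHS](@eq_integral_fun _ _ _ _ _ (fun w => \sum_(s <- words us n) tw s * p s w)); last first.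
  by move=> w; rewrite /fwd mulr_suml; apply: eq_bigr => s _; rewrite mulrA.
rewrite [in RHS]ge0_integral_rsum; last 2 first.
- by move=> s; apply: measurable_funM.
- by move=> s w; rewrite mulr_ge0 ?tilt_word_ge0.
have pI s : (\int[P]_w (p s w)%:E = (fine (\int[P]_w (p s w)%:E))%:E)%E.
  apply: (ge0_bounded_integral P (b := 1)) => // w.
  rewrite -[leRHS]mulr1; apply: ler_pM => //; rewrite ?path_weight_ge0 ?path_weight_le1//.
rewrite ge0_sume_distrr; last first.
  move=> s _; rewrite ge0_integral_rZl ?tilt_word_ge0// mule_ge0 ?lee_fin ?tilt_word_ge0//.
  by apply: integral_ge0 => w _; rewrite lee_fin.
apply: eq_big_seq => s; rewrite words_steps => /eqP sn.
rewrite !ge0_integral_rZl ?tilt_word_ge0//; last 2 first.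
- exact: measurable_funM.
- by move=> w; rewrite mulr_ge0.
rewrite (indep_integral hiid (S := times_lt n%:Z) (S' := times_ge n%:Z))//.
- have -> : (\int[P]_w (g s w)%:E = tilted_mass%:E)%E.
    rewrite -integral_fwd_with; apply: (env_shift_integral hiid n%:Z (pos s)
      (f := fun w => (fwd_with \1_A m w)%:E)).
      by apply/measurable_EFinP; exact: measurable_fwd_with.
    by move=> w; rewrite lee_fin fwd_with_ge0.
  by rewrite muleA muleC.
- by move=> i; rewrite /times_lt /times_ge => i1 i2; lia.
- move=> w w' ww'; rewrite /p (dC1 _ _ ww'); congr (_ * _).
  apply: depends_path_weight => i /andP[_ i1]; apply: ww'.
  by move: i1; rewrite /times_lt sn; lia.
- apply: (depends_shift (S' := times_ge n%:Z) (depends_fwd_with (leqnn m) dA1)) => i.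
  by rewrite /times_ge/=; lia.
Qed.

Lemma fwd_with_weak (h : E -> R) : measurable_fun setT h -> (forall w, 0 <= h w) ->
  (\int[P]_w (u w * h w)%:E < +oo)%E ->
  fine (\int[P]_w (fwd_with \1_A n w * h w)%:E)%E @[n --> \oo] -->
    tilted_mass * fine (\int[P]_w (u w * h w)%:E)%E.
Proof.
move=> mh h0 hoo.
pose W := fwd_with (\1_A : E -> R).
have mW n : measurable_fun setT (W n) by exact: measurable_fwd_with.
have W0 n w : 0 <= W n w by exact: fwd_with_ge0.
have Wu n : {ae P, forall w, W n w <= u w} by exact: fwd_with_le.
have u1 : (\int[P]_w (u w)%:E < +oo)%E by rewrite (integral_fwd_limit1 hiid hnn hu) ltry.
have k0 : 0 <= tilted_mass.
  by rewrite /tilted_mass fine_ge0// integral_ge0// => w _; rewrite lee_fin !mulr_ge0.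
have hW := @weak_convergence _ _ _ P W u tilted_mass mW mu_ W0 u0 Wu u1 k0 _
  (@sigma_cylinders _ _ _) (@setI_cylinders _ _ _) (@cylindersT _ _ _).
apply: (hW _ h mh h0 hoo).
move=> C cC; have mC := measurable_cylinders cC; have [B [mB [s sB] CE]] := cC.
pose n0 := \max_(i <- s) (absz i.1).+1.
have dC n : (n0 <= n)%N -> depends (times_lt n%:Z) C.
  move=> n0n; have imp w w' : (forall i, times_lt n%:Z i -> w i = w' i) -> cylinder B w -> cylinder B w'.
    move=> ww' Bw i; have [is_|is_] := boolP (i \in s); last by rewrite sB.
    rewrite -ww'; first exact: Bw.
    apply: absz_lt; apply: leq_trans n0n.
    by rewrite /n0 (big_rem i)//= leq_maxl.
  by move=> w w' ww'; rewrite CE; apply/propext; split; apply: imp => // i Si; rewrite ww'.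
apply: cvg_near_cst; near=> n.
have nn : (n0 + m <= n)%N by near: n; exact: nbhs_infty_ge.
rewrite -(subnK (leq_trans (leq_addl _ _) nn)) fwd_with_decouple//; last first.
  by apply: dC; rewrite leq_subRL ?(leq_trans (leq_addl _ _) nn)// addnC.
rewrite fineM//.
have uC : (\int[P]_w (u w * \1_C w)%:E <= \int[P]_w (u w)%:E)%E.
  apply: ge0_le_integral => //.
  - by move=> w _; rewrite lee_fin mulr_ge0// indicE.
  - by apply/measurable_EFinP; apply: measurable_funM => //; exact: measurable_indic.
  - exact/measurable_EFinP.
  - by move=> w _; rewrite lee_fin -[leRHS]mulr1 ler_wpM2l// indicE; case: (_ \in _).
rewrite ge0_fin_numE; last by apply: integral_ge0 => w _; rewrite lee_fin mulr_ge0// indicE.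
by apply: le_lt_trans uC _; rewrite (integral_fwd_limit1 hiid hnn hu) ltry.
Unshelve. all: by end_near. Qed.

End mass.

Context (L : probability E R).
Hypothesis L_inv : forall A, measurable A ->
  L A = (\int[L]_w (jump ker \1_A w)%:E)%E.
Hypothesis L_ac : forall n A, sigma_ge n A -> P A = 0%E -> L A = 0%E.

Let mker z : measurable_fun setT (ker ^~ z).
Proof. exact: (measurable_tilted_kernel hu). Qed.

Let ker0 w z : 0 <= ker w z. Proof. exact: (tilted_kernel_ge0 hu). Qed.

Lemma invariant_iter n (f : E -> R) : measurable_fun setT f -> (forall w, 0 <= f w) ->
  (\int[L]_w (f w)%:E = \int[L]_w (iter n (jump ker) f w)%:E)%E.
Proof.
move=> mf f0; elim: n => // n ->.
have [mg g0] : measurable_fun setT (iter n (jump ker) f) /\ forall w, 0 <= iter n (jump ker) f w.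
  elim: n => // n [mg g0]; split; first exact: measurable_jump.
  by move=> w; exact: jump_ge0.
rewrite (@transport_integral _ _ _ _ _ L L _ us (fun z w => ker w z) (fun z => env_shift 1 (sv z)))//.
Qed.

Let measurable_posu : measurable posu.
Proof.
have -> : posu = \bigcap_(i in [set: site d]) [set w | 0 < u (env_shift i.1 i.2 w)].
  by apply/seteqP; split => w h i; [move=> _; exact: h|exact: (h i I)].
apply: bigcap_measurable_countable => i _.
have := measurable_shifted i.1 i.2 mu_ measurableT (measurable_itv `]0, +oo[).
rewrite setTI; congr measurable; apply/seteqP; split => w; by rewrite /= in_itv/= andbT.
Qed.

(** Vanishing of [u] at a shift to time [i.1] is a [P]-null event of the future of that time, so the
    absolute continuity of [L] on futures covers each of the countably many sites. *)
Let L_posu : L (~` posu) = 0%E.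
Proof.
pose D (i : site d) := [set w : E | ~ 0 < u (env_shift i.1 i.2 w)].
have mD i : measurable (D i).
  have := measurable_shifted i.1 i.2 mu_ measurableT (measurable_itv `]-oo, 0]).
  rewrite setTI; congr measurable; apply/seteqP; split => w; rewrite /= in_itv/= leNgt.
    by move/negP.
  by move/negP.
have LD i : L (D i) = 0%E.
  apply: (L_ac (n := i.1)).
    apply/sigma_geE; split => // w w' ww'; rewrite /D/=.
    rewrite (_ : u (env_shift i.1 i.2 w) = u (env_shift i.1 i.2 w'))//.
    apply: (depends_shift (S' := times_ge i.1) (depends_fwd_limit hu)) ww' => j.
    by rewrite /times_ge/=; lia.
  have [N [mN N0 sN]] := env_shift_negligible hiid i.1 i.2 ugt0.
  by apply/negligibleP => //; exists N; split => // w /= h; apply: sN.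
have ae : {ae L, forall w, forall i : site d, 0 < u (env_shift i.1 i.2 w)}.
  have aei i : {ae L, forall w, 0 < u (env_shift i.1 i.2 w)}.
    by exists (D i); split; [exact: mD|exact: LD|].
  exact: (ae_forall_countable aei).
apply/negligibleP; first exact: measurableC.
exact: ae.
Qed.

(** Resetting all coordinates at negative times turns absolute continuity on [sigma_ge 0] into
    absolute continuity of two image measures on the whole sigma-algebra, and the Radon-Nikodym
    theorem applies to these. *)
Lemma future_density : exists r : E -> R, [/\ measurable_fun setT r, forall w, 0 <= r w &
  forall g : E -> R, measurable_fun setT g -> (forall w, 0 <= g w) -> depends (times_ge 0) g ->
    (\int[L]_w (g w)%:E = \int[P]_w (g w * r w)%:E)%E].
Proof.
pose rs : E -> E := restr (times_ge 0).
have mrs : measurable_fun setT rs by exact: measurable_restr.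
pose LR : probability E R := distribution L rs.
pose PR : probability E R := distribution P rs.
have dom : LR `<< PR.
  apply/null_content_dominatesP => A mA A0; apply: (L_ac (n := 0)) A0.
  apply/sigma_geE; split; first exact: (measurable_preim rs).
  move=> w w' ww'; rewrite /preimage/=; congr A.
  by apply/funext => i; rewrite /rs /restr; case: ifPn => // /ww'.
have [f [f0 ffin fint fE]] := radon_nikodym_sigma_finite dom.
pose r w := fine (f w).
have mf : measurable_fun setT f by exact: measurable_int fint.
have mr : measurable_fun setT r by exact: measurableT_comp mf.
have r0 w : 0 <= r w by rewrite fine_ge0.
exists (r \o rs); split.
- exact: measurableT_comp mrs.
- by move=> w; exact: r0.
move=> g mg g0 dg.
have push (m : probability E R) (k : E -> R) : measurable_fun setT k -> (forall w, 0 <= k w) ->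
    (\int[distribution m rs]_w (k w)%:E = \int[m]_w (k (rs w))%:E)%E.
  move=> mk k0; rewrite (@ge0_integral_pushforward _ _ _ _ _ rs mrs m setT (fun w => (k w)%:E))//.
    exact/measurable_EFinP.
  by move=> w _; rewrite lee_fin.
transitivity (\int[LR]_w (g w)%:E)%E.
  by rewrite push//; apply: eq_integral_fun => w; rewrite depends_restr.
rewrite (@density_integral _ _ _ LR PR r g)//; last first.
  move=> A mA; apply: etrans (fE A mA) _; apply: eq_integral => w _.
  by rewrite /r fineK.
rewrite push//; last by move=> w; rewrite mulr_ge0.
  by apply: eq_integral_fun => w; rewrite /= depends_restr.
exact: measurable_funM.
Qed.

Lemma invariant_future (A : set E) m : measurable A -> depends (times_ge (- m%:Z)) A ->
  L A = (\int[P]_w (\1_A w * (v w * u w))%:E)%E.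
Proof.
move=> mA dA; rewrite tilted_massE//.
have mA1 : measurable_fun setT (\1_A : E -> R) by exact: measurable_indic.
have A0 w : 0 <= (\1_A w : R) by rewrite indicE.
have dA1 : depends (times_ge (- m%:Z)) (\1_A : E -> R).
  move=> w w' ww'; rewrite !indicE /in_mem/=; congr (nat_of_bool `[< _ >])%:R.
  exact: dA.
have [r [mr r0 rE]] := future_density.
pose h w := r w * (u w)^-1.
have h0 w : 0 <= h w by rewrite mulr_ge0// invr_ge0.
have mV : measurable_fun setT (fun w => (u w)^-1).
  rewrite (_ : (fun w => _) = (fun w => powR (u w) (-1))); last first.
    by apply/funext => w; rewrite powR_inv1.
  exact: (measurableT_comp (measurable_powR _)).
have mh : measurable_fun setT h by exact: measurable_funM.
have uh : (\int[P]_w (u w * h w)%:E = 1)%E.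
  transitivity (\int[P]_w (cst 1 w * r w)%:E)%E.
    apply: (ae_integral measurableT).
    - exact: measurable_funM.
    - by apply: measurable_funM.
    apply: filterS ugt0 => w uw; rewrite /h mulrCA mulfV ?gt_eqF//.
    by rewrite mulr1 mul1r.
  rewrite -rE//; first exact: integral_one.
have LA : L A = (\int[L]_w (\1_A w)%:E)%E.
  by apply/esym; apply: etrans (integral_indic L measurableT mA) _; rewrite setIT.
(* By invariance the integral is the same for all [n >= m], so its limit under [fwd_with_weak],
   namely [tilted_mass] times the value 1 of [uh], is [L A] itself. *)
have aN n : (m <= n)%N -> (\int[P]_w (fwd_with \1_A n w * h w)%:E)%E = L A.
  move=> mn; rewrite LA (invariant_iter n)//.
  rewrite (@integral_modify _ _ _ L posu _ (fun w => (fwd_with \1_A n w * (u w)^-1)%:E) measurable_posu L_posu); last first.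
    by move=> w hw; rewrite iter_jumpE.
  have mF : measurable_fun setT (fwd_with \1_A n) by exact: measurable_fwd_with.
  rewrite rE; last first.
  - by move=> w w' ww'; rewrite (depends_fwd_with mn dA1 ww') (depends_fwd_limit hu ww').
  - by move=> w; rewrite mulr_ge0 ?invr_ge0 ?fwd_with_ge0.
  - exact: measurable_funM.
  - by apply: eq_integral_fun => w; rewrite /h mulrAC -mulrA.
have := fwd_with_weak mA dA mh h0; rewrite uh ltry => /(_ isT).
rewrite mulr1 => cv.
have LAE : L A = (fine (L A))%:E by rewrite fineK// fin_num_measure.
rewrite LAE; congr EFin; rewrite -(cvg_lim _ cv)//; apply/esym/cvg_lim => //.
apply: cvg_near_cst; near=> n; rewrite aN//.
by near: n; exact: nbhs_infty_ge.
Unshelve. all: by end_near. Qed.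

Lemma invariant_law (A : set E) : measurable A ->
  L A = (\int[P]_w (\1_A w * (v w * u w))%:E)%E.
Proof.
move=> mA; have [M hM] := tilted_exists hiid hnn hu hv.
pose m2 : probability E R := distribution M (mfun_of (@measurable_fst _ _ E (steps R d))).
have m2E B : measurable B -> m2 B = (\int[P]_w (\1_B w * (v w * u w))%:E)%E.
  move=> mB; transitivity (M (B `*` setT)).
    by congr (M _); apply/seteqP; split => -[w y] //= [].
  rewrite (tilted_marginal hM mB) integral_mkcond; apply: eq_integral => w _.
  by rewrite patchE indicE; case: ifP => _; rewrite ?mul1r ?mul0r.
rewrite -m2E//; apply: prodspace_measure_unique mA.
  by rewrite (le_lt_trans (probability_le1 _ measurableT)) ?ltry.
move=> C cC; have mC := measurable_cylinders cC; have [B [mB [s sB] CE]] := cC.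
have e2 := m2E C mC; apply: etrans (esym e2).
apply: (@invariant_future _ (\max_(i <- s) (absz i.1))) => //.
set m := \max_(i <- s) _.
have imp w w' : (forall i, times_ge (- m%:Z) i -> w i = w' i) -> cylinder B w -> cylinder B w'.
  move=> ww' Bw i; have [is_|is_] := boolP (i \in s); last by rewrite sB.
  rewrite -ww'; first exact: Bw.
  have : (absz i.1 <= m)%N by rewrite /m (big_rem i)//= leq_maxl.
  exact: absz_ge.
by move=> w w' ww'; rewrite CE; apply/propext; split; apply: imp => // i Si; rewrite ww'.
Qed.

End invariant_law.

Section process_uniqueness.
Context (R : realType) (d : nat) (P : probability (env R d) R) (c : R).
Hypothesis hiid : iid_environment P.
Hypothesis hnn : nearest_neighbor P.
Hypothesis c_gt0 : 0 < c.
Hypothesis hc : forall z : step R d, P [set w | c <= transition w 0 0 z] = 1%E.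
Context (th : 'rV[R]_d.+1) (u v : env R d -> R).
Hypothesis hu : subseq_limit P (fwd P th) u.
Hypothesis hv : subseq_limit P (bwd P th) v.

Lemma mu_process_unique (nu : probability (env_process R d) R) :
  stationary nu -> markov_process nu (tilted_kernel P th u) -> ac_on_futures P nu ->
  forall A, measurable A -> nu A = mu_process P th A.
Proof.
move=> snu mnu acnu.
have hM := mu_bar_tilted hiid hnn hu hv.
have mk z : measurable_fun setT (fun w => tilted_kernel P th u w z).
  exact: (measurable_tilted_kernel hu).
have k0 w z : 0 <= tilted_kernel P th u w z by exact: (tilted_kernel_ge0 hu).
apply: (markov_unique mk k0 mnu (tilted_markov hiid hnn c_gt0 hc hu hv hM)) => A mA.
rewrite (law_initial_set hu hv hM mA).
pose L : probability (env R d) R :=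
  distribution nu (mfun_of (measurable_eval_at (T' := env R d) 0%N)).
have LE B : L B = nu [set eta | B (eta 0%N)] by [].
rewrite -LE; apply: (invariant_law hiid hnn c_gt0 hc hu hv) => //.
move=> B mB; rewrite LE.
have mB0 : measurable [set eta : env_process R d | B (eta 0%N)].
  by rewrite -[X in measurable X]setTI; exact: (measurable_eval_at 0%N).
rewrite -(snu _ mB0).
transitivity (nu (setT `&` [set eta : env_process R d | B (eta 1%N)])).
  by rewrite setTI.
rewrite (markov_processP mk k0 mnu)//.
have mJ : measurable_fun setT (jump (tilted_kernel P th u) \1_B).
  by apply: measurable_jump => //; exact: measurable_indic.
have J0 w : 0 <= jump (tilted_kernel P th u) \1_B w.
  by apply: jump_ge0 => // w'; rewrite indicE.
rewrite [RHS](@ge0_integral_pushforward _ _ _ _ _ _ (measurable_eval_at (T' := env R d) 0%N) nu setT)//.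
- by apply: eq_integral => eta _; rewrite indicE in_setT mul1r.
- exact/measurable_EFinP.
- by move=> w _; rewrite lee_fin.
Qed.

End process_uniqueness.

(** * Calculus of the logarithmic moment generating function *)

Lemma sum_sub_distr (R : pzRingType) (J : Type) (s : seq J) (f g f' g' : J -> R) :
  \sum_(z <- s) \sum_(z' <- s) (f z * g z' - f' z * g' z') =
  (\sum_(z <- s) f z) * (\sum_(z <- s) g z) - (\sum_(z <- s) f' z) * (\sum_(z <- s) g' z).
Proof.
rewrite !big_distrlr -sumrB; apply: eq_bigr => z _.
by rewrite -sumrB.
Qed.

Section exponential_bounds.
Context (R : realType).

Lemma expR_le_quadratic (x : R) : `|x| <= 2^-1 -> expR x <= 1 + x + 2 * x ^+ 2.
Proof.
rewrite ler_norml => /andP[x1 x2].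
have e0 := expR_gt0 x; have h := expR_ge1Dx (- x).
have h1 : expR x * (1 - x) <= 1.
  apply: (@le_trans _ _ (expR x * expR (- x))); first by rewrite ler_wpM2l// ltW.
  by rewrite expRxMexpNx_1.
have p : 0 < 1 - x by lra.
rewrite -ler_pdivlMr// div1r in h1; apply: (le_trans h1).
rewrite -[leLHS]div1r ler_pdivrMr// expr2.
have xx : 0 <= x * x by rewrite -expr2 sqr_ge0.
have xxx : 0 <= x * x * (1 - 2 * x) by rewrite mulr_ge0//; lra.
nra.
Qed.

Lemma expR_ge_quadratic (x : R) : -2 <= x -> 1 + x + x ^+ 2 / 4 <= expR x.
Proof.
move=> x2; have h := expR_ge1Dx (x / 2).
have -> : expR x = expR (x / 2) ^+ 2 by rewrite expr2 -expRD; congr expR; field.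
have -> : 1 + x + x ^+ 2 / 4 = (1 + x / 2) ^+ 2 by field.
by rewrite ler_pXn2r// ?nnegrE ?expR_ge0//; lra.
Qed.

Lemma continuous_rsum (T : topologicalType) (J : Type) (s : seq J) (f : J -> T -> R) :
  (forall j, continuous (f j)) -> continuous (fun t => \sum_(j <- s) f j t).
Proof.
move=> cf t; elim: s => [|j s IHs].
  rewrite (_ : (fun t => _) = cst 0); first exact: cst_continuous.
  by apply/funext => t'; rewrite big_nil.
rewrite (_ : (fun t => _) = (fun t => f j t + \sum_(i <- s) f i t)).
  have c1 := cf j t; exact: (cvgD c1 IHs).
by apply/funext => t'; rewrite big_cons.
Qed.

Lemma expR_mono_sign (x y : R) : 0 <= (x - y) * (expR x - expR y).
Proof.
have [xy|/ltW xy] := leP x y.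
  by rewrite mulr_le0// subr_le0// ler_expR.
by rewrite mulr_ge0// subr_ge0// ler_expR.
Qed.

Lemma expR_mono_sign_eq0 (x y : R) : (x - y) * (expR x - expR y) = 0 -> x = y.
Proof.
move/eqP; rewrite mulf_eq0 !subr_eq0 => /orP[/eqP //|/eqP].
exact: expR_inj.
Qed.

(* A tilt that leaves the mean of [X] unchanged is trivial: twice the difference
   of the means is a sum of terms [(X z - X z') * (expR (X z) - expR (X z'))],
   all of them nonnegative. *)
Lemma exp_tilt_rigid (J : eqType) (s : seq J) (a b X : J -> R) (k : R) :
  0 < k -> (forall z, 0 < b z) -> (forall z, a z = b z * expR (X z) * k) ->
  \sum_(z <- s) a z = 1 -> \sum_(z <- s) b z = 1 ->
  \sum_(z <- s) a z * X z = \sum_(z <- s) b z * X z ->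
  forall z z', z \in s -> z' \in s -> X z = X z'.
Proof.
move=> k0 b0 abE sa sb aX.
have S0 : \sum_(z <- s) \sum_(z' <- s)
    b z * b z' * ((X z - X z') * (expR (X z) - expR (X z'))) = 0.
  apply: (mulfI (lt0r_neq0 k0)); rewrite mulr0.
  transitivity (\sum_(z <- s) \sum_(z' <- s) ((a z * X z) * b z' - a z * (b z' * X z')) +
      \sum_(z <- s) \sum_(z' <- s) (b z * (a z' * X z') - (b z * X z) * a z')).
    rewrite mulr_sumr -big_split; apply: eq_bigr => z _.
    rewrite mulr_sumr -big_split; apply: eq_bigr => z' _ /=.
    rewrite !abE; ring.
  have e1 : \sum_(z <- s) \sum_(z' <- s) ((a z * X z) * b z' - a z * (b z' * X z')) = 0.
    apply: etrans (sum_sub_distr s (fun z => a z * X z) b a (fun z => b z * X z)) _.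
    by rewrite sa sb aX mulr1 mul1r subrr.
  have e2 : \sum_(z <- s) \sum_(z' <- s) (b z * (a z' * X z') - (b z * X z) * a z') = 0.
    apply: etrans (sum_sub_distr s b (fun z => a z * X z) (fun z => b z * X z) a) _.
    by rewrite sa sb aX mulr1 mul1r subrr.
  by rewrite e1 e2 addr0.
have nn y y' : 0 <= b y * b y' * ((X y - X y') * (expR (X y) - expR (X y'))).
  by rewrite mulr_ge0 ?expR_mono_sign// mulr_ge0// ltW.
move=> z z' zs zs'; move/eqP: S0; rewrite psumr_eq0; last by move=> y _; apply: sumr_ge0.
move/allP/(_ z zs); rewrite psumr_eq0//.
move/allP/(_ z' zs'); rewrite mulf_eq0 mulf_eq0 (gt_eqF (b0 z)) (gt_eqF (b0 z'))/=.
by move/eqP/expR_mono_sign_eq0.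
Qed.

End exponential_bounds.

Section log_mgf.
Context (R : realType) (d : nat) (P : probability (env R d) R) (c : R).
Hypothesis hiid : iid_environment P.
Hypothesis hnn : nearest_neighbor P.
Hypothesis c_gt0 : 0 < c.
Hypothesis hc : forall z : step R d, P [set w | c <= transition w 0 0 z] = 1%E.
Local Notation U := (step R d).
Local Notation us := (steps_seq R d).
Local Notation sv := (@step_val R d : U -> lattice d).
Local Notation q := (q_step P).
Implicit Types (t : 'rV[R]_d.+1) (i : 'I_d.+1).

Definition step_coord i (z : U) : R := lat2vec R (sv z) 0 i.

Lemma step_coord_sqr_le1 i z : step_coord i z ^+ 2 <= 1.
Proof.
rewrite /step_coord mxE -rmorphXn/= -(rmorph1 (intmul (1 : R))) ler_int.
by have := step_coord_le1 z i; rewrite -[X in _ -> X <= _]real_normK// ?num_real// expr_le1.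
Qed.

Lemma dot_addl t t' (x : 'rV[R]_d.+1) : dot (t + t') x = dot t x + dot t' x.
Proof. by rewrite /dot -big_split; apply: eq_bigr => i _; rewrite mxE mulrDl. Qed.

Lemma dot_scalel (a : R) t (x : 'rV[R]_d.+1) : dot (a *: t) x = a * dot t x.
Proof. by rewrite /dot mulr_sumr; apply: eq_bigr => i _; rewrite mxE mulrA. Qed.

Lemma dot_delta i (x : 'rV[R]_d.+1) : dot (delta_mx 0 i) x = x 0 i.
Proof.
rewrite /dot (bigD1 i)//= !mxE !eqxx mul1r big1 ?addr0// => j ji.
by rewrite mxE (negbTE ji) andbF mul0r.
Qed.

Definition tilted_mean i t : R := \sum_(z <- us) tstep P t z * step_coord i z.

Lemma phi_line i t (h : R) : phi_a P (h *: delta_mx 0 i + t) =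
  \sum_(z <- us) q z * expR (dot t (lat2vec R (sv z)) + h * step_coord i z).
Proof.
rewrite phi_aE; apply: eq_bigr => z _.
by rewrite dot_addl dot_scalel dot_delta addrC.
Qed.

(** A one-sided quadratic expansion stands in for second derivatives: it identifies the maximizer in
    [tilt_exists] and bounds the tails in [tilted_hit_beyond]. *)
Lemma lmgf_line_le i t (h : R) : `|h| <= 2^-1 ->
  ln (phi_a P (h *: delta_mx 0 i + t)) <=
  ln (phi_a P t) + h * tilted_mean i t + 2 * h ^+ 2.
Proof.
move=> h2; have p0 := phi_gt0 t hiid hnn.
have p1 := phi_gt0 (h *: delta_mx 0 i + t) hiid hnn.
have ineq : phi_a P (h *: delta_mx 0 i + t) <=
    phi_a P t * (1 + (h * tilted_mean i t + 2 * h ^+ 2)).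
  have -> : phi_a P t * (1 + (h * tilted_mean i t + 2 * h ^+ 2)) =
      \sum_(z <- us) q z * expR (dot t (lat2vec R (sv z))) *
        (1 + h * step_coord i z + 2 * h ^+ 2).
    have e1 : 1 + (h * tilted_mean i t + 2 * h ^+ 2) =
        \sum_(z <- us) tstep P t z * (1 + h * step_coord i z + 2 * h ^+ 2).
      under eq_bigr do rewrite mulrDr mulrDr mulr1.
      rewrite !big_split/= (tstep_sum t hiid hnn) -mulr_suml (tstep_sum t hiid hnn) mul1r.
      rewrite -addrA; congr (_ + (_ + _)); rewrite /tilted_mean mulr_sumr.
      by apply: eq_bigr => z _; rewrite mulrCA.
    rewrite e1 mulr_sumr; apply: eq_bigr => z _.
    rewrite /tstep (tiltE _ hiid hnn); field; exact: lt0r_neq0.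
  rewrite phi_line; apply: ler_sum => z _.
  rewrite expRD -mulrA; apply: ler_wpM2l; first exact: q_ge0.
  apply: ler_wpM2l; first exact: expR_ge0.
  have b := step_coord_sqr_le1 i z.
  have hb : `|h * step_coord i z| <= 2^-1.
    rewrite normrM -[leRHS]mulr1; apply: ler_pM => //.
    by rewrite -(@ler_pXn2r _ 2)// ?nnegrE// expr1n real_normK// num_real.
  apply: le_trans (expR_le_quadratic hb) _; rewrite lerD2l exprMn ler_wpM2l//.
  by rewrite ler_piMr// sqr_ge0.
have pos : 0 < 1 + (h * tilted_mean i t + 2 * h ^+ 2).
  by rewrite -(pmulr_rgt0 _ p0); exact: lt_le_trans ineq.
rewrite -[leRHS]addrA -lerBlDl -ln_div ?posrE//.
apply: le_trans (le_ln1Dx _); last by lra.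
rewrite ler_ln ?posrE ?divr_gt0//.
by rewrite ler_pdivrMr// mulrC.
Qed.

Lemma gradient_lmgf t : gradient (fun t' => ln (phi_a P t')) t = \row_i tilted_mean i t.
Proof.
apply/rowP => i; rewrite !mxE.
pose b z := step_coord i z; pose a z := dot t (lat2vec R (sv z)).
pose F (s : seq U) (h : R) : R := \sum_(z <- s) q z * expR (a z + h * b z).
have dF s : is_derive (0 : R) 1 (F s) (\sum_(z <- s) q z * (b z * expR (a z))).
  elim: s => [|z s IHs].
    rewrite big_nil (_ : F _ = cst 0); last by apply/funext => h; rewrite /F big_nil.
    exact: is_derive_cst.
  rewrite big_cons (_ : F _ = (fun h => q z * expR (a z + h * b z)) + F s); last first.
    by apply/funext => h; rewrite /F big_cons.
  apply: is_deriveD.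
  have d1 : is_derive (0 : R) 1 (cst (a z) + (b z) \*: (id : R -> R)) (0 + b z *: 1).
    by apply: is_deriveD.
  have d2 := is_derive1_comp (is_derive_expR ((cst (a z) + (b z) \*: (id : R -> R)) 0)) d1.
  have d3 := is_deriveZ (q z) d2.
  rewrite (_ : (fun h => _) = q z \*: (expR \o (cst (a z) + (b z) \*: (id : R -> R)))).
    apply: (is_derive_eq d3).
    have -> : (cst (a z) + b z \*: (id : R -> R)) 0 = a z.
      by rewrite !fctE /= [_ *: _]mulr0 addr0.
    by rewrite add0r [_ *: 1]mulr1 [LHS]/(_ * _) (mulrC (b z)).
  by apply/funext => h; rewrite /= /GRing.scale/= (mulrC h).
have F0 : F us 0 = phi_a P t.
  by rewrite phi_aE; apply: eq_bigr => z _; rewrite mul0r addr0.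
have p0 := phi_gt0 t hiid hnn.
have dl : is_derive (F us 0) 1 (@ln R) (F us 0)^-1 by apply: is_derive1_ln; rewrite F0.
have [_ dE] := is_derive1_comp dl (dF us).
transitivity ('D_1 (@ln R \o F us) 0).
  have fE : (fun h : R => h^-1 *: (((fun t' => ln (phi_a P t')) \o shift t)
        (h *: delta_mx 0 i) - ln (phi_a P t))) =
      (fun h : R => h^-1 *: (((@ln R \o F us) \o shift 0) (h *: 1) - (@ln R \o F us) 0)).
    apply/funext => h /=; rewrite addr0 [h *: 1]mulr1 F0 /F; congr (_ *: (ln _ - _)).
    exact: phi_line.
  by rewrite /derive fE.
rewrite dE F0 /tilted_mean mulr_sumr; apply: eq_bigr => z _.
rewrite /tstep (tiltE _ hiid hnn) /b /a; field; exact: lt0r_neq0.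
Qed.

Lemma dot_le_enorm t (x : 'rV[R]_d.+1) : dot t x <= l1norm t * enorm x.
Proof.
apply: le_trans (ler_norm _) _; apply: le_trans (ler_norm_sum _ _ _) _.
rewrite /l1norm mulr_suml; apply: ler_sum => i _; rewrite normrM ler_wpM2l//.
rewrite -(@ler_pXn2r _ 2)// ?nnegrE ?sqrtr_ge0// real_normK ?num_real//.
rewrite sqr_sqrtr; last by apply: sumr_ge0 => j _; exact: sqr_ge0.
by rewrite (bigD1 i)//= lerDl sumr_ge0// => j _; exact: sqr_ge0.
Qed.

Lemma dot_xi_o t : dot t (xi_o P) = \sum_(z <- us) q z * dot t (lat2vec R (sv z)).
Proof.
rewrite /xi_o fsbig_finite/=; last exact: finite_steps.
transitivity (\sum_i \sum_(z <- us) t 0 i * (q z * lat2vec R (sv z) 0 i)).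
  apply: eq_bigr => i _; rewrite summxE mulr_sumr.
  by apply: eq_bigr => z _; rewrite mxE.
rewrite exchange_big; apply: eq_bigr => z _; rewrite mulr_sumr.
by apply: eq_bigr => i _; rewrite mulrCA.
Qed.

Lemma dot_signed_step t i b :
  dot t (lat2vec R (sv (signed_step R i b))) = (if b then 1 else -1) * t 0 i.
Proof.
rewrite /dot (bigD1 i)//= big1 ?addr0 => [|j ji].
  by rewrite !mxE; case: b; rewrite !mxE !eqxx ?mul1r ?mulr1 //= mulrNz mulrN1 mulN1r.
by rewrite !mxE; case: b; rewrite !mxE (negbTE ji) andbF ?oppr0 ?mulr0.
Qed.

(** The exponentials are expanded around their mean [m], where the linear terms cancel. Of the
    quadratic terms the two opposite steps along axis [i] suffice: each has probability at least
    [c], and their squares add up to at least twice [t 0 i ^+ 2]. The bound on [l1norm t] keeps the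
    arguments in the range of [expR_ge_quadratic]. *)
Lemma lmgf_ge t i : l1norm t <= 1 ->
  dot t (xi_o P) + ln (1 + c / 2 * (t 0 i) ^+ 2) <= ln (phi_a P t).
Proof.
move=> t1; set m := dot t (xi_o P).
pose x z := dot t (lat2vec R (sv z)).
have sq : \sum_(z <- us) q z = 1 by exact: q_sum.
have x1 z : `|x z| <= 1 by apply: le_trans t1; exact: dot_step_le.
have m1 : `|m| <= 1.
  rewrite /m dot_xi_o; apply: le_trans (ler_norm_sum _ _ _) _.
  rewrite -sq; apply: ler_sum => z _; rewrite normrM ger0_norm ?q_ge0//.
  by rewrite -[leRHS]mulr1 ler_wpM2l ?q_ge0// x1.
have phiE : phi_a P t = expR m * \sum_(z <- us) q z * expR (x z - m).
  rewrite phi_aE mulr_sumr; apply: eq_bigr => z _.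
  by rewrite mulrCA -expRD; congr (_ * expR _); rewrite addrC subrK.
have p0 := phi_gt0 t hiid hnn.
have pos : 0 < 1 + c / 2 * (t 0 i) ^+ 2.
  by rewrite ltr_pwDl// mulr_ge0 ?sqr_ge0// divr_ge0// ltW.
have key : 1 + c / 2 * (t 0 i) ^+ 2 <= \sum_(z <- us) q z * expR (x z - m).
  apply: (@le_trans _ _ (\sum_(z <- us) q z * (1 + (x z - m) + (x z - m) ^+ 2 / 4))); last first.
    apply: ler_sum => z _; rewrite ler_wpM2l ?q_ge0//; apply: expR_ge_quadratic.
    have := x1 z; move: m1; rewrite !ler_norml => /andP[a1 a2] /andP[a3 a4]; lra.
  have -> : \sum_(z <- us) q z * (1 + (x z - m) + (x z - m) ^+ 2 / 4) =
      1 + \sum_(z <- us) q z * ((x z - m) ^+ 2 / 4).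
    under eq_bigr do rewrite mulrDr; rewrite big_split/=; congr (_ + _).
    under eq_bigr do rewrite mulrDr mulr1 mulrBr; rewrite big_split/= sumrB sq.
    by rewrite -mulr_suml sq mul1r /x -dot_xi_o -/m subrr addr0.
  rewrite lerD2l.
  pose z1 := signed_step R i true; pose z2 := signed_step R i false.
  have z12 : z2 != z1.
    apply/eqP => /(congr1 (fun z : U => (z : lattice d) 0 i)).
    by rewrite /= !mxE !eqxx.
  rewrite (bigD1_seq z1)/=; [|exact: mem_steps|exact: steps_uniq].
  rewrite big_mkcond/= (bigD1_seq z2)/= ?z12; [|exact: mem_steps|exact: steps_uniq].
  set rest := \sum_(j <- _ | _) _.
  have rest0 : 0 <= rest.
    apply: sumr_ge0 => z _; case: ifP => // _.
    by rewrite mulr_ge0 ?q_ge0// divr_ge0// sqr_ge0.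
  rewrite /x !dot_signed_step mul1r mulN1r.
  have q1 := q_ge hiid c_gt0 hc z1; have q2 := q_ge hiid c_gt0 hc z2.
  have h1 : c * ((t 0 i - m) ^+ 2 / 4) <= q z1 * ((t 0 i - m) ^+ 2 / 4).
    by rewrite ler_wpM2r// divr_ge0// sqr_ge0.
  have h2 : c * ((- t 0 i - m) ^+ 2 / 4) <= q z2 * ((- t 0 i - m) ^+ 2 / 4).
    by rewrite ler_wpM2r// divr_ge0// sqr_ge0.
  have h3 : c / 2 * t 0 i ^+ 2 <= c * ((t 0 i - m) ^+ 2 / 4) + c * ((- t 0 i - m) ^+ 2 / 4).
    have -> : c * ((t 0 i - m) ^+ 2 / 4) + c * ((- t 0 i - m) ^+ 2 / 4) =
      c / 2 * t 0 i ^+ 2 + c / 2 * m ^+ 2 by field.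
    by rewrite lerDl mulr_ge0 ?sqr_ge0// divr_ge0// ltW.
  by apply: (le_trans h3); rewrite addrA -[leLHS]addr0; apply: lerD => //; exact: lerD.
rewrite phiE lnM ?posrE ?expR_gt0//; last exact: lt_le_trans key.
rewrite expRK lerD2l ler_ln ?posrE//; exact: lt_le_trans key.
Qed.

Lemma continuous_dot (x : 'rV[R]_d.+1) : continuous (fun t : 'rV[R]_d.+1 => dot t x).
Proof.
apply: (continuous_rsum (f := fun i t => t 0 i * x 0 i)) => i t.
have ct : continuous (fun t : 'rV[R]_d.+1 => t 0 i) by move=> t'; exact: coord_continuous.
exact: (cvgMr_tmp (ct t)).
Qed.

Lemma continuous_lmgf : continuous (fun t : 'rV[R]_d.+1 => ln (phi_a P t)).
Proof.
move=> t; have p0 := phi_gt0 t hiid hnn.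
apply: (@continuous_comp _ _ _ (phi_a P) (@ln R)); last exact: continuous_ln.
rewrite (_ : phi_a P = fun t => \sum_(z <- us) q z * expR (dot t (lat2vec R (sv z)))); last first.
  by apply/funext => t'; exact: phi_aE.
apply: (continuous_rsum (f := fun z t => q z * expR (dot t (lat2vec R (sv z))))) => z t'.
have ct : {for t', continuous (expR \o (fun t => dot t (lat2vec R (sv z))))}.
  by apply: continuous_comp; [exact: continuous_dot|exact: continuous_expR].
exact: (cvgMl_tmp ct).
Qed.

Lemma continuous_l1norm : continuous (fun t : 'rV[R]_d.+1 => l1norm t).
Proof.
apply: (continuous_rsum (f := fun i t => `|t 0 i|)) => i t.
apply: (@continuous_comp _ _ _ (fun t : 'rV[R]_d.+1 => t 0 i) (@Num.norm R R)).
  exact: coord_continuous.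
exact: norm_continuous.
Qed.

Lemma norm_le_l1norm t : `|t| <= l1norm t.
Proof.
rewrite [leLHS]/Num.norm/= mx_normrE; apply/bigmax_leP; split; first exact: sumr_ge0.
move=> [j i] _ /=; rewrite (ord1 j) /l1norm (bigD1 i)//= lerDl; exact: sumr_ge0.
Qed.

Lemma l1normD t t' : l1norm (t + t') <= l1norm t + l1norm t'.
Proof.
by rewrite /l1norm -big_split; apply: ler_sum => i _; rewrite mxE ler_normD.
Qed.

Lemma l1normN t : l1norm (- t) = l1norm t.
Proof. by apply: eq_bigr => i _; rewrite mxE normrN. Qed.

Lemma l1norm_delta i (h : R) : l1norm (h *: delta_mx 0 i) = `|h|.
Proof.
rewrite /l1norm (bigD1 i)//= !mxE !eqxx mulr1 big1 ?addr0// => j ji.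
by rewrite !mxE (negbTE ji) andbF mulr0 normr0.
Qed.

(** The tilt is a maximizer of <t, xi> - log phi(t) on the compact ball [l1norm t <= rho]. The value
    0 at the origin beats the boundary, and at an interior maximizer the gradient vanishes. *)
Lemma tilt_exists (rho : R) : 0 < rho -> rho <= 1 -> exists2 eta : R, 0 < eta &
  forall xi : 'rV[R]_d.+1, enorm (xi - xi_o P) < eta ->
    exists2 t, l1norm t < rho & forall i, tilted_mean i t = xi 0 i.
Proof.
move=> rho0 rho1.
(* On the boundary some coordinate is at least [rho / d.+1] in absolute value, so by [lmgf_ge] log
   phi exceeds its linear part by at least [m]; a velocity closer than [m / rho] to [xi_o] cannot
   make up for this. *)
pose m := ln (1 + c / 2 * (rho / d.+1%:R) ^+ 2).
have c2 : 0 < c / 2 * (rho / d.+1%:R) ^+ 2 by rewrite mulr_gt0 ?divr_gt0// exprn_gt0 ?divr_gt0.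
have m0 : 0 < m by rewrite ln_gt0// ltrDl.
exists (m / rho) => [|xi hxi]; first by rewrite divr_gt0.
pose B : set 'rV[R]_d.+1 := [set t | l1norm t <= rho].
pose F (t : 'rV[R]_d.+1) := dot t xi - ln (phi_a P t).
have cF : continuous F.
  move=> t; have c1 := @continuous_dot xi t; have c2' := @continuous_lmgf t.
  exact: (cvgB c1 c2').
have l10 : l1norm (0 : 'rV[R]_d.+1) = 0 by rewrite /l1norm big1// => i _; rewrite mxE normr0.
have B0 : B 0 by rewrite /B/= l10 ltW.
have cB : compact B.
  apply: bounded_closed_compact.
    exists rho; split; first exact: num_real.
    move=> M rM t Bt; apply: le_trans (norm_le_l1norm t) _.
    exact: le_trans Bt (ltW rM).
  have := @preimage_closed _ _ (fun t : 'rV[R]_d.+1 => l1norm t) [set x | x <= rho].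
  apply; last exact: closed_le.
  by move=> t _; exact: continuous_l1norm.
have [t /set_mem tB tmax] := EVT_max_rV (ex_intro _ 0 B0) cB (continuous_subspaceT cF).
have F0 : F 0 = 0.
  rewrite /F phi_aE.
  have -> : \sum_(z <- us) q z * expR (dot 0 (lat2vec R (sv z))) = 1.
    rewrite -[RHS](q_sum hiid hnn); apply: eq_bigr => z _.
    by rewrite /dot big1 ?expR0 ?mulr1// => i _; rewrite mxE mul0r.
  by rewrite ln1 subr0 /dot big1// => i _; rewrite mxE mul0r.
have t_lt : l1norm t < rho.
  rewrite lt_neqAle; apply/andP; split => //; apply/eqP => tr.
  have [i hi] : exists i, rho / d.+1%:R <= `|t 0 i|.
    apply: contrapT => /forallNP h; have : l1norm t < rho.
      have -> : rho = \sum_(i < d.+1) rho / d.+1%:R.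
        by rewrite sumr_const card_ord -[RHS]mulr_natr divfK// pnatr_eq0.
      apply: ltr_sum; first by apply/hasP; exists ord0 => //; exact: mem_index_enum.
      by move=> i _; rewrite ltNge; apply/negP; exact: h.
    by rewrite tr ltxx.
  have := tmax 0 (mem_set B0); rewrite F0 leNgt => /negP; apply.
  have h1 : dot t xi = dot t (xi - xi_o P) + dot t (xi_o P).
    by rewrite -dotDr subrK.
  have h2 := lmgf_ge i (le_trans tB rho1).
  have h3 : m <= ln (1 + c / 2 * t 0 i ^+ 2).
    rewrite ler_ln ?posrE; last 2 first.
    - by rewrite ltr_pwDl// ltW.
    - by rewrite ltr_pwDl// mulr_ge0 ?sqr_ge0// divr_ge0// ltW.
    rewrite lerD2l; apply: ler_wpM2l; first by rewrite divr_ge0// ltW.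
    rewrite -[leRHS]real_normK ?num_real//.
    by rewrite ler_pXn2r// nnegrE divr_ge0// ltW.
  have h4 : dot t (xi - xi_o P) < m.
    apply: le_lt_trans (dot_le_enorm _ _) _; rewrite tr.
    by rewrite mulrC -ltr_pdivlMr.
  rewrite /F h1; lra.
exists t => // i; set D := xi 0 i - tilted_mean i t.
suff : D = 0 by rewrite /D => /eqP; rewrite subr_eq0 => /eqP.
(* Moving by [s * D] along axis [i] gains [s * D^2] to first order and loses at most twice the
   square of the move. With [s <= 1/4] the gain prevails; [ka] keeps the move inside the ball and
   within the range of [lmgf_line_le]. *)
apply: contrapT => /eqP D0; pose ka := Num.min 2^-1 (rho - l1norm t).
have ka0 : 0 < ka by rewrite lt_min invr_gt0 ltr0n/= subr_gt0.
have nD : 0 < `|D| by rewrite normr_gt0.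
pose s := Num.min 4^-1 (ka / `|D|).
have s0 : 0 < s by rewrite lt_min invr_gt0 ltr0n/= divr_gt0.
have s4 : s <= 4^-1 by rewrite ge_min lexx.
have sD : `|s * D| <= ka.
  by rewrite normrM (gtr0_norm s0) -ler_pdivlMr// ge_min lexx orbT.
have h2 : `|s * D| <= 2^-1 by apply: le_trans sD _; rewrite ge_min lexx.
have tB' : B ((s * D) *: delta_mx 0 i + t).
  rewrite /B/=; apply: le_trans (l1normD _ _) _; rewrite l1norm_delta -lerBrDr.
  by apply: le_trans sD _; rewrite ge_min lexx orbT.
have := tmax _ (mem_set tB'); have := lmgf_line_le i t h2.
rewrite /F dot_addl dot_scalel dot_delta => k1 k2.
have k3 : s * D * D <= 2 * (s * D) ^+ 2 by rewrite {2}/D; lra.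
have DD : 0 < s * (D * D) by rewrite mulr_gt0// -expr2 exprn_even_gt0.
have k4 : s * (D * D) * (1 - 2 * s) <= 0.
  by rewrite mulrBr mulr1 subr_le0; apply: le_trans (_ : s * D * D <= _); [rewrite mulrA|apply: le_trans k3 _; rewrite expr2; lra].
by move: k4; rewrite leNgt mulr_gt0//; lra.
Qed.

(** The two step laws differ by a tilt with [X], the pairing with [t - t'], and give it the same
    mean, so [exp_tilt_rigid] makes [X] constant on steps. Opposite steps then force
    [t - t' = 0]. *)
Lemma tilted_mean_inj t t' : (forall i, tilted_mean i t = tilted_mean i t') -> t = t'.
Proof.
move=> tt'; pose D := t - t'; pose X z := dot D (lat2vec R (sv z)).
pose a z := tstep P t z; pose b z := tstep P t' z.
have p0 := phi_gt0 t hiid hnn; have p0' := phi_gt0 t' hiid hnn.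
have b0 z : 0 < b z.
  by rewrite mulr_gt0 ?tilt_gt0//; apply: lt_le_trans (q_ge hiid c_gt0 hc z).
pose k := phi_a P t' / phi_a P t.
have k0 : 0 < k by rewrite divr_gt0.
have abE z : a z = b z * expR (X z) * k.
  rewrite /a /b /tstep !(tiltE _ hiid hnn) /k.
  have -> : dot t (lat2vec R (sv z)) = dot t' (lat2vec R (sv z)) + X z.
    by rewrite /X -dot_addl /D addrC subrK.
  rewrite expRD; field; by rewrite !lt0r_neq0.
have sX (p : U -> R) (th : 'rV[R]_d.+1) : (forall z, p z = tstep P th z) ->
    \sum_(z <- us) p z * X z = \sum_i D 0 i * tilted_mean i th.
  move=> pE; rewrite /tilted_mean; under [RHS]eq_bigr do rewrite mulr_sumr.
  rewrite exchange_big; apply: eq_bigr => z _; rewrite pE /X /dot mulr_sumr.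
  by apply: eq_bigr => i _; rewrite mulrCA.
have aX : \sum_(z <- us) a z * X z = \sum_(z <- us) b z * X z.
  apply: etrans (sX a t (fun=> erefl)) _; apply: etrans _ (esym (sX b t' (fun=> erefl))).
  by apply: eq_bigr => i _; rewrite tt'.
have sa : \sum_(z <- us) a z = 1 by exact: tstep_sum.
have sb : \sum_(z <- us) b z = 1 by exact: tstep_sum.
have term z z' : X z = X z'.
  exact: (exp_tilt_rigid k0 b0 abE sa sb aX (mem_steps z) (mem_steps z')).
apply/eqP; rewrite -subr_eq0; apply/eqP/rowP => i; rewrite mxE.
have := term (signed_step R i true) (signed_step R i false).
rewrite /X !dot_signed_step mul1r mulN1r => /eqP.
by rewrite -subr_eq0 opprK -mulr2n mulrn_eq0/= => /eqP; rewrite /D !mxE.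
Qed.

End log_mgf.

(** * Exponential growth of the partition functions *)

Section subexponential_growth.
Context (dT : measure_display) (T : measurableType dT) (R : realType)
  (P : probability T R).

Lemma near_cvg_series_lt1 (x : nat -> R) : (forall n, 0 <= x n) -> cvgn (series x) ->
  \forall n \near \oo, x n < 1.
Proof.
move=> x0 cx; have /cvgrPdist_lt/(_ 1 ltr01) := cvg_series_cvg_0 cx.
by apply: filterS => n; rewrite sub0r normrN ger0_norm.
Qed.

(** Multiplied by exp(-e n), the expectations are summable, so the terms tend to 0 almost surely.
    The rates 1 / (j + 1) suffice and keep the exceptional set independent of [e]. *)
Lemma subexponential_ae (X : nat -> T -> R) :
  (forall n, measurable_fun setT (X n)) -> (forall n w, 0 <= X n w) ->
  (forall e : R, 0 < e -> exists K : R, forall n,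
     (\int[P]_w (X n w)%:E <= (K * expR (e * n%:R))%:E)%E) ->
  {ae P, forall w, forall e : R, 0 < e ->
     \forall n \near \oo, X n w <= expR (e * n%:R)}.
Proof.
move=> mX X0 hX.
have key (j : nat) : {ae P, forall w,
    \forall n \near \oo, X n w <= expR (j.+1%:R^-1 * n%:R)}.
  pose e : R := j.+1%:R^-1; have e0 : 0 < e by rewrite invr_gt0.
  have [K hK] := hX (e / 2) (divr_gt0 e0 (ltr0Sn _ 1)).
  pose Y n (w : T) : R := expR (- (e * n%:R)) * X n w.
  have mY n : measurable_fun setT (Y n) by apply: measurable_funM.
  have Y0 n w : 0 <= Y n w by rewrite mulr_ge0 ?expR_ge0.
  have iY n : (\int[P]_w (Y n w)%:E <= (K * expR (- (e / 2)) ^+ n)%:E)%E.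
    under eq_integral do rewrite EFinM.
    rewrite ge0_integralZl_EFin ?expR_ge0//; last 2 first.
    - by move=> w _; rewrite lee_fin.
    - exact/measurable_EFinP.
    apply: (@le_trans _ _ ((expR (- (e * n%:R)))%:E * (K * expR (e / 2 * n%:R))%:E)%E).
      by apply: lee_wpmul2l => //; rewrite lee_fin expR_ge0.
    rewrite -EFinM lee_fin mulrCA -expRM_natl -expRD le_eqVlt; apply/orP; left.
    by apply/eqP; congr (_ * expR _); rewrite mulrN; field.
  have cvg : cvgn (series (fun n => K * expR (- (e / 2)) ^+ n)).
    rewrite (_ : (fun n => _) = geometric K (expR (- (e / 2)))) //.
    apply: is_cvg_geometric_series; rewrite ger0_norm ?expR_ge0//.
    by rewrite -expR0 ltr_expR oppr_lt0 divr_gt0.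
  have := nneseries_ae_cvg mY Y0 iY cvg; apply: filterS => w cw.
  have := near_cvg_series_lt1 (fun n => Y0 n w) cw; apply: filterS => n.
  by rewrite /Y expRN mulrC ltr_pdivrMr ?expR_gt0// mul1r => /ltW.
have := ae_forall_countable key; apply: filterS => w hw e e0.
have [j hj] : exists j : nat, (j.+1%:R^-1 : R) < e.
  by exists (Num.truncn e^-1); rewrite invf_plt ?posrE// truncnS_gt.
have := hw j; apply: filterS => n hn; apply: le_trans hn _.
by rewrite ler_expR ler_wpM2r// ltW.
Qed.

End subexponential_growth.

Lemma poly_le_exp (R : realType) (k : nat) (e : R) : 0 < e ->
  exists K : R, forall n : nat, ((n.*2.+1 ^ k)%N%:R : R) <= K * expR (e * n%:R).
Proof.
move=> e0; case: k => [|k].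
  by exists 1 => n; rewrite expn0 mul1r -expR0 ler_expR mulr_ge0// ltW.
pose dl : R := e / k.+1%:R; have d0 : 0 < dl by rewrite divr_gt0.
exists ((1 + 2 / dl) ^+ k.+1) => n; rewrite natrX.
have -> : e * n%:R = k.+1%:R * (dl * n%:R) by rewrite /dl; field.
rewrite expRM_natl -exprMn ler_pXn2r ?nnegrE//; last first.
  by rewrite mulr_ge0 ?expR_ge0// addr_ge0// divr_ge0// ltW.
apply: (@le_trans _ _ ((1 + 2 / dl) * (1 + dl * n%:R))); last first.
  by rewrite ler_wpM2l ?expR_ge1Dx// addr_ge0// divr_ge0// ltW.
have -> : (1 + 2 / dl) * (1 + dl * n%:R) = 1 + dl * n%:R + 2 / dl + 2 * n%:R.
  by field; rewrite lt0r_neq0.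
rewrite -addn1 natrD -muln2 natrM mulrC addrC lerD2r.
by rewrite -addrA lerDl; apply: addr_ge0; [apply: mulr_ge0|apply: divr_ge0]; rewrite // ltW.
Qed.

Section fwd_growth.
Context (R : realType) (d : nat) (P : probability (env R d) R) (c : R).
Hypothesis hiid : iid_environment P.
Hypothesis hnn : nearest_neighbor P.
Hypothesis c_gt0 : 0 < c.
Hypothesis hc : forall z : step R d, P [set w | c <= transition w 0 0 z] = 1%E.
Local Notation E := (env R d).
Local Notation U := (step R d).
Local Notation us := (steps_seq R d).
Local Notation sv := (@step_val R d : U -> lattice d).
Implicit Types (th t : 'rV[R]_d.+1).

Lemma dot_step_diff th t (z : U) :
  dot th (lat2vec R (sv z)) <= l1norm (th - t) + dot t (lat2vec R (sv z)).
Proof.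
rewrite -{1}(subrK t th) dot_addl lerD2r.
exact: le_trans (ler_norm _) (dot_step_le _ _).
Qed.

Lemma lmgf_lipschitz th t :
  ln (phi_a P th) <= l1norm (th - t) + ln (phi_a P t).
Proof.
have p0 := phi_gt0 th hiid hnn; have p1 := phi_gt0 t hiid hnn.
rewrite -(@expRK _ (l1norm _)) -lnM ?posrE ?expR_gt0// ler_ln ?posrE ?mulr_gt0 ?expR_gt0//.
rewrite !phi_aE mulr_sumr; apply: ler_sum => z _.
rewrite mulrCA ler_wpM2l ?q_ge0// -expRD ler_expR; exact: dot_step_diff.
Qed.

Lemma tilt_lipschitz th t (z : U) :
  tilt P th z <= expR (2 * l1norm (th - t)) * tilt P t z.
Proof.
rewrite -expRD ler_expR.
have := dot_step_diff th t z; have := lmgf_lipschitz t th.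
rewrite -(l1normN (t - th)) opprB; lra.
Qed.

Lemma tilt_word_lipschitz th t (s : seq U) :
  tilt_word P th s <= expR (2 * l1norm (th - t) * (size s)%:R) * tilt_word P t s.
Proof.
elim: s => [|z s IHs].
  by rewrite [size _]/= mulr0 expR0 mul1r !tilt_word_nil.
rewrite !tilt_word_cons [size _]/= -[(size s).+1]addn1 natrD mulrDr mulr1 addrC expRD mulrACA.
by apply: ler_pM (tilt_lipschitz _ _ _) IHs; [exact: tilt_ge0|exact: tilt_word_ge0].
Qed.

Lemma fwd_lipschitz th t n (w : E) :
  fwd P th n w <= expR (2 * l1norm (th - t) * n%:R) * fwd P t n w.
Proof.
rewrite /fwd mulr_sumr big_seq [leRHS]big_seq; apply: ler_sum => s sn.
rewrite mulrA ler_wpM2r ?path_weight_ge0//.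
by rewrite -(size_words sn); exact: tilt_word_lipschitz.
Qed.

(** A countable dense family: the exceptional environments must not depend on the tilt, and
    [fwd_lipschitz] extends growth rates from this family to every tilt. *)
Definition rational_tilt (p : nat * lattice d) : 'rV[R]_d.+1 :=
  p.1.+1%:R^-1 *: lat2vec R p.2.

Lemma rational_tilt_dense th (e : R) : 0 < e ->
  exists p, l1norm (rational_tilt p - th) < e.
Proof.
move=> e0; pose k := Num.truncn (d.+1%:R / e : R).
pose x : lattice d := \row_i Num.floor (k.+1%:R * th 0 i).
exists (k, x); have k0 : 0 < k.+1%:R :> R by rewrite ltr0n.
apply: (@le_lt_trans _ _ (\sum_(i < d.+1) k.+1%:R^-1)).
  apply: ler_sum => i _; rewrite !mxE /=.
  have /andP[h1 h2] := floor_itv (k.+1%:R * th 0 i).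
  have -> : k.+1%:R^-1 * (Num.floor (k.+1%:R * th 0 i))%:~R - th 0 i =
    k.+1%:R^-1 * ((Num.floor (k.+1%:R * th 0 i))%:~R - k.+1%:R * th 0 i).
    by field; rewrite lt0r_neq0.
  rewrite normrM ger0_norm ?invr_ge0// ler_piMr ?invr_ge0// ler_norml.
  by move: h2; rewrite rmorphD/= => h2; apply/andP; split; lra.
rewrite sumr_const card_ord -[ltLHS]mulr_natl ltr_pdivrMr// -ltr_pdivrMl//.
by rewrite mulrC; exact: truncnS_gt.
Qed.

Lemma fwd_growth_le : {ae P, forall w, forall th (e : R), 0 < e ->
  \forall n \near \oo, fwd P th n w <= expR (e * n%:R)}.
Proof.
have key (p : nat * lattice d) : {ae P, forall w, forall e : R, 0 < e ->
    \forall n \near \oo, fwd P (rational_tilt p) n w <= expR (e * n%:R)}.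
  apply: subexponential_ae; first exact: measurable_fwd.
    exact: fwd_ge0.
  move=> e e0; exists 1 => n; rewrite integral_fwd// mul1r lee_fin -expR0 ler_expR.
  by rewrite mulr_ge0// ltW.
have := ae_forall_countable key; apply: filterS => w hw th e e0.
have e4 : 0 < e / 4 by rewrite divr_gt0.
have [p pth] := rational_tilt_dense th e4.
have := hw p (e / 2) (divr_gt0 e0 (ltr0Sn _ 1)); apply: filterS => n hn.
apply: le_trans (fwd_lipschitz _ (rational_tilt p) _ _) _.
have -> : e * n%:R = (e / 2) * n%:R + (e / 2) * n%:R by field.
rewrite [leRHS]expRD; apply: ler_pM; rewrite ?expR_ge0 ?fwd_ge0// ler_expR ler_wpM2r//.
by rewrite -l1normN opprB; lra.
Qed.

Definition box_sum (u : E -> R) (n : nat) (w : E) : R :=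
  \sum_(f : {ffun 'I_d.+1 -> 'I_n.*2.+1})
    u (env_shift n%:Z (\row_i ((f i)%:Z - n%:Z)) w).

Lemma pos_coord_le (s : seq U) (i : 'I_d.+1) : `|pos sv s 0 i| <= (size s)%:Z.
Proof.
elim: s => [|z s IHs]; first by rewrite /pos big_nil mxE normr0.
rewrite pos_cons mxE [size _]/= -[(size s).+1]add1n PoszD; apply: le_trans (ler_normD _ _) _.
by apply: lerD IHs; exact: step_coord_le1.
Qed.

Lemma le_box_sum (u : E -> R) n (w : E) (s : seq U) : (forall w', 0 <= u w') ->
  size s = n -> u (env_shift n%:Z (pos sv s) w) <= box_sum u n w.
Proof.
move=> u0 sn; have hs i := pos_coord_le s i.
pose f : {ffun 'I_d.+1 -> 'I_n.*2.+1} := [ffun i => inord (absz (pos sv s 0 i + n%:Z))].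
have -> : pos sv s = \row_i ((f i)%:Z - n%:Z).
  apply/rowP => i; rewrite !mxE ffunE; have := hs i; rewrite sn.
  move: (pos sv s 0 i) => a ha; rewrite /= inordK; lia.
rewrite /box_sum (bigD1 f)//= lerDl; exact: sumr_ge0.
Qed.

Lemma integral_box_sum (u : E -> R) n : measurable_fun setT u -> (forall w, 0 <= u w) ->
  (\int[P]_w (u w)%:E = 1)%E ->
  (\int[P]_w (box_sum u n w)%:E = (n.*2.+1 ^ d.+1)%:R%:E)%E.
Proof.
move=> mu u0 iu; rewrite /box_sum ge0_integral_rsum//; last first.
  by move=> f; exact: measurableT_comp (measurable_env_shift _ _).
under eq_bigr => f _.
  rewrite (env_shift_integral hiid n%:Z (\row_i ((f i)%:Z - n%:Z)) (f := fun w => (u w)%:E)).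
  - rewrite iu; over.
  - exact/measurable_EFinP.
  - by move=> w; rewrite lee_fin.
by rewrite sumEFin sumr_const card_ffun !card_ord.
Qed.

Lemma fwd_limit_growth_ge th (u : E -> R) : subseq_limit P (fwd P th) u ->
  {ae P, forall w, forall e : R, 0 < e ->
    \forall n \near \oo, expR (- e * n%:R) <= fwd P th n w}.
Proof.
move=> hu; have mu := lim_meas hu; have u0 := lim_ge0 hu.
have iu := integral_fwd_limit1 hiid hnn hu.
have gS : {ae P, forall w, forall e : R, 0 < e ->
    \forall n \near \oo, box_sum u n w <= expR (e * n%:R)}.
  apply: subexponential_ae.
  - move=> n; apply: measurable_sum => f.
    exact: measurableT_comp (measurable_env_shift _ _).
  - by move=> n w; exact: sumr_ge0.
  - move=> e e0; have [K hK] := poly_le_exp d.+1 e0.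
    by exists K => n; rewrite integral_box_sum// lee_fin.
have gw := ae_forall_countable (fwd_limit_words hiid hu).
have gp := fwd_limit_gt0 hiid hnn c_gt0 hc hu.
move: gS gw gp; apply: filterS3 => w hS hw uw e e0.
have e2 : 0 < e / 2 by rewrite divr_gt0.
have h1 : \forall n \near \oo, expR (- (e / 2) * n%:R) <= u w.
  near=> n; rewrite -(@lnK _ (u w)) ?posrE// ler_expR mulNr lerNl -ler_pdivrMl//.
  by near: n; exact: nbhs_infty_ger.
move: h1 (hS _ e2); apply: filterS2 => n h1 h2.
have h3 : u w <= fwd P th n w * box_sum u n w.
  rewrite {1}(hw n) mulr_suml big_seq [leRHS]big_seq; apply: ler_sum => s sn.
  rewrite mulrA; apply: ler_wpM2l; last by apply: le_box_sum => //; exact: size_words sn.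
  by rewrite mulr_ge0 ?tilt_word_ge0 ?path_weight_ge0.
have h4 : expR (- (e / 2) * n%:R) <= fwd P th n w * expR (e / 2 * n%:R).
  by apply: le_trans h1 (le_trans h3 _); rewrite ler_wpM2l ?fwd_ge0.
have -> : - e * n%:R = - (e / 2) * n%:R - (e / 2) * n%:R by field.
by rewrite expRD expRN ler_pdivrMr ?expR_gt0.
Unshelve. all: by end_near.
Qed.

Lemma fwd_growth_ge (r : R) :
  (forall th, l1norm th <= r -> exists u, subseq_limit P (fwd P th) u) ->
  {ae P, forall w, forall th (e : R), l1norm th < r -> 0 < e ->
    \forall n \near \oo, expR (- e * n%:R) <= fwd P th n w}.
Proof.
move=> hr.
have key (p : nat * lattice d) : {ae P, forall w, l1norm (rational_tilt p) <= r ->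
    forall e : R, 0 < e ->
    \forall n \near \oo, expR (- e * n%:R) <= fwd P (rational_tilt p) n w}.
  have [pr|pr] := boolP (l1norm (rational_tilt p) <= r); last exact: aeW.
  have [u hu] := hr _ pr.
  by have := fwd_limit_growth_ge hu; apply: filterS => w hw _; exact: hw.
have := ae_forall_countable key; apply: filterS => w hw th e thr e0.
(* The approximating tilt has to remain within radius [r], where a limit [u] exists; strictness of
   [l1norm th < r] leaves the room. *)
pose e4 := Num.min (e / 4) (r - l1norm th).
have e40 : 0 < e4 by rewrite lt_min divr_gt0//= subr_gt0.
have [p pth] := rational_tilt_dense th e40.
have pr : l1norm (rational_tilt p) <= r.
  rewrite -(subrK th (rational_tilt p)); apply: le_trans (l1normD _ _) _.
  by rewrite -lerBrDr; apply: le_trans (ltW pth) _; rewrite ge_min lexx orbT.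
have := hw p pr (e / 2) (divr_gt0 e0 (ltr0Sn _ 1)); apply: filterS => n hn.
have h := le_trans hn (fwd_lipschitz (rational_tilt p) th n w).
have -> : - e * n%:R = - (e / 2) * n%:R - (e / 2) * n%:R by field.
rewrite expRD expRN ler_pdivrMr ?expR_gt0// [leRHS]mulrC; apply: le_trans h _.
rewrite ler_wpM2r ?fwd_ge0// ler_expR ler_wpM2r//.
have : l1norm (rational_tilt p - th) <= e / 4.
  by apply: le_trans (ltW pth) _; rewrite ge_min lexx.
lra.
Qed.

End fwd_growth.

(** * Large deviations *)

Section exponential_rates.
Context (R : realType).
Implicit Types (p : nat -> R) (a b e : R).

Lemma near_le_exp (K e : R) : 0 < e -> \forall n \near \oo, K <= expR (e * n%:R).
Proof.
move=> e0; near=> n; apply: (@le_trans _ _ (e * n%:R)).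
  by rewrite mulrC -ler_pdivrMr//; near: n; exact: nbhs_infty_ger.
by apply: le_trans (expR_ge1Dx _); rewrite lerDr.
Unshelve. all: by end_near.
Qed.

Lemma rate_esup_le p b : (\forall n \near \oo, p n <= expR (b * n%:R)) ->
  (limn_esup (fun n => n%:R^-1%:E * lne (p n)%:E) <= b%:E)%E.
Proof.
move=> hp; pose A := [set n : nat | (n%:R^-1%:E * lne (p n)%:E <= b%:E)%E].
apply: (@le_trans _ _ (ereal_sup ((fun n => (n%:R^-1%:E * lne (p n)%:E)%E) @` A))).
  apply: ereal_inf_lbound; exists A => //; near=> n; rewrite /A /mkset.
  have n0 : 0 < n%:R :> R by rewrite ltr0n; near: n; exact: nbhs_infty_gt.
  have [p0|p0] := leP (p n) 0.
    by rewrite le0_lneNy ?lee_fin// gt0_muleNy ?lte_fin ?invr_gt0// leNye.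
  rewrite lne_EFin// -EFinM lee_fin ler_pdivrMl// mulrC -(@expRK _ (b * _)).
  by rewrite ler_ln ?posrE ?expR_gt0//; near: n.
by apply: ge_ereal_sup => _ [n An <-].
Unshelve. all: by end_near.
Qed.

Lemma rate_einf_ge p b : (\forall n \near \oo, expR (b * n%:R) <= p n) ->
  (b%:E <= limn_einf (fun n => n%:R^-1%:E * lne (p n)%:E))%E.
Proof.
move=> hp; rewrite /limn_einf leeNr /limn_esup /limf_esup.
pose A := [set n : nat | (- (n%:R^-1%:E * lne (p n)%:E) <= - b%:E)%E].
apply: (@le_trans _ _ (ereal_sup ((fun n => (- (n%:R^-1%:E * lne (p n)%:E))%E) @` A))).
  apply: ereal_inf_lbound; exists A => //; near=> n; rewrite /A /mkset leeN2.
  have n0 : 0 < n%:R :> R by rewrite ltr0n; near: n; exact: nbhs_infty_gt.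
  have h : expR (b * n%:R) <= p n by near: n.
  have p0 : 0 < p n by apply: lt_le_trans h; exact: expR_gt0.
  rewrite lne_EFin// -EFinM lee_fin ler_pdivlMl// mulrC -(@expRK _ (b * _)).
  by rewrite ler_ln ?posrE ?expR_gt0.
by apply: ge_ereal_sup => _ [n An <-].
Unshelve. all: by end_near.
Qed.

Lemma sum_rate_le (J : Type) (f : J -> nat -> R) a :
  (forall j e, 0 < e -> \forall n \near \oo, f j n <= expR ((a + e) * n%:R)) ->
  forall (s : seq J) e, 0 < e ->
    \forall n \near \oo, \sum_(j <- s) f j n <= expR ((a + e) * n%:R).
Proof.
move=> hf; elim=> [|j s IHs] e e0.
  by apply: nearW => n; rewrite big_nil expR_ge0.
have e2 : 0 < e / 2 by rewrite divr_gt0.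
move: (hf j _ e2) (IHs _ e2) (near_le_exp 2 e2); apply: filterS3 => n h1 h2 h3.
rewrite big_cons.
have -> : (a + e) * n%:R = e / 2 * n%:R + (a + e / 2) * n%:R by field.
rewrite expRD; apply: le_trans (lerD h1 h2) _.
by rewrite -mulr2n -[leLHS]mulr_natl ler_wpM2r ?expR_ge0.
Qed.

(** Upper bounds are proved at finite levels [a] below the infimum of the rate function; this also
    settles an infinite infimum. *)
Lemma ereal_le_oppr (x y : \bar R) :
  (forall a, (a%:E < y)%E -> (x <= (- a)%:E)%E) -> (x <= - y)%E.
Proof.
case: y => [r| |] h; last by rewrite leey.
  rewrite -EFinN; apply/lee_addgt0Pr => e e0; rewrite -EFinD.
  have -> : - r + e = - (r - e) by rewrite opprB addrC.
  by apply: h; rewrite lte_fin ltrBlDr ltrDl.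
case: x h => [r| |] // h; last by have := h 0 (ltry _).
by have := h (- (r - 1)) (ltry _); rewrite lee_fin opprK => hr; exfalso; lra.
Qed.

End exponential_rates.

Fact half_mass_left (R : realType) (a b e f S x g : R) :
  a <= f -> S <= b -> f <= x + S -> 2 * b <= a -> 2 * e <= a -> g <= e -> g <= x.
Proof. lra. Qed.

Section hitting.
Context (R : realType) (d : nat) (P : probability (env R d) R) (c : R).
Hypothesis hiid : iid_environment P.
Hypothesis hnn : nearest_neighbor P.
Hypothesis c_gt0 : 0 < c.
Hypothesis hc : forall z : step R d, P [set w | c <= transition w 0 0 z] = 1%E.
Local Notation E := (env R d).
Local Notation U := (step R d).
Local Notation us := (steps_seq R d).
Local Notation sv := (@step_val R d : U -> lattice d).
Local Notation V := 'rV[R]_d.+1.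
Implicit Types (t xi : V) (w : E) (B : set V).

Definition velocity (n : nat) (s : seq U) : V := n%:R^-1 *: lat2vec R (pos sv s).

Definition hit B (n : nat) w : R :=
  \sum_(s <- words us n) path_weight w 0 0 s * \1_B (velocity n s).

Lemma quenched_hit B n w : nn_env w ->
  quenched w 0 0 [set X | B (mean_velocity R n X)] = (hit B n w)%:E.
Proof.
move=> wn; pose A := [set X : paths d | B (mean_velocity R n X)].
have mA : measurable A.
  have -> : A = eval_at n @^-1` [set x : lattice d | B (n%:R^-1 *: lat2vec R x)] by [].
  by rewrite -[X in measurable X]setTI; exact: measurable_eval_at.
have := walk_law_integral (n := n) (g := \1_A) wn (quenched_law 0 0 wn).
rewrite integral_indic// setIT => ->; last first.
  move=> X X' XX'; rewrite !indicE; congr (_%:R); congr nat_of_bool.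
  by apply/idP/idP; rewrite !inE /A /mkset /mean_velocity XX'.
congr EFin; rewrite /hit big_seq [RHS]big_seq; apply: eq_bigr => s sn.
congr (_ * _); rewrite !indicE; congr (_%:R); congr nat_of_bool.
have -> : velocity n s = mean_velocity R n (path_of 0 s); last by apply/idP/idP; rewrite !inE.
by rewrite /mean_velocity /path_of /velocity add0r take_oversize// (size_words sn).
Qed.

Lemma dot_scaler t (a : R) (x : V) : dot t (a *: x) = a * dot t x.
Proof. by rewrite /dot mulr_sumr; apply: eq_bigr => i _; rewrite mxE mulrCA. Qed.

Lemma tilt_word_velocity t n s : (0 < n)%N -> size s = n ->
  tilt_word P t s = expR ((dot t (velocity n s) - ln (phi_a P t)) * n%:R).
Proof.
move=> n0 sn; have n0' : n%:R != 0 :> R by rewrite pnatr_eq0 -lt0n.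
by rewrite tilt_wordE sn dot_scaler; congr expR; field.
Qed.

Lemma hit_le_fwd B t a n w : (0 < n)%N ->
  (forall x, B x -> a <= dot t x - ln (phi_a P t)) ->
  hit B n w <= expR (- a * n%:R) * fwd P t n w.
Proof.
move=> n0 hB; rewrite /hit /fwd mulr_sumr big_seq [leRHS]big_seq; apply: ler_sum => s sn.
rewrite mulrA [leLHS]mulrC ler_wpM2r ?path_weight_ge0//.
rewrite indicE; case: (boolP (_ \in _)) => [|_]; last by rewrite mulr_ge0 ?expR_ge0 ?tilt_word_ge0.
rewrite inE => /hB h; rewrite (tilt_word_velocity _ n0 (size_words sn)) -expRD -expR0 ler_expR.
by rewrite -mulrDl mulr_ge0// addrC subr_ge0.
Qed.

Lemma hit_sub_sum (J : eqType) (r : seq J) (W : J -> set V) B n w :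
  (forall x, B x -> exists2 j, j \in r & W j x) ->
  hit B n w <= \sum_(j <- r) hit (W j) n w.
Proof.
move=> hB; rewrite exchange_big; apply: ler_sum => s _; rewrite -mulr_sumr.
rewrite ler_wpM2l ?path_weight_ge0// indicE; case: (boolP (_ \in _)) => [|_]; last exact: sumr_ge0.
rewrite inE => /hB[j jr Wj]; rewrite (big_rem _ jr)/= indicE mem_set// lerDl.
exact: sumr_ge0.
Qed.

Definition box xi (dl : R) : set V := [set x | forall i, `|x 0 i - xi 0 i| <= dl].

Definition beyond xi (dl : R) (j : 'I_d.+1 * bool) : set V :=
  [set x | dl <= (-1) ^+ j.2 * (x 0 j.1 - xi 0 j.1)].

Definition tilted_hit B t n w : R :=
  \sum_(s <- words us n) tilt_word P t s * path_weight w 0 0 s * \1_B (velocity n s).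

(** Exponential Markov inequality under the weights tilted by [t]: a further tilt by [h] toward the
    half-space gains [h * dl], and costs at most [2 * h ^+ 2] by [lmgf_line_le], as [xi] is the
    tilted mean. *)
Lemma tilted_hit_beyond t xi (dl h : R) (j : 'I_d.+1 * bool) n w : (0 < n)%N ->
  (forall i, tilted_mean P i t = xi 0 i) -> 0 <= h -> h <= 2^-1 ->
  tilted_hit (beyond xi dl j) t n w <=
  expR (- (h * dl - 2 * h ^+ 2) * n%:R) *
    fwd P (((-1) ^+ j.2 * h) *: delta_mx 0 j.1 + t) n w.
Proof.
move=> n0 txi h0 h2; set k := (-1) ^+ j.2 * h; set t' := _ + t.
rewrite /tilted_hit /fwd mulr_sumr big_seq [leRHS]big_seq; apply: ler_sum => s sn.
rewrite mulrA -mulrA [path_weight _ _ _ _ * _]mulrC mulrA ler_wpM2r ?path_weight_ge0//.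
rewrite indicE; case: (boolP (_ \in _)) => [|_]; last first.
  by rewrite mulr0 mulr_ge0 ?expR_ge0 ?tilt_word_ge0.
rewrite inE mulr1 => /= hx; have sz := size_words sn.
rewrite !(tilt_word_velocity _ n0 sz) -expRD ler_expR -mulrDl ler_wpM2r//.
have kn : `|k| <= 2^-1 by rewrite /k normrM normrX normrN1 expr1n mul1r ger0_norm.
have k2 : k ^+ 2 = h ^+ 2 by rewrite /k exprMn sqrr_sign mul1r.
have := lmgf_line_le hiid hnn j.1 t kn; rewrite k2 txi -/t' => hl.
rewrite /t' dot_addl dot_scalel dot_delta -/t'.
have h3 : h * dl <= k * (velocity n s 0 j.1 - xi 0 j.1).
  by rewrite /k [_ * h]mulrC -mulrA ler_wpM2l.
move: hl h3; set a := ln _; set b := ln _; set x := velocity n s 0 j.1; lra.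
Qed.

Lemma fwd_le_box t xi (dl : R) n w : fwd P t n w <=
  tilted_hit (box xi dl) t n w +
  \sum_(j : 'I_d.+1 * bool) tilted_hit (beyond xi dl j) t n w.
Proof.
rewrite exchange_big -big_split; apply: ler_sum => s _ /=.
rewrite -mulr_sumr -mulrDr -[leLHS]mulr1 ler_wpM2l ?mulr_ge0 ?tilt_word_ge0 ?path_weight_ge0//.
have [xb|] := pselect (box xi dl (velocity n s)).
  by rewrite indicE mem_set// lerDl sumr_ge0.
move/existsNP => [i /negP]; rewrite -ltNge => hi.
rewrite -[leLHS]add0r; apply: lerD; first by rewrite indicE.
suff [b hb] : exists b, beyond xi dl (i, b) (velocity n s).
  by rewrite (bigD1 (i, b))//= indicE mem_set// lerDl sumr_ge0.
move: hi; rewrite ltr_normr => /orP[hi|hi].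
  by exists false; rewrite /beyond/= expr0 mul1r ltW.
by exists true; rewrite /beyond/= expr1 mulN1r ltW.
Qed.

Lemma tilted_hit_box t xi (dl : R) n w : (0 < n)%N ->
  tilted_hit (box xi dl) t n w <=
  expR ((dot t xi - ln (phi_a P t) + l1norm t * dl) * n%:R) * hit (box xi dl) n w.
Proof.
move=> n0; rewrite /tilted_hit /hit mulr_sumr big_seq [leRHS]big_seq.
apply: ler_sum => s sn; rewrite mulrA indicE; case: (boolP (_ \in _)) => [|_]; last first.
  by rewrite !mulr0.
rewrite inE !mulr1 => hx; rewrite ler_wpM2r ?path_weight_ge0//.
rewrite (tilt_word_velocity _ n0 (size_words sn)) ler_expR ler_wpM2r//.
rewrite addrAC lerD2r -lerBlDl.
have -> : dot t (velocity n s) - dot t xi = \sum_i t 0 i * (velocity n s 0 i - xi 0 i).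
  by rewrite /dot -sumrB; apply: eq_bigr => i _; rewrite mulrBr.
rewrite /l1norm mulr_suml; apply: ler_sum => i _; apply: le_trans (ler_norm _) _.
by rewrite normrM ler_wpM2l.
Qed.

Lemma hit_box_ge t xi (dl e : R) w :
  (forall i, tilted_mean P i t = xi 0 i) -> 0 < dl -> 0 < e ->
  (forall t' (e' : R), 0 < e' -> \forall n \near \oo, fwd P t' n w <= expR (e' * n%:R)) ->
  (forall e' : R, 0 < e' -> \forall n \near \oo, expR (- e' * n%:R) <= fwd P t n w) ->
  \forall n \near \oo,
    expR (- (dot t xi - ln (phi_a P t) + l1norm t * dl + e) * n%:R) <= hit (box xi dl) n w.
Proof.
move=> txi dl0 e0 gle gge.
(* With [h <= dl / 4] the cost [2 * h ^+ 2] is at most half of the gain [h * dl], which leaves the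
   rate [ka]. *)
pose h := Num.min (dl / 4) 2^-1; have h0 : 0 < h by rewrite lt_min divr_gt0//= invr_gt0 ltr0n.
have h2 : h <= 2^-1 by rewrite ge_min lexx orbT.
have h4 : h <= dl / 4 by rewrite ge_min lexx.
pose ka : R := h * dl / 2; have ka0 : 0 < ka by rewrite !mulr_gt0.
have kaE : ka <= h * dl - 2 * h ^+ 2.
  rewrite /ka expr2 -subr_ge0 (_ : _ - _ = h * (dl / 2 - 2 * h)); last by field.
  by rewrite mulr_ge0 ?(ltW h0)//; lra.
(* Since [4 * e1 <= ka], the tails decay at least like exp(-3 e1 n), while the total mass is at
   least exp(-e1 n): eventually at least half of the mass stays in the box. *)
pose e1 := Num.min (e / 2) (ka / 4); have e10 : 0 < e1 by rewrite lt_min; apply/andP; split; exact: divr_gt0.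
have e1e : e1 <= e / 2 by rewrite ge_min lexx.
have e1k : e1 <= ka / 4 by rewrite ge_min lexx orbT.
have tails : forall e', 0 < e' -> \forall n \near \oo,
    \sum_(j : 'I_d.+1 * bool) tilted_hit (beyond xi dl j) t n w <=
    expR ((- ka + e') * n%:R).
  apply: (@sum_rate_le _ _ (fun j n => tilted_hit (beyond xi dl j) t n w)) => j e' e'0.
  near=> n.
  have n0 : (0 < n)%N by near: n; exact: nbhs_infty_gt.
  apply: le_trans (tilted_hit_beyond dl j w n0 txi (ltW h0) h2) _.
  rewrite [leRHS](_ : _ = expR (- ka * n%:R) * expR (e' * n%:R)); last by rewrite -expRD mulrDl.
  apply: ler_pM; rewrite ?expR_ge0 ?fwd_ge0//.
    by rewrite ler_expR ler_wpM2r// lerN2.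
  by near: n; exact: gle.
near=> n.
have n0 : (0 < n)%N by near: n; exact: nbhs_infty_gt.
have b1 : expR (- e1 * n%:R) <= fwd P t n w by near: n; exact: gge.
have b2 : \sum_(j : 'I_d.+1 * bool) tilted_hit (beyond xi dl j) t n w <=
    expR ((- ka + e1) * n%:R) by near: n; exact: tails.
have b3 : 2 <= expR (e1 * n%:R) by near: n; exact: near_le_exp.
have b4 := fwd_le_box t xi dl n w.
have b5 := tilted_hit_box t xi dl w n0.
have b6 : 2 * expR ((- ka + e1) * n%:R) <= expR (- e1 * n%:R).
  have -> : - e1 * n%:R = e1 * n%:R + (- (2 * e1)) * n%:R by ring.
  rewrite [leRHS]expRD; apply: ler_pM; rewrite ?expR_ge0// ler_expR ler_wpM2r//; lra.
have b7 : 2 * expR (- (2 * e1) * n%:R) <= expR (- e1 * n%:R).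
  have -> : - e1 * n%:R = e1 * n%:R + (- (2 * e1)) * n%:R by ring.
  by rewrite [leRHS]expRD ler_wpM2r ?expR_ge0.
have b8 : expR (- e * n%:R) <= expR (- (2 * e1) * n%:R).
  by rewrite ler_expR ler_wpM2r//; lra.
have b9 : expR (- e * n%:R) <= tilted_hit (box xi dl) t n w.
  exact: half_mass_left b1 b2 b4 b6 b7 b8.
set a := dot t xi - _ + _ in b5 *.
have -> : - (a + e) * n%:R = - e * n%:R - a * n%:R by ring.
rewrite expRD expRN ler_pdivrMr ?expR_gt0// [leRHS]mulrC.
exact: le_trans b9 b5.
Unshelve. all: by end_near.
Qed.

Lemma ldp_upper (eta : R) w : nn_env w ->
  (forall t (e : R), 0 < e -> \forall n \near \oo, fwd P t n w <= expR (e * n%:R)) ->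
  forall F : set V, closed F -> F `<=` [set xi | enorm (xi - xi_o P) < eta] ->
  (limn_esup (fun n : nat => n%:R^-1%:E *
     lne (quenched w 0%R 0%R [set X | F (mean_velocity R n X)])) <=
   - ereal_inf (I_a P @` F))%E.
Proof.
move=> wn gle F cF Feta.
under eq_fun do rewrite quenched_hit//.
apply: ereal_le_oppr => a aF; apply/lee_addgt0Pr => e e0; rewrite -EFinD.
apply: rate_esup_le; pose W t : set V := [set x | a < dot t x - ln (phi_a P t)].
have oW t : open (W t).
  have -> : W t = (fun x => dot t x) @^-1` [set y | a + ln (phi_a P t) < y].
    by apply/seteqP; split => x; rewrite /W /= ltrBrDr.
  apply: open_comp; last exact: open_gt.
  have dC x : dot t x = dot x t by apply: eq_bigr => i _; rewrite mulrC.
  by rewrite (funext dC) => x _; exact: continuous_dot.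
have FW : F `<=` cover setT W.
  move=> x Fx; have : (a%:E < I_a P x)%E.
    by apply: lt_le_trans aF _; apply: ereal_inf_lbound; exists x.
  by move/ereal_sup_gt => [_ [t _ <-]]; rewrite lte_fin => ax; exists t.
have kF : compact F.
  apply: bounded_closed_compact cF.
  exists (`|xi_o P| + eta); split; first exact: num_real.
  move=> M hM x /Feta/= xe; rewrite -(subrK (xi_o P) x); apply: le_trans (ler_normD _ _) _.
  apply: ltW; apply: le_lt_trans hM; rewrite addrC lerD2l; apply: ltW; apply: le_lt_trans xe.
  rewrite [leLHS]/Num.norm/= mx_normrE; apply/bigmax_leP; split; first exact: sqrtr_ge0.
  move=> [k i] _ /=; rewrite (ord1 k) -(@ler_pXn2r _ 2)// ?nnegrE ?sqrtr_ge0//.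
  rewrite real_normK ?num_real// sqr_sqrtr ?sumr_ge0// => [|j _]; last exact: sqr_ge0.
  by rewrite (bigD1 i)//= lerDl sumr_ge0// => j _; exact: sqr_ge0.
move: kF; rewrite compact_cover => /(_ _ setT W (fun t _ => oW t) FW)[D _ FD].
have rW t e' : 0 < e' -> \forall n \near \oo, hit (W t) n w <= expR ((- a + e') * n%:R).
  move=> e'0; near=> n; have n0 : (0 < n)%N by near: n; exact: nbhs_infty_gt.
  apply: le_trans (@hit_le_fwd (W t) t a n w n0 (fun x ax => ltW ax)) _.
  by rewrite mulrDl expRD ler_wpM2l ?expR_ge0//; near: n; exact: gle.
have := sum_rate_le rW (finmap.enum_fset D) e0; apply: filterS => n; apply: le_trans.
by apply: hit_sub_sum => x /FD[t tD Wt]; exists t.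
Unshelve. all: by end_near.
Qed.

(** Around [xi] the probability of a small box decays at a rate arbitrarily close to <t, xi> - log
    phi(t) with the matching [t], and this value is at most [I_a xi] as one of the terms of the
    supremum. *)
Lemma ldp_lower (r eta : R) w : nn_env w ->
  (forall xi, enorm (xi - xi_o P) < eta ->
     exists2 t, l1norm t < r & forall i, tilted_mean P i t = xi 0 i) ->
  (forall t (e : R), 0 < e -> \forall n \near \oo, fwd P t n w <= expR (e * n%:R)) ->
  (forall t (e : R), l1norm t < r -> 0 < e ->
     \forall n \near \oo, expR (- e * n%:R) <= fwd P t n w) ->
  forall G : set V, open G -> G `<=` [set xi | enorm (xi - xi_o P) < eta] ->
  (- ereal_inf (I_a P @` G) <=
   limn_einf (fun n : nat => n%:R^-1%:E *
     lne (quenched w 0%R 0%R [set X | G (mean_velocity R n X)])))%E.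
Proof.
move=> wn htilt gle gge G oG Geta; rewrite leeNl.
under eq_fun do rewrite quenched_hit//.
apply: le_ereal_inf_tmp => _ [xi Gxi <-].
have [t tr txi] := htilt _ (Geta _ Gxi).
apply: (@le_trans _ _ (dot t xi - ln (phi_a P t))%:E); last first.
  by apply: ereal_sup_ubound; exists t.
rewrite leeNl -EFinN; apply/lee_subgt0Pr => e e0; rewrite -EFinB.
have [rho /= rho0 hrho] : exists2 rho : R, 0 < rho & ball xi rho `<=` G.
  by have /nbhs_ballP[rho] := open_nbhs_nbhs (conj oG Gxi); exists rho.
pose dl := Num.min (rho / 2) (e / (2 * (l1norm t + 1))).
have l0 : 0 < l1norm t + 1 by rewrite ltr_wpDl ?l1norm_ge0.
have dl0 : 0 < dl by rewrite lt_min !divr_gt0// mulr_gt0.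
have dlr : dl < rho.
  by apply: (@le_lt_trans _ _ (rho / 2)); [rewrite ge_min lexx|lra].
have dle : l1norm t * dl <= e / 2.
  apply: (@le_trans _ _ ((l1norm t + 1) * dl)); first by rewrite ler_wpM2r ?(ltW dl0)// lerDl.
  rewrite mulrC -ler_pdivlMr// (_ : e / 2 / _ = e / (2 * (l1norm t + 1))).
    by rewrite ge_min lexx orbT.
  by field; rewrite lt0r_neq0.
have boxG : box xi dl `<=` G.
  move=> x hx; apply: hrho; split => // k i; rewrite (ord1 k) /ball/= distrC.
  exact: le_lt_trans (hx i) dlr.
apply: rate_einf_ge.
have e2 : 0 < e / 2 by rewrite divr_gt0.
have := hit_box_ge txi dl0 e2 gle (fun e' => gge t e' tr); apply: filterS => n hn.
apply: (@le_trans _ _ (hit (box xi dl) n w)).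
  apply: le_trans hn; rewrite ler_expR ler_wpM2r//; lra.
apply: ler_sum => s _; rewrite ler_wpM2l ?path_weight_ge0// !indicE ler_nat.
by case: (boolP (_ \in box _ _)) => // /set_mem/boxG/mem_set ->.
Qed.

End hitting.

Theorem theorem4 (R : realType) (d : nat) (P : probability (env R d) R)
    (hd : (3 <= d.+1)%N) (hiid : iid_environment P)
    (hnn : nearest_neighbor P) (hell : uniformly_elliptic P) :
  exists2 eta : R, 0 < eta &
    quenched_LDP P [set xi | enorm (xi - xi_o P) < eta] (I_a P) /\
    forall xi : 'rV[R]_d.+1,
      interior (dom_I_a P) xi -> enorm (xi - xi_o P) < eta ->
      exists2 theta : 'rV[R]_d.+1,
        unique (fun t => xi = gradient (fun t' => ln (phi_a P t')) t) theta &
        exists u : env R d -> R,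
          [/\ forall Y : set R, measurable Y -> sigma_ge 0 (u @^-1` Y),
              {ae P, forall w, 0 < u w},
              (\int[P]_w (u w)%:E = 1)%E &
              {ae P, forall w, u w = \sum_(z \in [set: step R d])
                 (transition w 0 0 z *
                  expR (dot theta (lat2vec R z) - ln (phi_a P theta)) *
                  u (env_shift 1 z w))}] /\
          [/\ stationary (mu_process P theta),
              markov_process (mu_process P theta) (tilted_kernel P theta u),
              ac_on_futures P (mu_process P theta) &
              forall nu : probability (env_process R d) R,
                stationary nu -> markov_process nu (tilted_kernel P theta u) ->
                ac_on_futures P nu ->
                forall A : set (env_process R d), measurable A ->
                  nu A = mu_process P theta A].
Proof.
have [c c_gt0 hc] := hell.
have [r r0 [C hC]] := second_moment_radius hd hiid hnn c_gt0 hc.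
(* [tilt_exists] requires a radius at most 1, and within [r] the second moments are bounded. *)
pose rho := Num.min r 1; have rho0 : 0 < rho by rewrite lt_min r0 ltr01.
have rhor t : l1norm t < rho -> l1norm t <= r.
  by move/ltW/le_trans; apply; rewrite ge_min lexx.
have hu t : l1norm t <= r -> exists u, subseq_limit P (fwd P t) u.
  by move=> tr; apply: (fwd_limit_exists hiid hnn (C := C)) => n; have [] := hC t tr n.
have hv t : l1norm t <= r -> exists v, subseq_limit P (bwd P t) v.
  by move=> tr; apply: (bwd_limit_exists hiid hnn (C := C)) => n; have [] := hC t tr n.
have [eta eta0 htilt] : exists2 eta : R, 0 < eta &
    forall xi : 'rV[R]_d.+1, enorm (xi - xi_o P) < eta ->
    exists2 t, l1norm t < rho & forall i, tilted_mean P i t = xi 0 i.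
  by apply: (tilt_exists hiid hnn c_gt0 hc rho0); rewrite ge_min lexx orbT.
exists eta => //; split.
  have h1 := nn_env_ae hiid hnn; have h2 := fwd_growth_le hiid hnn.
  have h3 := fwd_growth_ge hiid hnn c_gt0 hc hu.
  move: h1 h2 h3; apply: filterS3 => w wn gle gge; split.
    apply: (ldp_lower hiid hnn wn htilt gle) => t e tr.
    by apply: gge; apply: lt_le_trans tr _; rewrite ge_min lexx.
  exact: (ldp_upper wn gle).
move=> xi _ /htilt[theta /rhor tr mtheta].
have gradE t : gradient (fun t' => ln (phi_a P t')) t = \row_i tilted_mean P i t.
  exact: gradient_lmgf.
have [u hu'] := hu theta tr; have [v hv'] := hv theta tr.
have mu := mu_bar_tilted hiid hnn hu' hv'.
exists theta.
  split=> [|t ht]; first by rewrite gradE; apply/rowP => i; rewrite mxE mtheta.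
  apply: (tilted_mean_inj hiid hnn c_gt0 hc) => i.
  by rewrite mtheta ht gradE mxE.
exists u; split; split.
- move=> Y mY; apply/sigma_geE; split.
    by rewrite -[X in measurable X]setTI; exact: (lim_meas hu').
  by move=> w w' ww'; rewrite /preimage /mkset (depends_fwd_limit hu' ww').
- exact: (fwd_limit_gt0 hiid hnn c_gt0 hc hu').
- exact: (integral_fwd_limit1 hiid hnn hu').
- have := fwd_limit_harmonic hiid hu'; apply: filterS => w uE.
  rewrite {1}uE; symmetry; apply: etrans (fsum_steps _) _; apply: eq_bigr => z _.
  by rewrite /transition subr0 mulrCA mulrA.
- exact: (tilted_stationary hiid hnn c_gt0 hc hu' hv' mu).
- exact: (tilted_markov hiid hnn c_gt0 hc hu' hv' mu).
- exact: (tilted_ac hu' hv' mu).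
- by move=> nu; exact: (mu_process_unique hiid hnn c_gt0 hc hu' hv').
Qed.
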